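(* Let $k\ge2$, $\ell=2k-1$, $d=k-1$. For every $\mathbf G\in H^+_{3/2}(\sigma_\ell^\vee)$ satisfying $\xi_{3/2}\mathbf G=-\boldsymbol\Theta_\ell$, put $$\mathscr C_{\ell,\mathbf G}(X,\tau)=X^{-1}+\sum_{n\ge0}a_{n,\ell}(\mathbf G)(\tau)\,X^{2n+1}.$$ Then, as an identity of Laurent series at $X=0$ (equivalently, of meromorphic germs there), $$\mathscr Q_\ell\,\mathscr C_{\ell,\mathbf G}(X,\tau)=(\ell-1)!\,X^{-\ell}\,\mathscr S_\ell^{\mathrm{src}}(X,\tau).$$
   Context: **General conventions.** $\mathbb H$ is the upper half-plane, $\tau=u+iv$, $q=e^{2\pi i\tau}$, $D=\frac1{2\pi i}\partial_\tau$, $e(x):=e^{2\pi ix}$, $\eta=q^{1/24}\prod_{m\ge1}(1-q^m)$, $E_{2m}$ the weight-$2m$ Eisenstein series with constant term $1$, $B_{2m}$ the Bernoulli numbers. $\mathrm{Mp}_2(\mathbb Z)$ is the group of pairs $(\gamma,\varphi)$, $\gamma\in\mathrm{SL}_2(\mathbb Z)$ with lower row $(c_\gamma,d_\gamma)$, $\varphi$ holomorphic on $\mathbb H$, $\varphi(\tau)^2=c_\gamma\tau+d_\gamma$, product $(\gamma_1,\varphi_1)(\gamma_2,\varphi_2)=(\gamma_1\gamma_2,(\varphi_1\circ\gamma_2)\varphi_2)$; generators $\widetilde T=(\begin{pmatrix}1&1\\0&1\end{pmatrix},1)$, $\widetilde S=(\begin{pmatrix}0&-1\\1&0\end{pmatrix},\sqrt\tau)$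 (principal root). Slash action: $(F|_{\kappa,\rho}(\gamma,\varphi))(\tau)=\varphi(\tau)^{-2\kappa}\rho(\gamma,\varphi)^{-1}F(\gamma\tau)$; weight $\kappa$, type $\rho$ means slash invariance. $\rho^\vee$ is the contragredient. $S_\kappa(\rho)$: holomorphic forms of weight $\kappa$, type $\rho$ with only positive exponents at $i\infty$. $\xi_\kappa F=2iv^\kappa\overline{\partial_{\bar\tau}F}$, $\Delta_\kappa=-v^2(\partial_u^2+\partial_v^2)+i\kappa v(\partial_u+i\partial_v)$. $H^+_\kappa(\rho)$: smooth $F$ of weight $\kappa$, type $\rho$, $\Delta_\kappa F=0$, $F=O(e^{Cv})$ as $v\to\infty$ for some $C$, $\xi_\kappa F\in S_{2-\kappa}(\rho^\vee)$. **Serre derivatives.** $\mathscr D_\kappa=D-\frac\kappa{12}E_2$; $\mathscr D_\kappa^{[0]}=\mathrm{Id}$, $\mathscr D_\kappa^{[1]}=\mathscr D_\kappa$, $\mathscr D_\kappa^{[n+1]}=\mathscr D_{\kappa+2n}\mathscr D_\kappa^{[n]}-\frac{n(n+\kappa-1)}{144}E_4\mathscr D_\kappa^{[n-1]}$ for $n\ge1$. **Theta vector and representation.** $\vartheta_{\mathrm J}(z;\tau)=\sum_{n\in\frac12+\mathbb Z}e^{\pi in^2\tau+2\pi in(z+1/2)}$; $\Theta_{\ell,j}(\tau)=q^{j^2/(2\ell)}\vartheta_{\mathrm J}(j\tau;\ell\tau)$ for $1\le j\le d$, $\boldsymbol\Theta_\ell=(\Theta_{\ell,1},\dots,\Theta_{\ell,d})^{\mathsf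 T}$. $\sigma_\ell$ is the $d$-dimensional unitary representation with $\sigma_\ell(\widetilde T)=\mathrm{diag}(e((\ell-2j)^2/(8\ell)))_{1\le j\le d}$, $\sigma_\ell(\widetilde S)=e(-1/8)\bigl(\frac{2(-1)^{k+j+m}}{\sqrt\ell}\sin\frac{2\pi jm}{\ell}\bigr)_{1\le j,m\le d}$; $\boldsymbol\Theta_\ell\in S_{1/2}(\sigma_\ell)$. $\mathbf F_\ell=-i\sqrt{\ell/2}\,\boldsymbol\Theta_\ell/\eta$, $\mathbf H_\ell=\eta\mathbf F_\ell$. **Completed $k$-rank Taylor coefficients.** Let $E(t)=2\int_0^te^{-\pi w^2}dw$, $$\mathscr S^\sharp(Z,W;\sigma)=\sum_{n\in\frac12+\mathbb Z}\Bigl[\mathrm{sgn}(n)-E\Bigl(\bigl(n+\tfrac{Z-W}{2i\,\mathrm{Im}\,\sigma}\bigr)\sqrt{2\,\mathrm{Im}\,\sigma}\Bigr)\Bigr](-1)^{n-1/2}e^{-\pi i\sigma n^2-2\pi inZ},$$ $A_\ell(z_1,z_2;\tau)=e^{\pi i\ell z_1}\sum_{n\in\mathbb Z}\frac{(-1)^nq^{\ell n(n+1)/2}e^{2\pi inz_2}}{1-e^{2\pi iz_1}q^n}$, $$\widehat A^\sharp_{\ell,0}(Z,W;\tau)=A_\ell(Z,0;\tau)+\tfrac i2\sum_{\nu=0}^{\ell-1}e^{2\pi i\nu Z}\vartheta_{\mathrm J}(\nu\tau+k;\ell\tau)\,\mathscr S^\sharp(\ell Z-\nu\tau-k,\ell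 W-\nu\bar\tau-k;\ell\tau),$$ $\widehat{\mathcal R}^\sharp(Z,W;\tau)=-\eta^{-1}\widehat A^\sharp_{\ell,0}(Z,W;\tau)\exp(-\frac{\ell\pi^2}6E_2Z^2)$. The functions $\mathsf r_{2n+1,k}$ are defined by $\frac12(\widehat{\mathcal R}^\sharp(Z,0;\tau)-\widehat{\mathcal R}^\sharp(-Z,0;\tau))=\frac1{2\pi i\eta}Z^{-1}+\sum_{n\ge0}\mathsf r_{2n+1,k}Z^{2n+1}$. **Scalar corrections.** $a_{n,\ell}(\mathbf G)=\frac\eta{(2\pi i)^{2n+1}}\bigl[\mathsf r_{2n+1,k}-\frac{(8\ell\pi^2)^n}{(2n+1)!}\mathbf F_\ell^{\mathsf T}\mathscr D^{[n]}_{3/2}\mathbf G\bigr]$. **Operator and source.** $\mathbf H_\ell^{\langle0\rangle}=\mathbf H_\ell$, $\mathbf H_\ell^{\langle r+1\rangle}=\mathscr D_{1/2+2r}\mathbf H_\ell^{\langle r\rangle}$. $F^{(\ell)}_{\ell-2r-1}\in M_{\ell-2r-1}(\mathrm{SL}_2(\mathbb Z))$ ($0\le r\le d$), with $F_0^{(\ell)}=1$, are the unique holomorphic modular forms with $\sum_{r=0}^dF^{(\ell)}_{\ell-2r-1}\mathbf H_\ell^{\langle r\rangle}=0$. $\mathscr H_\lambda=\partial_X^2+2\ell D-\frac\ell6E_2(X\partial_X+\lambda)+\frac{\ell^2}{144}E_4X^2$; $\mathscr H^{\langle0\rangle}=\mathrm{Id}$, $\mathscr H^{\langle r\rangle}=\mathscr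 H_{2r-1}\mathscr H_{2r-3}\cdots\mathscr H_1$; $\mathscr Q_\ell=\sum_{r=0}^d(2\ell)^{d-r}F^{(\ell)}_{\ell-2r-1}\mathscr H^{\langle r\rangle}$. $\mathscr S_\ell^{\mathrm{src}}(X,\tau)=\exp\bigl(-\ell\sum_{m\ge2}\frac{B_{2m}}{2m(2m)!}E_{2m}(\tau)X^{2m}\bigr)$. *)

(* Defs.v *)
From HB Require Import structures.
From mathcomp Require Import all_boot all_order all_algebra.
From mathcomp Require Import all_classical all_reals all_analysis.
From mathcomp Require Import complex.
Set Implicit Arguments.
Unset Strict Implicit.
Unset Printing Implicit Defensive.
Import Order.TTheory GRing.Theory Num.Theory.
Import numFieldNormedType.Exports.
Local Open Scope classical_set_scope.
Local Open Scope ring_scope.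
Local Open Scope complex_scope.

(* B_n = - (n+1)^-1 \sum_(j < n) 'C(n+1, j) B_j for n > 0, and B_0 = 1;
   bernoulli_seq n = [:: B_0; ...; B_(n-1)]. *)
Fixpoint bernoulli_seq (n : nat) : seq rat :=
  if n is m.+1 then
    let s := bernoulli_seq m in
    rcons s ((m == 0%N)%:R
             - (m.+1%:R)^-1 * \sum_(j < m) 'C(m.+1, j)%:R * s`_j)
  else [::].

Definition bernoulli (n : nat) : rat := (bernoulli_seq n.+1)`_n.

Definition sigma_div (s n : nat) : nat := (\sum_(d <- divisors n) d ^ s)%N.

Definition ell (k : nat) : nat := (2 * k - 1)%N.

Section Defs.
Variable R : realType.
Local Notation C := R[i].
Local Notation Re := (@complex.Re R).
Local Notation Im := (@complex.Im R).

(* R[i]^o is R[i] with the topology of its norm. *)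
Definition clim (u : nat -> C) : C := limn (u : nat -> C^o).

Definition csum (f : nat -> C) : C := clim (fun N => \sum_(0 <= n < N) f n).

(* Sum over Z; all bilateral series below converge absolutely. *)
Definition zsum (f : int -> C) : C :=
  csum (fun n => f (Posz n)) + csum (fun n => f (Negz n)).

Definition cexp (z : C) : C :=
  (expR (Re z))%:C * (cos (Im z) +i* sin (Im z)).

Definition cpi : C := (pi : R)%:C.

(* 'i%C is Complex 0 1; plain 'i may elaborate to Num.imaginary. *)
Definition ee (x : C) : C := cexp (2 * cpi * 'i%C * x).

Definition holomorphic_H (f : C -> C) : Prop :=
  forall t : C, 0 < Im t -> derivable (f : C^o -> C^o) t 1.

(* Functions on the upper half-plane are total functions C -> C whose values
   off the half-plane are irrelevant.  Derivatives along w are real ones,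
   taken componentwise. *)

Definition along (w : C) (f : C -> C) (t : C) : R -> C :=
  fun s => f (t + s%:C * w).

Definition has_dpart (w : C) (f : C -> C) (t : C) : Prop :=
  derivable (fun s : R => Re (along w f t s)) 0 1 /\
  derivable (fun s : R => Im (along w f t s)) 0 1.

Definition dpart (w : C) (f : C -> C) : C -> C := fun t =>
  derive1 (fun s : R => Re (along w f t s)) 0
  +i* derive1 (fun s : R => Im (along w f t s)) 0.

Definition du : (C -> C) -> C -> C := dpart 1.
Definition dv : (C -> C) -> C -> C := dpart 'i%C.

Fixpoint Cn_H (n : nat) (f : C -> C) : Prop :=
  (forall t : C, 0 < Im t -> {for t, continuous (f : C^o -> C^o)}) /\
  (if n is m.+1 then
     [/\ forall t : C, 0 < Im t -> has_dpart 1 f t /\ has_dpart 'i%C f t,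
         Cn_H m (du f) & Cn_H m (dv f)]
   else True).

Definition smooth_H (f : C -> C) : Prop := forall n, Cn_H n f.

Definition dtau (f : C -> C) : C -> C := fun t => 2^-1 * (du f t - 'i%C * dv f t).
Definition dtaubar (f : C -> C) : C -> C := fun t =>
  2^-1 * (du f t + 'i%C * dv f t).

(* Wirtinger derivative, so that D also acts on non-holomorphic functions. *)
Definition D (f : C -> C) : C -> C := fun t => (2 * cpi * 'i%C)^-1 * dtau f t.

Definition vop (d : nat) (op : (C -> C) -> C -> C) (F : C -> 'cV[C]_d) :
    C -> 'cV[C]_d :=
  fun t => \col_j op (fun s => F s j 0) t.

Definition eta (t : C) : C :=
  ee (t / 24) * clim (fun N => \prod_(1 <= m < N.+1) (1 - ee (m%:R * t))).

Definition eisenstein (w : nat) (t : C) : C :=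
  1 - 2 * w%:R / ratr (bernoulli w)
      * csum (fun n => (sigma_div w.-1 n.+1)%:R * ee (n.+1%:R * t)).

Definition serre (kappa : C) (f : C -> C) : C -> C := fun t =>
  D f t - kappa / 12 * eisenstein 2 t * f t.

Fixpoint serre_iter (kappa : C) (n : nat) (f : C -> C) : C -> C :=
  match n with
  | 0%N => f
  | 1%N => serre kappa f
  | (m.+1 as p).+1 => fun t =>
      serre (kappa + 2 * p%:R) (serre_iter kappa p f) t
      - p%:R * (p%:R + kappa - 1) / 144 * eisenstein 4 t
        * serre_iter kappa m f t
  end.

Definition mat2 (a b c d : int) : 'M[int]_2 :=
  \matrix_(i, j) nth 0 (nth [::] [:: [:: a; b]; [:: c; d]] i) j.

Definition auto_den (g : 'M[int]_2) (t : C) : C :=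
  (g 1 0)%:~R * t + (g 1 1)%:~R.

Definition moebius (g : 'M[int]_2) (t : C) : C :=
  ((g 0 0)%:~R * t + (g 0 1)%:~R) / auto_den g t.

(* Mp_2(Z) is carved out of the type of pairs by the predicate Mp2.  The second
   component, a function on the upper half-plane, is extended by 0 to all of C,
   so that equality of pairs is equality in Mp_2(Z). *)
Definition mp : Type := ('M[int]_2 * (C -> C))%type.

Definition Mp2 (g : mp) : Prop :=
  [/\ \det g.1 = 1,
      holomorphic_H g.2,
      forall t : C, 0 < Im t -> g.2 t ^+ 2 = auto_den g.1 t &
      forall t : C, ~~ (0 < Im t) -> g.2 t = 0].

Definition on_H (f : C -> C) : C -> C := fun t => if 0 < Im t then f t else 0.

Definition mp_mul (g h : mp) : mp :=
  (g.1 *m h.1, fun t => g.2 (moebius h.1 t) * h.2 t).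

Definition mp_one : mp := (1%:M, on_H (fun=> 1)).
Definition mp_T : mp := (mat2 1 1 0 1, on_H (fun=> 1)).
Definition mp_S : mp := (mat2 0 (-1) 1 0, on_H (@sqrtc R)).

Definition Mp2_rep (d : nat) (rho : mp -> 'M[C]_d) : Prop :=
  rho mp_one = 1%:M /\
  forall g h, Mp2 g -> Mp2 h -> rho (mp_mul g h) = rho g *m rho h.

Definition contragredient (d : nat) (rho : mp -> 'M[C]_d) : mp -> 'M[C]_d :=
  fun g => (invmx (rho g))^T.

(* The argument m stands for twice the weight: kappa = m / 2. *)
Definition slash (d : nat) (m : int) (rho : mp -> 'M[C]_d) (F : C -> 'cV[C]_d)
    (g : mp) : C -> 'cV[C]_d :=
  fun t => (g.2 t) ^ (- m) *: (invmx (rho g) *m F (moebius g.1 t)).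

Definition of_weight_type (d : nat) (m : int) (rho : mp -> 'M[C]_d)
    (F : C -> 'cV[C]_d) : Prop :=
  forall g, Mp2 g -> forall t : C, 0 < Im t -> slash m rho F g t = F t.

(* "Only positive exponents": each component has an expansion in powers
   q^(n / N), n > 0 (enough for representations where T has finite order). *)
Definition cusp_form (d : nat) (m : int) (rho : mp -> 'M[C]_d)
    (F : C -> 'cV[C]_d) : Prop :=
  [/\ forall j, holomorphic_H (fun t => F t j 0),
      of_weight_type m rho F &
      forall j, exists (N : nat) (c : nat -> C), (0 < N)%N /\
        forall t : C, 0 < Im t ->
          series (fun n => c n * ee (n.+1%:R / N%:R * t) : C^o) @ \oo
            --> (F t j 0 : C^o)].

Definition half_weight (m : int) : R := m%:~R / 2.

Definition xi (m : int) (f : C -> C) : C -> C := fun t =>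
  2 * 'i%C * (powR (Im t) (half_weight m))%:C * conjc (dtaubar f t).

Definition Delta (m : int) (f : C -> C) : C -> C := fun t =>
  - ((Im t)%:C ^+ 2) * (du (du f) t + dv (dv f) t)
  + 'i%C * (half_weight m)%:C * (Im t)%:C * (du f t + 'i%C * dv f t).

Definition harmonic_plus (d : nat) (m : int) (rho : mp -> 'M[C]_d)
    (F : C -> 'cV[C]_d) : Prop :=
  [/\ forall j, smooth_H (fun t => F t j 0),
      of_weight_type m rho F,
      forall t : C, 0 < Im t -> vop (Delta m) F t = 0,
      exists A M v0 : R, forall t : C, 0 < Im t -> v0 <= Im t ->
        forall j, `|F t j 0| <= (M * expR (A * Im t))%:C &
      cusp_form (4 - m) (contragredient rho) (vop (xi m) F)].

Definition modular_form (w : nat) (f : C -> C) : Prop :=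
  [/\ holomorphic_H f,
      forall (g : 'M[int]_2) (t : C), \det g = 1 -> 0 < Im t ->
        f (moebius g t) = auto_den g t ^+ w * f t &
      exists c : nat -> C, forall t : C, 0 < Im t ->
        series (fun n => c n * ee (n%:R * t) : C^o) @ \oo --> (f t : C^o)].

Definition half_int (m : int) : C := m%:~R + 2^-1.

Definition thetaJ (z t : C) : C := zsum (fun m =>
  cexp (cpi * 'i%C * half_int m ^+ 2 * t
        + 2 * cpi * 'i%C * half_int m * (z + 2^-1))).

Definition Theta_coord (l j : nat) (t : C) : C :=
  ee (j%:R ^+ 2 / (2 * l%:R) * t) * thetaJ (j%:R * t) (l%:R * t).

(* Coordinates 1..d are indexed by j : 'I_d through j.+1. *)
Definition Theta (k : nat) (t : C) : 'cV[C]_(k.-1) :=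
  \col_j Theta_coord (ell k) j.+1 t.

Definition Fvec (k : nat) (t : C) : 'cV[C]_(k.-1) :=
  (- 'i%C * (Num.sqrt ((ell k)%:R / 2))%:C / eta t) *: Theta k t.

Definition Hvec (k : nat) (t : C) : 'cV[C]_(k.-1) := eta t *: Fvec k t.

Definition sigma_T (k : nat) : 'M[C]_(k.-1) :=
  \matrix_(i, j)
    ((i == j)%:R * ee (((ell k)%:R - 2 * j.+1%:R) ^+ 2 / (8 * (ell k)%:R))).

Definition sigma_S (k : nat) : 'M[C]_(k.-1) :=
  ee (- 8^-1) *: \matrix_(i, j)
    (2 * (-1) ^+ (k + i.+1 + j.+1)
     * (sin (2 * pi * i.+1%:R * j.+1%:R / (ell k)%:R)
        / Num.sqrt (ell k)%:R)%:C).

Definition is_sigma (k : nat) (sigma : mp -> 'M[C]_(k.-1)) : Prop :=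
  [/\ Mp2_rep sigma,
      forall g, Mp2 g -> sigma g \is unitarymx,
      sigma mp_T = sigma_T k &
      sigma mp_S = sigma_S k].

Definition cint01 (f : R -> C) : C :=
  (\int[lebesgue_measure]_(s in `[0, 1]) Re (f s))
  +i* (\int[lebesgue_measure]_(s in `[0, 1]) Im (f s)).

(* E(z) = 2 \int_0^z exp(- pi w^2) dw along the segment w = z s. *)
Definition Efun (z : C) : C :=
  2 * cint01 (fun s => z * cexp (- cpi * (z * s%:C) ^+ 2)).

Definition Ssharp (Z W s : C) : C := zsum (fun m =>
  ((Num.sg (m%:~R + 2^-1 : R))%:C
   - Efun ((half_int m + (Z - W) / (2 * 'i%C * (Im s)%:C))
           * (Num.sqrt (2 * Im s))%:C))
  * (-1) ^ m
  * cexp (- cpi * 'i%C * s * half_int m ^+ 2 - 2 * cpi * 'i%C * half_int m * Z)).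

Definition appell (l : nat) (z1 z2 t : C) : C :=
  cexp (cpi * 'i%C * l%:R * z1) * zsum (fun n =>
    (-1) ^ n * ee (l%:R * n%:~R * (n%:~R + 1) / 2 * t) * ee (n%:~R * z2)
    / (1 - ee z1 * ee (n%:~R * t))).

Definition Asharp (k : nat) (Z W t : C) : C :=
  let l : C := (ell k)%:R in
  appell (ell k) Z 0 t
  + 'i%C / 2 * \sum_(nu < ell k)
      ee (nu%:R * Z) * thetaJ (nu%:R * t + k%:R) (l * t)
      * Ssharp (l * Z - nu%:R * t - k%:R) (l * W - nu%:R * conjc t - k%:R)
               (l * t).

Definition Rsharp (k : nat) (Z W t : C) : C :=
  - (eta t)^-1 * Asharp k Z W t
  * cexp (- ((ell k)%:R * cpi ^+ 2 / 6) * eisenstein 2 t * Z ^+ 2).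

(* r n is the coefficient r_(2n+1,k) of Z^(2n+1). *)
Definition rank_taylor (k : nat) (r : nat -> C -> C) : Prop :=
  forall t : C, 0 < Im t -> exists2 e : R, 0 < e &
    forall Z : C, 0 < `|Z| -> `|Z| < e%:C ->
      series (fun n => r n t * Z ^+ (2 * n + 1) : C^o) @ \oo -->
        (2^-1 * (Rsharp k Z 0 t - Rsharp k (- Z) 0 t)
         - (2 * cpi * 'i%C * eta t)^-1 * Z^-1 : C^o).

Definition a_coef (k : nat) (r : nat -> C -> C) (G : C -> 'cV[C]_(k.-1))
    (n : nat) (t : C) : C :=
  eta t / (2 * cpi * 'i%C) ^+ (2 * n + 1)
  * (r n t - (8 * (ell k)%:R * cpi ^+ 2) ^+ n / ((2 * n + 1)`!)%:R
             * ((Fvec k t)^T *m vop (serre_iter (3 / 2) n) G t) 0 0).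

Fixpoint Hiter (k r : nat) : C -> 'cV[C]_(k.-1) :=
  if r is p.+1 then vop (serre (2^-1 + 2 * p%:R)) (Hiter k p) else Hvec k.

(* F w is the form F^(l)_w, indexed by its weight. *)
Definition annihilating_forms (k : nat) (F : nat -> C -> C) : Prop :=
  [/\ forall r, (r <= k.-1)%N ->
        modular_form (ell k - 2 * r - 1) (F (ell k - 2 * r - 1)%N),
      forall t : C, 0 < Im t -> F 0%N t = 1 &
      forall t : C, 0 < Im t ->
        \sum_(r < (k.-1).+1) F (ell k - 2 * r - 1)%N t *: Hiter k r t = 0].

(* Formal Laurent series in X whose coefficients are functions of tau:
   c n is the coefficient of X^n. *)
Definition laurent : Type := int -> C -> C.

Definition lshift (p : int) (c : laurent) : laurent := fun n => c (n - p).

Definition lder (c : laurent) : laurent :=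
  fun n t => (n + 1)%:~R * c (n + 1) t.

Definition of_powerseries (s : nat -> C -> C) : laurent :=
  fun n => if n is Posz m then s m else fun=> 0.

Definition heat (l lam : nat) (c : laurent) : laurent := fun n t =>
  lder (lder c) n t + 2 * l%:R * D (c n) t
  - l%:R / 6 * eisenstein 2 t * (lshift 1 (lder c) n t + lam%:R * c n t)
  + l%:R ^+ 2 / 144 * eisenstein 4 t * lshift 2 c n t.

Fixpoint heat_iter (l r : nat) (c : laurent) : laurent :=
  if r is p.+1 then heat l (2 * p + 1) (heat_iter l p c) else c.

Definition Qop (k : nat) (F : nat -> C -> C) (c : laurent) : laurent :=
  fun n t => \sum_(r < (k.-1).+1)
    (2 * (ell k)%:R) ^+ (k.-1 - r) * F (ell k - 2 * r - 1)%N t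
    * heat_iter (ell k) r c n t.

Definition Cseries (k : nat) (r : nat -> C -> C) (G : C -> 'cV[C]_(k.-1)) :
    laurent := fun n t =>
  match n with
  | Posz m => if odd m then a_coef r G m./2 t else 0
  | Negz m => (m == 0%N)%:R
  end.

(* Coefficient of X^n in exp(\sum_i p_i X^i), for p_0 = 0. *)
Definition ps_exp (p : nat -> C) (n : nat) : C :=
  (\sum_(j < n.+1) (j`!%:R)^-1 *: (\poly_(i < n.+1) p i) ^+ j)`_n.

Definition src_exponent (l : nat) (t : C) (i : nat) : C :=
  if ~~ odd i && (4 <= i)%N then
    - l%:R * (ratr (bernoulli i) / (i%:R * i`!%:R)) * eisenstein i t
  else 0.

Definition Ssrc (l n : nat) (t : C) : C := ps_exp (src_exponent l t) n.

Definition rhs_series (l : nat) : laurent := fun n t =>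
  (l.-1)`!%:R * lshift (- l%:Z) (of_powerseries (Ssrc l)) n t.

End Defs.

(* Main.v *)
From HB Require Import structures.
Require Import Defs.
From mathcomp Require Import all_boot all_order all_algebra.
From mathcomp Require Import all_classical all_reals all_analysis.
From mathcomp Require Import complex ring lra zify.
Set Implicit Arguments.
Unset Strict Implicit.
Unset Printing Implicit Defensive.
Import Order.TTheory GRing.Theory Num.Theory.
Import numFieldNormedType.Exports.
Local Open Scope classical_set_scope.
Local Open Scope ring_scope.
Local Open Scope complex_scope.

(** Conjugation by [exp (l E2 X^2 / 24)] and Ramanujan's formula for [D E2] turn the heat operators into
    [Delta = d^2/dX^2 + 2 l D] plus scalars, so [Q_l] becomes a polynomial in [Delta], monic of degree
    [d], which annihilates the theta vector by the defining relation of the forms [F].  Up to the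
    conjugating factor, the series [C_{l,G}] is the odd part of three contributions.  Those of the
    completion and of the Serre derivatives of [G] are sums of a unary theta function times a series
    killed by [Delta], so [Q_l] kills them.  The third is the Appell function, which is
    [e^(l x / 2) / (1 - e^x)] plus a sum of terms [q^a e^(b x)] on which [Delta] acts by scalars.  At fixed
    [tau] let [B] be the image of the latter.  The bilateral series [theta^l e^(- l x / 2) B] has
    coefficients [h_n] with [(q^n - 1) h_n = 0], so it is constant; hence [B] is a multiple of
    [e^(l x / 2) / theta^l], whose logarithmic derivative is the generating series of the Eisenstein series.
    This gives the source, and the pole of order [l] at [0] gives the constant.  Identities between
    Laurent series in [X] are obtained by comparing asymptotic expansions for real [x] tending to [0]. *)

(** * Real-valued modulus on [R[i]] and limits of complex sequences *)

Section Modulus.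
Variable R : realType.
Local Notation C := R[i].
Local Notation Re := (@complex.Re R).
Local Notation Im := (@complex.Im R).
Implicit Types (x y z : C) (a b : R).

(** The completion and [G] are only smooth in [t], and the bilateral series in [zeta = e^x] converge
    at best in an annulus. This dictates the tools: unconditional sums over arbitrary index types,
    differentiated termwise by domination, and formal series in [X], tied to functions of real [x]
    by asymptotic expansions. The functional equation of [B] under [zeta -> q zeta] has the
    right-hand side [\sum_s P(s + l/2) zeta^s], with [P] an even polynomial of degree [2 d]; this
    series converges nowhere, so the equation is used on coefficients only. The decisive coincidence
    is [2 d = l - 1]: [theta^l] vanishes to order [l] at [zeta = 1], so its coefficients are
    orthogonal to all polynomials of degree below [l], hence to [P], and the right-hand side
    disappears after convolution. The same coincidence makes the pole of order [2 d + 1] one of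
    order [l]. No product formula for theta is used: its logarithmic derivative comes from a
    recurrence, its non-vanishing from a moment argument, and Ramanujan's formula from its heat
    equation. *)

Definition nm z : R := Normc.normc z.
Arguments nm : simpl never.

Lemma normE z : `|z| = (nm z)%:C. Proof. by case: z. Qed.

Lemma nm0 : nm 0 = 0. Proof. exact: Normc.normc0. Qed.
Lemma nm1 : nm 1 = 1. Proof. exact: Normc.normc1. Qed.
Lemma nm_ge0 z : 0 <= nm z. Proof. by case: z => a b; exact: sqrtr_ge0. Qed.
Lemma nmD x y : nm (x + y) <= nm x + nm y. Proof. exact: le_normcD. Qed.
Lemma nmM x y : nm (x * y) = nm x * nm y. Proof. exact: Normc.normcM. Qed.
Lemma nmN x : nm (- x) = nm x. Proof. exact: normcN. Qed.
Lemma nmV x : nm x^-1 = (nm x)^-1. Proof. exact: Normc.normcV. Qed.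
Lemma nmB x y : nm (x - y) <= nm x + nm y. Proof. by rewrite -(nmN y) nmD. Qed.
Lemma nmBC x y : nm (x - y) = nm (y - x). Proof. by rewrite -opprB nmN. Qed.
Lemma nm_eq0 z : (nm z == 0) = (z == 0).
Proof. by apply/eqP/eqP => [/Normc.eq0_normc//|->]; rewrite nm0. Qed.
Lemma nm_gt0 z : (0 < nm z) = (z != 0).
Proof. by rewrite lt0r nm_eq0 nm_ge0 andbT. Qed.
Lemma nmX z n : nm (z ^+ n) = nm z ^+ n.
Proof. by elim: n => [|n IH]; rewrite ?expr0 ?nm1// !exprS nmM IH. Qed.
Lemma nm_sum (I : Type) (s : seq I) (P : pred I) (f : I -> C) :
  nm (\sum_(i <- s | P i) f i) <= \sum_(i <- s | P i) nm (f i).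
Proof.
elim/big_rec2: _ => [|i y z _ le_yz]; first by rewrite nm0.
by rewrite (le_trans (nmD _ _))// lerD2l.
Qed.
Lemma nm_real a : nm a%:C = `|a|.
Proof. by rewrite /nm /= expr0n addr0 sqrtr_sqr. Qed.
Lemma nm_nat n : nm n%:R = n%:R :> R.
Proof. by rewrite -(rmorph_nat (real_complex R)) nm_real normr_nat. Qed.
Lemma nm_i : nm 'i%C = 1.
Proof. by rewrite /nm /= expr0n add0r expr1n sqrtr1. Qed.
Lemma nm_Re z : `|Re z| <= nm z.
Proof.
by case: z => a b; rewrite /nm /= -sqrtr_sqr ler_wsqrtr// lerDl sqr_ge0.
Qed.
Lemma nm_Im z : `|Im z| <= nm z.
Proof.
by case: z => a b; rewrite /nm /= -sqrtr_sqr ler_wsqrtr// lerDr sqr_ge0.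
Qed.
Lemma cRect z : z = (Re z)%:C + 'i%C * (Im z)%:C. Proof. exact: complexE. Qed.
Lemma nm_ReIm z : nm z <= `|Re z| + `|Im z|.
Proof. by rewrite {1}(cRect z) (le_trans (nmD _ _))// nmM nm_i mul1r !nm_real. Qed.
Lemma nm_sign n : nm ((-1) ^+ n) = 1.
Proof. by rewrite nmX nmN nm1 expr1n. Qed.
Lemma cReD x y : Re (x + y) = Re x + Re y. Proof. by case: x y => ? ? []. Qed.
Lemma cImD x y : Im (x + y) = Im x + Im y. Proof. by case: x y => ? ? []. Qed.
Lemma cReN x : Re (- x) = - Re x. Proof. by case: x. Qed.
Lemma cImN x : Im (- x) = - Im x. Proof. by case: x. Qed.
Lemma cReM x y : Re (x * y) = Re x * Re y - Im x * Im y.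
Proof. by case: x y => ? ? []. Qed.
Lemma cImM x y : Im (x * y) = Re x * Im y + Im x * Re y.
Proof. by case: x y => ? ? []. Qed.
Lemma Re_natC n : Re (n%:R : C) = n%:R.
Proof. by rewrite -(rmorph_nat (real_complex R)). Qed.
Lemma Im_natC n : Im (n%:R : C) = 0.
Proof. by rewrite -(rmorph_nat (real_complex R)). Qed.

Lemma le_eps a b : (forall e, 0 < e -> a <= b + e) -> a <= b.
Proof. by move=> h; apply/ler_addgt0Pr => e /h. Qed.

Lemma le_epsM (K a b : R) : (forall e, 0 < e -> a <= b + K * e) -> a <= b.
Proof.
move=> h; apply: le_eps => e e0.
have K1 : 0 < `|K| + 1 by rewrite ltr_wpDl.
have := h (e / (`|K| + 1)) (divr_gt0 e0 K1) => /le_trans; apply.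
rewrite lerD2l mulrA ler_pdivrMr// mulrC ler_pM2l//.
by rewrite (le_trans (ler_norm _))// lerDl.
Qed.

Lemma eq_eps x y : (forall e, 0 < e -> nm (x - y) <= e) -> x = y.
Proof.
move=> h; apply/eqP; rewrite -subr_eq0 -nm_eq0 eq_le nm_ge0 andbT.
by apply: le_eps => e /h; rewrite add0r.
Qed.

Lemma cvgCP (u : nat -> C) (l : C) :
  (u : nat -> C^o) @ \oo --> (l : C^o) <->
  (forall e, 0 < e -> exists N, forall n, (N <= n)%N -> nm (u n - l) <= e).
Proof.
split.
  move=> /cvgrPdist_lt h e e0.
  have e0' : 0 < e%:C by rewrite ltcR.
  have [N _ hN] := h _ e0'; exists N => n Nn.
  by have := hN n Nn; rewrite /= normE ltcR nmBC => /ltW.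
move=> h; apply/cvgrPdist_lt => e e0.
(* The tolerance is a positive element of [R[i]], hence real. *)
have [Re0 eE] : 0 < Re e /\ e = (Re e)%:C.
  move: e0; rewrite ltcE /= => /andP[/eqP Ie Re0]; split => //.
  by case: (e) Ie => p w /= ->.
have [|N hN] := h (Re e / 2); first by rewrite divr_gt0.
exists N => // n Nn; rewrite /= normE eE ltcR nmBC (le_lt_trans (hN n Nn))//.
by rewrite ltr_pdivrMr// ltr_pMr// ltr1n.
Qed.

Lemma clim_eq (u : nat -> C) (l : C) :
  (u : nat -> C^o) @ \oo --> (l : C^o) -> clim u = l.
Proof. by move=> h; apply: (@cvg_lim C^o) => //; exact: norm_hausdorff. Qed.

End Modulus.

Arguments nm {R} z : simpl never.

(** * Unconditional summation over arbitrary index types *)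

Section Summation.
Variable R : realType.
Local Notation C := R[i].
Local Notation Re := (@complex.Re R).
Local Notation Im := (@complex.Im R).

Section Def.
Variable I : choiceType.
Implicit Types (f g : I -> C) (h : I -> R) (A B : seq I) (K : R).

(** Convergence along the net of finite subsets, coded as duplicate-free sequences. As no order
    enters, absolutely summable families can be reindexed, split and exchanged freely; the ordered
    sums [csum] and [zsum] are recovered from this one. *)
Definition has_tsum f (s : C) := forall e : R, 0 < e -> exists A,
  forall B, uniq B -> {subset A <= B} -> nm (\sum_(i <- B) f i - s) <= e.

Definition bsum h K := forall B, uniq B -> \sum_(i <- B) h i <= K.

Definition asum f := exists K, bsum (fun i => nm (f i)) K.

Definition tsum f : C := xget 0 [set s | has_tsum f s].

Lemma has_tsum_uniq f s s' : has_tsum f s -> has_tsum f s' -> s = s'.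
Proof.
move=> h h'; apply: eq_eps => e e0.
have e2 : 0 < e / 2 by rewrite divr_gt0.
have [A hA] := h _ e2; have [A' hA'] := h' _ e2.
set B := undup (A ++ A'); set S := \sum_(i <- B) f i.
have -> : s - s' = - (S - s) + (S - s') by ring.
rewrite (le_trans (nmD _ _))// nmN [e in _ <= e]splitr lerD//.
  by apply: hA => [|i Ai]; rewrite ?undup_uniq// mem_undup mem_cat Ai.
by apply: hA' => [|i Ai]; rewrite ?undup_uniq// mem_undup mem_cat Ai orbT.
Qed.

Lemma tsum_has_tsum f s : has_tsum f s -> tsum f = s.
Proof. by move=> h; apply: (has_tsum_uniq _ h); apply: (xgetPex 0); exists s. Qed.

Lemma hsD f g s s' : has_tsum f s -> has_tsum g s' -> has_tsum (fun i => f i + g i) (s + s').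
Proof.
move=> h h' e e0.
have e2 : 0 < e / 2 by rewrite divr_gt0.
have [A hA] := h _ e2; have [A' hA'] := h' _ e2; exists (A ++ A') => B uB sB.
rewrite big_split /= opprD addrACA [e in _ <= e]splitr (le_trans (nmD _ _))//.
by rewrite lerD// ?hA// ?hA'// => i Ai; apply: sB; rewrite mem_cat Ai ?orbT.
Qed.

Lemma hsZ c f s : has_tsum f s -> has_tsum (fun i => c * f i) (c * s).
Proof.
move=> h e e0.
have c0 : 0 < nm c + 1 by rewrite ltr_wpDl ?nm_ge0.
have [A hA] := h (e / (nm c + 1)) (divr_gt0 e0 c0); exists A => B uB sB.
rewrite -mulr_sumr -mulrBr nmM (le_trans (ler_wpM2l _ (hA B uB sB))) ?nm_ge0//.
by rewrite mulrCA ler_piMr ?(ltW e0)// ler_pdivrMr// mul1r lerDl.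
Qed.

Lemma has_tsum_real_sup h K : (forall i, 0 <= h i) -> bsum h K ->
  exists s : R, has_tsum (fun i => (h i)%:C) s%:C.
Proof.
move=> h0 hK; pose S := [set x | exists2 B, uniq B & x = \sum_(i <- B) h i].
have supS : has_sup S.
  split; first by exists 0, [::]; rewrite ?big_nil.
  by exists K => x [B uB ->]; exact: hK.
exists (sup S) => e e0.
have [x [A uA ->] xs] := sup_adherent e0 supS; exists A => B uB sB.
rewrite -rmorph_sum -rmorphB nm_real.
have B_le : \sum_(i <- B) h i <= sup S by apply: ub_le_sup; [exact: supS.2|exists B].
have A_le : \sum_(i <- A) h i <= \sum_(i <- B) h i.
  have pB : perm_eq B (A ++ [seq i <- B | i \notin A]).
    apply: uniq_perm => //.
      rewrite cat_uniq uA filter_uniq// andbT -all_predC; apply/allP => i.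
      by rewrite mem_filter => /andP[].
    move=> i; rewrite mem_cat mem_filter; have [/sB ->//|] := boolP (i \in A).
    by [].
  by rewrite (perm_big _ pB) big_cat lerDl sumr_ge0.
rewrite ler0_norm ?subr_le0// opprB lerBlDr -lerBlDl (le_trans _ A_le)//.
exact: ltW.
Qed.

Lemma asum_has_tsum f : asum f -> has_tsum f (tsum f).
Proof.
move=> [K hK]; apply: (xgetPex 0).
have pos (k : C -> R) : (forall z, `|k z| <= nm z) ->
    exists s, has_tsum (fun i => (k (f i))%:C) s.
  move=> hk.
  (* [nm + k] is nonnegative and at most twice [nm], so it has a sum; the sum of [nm] is then
     subtracted. *)
  have [s hs1] : exists s : R, has_tsum (fun i => (nm (f i) + k (f i))%:C) s%:C.
    apply: (@has_tsum_real_sup _ (K + K)) => [i|B uB].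
      by rewrite -lerBlDr sub0r (le_trans _ (hk _))// lerNl lerNnormlW.
    rewrite big_split lerD ?hK// (le_trans _ (hK B uB))// ler_sum// => i _.
    by rewrite (le_trans (ler_norm _)).
  have [s' hs2] : exists s : R, has_tsum (fun i => (nm (f i))%:C) s%:C.
    by apply: (@has_tsum_real_sup _ K) => // i; exact: nm_ge0.
  exists (s%:C + (-1) * s'%:C).
  have := hsD hs1 (hsZ (-1) hs2); congr has_tsum; apply/funext => i.
  by rewrite rmorphD /=; ring.
have [s hr] := pos Re (@nm_Re R); have [s' hi] := pos Im (@nm_Im R).
exists (s + 'i%C * s'); have := hsD hr (hsZ 'i%C hi); congr has_tsum.
by apply/funext => i; rewrite [RHS]complexE.
Qed.

Lemma asum_eq f g : f =1 g -> asum f -> asum g.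
Proof. by move=> /funext ->. Qed.

Lemma eq_tsum f g : f =1 g -> tsum f = tsum g.
Proof. by move=> /funext ->. Qed.

Lemma asum_le (h : I -> R) K f : bsum h K -> (forall i, nm (f i) <= h i) ->
  asum f.
Proof. by move=> hK le_fh; exists K => B /hK; apply: le_trans; exact: ler_sum. Qed.

Lemma asum_nm f g : asum g -> (forall i, nm (f i) <= nm (g i)) -> asum f.
Proof. by move=> [K /asum_le]; apply. Qed.

Lemma asumD f g : asum f -> asum g -> asum (fun i => f i + g i).
Proof.
move=> [K hK] [L hL]; exists (K + L) => B uB.
apply: le_trans (lerD (hK B uB) (hL B uB)); rewrite -big_split ler_sum// => i _.
exact: nmD.
Qed.

Lemma bsumZ c h K : 0 <= c -> bsum h K -> bsum (fun i => c * h i) (c * K).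
Proof. by move=> c0 hK B uB; rewrite -mulr_sumr ler_wpM2l// hK. Qed.

Lemma asumZ c f : asum f -> asum (fun i => c * f i).
Proof.
move=> [K hK]; exists (nm c * K); have := bsumZ (nm_ge0 c) hK.
by congr bsum; apply/funext => i; rewrite nmM.
Qed.

Lemma tsumD f g : asum f -> asum g ->
  tsum (fun i => f i + g i) = tsum f + tsum g.
Proof. by move=> /asum_has_tsum hf /asum_has_tsum hg; apply: tsum_has_tsum; exact: hsD. Qed.

Lemma tsumZ c f : asum f -> tsum (fun i => c * f i) = c * tsum f.
Proof. by move=> /asum_has_tsum hf; apply: tsum_has_tsum; exact: hsZ. Qed.

Lemma tsumB f g : asum f -> asum g ->
  tsum (fun i => f i - g i) = tsum f - tsum g.
Proof.
move=> hf hg; rewrite -[- tsum g]mulN1r -tsumZ// -tsumD//; last exact: asumZ.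
by apply: eq_tsum => i; rewrite mulN1r.
Qed.

Lemma asum0 : asum (fun=> 0).
Proof. by exists 0 => B _; rewrite big1// => i _; rewrite nm0. Qed.

Lemma tsum0 : tsum (fun=> 0) = 0.
Proof.
by apply: tsum_has_tsum => e e0; exists [::] => B _ _; rewrite big1// subr0 nm0 ltW.
Qed.

Lemma asum_sum (n : nat) (F : nat -> I -> C) :
  (forall j, (j < n)%N -> asum (F j)) -> asum (fun i => \sum_(j < n) F j i).
Proof.
elim: n => [|n IH] h; first by apply: asum_eq asum0 => i; rewrite big_ord0.
apply: asum_eq (asumD (IH _) (h n _)) => [i|j jn|//]; first by rewrite big_ord_recr.
exact/h/ltnW.
Qed.

Lemma tsum_sum (n : nat) (F : nat -> I -> C) :
  (forall j, (j < n)%N -> asum (F j)) ->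
  tsum (fun i => \sum_(j < n) F j i) = \sum_(j < n) tsum (F j).
Proof.
elim: n => [|n IH] h.
  by rewrite big_ord0 -[RHS]tsum0; apply: eq_tsum => i; rewrite big_ord0.
have h' j : (j < n)%N -> asum (F j) by move=> jn; exact/h/ltnW.
rewrite big_ord_recr /= -IH// -(tsumD (asum_sum h') (h n (ltnSn n))).
by apply: eq_tsum => i; rewrite big_ord_recr.
Qed.

Lemma has_tsum_le f s K : has_tsum f s ->
  (forall B, uniq B -> \sum_(i <- B) nm (f i) <= K) -> nm s <= K.
Proof.
move=> h hK; apply: le_eps => e /h[A hA].
have := hA (undup A) (undup_uniq _); set S := \sum_(i <- _) _ => hS.
have -> : s = S - (S - s) by ring.
rewrite (le_trans (nmB _ _))// lerD ?hS// => [|i]; last by rewrite mem_undup.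
by rewrite (le_trans (nm_sum _ _ _))// hK ?undup_uniq.
Qed.

Lemma tsum_le (h : I -> R) K f :
  bsum h K -> (forall i, nm (f i) <= h i) -> nm (tsum f) <= K.
Proof.
move=> hK le_fh; apply: (has_tsum_le (asum_has_tsum (asum_le hK le_fh))) => B uB.
by rewrite (le_trans _ (hK B uB))// ler_sum.
Qed.

(** [A] is a finite set whose sum is within [e] of the supremum of all finite sums. *)
Lemma bsum_tail h K : (forall i, 0 <= h i) -> bsum h K ->
  forall e, 0 < e -> exists2 A, uniq A &
    forall B, uniq B -> (forall i, i \in B -> i \notin A) ->
      \sum_(i <- B) h i <= e.
Proof.
move=> h0 hK; pose S := [set x | exists2 B, uniq B & x = \sum_(i <- B) h i].
have supS : has_sup S.
  split; first by exists 0, [::]; rewrite ?big_nil.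
  by exists K => x [B uB ->]; exact: hK.
move=> e e0; have [x [A uA ->] xs] := sup_adherent e0 supS; exists A => // B uB dB.
have : \sum_(i <- A ++ B) h i <= sup S.
  apply: ub_le_sup; [exact: supS.2|exists (A ++ B) => //].
  by rewrite cat_uniq uA uB andbT -all_predC; apply/allP.
by rewrite big_cat /= => hAB; lra.
Qed.

End Def.

Lemma perm_cat_filter (I : choiceType) (A B : seq I) : uniq A -> uniq B ->
  {subset A <= B} -> perm_eq B (A ++ [seq i <- B | i \notin A]).
Proof.
move=> uA uB sB; apply: uniq_perm => //.
  rewrite cat_uniq uA filter_uniq// andbT -all_predC; apply/allP => i.
  by rewrite mem_filter => /andP[].
by move=> i; rewrite mem_cat mem_filter; have [/sB ->|] := boolP (i \in A).
Qed.

Section Reindex.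
Variables (I J : choiceType) (h : I -> J) (g : J -> option I).
Hypothesis hK : pcancel h g.
Hypothesis gK : forall i j, g j = Some i -> h i = j.

Let sum_pmap (V : zmodType) (f : J -> V) (B : seq J) :
  (forall j, g j = None -> f j = 0) ->
  \sum_(j <- B) f j = \sum_(i <- pmap g B) f (h i).
Proof.
move=> f0; elim: B => [|j B IH]; first by rewrite !big_nil.
rewrite big_cons /=; case gj: (g j) => [i|] /=; last by rewrite f0// add0r.
by rewrite big_cons IH (gK gj).
Qed.

Let uniq_pmapg (B : seq J) : uniq B -> uniq (pmap g B).
Proof.
elim: B => //= j B IH /andP[jB /IH uB]; case gj: (g j) => [i|] //=.
rewrite uB andbT; apply: contra jB; rewrite mem_pmap => /mapP[k kB] /esym/gK.
by rewrite (gK gj) => ->.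
Qed.

(** [g] is a partial inverse of [h] which returns [None] exactly off the image, so the hypothesis
    says that [f] is supported on that image. *)
Lemma has_tsum_inj (f : J -> C) s : (forall j, g j = None -> f j = 0) ->
  has_tsum (f \o h) s -> has_tsum f s.
Proof.
move=> f0 hf e /hf[A hA]; exists (map h A) => B uB sB.
rewrite (sum_pmap _ f0); apply: hA => [|i iA]; first exact: uniq_pmapg.
by rewrite mem_pmap -hK map_f// sB// map_f.
Qed.

Lemma asum_inj (f : J -> C) : (forall j, g j = None -> f j = 0) ->
  asum (f \o h) -> asum f.
Proof.
move=> f0 [K hK']; exists K => B uB.
rewrite (@sum_pmap _ (fun j => nm (f j))) ?hK' ?uniq_pmapg// => j /f0 ->.
exact: nm0.
Qed.

Lemma asum_comp (f : J -> C) : asum f -> asum (f \o h).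
Proof.
move=> [K hK']; exists K => B uB; rewrite -(big_map h xpredT (fun j => nm (f j))).
by rewrite hK' ?map_inj_uniq//; exact: pcan_inj hK.
Qed.

Lemma tsum_inj (f : J -> C) : (forall j, g j = None -> f j = 0) ->
  asum (f \o h) -> tsum f = tsum (f \o h).
Proof. by move=> f0 /asum_has_tsum hf; apply: tsum_has_tsum; exact: has_tsum_inj. Qed.

End Reindex.

Section Bijection.
Variables (I J : choiceType) (h : I -> J) (g : J -> I).
Hypotheses (hK : cancel h g) (gK : cancel g h).

Lemma tsum_bij (f : J -> C) : asum f -> tsum f = tsum (f \o h).
Proof.
move=> af; apply: (@tsum_inj _ _ h (Some \o g)) => //=; first by move=> i; rewrite /= hK.
  by move=> i j [<-].
by apply: (@asum_comp _ _ _ (Some \o g)) => // i; rewrite /= hK.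
Qed.

Lemma asum_bij (f : J -> C) : asum f -> asum (f \o h).
Proof. by apply: (@asum_comp _ _ _ (Some \o g)) => // i; rewrite /= hK. Qed.

End Bijection.

Section Pairs.
Variables I J : choiceType.
Implicit Types f : I * J -> C.

Lemma asum_fst f i : asum f -> asum (fun j => f (i, j)).
Proof.
move=> [K hK]; exists K => B uB.
have := hK [seq (i, j) | j <- B]; rewrite big_map; apply.
by rewrite map_inj_uniq// => j j' [].
Qed.

(** One finite set serves finitely many rows at once and may be asked to contain a given one;
    rectangles can then be compared both with the double sum and with the row sums. *)
Let approx f (B : seq I) (A : seq J) e : asum f -> 0 < e ->
  exists A', [/\ uniq A', {subset A <= A'} & forall i, i \in B ->
    nm (\sum_(j <- A') f (i, j) - tsum (fun j => f (i, j))) <= e].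
Proof.
move=> af e0; have hi i := asum_has_tsum (asum_fst i af) e0.
pose Ai i := xget [::] [set A : seq J | forall A' : seq J, uniq A' -> {subset A <= A'} ->
  nm (\sum_(j <- A') f (i, j) - tsum (fun j => f (i, j))) <= e].
have hAi i := xgetPex [::] (hi i) : _ (Ai i).
exists (undup (A ++ flatten (map Ai B))); split; first exact: undup_uniq.
  by move=> j jA; rewrite mem_undup mem_cat jA.
move=> i iB; apply: hAi => [|j jA]; first exact: undup_uniq.
rewrite mem_undup mem_cat; apply/orP; right; apply/flattenP.
by exists (Ai i) => //; exact: map_f.
Qed.

Let sum_prod (V : zmodType) (g : I * J -> V) (B : seq I) (A : seq J) :
  \sum_(p <- [seq (i, j) | i <- B, j <- A]) g p =
  \sum_(i <- B) \sum_(j <- A) g (i, j).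
Proof. exact: big_allpairs. Qed.

Let uniq_prod (B : seq I) (A : seq J) : uniq B -> uniq A ->
  uniq [seq (i, j) | i <- B, j <- A].
Proof. by move=> uB uA; apply: allpairs_uniq => // -[? ?] [? ?]. Qed.

Lemma asum_pair f : asum f -> asum (fun i => tsum (fun j => f (i, j))).
Proof.
move=> af; have [K hK] := af; exists K => B uB.
apply: (@le_epsM _ (size B)%:R) => e e0.
have [A [uA _ hA]] := approx B [::] af e0.
apply: le_trans (lerD (hK _ (uniq_prod uB uA)) (lexx _)).
have -> : (size B)%:R * e = \sum_(i <- B) e.
  by rewrite big_const_seq count_predT iter_addr_0 mulr_natl.
rewrite sum_prod -big_split /= big_seq [leRHS]big_seq ler_sum// => i iB.
set t := tsum _; set s := \sum_(j <- A) f (i, j).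
have -> : t = s - (s - t) by ring.
by rewrite (le_trans (nmB _ _))// lerD ?hA ?nm_sum.
Qed.

Lemma has_tsum_pair f s : asum f -> has_tsum f s -> has_tsum (fun i => tsum (fun j => f (i, j))) s.
Proof.
move=> af hf e e0.
have e2 : 0 < e / 2 by rewrite divr_gt0.
have [A hA] := hf _ e2; exists (map fst A) => B uB sB.
have b0 : 0 < (size B)%:R + 1 :> R by rewrite ltr_wpDl.
(* Every row receives an equal share of the tolerance; the [+ 1] covers an empty [B]. *)
have d0 : 0 < e / 2 / ((size B)%:R + 1) by rewrite divr_gt0.
have [A' [uA' sA' hA']] := approx B (map snd A) af d0.
have := hA _ (uniq_prod uB uA').
rewrite sum_prod; set S1 := \sum_(i <- B) _; set S2 := \sum_(i <- B) _ => h.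
have -> : S2 - s = (S2 - S1) + (S1 - s) by ring.
rewrite (le_trans (nmD _ _))// [e in _ <= e]splitr lerD//; last first.
  apply: h => -[i j] ijA; apply/allpairsP; exists (i, j) => /=.
  by split=> //; [apply/sB/(map_f fst ijA)|apply/sA'/(map_f snd ijA)].
have -> : S2 - S1 = \sum_(i <- B) (tsum (fun j => f (i, j)) -
    \sum_(j <- A') f (i, j)) by rewrite sumrB.
rewrite (le_trans (nm_sum _ _ _))//.
apply: (@le_trans _ _ (\sum_(i <- B) (e / 2 / ((size B)%:R + 1)))).
  by rewrite big_seq [leRHS]big_seq ler_sum// => i iB; rewrite nmBC hA'.
rewrite big_const_seq count_predT iter_addr_0 -[leLHS]mulr_natl mulrCA.
by rewrite ler_piMr ?(ltW e2)// ler_pdivrMr// mul1r lerDl.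
Qed.

Lemma tsum_pair f : asum f ->
  tsum f = tsum (fun i => tsum (fun j => f (i, j))).
Proof. by move=> af; apply/esym/tsum_has_tsum/has_tsum_pair/asum_has_tsum. Qed.

Lemma bsum_prod (g : I -> R) (h : J -> R) K L : (forall i, 0 <= g i) ->
  (forall j, 0 <= h j) -> bsum g K -> bsum h L ->
  bsum (fun p : I * J => g p.1 * h p.2) (K * L).
Proof.
move=> g0 h0 hK hL B uB.
pose B1 := undup (map fst B); pose B2 := undup (map snd B).
have u12 : uniq [seq (i, j) | i <- B1, j <- B2] by rewrite uniq_prod ?undup_uniq.
have s12 : {subset B <= [seq (i, j) | i <- B1, j <- B2]}.
  move=> [i j] ijB; apply/allpairsP; exists (i, j); rewrite !mem_undup /=.
  by split=> //; [exact: (map_f fst ijB)|exact: (map_f snd ijB)].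
apply: (@le_trans _ _ (\sum_(p <- [seq (i, j) | i <- B1, j <- B2]) g p.1 * h p.2)).
  rewrite (perm_big _ (perm_cat_filter uB u12 s12)) big_cat lerDl sumr_ge0// => p _.
  exact: mulr_ge0.
rewrite sum_prod /=.
under eq_bigr do rewrite -mulr_sumr.
rewrite -mulr_suml ler_pM ?sumr_ge0//; first by rewrite hK ?undup_uniq.
by rewrite hL ?undup_uniq.
Qed.

Lemma asum_prod (f : I -> C) (g : J -> C) : asum f -> asum g ->
  asum (fun p : I * J => f p.1 * g p.2).
Proof.
move=> [K hK] [L hL]; exists (K * L).
have := @bsum_prod _ _ K L (fun=> nm_ge0 _) (fun=> nm_ge0 _) hK hL.
by congr bsum; apply/funext => p; rewrite nmM.
Qed.

Lemma tsum_prod (f : I -> C) (g : J -> C) : asum f -> asum g ->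
  tsum (fun p : I * J => f p.1 * g p.2) = tsum f * tsum g.
Proof.
move=> af ag; rewrite tsum_pair; last exact: asum_prod.
rewrite mulrC -tsumZ//; apply: eq_tsum => i /=.
by rewrite tsumZ// mulrC.
Qed.

End Pairs.

Section Disjoint.
Variables I J : choiceType.
Implicit Types f : I + J -> C.

Let sum_sum (V : zmodType) (g : I + J -> V) (B : seq (I + J)) :
  \sum_(p <- B) g p =
  \sum_(i <- pmap (fun p => if p is inl i then Some i else None) B) g (inl i) +
  \sum_(j <- pmap (fun p => if p is inr i then Some i else None) B) g (inr j).
Proof.
elim: B => [|[i|j] B IH]; first by rewrite !big_nil addr0.
  by rewrite /= !big_cons IH addrA.
by rewrite /= !big_cons IH addrCA.
Qed.

Let pmap_uniq_l (B : seq (I + J)) : uniq B ->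
  uniq (pmap (fun p => if p is inl i then Some i else None) B).
Proof.
elim: B => //= -[i|j] B IH /andP[iB /IH uB] //=; rewrite uB andbT.
by apply: contra iB; rewrite mem_pmap => /mapP[[k|//] kB [->]].
Qed.

Let pmap_uniq_r (B : seq (I + J)) : uniq B ->
  uniq (pmap (fun p => if p is inr i then Some i else None) B).
Proof.
elim: B => //= -[i|j] B IH /andP[iB /IH uB] //=; rewrite uB andbT.
by apply: contra iB; rewrite mem_pmap => /mapP[[//|k] kB [->]].
Qed.

Lemma bsum_sumt (g : I + J -> R) K L : bsum (fun i => g (inl i)) K ->
  bsum (fun j => g (inr j)) L -> bsum g (K + L).
Proof.
by move=> hK hL B uB; rewrite sum_sum lerD// ?hK ?hL ?pmap_uniq_l ?pmap_uniq_r.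
Qed.

Lemma asum_sumt f : asum (fun i => f (inl i)) -> asum (fun j => f (inr j)) ->
  asum f.
Proof. by move=> [K hK] [L hL]; exists (K + L); exact: bsum_sumt. Qed.

Lemma tsum_sumt f : asum (fun i => f (inl i)) -> asum (fun j => f (inr j)) ->
  tsum f = tsum (fun i => f (inl i)) + tsum (fun j => f (inr j)).
Proof.
move=> /asum_has_tsum h1 /asum_has_tsum h2; apply: tsum_has_tsum => e e0.
have e2 : 0 < e / 2 by rewrite divr_gt0.
have [A hA] := h1 _ e2; have [A' hA'] := h2 _ e2.
exists (map inl A ++ map inr A') => B uB sB.
rewrite sum_sum opprD addrACA [e in _ <= e]splitr (le_trans (nmD _ _))// lerD//.
  apply: hA => [|i iA]; first exact: pmap_uniq_l.
  rewrite mem_pmap; apply/mapP; exists (inl i) => //; apply: sB.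
  by rewrite mem_cat map_f.
apply: hA' => [|i iA]; first exact: pmap_uniq_r.
rewrite mem_pmap; apply/mapP; exists (inr i) => //; apply: sB.
by rewrite mem_cat orbC map_f.
Qed.

End Disjoint.

Lemma has_tsum_series (f : nat -> C) s : has_tsum f s ->
  (fun N => \sum_(0 <= n < N) f n : C^o) @ \oo --> (s : C^o).
Proof.
move=> h; apply/cvgCP => e /h[A hA].
exists (\max_(i <- A) i).+1 => n An; apply: hA; first exact: iota_uniq.
move=> i iA; rewrite mem_index_iota /= (leq_trans _ An)// ltnS.
exact: leq_bigmax_seq.
Qed.

Lemma csum_tsum (f : nat -> C) : asum f -> csum f = tsum f.
Proof. by move=> /asum_has_tsum/has_tsum_series/clim_eq. Qed.

Definition int_of_sum (p : nat + nat) : int :=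
  match p with inl n => Posz n | inr n => Negz n end.
Definition sum_of_int (n : int) : nat + nat :=
  match n with Posz n => inl n | Negz n => inr n end.
Lemma int_of_sumK : cancel int_of_sum sum_of_int. Proof. by case. Qed.
Lemma sum_of_intK : cancel sum_of_int int_of_sum. Proof. by case. Qed.

Lemma asum_Posz (f : int -> C) : asum f -> asum (fun n : nat => f n).
Proof.
by apply: (@asum_comp _ _ Posz (fun n => if n is Posz m then Some m else None)).
Qed.

Lemma asum_Negz (f : int -> C) : asum f -> asum (fun n : nat => f (Negz n)).
Proof.
by apply: (@asum_comp _ _ Negz (fun n => if n is Negz m then Some m else None)).
Qed.

Lemma tsum_int (f : int -> C) : asum f ->
  tsum f = tsum (fun n : nat => f n) + tsum (fun n : nat => f (Negz n)).
Proof.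
move=> af; rewrite (tsum_bij int_of_sumK sum_of_intK af).
by rewrite tsum_sumt//=; [exact: asum_Posz|exact: asum_Negz].
Qed.

Lemma asum_int (f : int -> C) : asum (fun n : nat => f n) ->
  asum (fun n : nat => f (Negz n)) -> asum f.
Proof.
move=> h1 h2.
apply: (@asum_eq _ (f \o int_of_sum \o sum_of_int)) => [i|].
  by rewrite /= sum_of_intK.
by apply: (asum_bij sum_of_intK); exact: asum_sumt.
Qed.

Lemma zsum_tsum (f : int -> C) : asum f -> zsum f = tsum f.
Proof.
move=> af; rewrite tsum_int// /zsum !csum_tsum//; first exact: asum_Negz.
exact: asum_Posz.
Qed.

End Summation.

(** * Comparison with geometric series *)

Section Domination.
Variable R : realType.
Local Notation C := R[i].

(** Height functions for which every geometric series converges. They are stable under products and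
    disjoint unions, so that later convergence proofs reduce to a bound by [K * r ^+ h i]. *)
Definition geom_summable (I : choiceType) (h : I -> nat) :=
  forall r : R, 0 < r < 1 -> asum (fun i => (r ^+ h i)%:C).

Lemma geom_summable_nat : geom_summable id.
Proof.
move=> r /andP[r0 r1]; exists (1 - r)^-1 => B uB.
have r1' : 0 < 1 - r by rewrite subr_gt0.
under eq_bigr => i _ do rewrite nm_real ger0_norm ?exprn_ge0 ?(ltW r0)//.
pose N := (\max_(i <- B) i).+1.
have sB : {subset B <= index_iota 0 N}.
  by move=> i iB; rewrite mem_index_iota /= ltnS; exact: leq_bigmax_seq.
apply: (@le_trans _ _ (\sum_(i <- index_iota 0 N) r ^+ i)).
  rewrite (perm_big _ (perm_cat_filter uB (iota_uniq _ _) sB)) big_cat lerDl.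
  by rewrite sumr_ge0// => i _; rewrite exprn_ge0// ltW.
rewrite -[leRHS]mul1r ler_pdivlMr// big_mkord mulrC.
have -> : (1 - r) * \sum_(i < N) r ^+ i = 1 - r ^+ N.
  by rewrite -opprB mulNr -subrX1 opprB.
by rewrite gerBl exprn_ge0// ltW.
Qed.

Lemma geom_summable_pair (I J : choiceType) (h : I -> nat) (k : J -> nat) :
  geom_summable h -> geom_summable k -> geom_summable (fun p : I * J => (h p.1 + k p.2)%N).
Proof.
move=> gh gk r r01; apply: asum_eq (asum_prod (gh r r01) (gk r r01)) => -[i j] /=.
by rewrite exprD rmorphM.
Qed.

Lemma geom_summable_sumt (I J : choiceType) (h : I -> nat) (k : J -> nat) :
  geom_summable h -> geom_summable k ->
  geom_summable (fun p : I + J => match p with inl i => h i | inr j => k j end).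
Proof. by move=> gh gk r r01; apply: asum_sumt; [exact: gh|exact: gk]. Qed.

Lemma geom_summable_int : geom_summable (absz : int -> nat).
Proof.
move=> r r01; apply: asum_int; first exact: geom_summable_nat.
apply: asum_eq (asumZ r%:C (geom_summable_nat r01)) => n.
by rewrite /= -rmorphM -exprS.
Qed.

Lemma asum_geom_summable (I : choiceType) (h : I -> nat) (f : I -> C) (K r : R) :
  geom_summable h -> 0 < r < 1 -> (forall i, nm (f i) <= K * r ^+ h i) -> asum f.
Proof.
move=> gh r01 le_f; apply: asum_nm (asumZ K%:C (gh r r01)) _ => i.
rewrite -rmorphM nm_real (le_trans (le_f i))//; exact: ler_norm.
Qed.

Lemma poly_geo j (s : R) : 1 < s ->
  exists2 K, 0 < K & forall n, n%:R ^+ j <= K * s ^+ n.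
Proof.
elim: j s => [|j IH] s s1.
  exists 1 => // n; rewrite expr0 mul1r exprn_ege1//; exact: ltW.
have s0 : 0 < s by exact: lt_trans s1.
(* One half of the exponential [s ^+ n = u ^+ n * u ^+ n] absorbs a factor [n], by
   [n * (u - 1) <= u ^+ n], and the other half the remaining power. *)
pose u := Num.sqrt s; have u1 : 1 < u by rewrite -sqrtr1 ltr_sqrt.
have [K K0 hK] := IH u u1.
have d0 : 0 < u - 1 by rewrite subr_gt0.
exists (K / (u - 1)); first by rewrite divr_gt0.
move=> n; have -> : s ^+ n = u ^+ n * u ^+ n by rewrite -exprMn -expr2 sqr_sqrtr// ltW.
have -> : K / (u - 1) * (u ^+ n * u ^+ n) = (u ^+ n / (u - 1)) * (K * u ^+ n) by ring.
rewrite exprS ler_pM// ?exprn_ge0//; rewrite ler_pdivlMr//.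
elim: n => [|n IHn]; first by rewrite mul0r expr0.
rewrite -natr1 mulrDl mul1r exprS.
have : u ^+ n <= u * u ^+ n by rewrite ler_peMl ?exprn_ge0 ?ltW// (lt_trans _ u1).
have : 1 <= u ^+ n by rewrite exprn_ege1// ltW.
nra.
Qed.

End Domination.

(** * Derivatives of complex-valued functions of a real variable, and termwise differentiation *)

Section RealDerivative.
Variable R : realType.
Local Notation C := R[i].
Local Notation Re := (@complex.Re R).
Local Notation Im := (@complex.Im R).
Implicit Types (f g : R -> C) (x : R) (l : C).

(** A first-order expansion with explicit error: no quotient is formed, [h = 0] needs no exception,
    and the bounds add up under infinite sums. *)
Definition rd f x l := forall e : R, 0 < e -> exists2 d, 0 < d &
  forall h, `|h| <= d -> nm (f (x + h) - f x - h%:C * l) <= e * `|h|.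

Lemma rd_cst x l : rd (fun=> l) x 0.
Proof.
move=> e e0; exists 1 => // h _.
by rewrite mulr0 subrr subr0 nm0 mulr_ge0// ltW.
Qed.

Lemma rd_eq f g x l : (forall s, f s = g s) -> rd f x l -> rd g x l.
Proof. by move=> /funext ->. Qed.

Lemma rd_near f g x l d : 0 < d -> (forall s, `|s - x| <= d -> f s = g s) ->
  rd f x l -> rd g x l.
Proof.
move=> d0 fg h e /h[d' d'0 hd]; exists (Num.min d d'); first by rewrite lt_min d0.
move=> s; rewrite le_min => /andP[sd sd'].
by rewrite -!fg ?hd// ?subrr ?normr0 ?(ltW d0)// addrC addKr.
Qed.

Lemma rdD f g x l m : rd f x l -> rd g x m -> rd (fun s => f s + g s) x (l + m).
Proof.
move=> hf hg e e0; have e2 : 0 < e / 2 by rewrite divr_gt0.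
have [d d0 hd] := hf _ e2; have [d' d'0 hd'] := hg _ e2.
exists (Num.min d d'); first by rewrite lt_min d0.
move=> s; rewrite le_min => /andP[sd sd'].
have -> : f (x + s) + g (x + s) - (f x + g x) - s%:C * (l + m) =
  (f (x + s) - f x - s%:C * l) + (g (x + s) - g x - s%:C * m) by ring.
by rewrite (le_trans (nmD _ _))// [e in _ <= e * _]splitr mulrDl lerD ?hd ?hd'.
Qed.

Lemma rd_lip f x l : rd f x l -> exists2 d, 0 < d &
  forall h, `|h| <= d -> nm (f (x + h) - f x) <= (nm l + 1) * `|h|.
Proof.
move=> /(_ 1 ltr01)[d d0 hd]; exists d => // h /hd; rewrite mul1r => hh.
have -> : f (x + h) - f x = (f (x + h) - f x - h%:C * l) + h%:C * l by ring.
rewrite (le_trans (nmD _ _))// mulrDl mul1r addrC lerD//.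
by rewrite nmM nm_real mulrC.
Qed.

Lemma rdM f g x l m : rd f x l -> rd g x m ->
  rd (fun s => f s * g s) x (l * g x + f x * m).
Proof.
move=> hf hg.
have [d1 d10 h1] := rd_lip hf; have [d2 d20 h2] := rd_lip hg.
set L := nm l + 1 in h1; set M := nm m + 1 in h2.
have L0 : 0 < L by rewrite ltr_wpDl ?nm_ge0.
have M0 : 0 < M by rewrite ltr_wpDl ?nm_ge0.
pose T := nm (f x) + nm (g x) + L * M + 1.
have T0 : 0 < T by rewrite ltr_wpDl// !addr_ge0 ?nm_ge0// mulr_ge0// ltW.
move=> e e0; have eT : 0 < e / T by rewrite divr_gt0.
have [d3 d30 h3] := hf _ eT; have [d4 d40 h4] := hg _ eT.
exists (Num.min (Num.min d1 d2) (Num.min (Num.min d3 d4) (e / T))).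
  by rewrite !lt_min d10 d20 d30 d40 eT.
move=> s; rewrite !le_min => /andP[/andP[/h1 s1 /h2 s2] /andP[/andP[/h3 s3 /h4 s4] s5]].
have -> : f (x + s) * g (x + s) - f x * g x - s%:C * (l * g x + f x * m) =
  (f (x + s) - f x - s%:C * l) * g x + f x * (g (x + s) - g x - s%:C * m) +
  (f (x + s) - f x) * (g (x + s) - g x) by ring.
apply: (@le_trans _ _ (e / T * `|s| * nm (g x) + nm (f x) * (e / T * `|s|) +
   (L * `|s|) * (M * `|s|))).
  rewrite (le_trans (nmD _ _))// lerD//.
    by rewrite (le_trans (nmD _ _))// !nmM lerD// ?ler_wpM2r ?ler_wpM2l ?nm_ge0.
  by rewrite nmM ler_pM ?nm_ge0.
have -> : e * `|s| = T * (e / T * `|s|).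
  by rewrite mulrA mulrCA mulfV ?mulr1// gt_eqF.
set q := e / T in eT s5 *; have := normr_ge0 s; set a := `|s| in s5 * => a0.
have : L * M * (a * a) <= L * M * (q * a).
  by rewrite ler_wpM2l ?mulr_ge0 ?(ltW L0) ?(ltW M0)// ler_wpM2r.
have : 0 <= q * a by rewrite mulr_ge0 ?(ltW eT).
rewrite /T; lra.
Qed.

Lemma rdZ c f x l : rd f x l -> rd (fun s => c * f s) x (c * l).
Proof. by move=> hf; have := rdM (rd_cst x c) hf; rewrite mul0r add0r. Qed.

Lemma rdN f x l : rd f x l -> rd (fun s => - f s) x (- l).
Proof.
move=> /(rdZ (-1)); rewrite mulN1r; apply: rd_eq => s; exact: mulN1r.
Qed.

Lemma rd_sum (n : nat) (F : nat -> R -> C) (l : nat -> C) x :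
  (forall j, (j < n)%N -> rd (F j) x (l j)) ->
  rd (fun s => \sum_(j < n) F j s) x (\sum_(j < n) l j).
Proof.
elim: n => [|n IH] h.
  by rewrite big_ord0; apply: rd_eq (rd_cst x 0) => s; rewrite big_ord0.
rewrite big_ord_recr; apply: (rd_eq _ (rdD (IH _) (h n (ltnSn n)))) => [s|j jn].
  by rewrite big_ord_recr.
exact/h/ltnW.
Qed.

Lemma rd_is_derive (f : R -> R) x (l : R) :
  is_derive x 1 f l -> rd (fun s => (f s)%:C) x l%:C.
Proof.
move=> [df <-] e e0; have := df; rewrite /derivable => /cvgrPdist_le/(_ e e0).
rewrite /dnbhs/= => -[d /= d0 hd]; exists (d / 2); first by rewrite divr_gt0.
move=> h hh; have [->|h0] := eqVneq h 0.
  by rewrite addr0 subrr normr0 mulr0 mul0r subr0 nm0.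
have := hd h; rewrite /= sub0r normrN => /(_ _ h0).
have -> : (`|h| < d)%R by rewrite (le_lt_trans hh)// ltr_pdivrMr// ltr_pMr// ltr1n.
move=> /(_ isT); rewrite -/('D_1 f x) /= /shift /= -[h *: 1]/(h * 1) mulr1 [h + x]addrC.
rewrite -[_ *: _]/(_ * _) distrC => le_e.
rewrite -rmorphB -rmorphM -rmorphB nm_real.
have -> : f (x + h) - f x - h * 'D_1 f x = h * (h^-1 * (f (x + h) - f x) - 'D_1 f x).
  by rewrite mulrBr mulrA mulfV// mul1r.
by rewrite normrM mulrC ler_wpM2r.
Qed.

Lemma is_derive_real (f : R -> R) x (l : R) :
  rd (fun s => (f s)%:C) x l%:C -> is_derive x 1 f l.
Proof.
move=> hf.
have hc : (fun h : R => h^-1 *: ((f \o shift x) (h *: (1 : R)) - f x)) @ 0^' --> l.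
  apply/cvgrPdist_le => e e0; have [d d0 hd] := hf e e0.
  rewrite /dnbhs /=; exists d => //= h /=; rewrite sub0r normrN => hh h0.
  have := hd h (ltW hh); rewrite -rmorphB -rmorphM -rmorphB nm_real.
  rewrite /shift /= -[h *: 1]/(h * 1) mulr1 [h + x]addrC -[_ *: _]/(_ * _) distrC.
  have -> : h * l - (f (x + h) - f x) = h * (l - h^-1 * (f (x + h) - f x)).
    by rewrite mulrBr mulrA mulfV// mul1r.
  by rewrite normrM mulrC ler_pM2r// normr_gt0.
by split; [apply/cvg_ex; exists l|apply: cvg_lim => //; exact: Rhausdorff].
Qed.

Lemma rd_Re f x l : rd f x l -> is_derive x 1 (fun s => Re (f s)) (Re l).
Proof.
move=> h; apply: is_derive_real => e /h[d d0 hd]; exists d => // s /hd.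
apply: le_trans; rewrite -rmorphB -rmorphM -rmorphB nm_real.
apply: le_trans (nm_Re _); rewrite !cReD !cReN cReM /= mul0r subr0.
exact: lexx.
Qed.

Lemma rd_Im f x l : rd f x l -> is_derive x 1 (fun s => Im (f s)) (Im l).
Proof.
move=> h; apply: is_derive_real => e /h[d d0 hd]; exists d => // s /hd.
apply: le_trans; rewrite -rmorphB -rmorphM -rmorphB nm_real.
apply: le_trans (nm_Im _); rewrite !cImD !cImN cImM /= mul0r addr0.
exact: lexx.
Qed.

Lemma rd_ReIm f x (a b : R) : is_derive x 1 (fun s => Re (f s)) a ->
  is_derive x 1 (fun s => Im (f s)) b -> rd f x (a +i* b).
Proof.
move=> /rd_is_derive h1 /rd_is_derive h2.
have -> : a +i* b = a%:C + 'i%C * b%:C by rewrite [LHS]complexE.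
by apply: rd_eq (rdD h1 (rdZ 'i%C h2)) => s; rewrite [RHS]complexE.
Qed.

Lemma real_mvt (f df : R -> R) x d (K : R) y :
  (forall s, `|s - x| <= d -> is_derive s 1 f (df s) /\ `|df s| <= K) ->
  `|y - x| <= d -> `|f y - f x| <= K * `|y - x|.
Proof.
move=> h yx.
have key a b : a < b -> (forall s, a <= s <= b -> `|s - x| <= d) ->
    `|f b - f a| <= K * `|b - a|.
  move=> ab hab.
  have [||c] := @MVT R f df a b ab.
  - move=> s; rewrite in_itv /= => /andP[/ltW a_s /ltW sb].
    by have [] := h s (hab s _); rewrite ?a_s.
  - apply: derivable_within_continuous => s; rewrite in_itv /= => /hab/h[has_tsum _].
    exact: ex_derive.
  rewrite in_itv /= => /andP[/ltW ac /ltW cb] ->.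
  by rewrite normrM ler_wpM2r//; have [] := h c (hab c _); rewrite ?ac.
have [xy|yx'|->] := ltgtP x y; last by rewrite !subrr normr0 mulr0.
- apply: key => // s /andP[xs sy]; apply: le_trans yx.
  by rewrite !ger0_norm ?subr_ge0 ?(ltW xy)// lerD2r.
- rewrite distrC (distrC y); apply: key => // s /andP[ys sx]; apply: le_trans yx.
  by rewrite !ler0_norm ?subr_le0 ?(ltW yx')// lerN2 lerD2r.
Qed.

(** The mean value theorem is applied to the real and imaginary parts separately, whence the factor
    2. *)
Lemma rd_mvt f (f' : R -> C) x d (K : R) y :
  (forall s, `|s - x| <= d -> rd f s (f' s) /\ nm (f' s) <= K) ->
  `|y - x| <= d -> nm (f y - f x) <= 2 * K * `|y - x|.
Proof.
move=> h yx; rewrite (le_trans (nm_ReIm _))//.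
have -> : 2 * K * `|y - x| = K * `|y - x| + K * `|y - x| by ring.
rewrite !cReD !cImD !cReN !cImN lerD//.
  apply: (@real_mvt (fun s => Re (f s)) (fun s => Re (f' s)) x d) => // s /h[has_tsum hK].
  by split; [exact: rd_Re|exact: le_trans (nm_Re _) hK].
apply: (@real_mvt (fun s => Im (f s)) (fun s => Im (f' s)) x d) => // s /h[has_tsum hK].
by split; [exact: rd_Im|exact: le_trans (nm_Im _) hK].
Qed.

Section Termwise.
Variables (I : choiceType) (F F' : I -> R -> C) (x d : R) (k : I -> R) (K : R).
Hypotheses (d0 : 0 < d) (kK : bsum k K).
Hypothesis hF : forall i s, `|s - x| <= d -> rd (F i) s (F' i s) /\ nm (F' i s) <= k i.
Hypothesis aF : asum (fun i => F i x).

Let x_in : `|x - x| <= d. Proof. by rewrite subrr normr0 ltW. Qed.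

Lemma asum_rd s : `|s - x| <= d -> asum (fun i => F i s).
Proof.
move=> sx; have le_k i : nm (F i s - F i x) <= 2 * k i * `|s - x|.
  exact: (@rd_mvt (F i) (F' i) x d (k i) s (hF i) sx).
apply: asum_eq (asumD aF (asum_le _ le_k)) => [i|]; first by rewrite addrC subrK.
have s0 : 0 <= 2 * `|s - x| by rewrite mulr_ge0.
have := bsumZ s0 kK.
rewrite (_ : (fun i => _) = (fun i => 2 * k i * `|s - x|)); first exact.
by apply/funext => i; rewrite mulrAC.
Qed.

Lemma asum_rd' : asum (fun i => F' i x).
Proof. by apply: asum_le kK _ => i; have [] := hF i x_in. Qed.

Lemma rd_tsum :
  rd (fun s => tsum (fun i => F i s)) x (tsum (fun i => F' i x)).
Proof.
have k0 i : 0 <= k i by have [_] := hF i x_in; apply: le_trans; exact: nm_ge0.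
(* Outside [A] an error term is at most [3 * |h| * k i]: 2 from the mean value inequality and 1 from
   the derivative. A tail of [k] below [e / 6] therefore costs half of [e * |h|]. *)
move=> e e0; have e6 : 0 < e / 6 by rewrite divr_gt0.
have [A uA hA] := bsum_tail k0 kK e6.
pose T i h := F i (x + h) - F i x - h%:C * F' i x.
have [d1 d10 hd1] : exists2 d1, 0 < d1 & forall h, `|h| <= d1 ->
    \sum_(i <- A) nm (T i h) <= e / 2 * `|h|.
  have : 0 < e / 2 by rewrite divr_gt0.
  elim: (A) (e / 2) => [|i A' IH] q q0.
    by exists 1 => // h _; rewrite big_nil mulr_ge0// ltW.
  have q2 : 0 < q / 2 by rewrite divr_gt0.
  have [d1 d10 h1] := IH _ q2; have [d2 d20 h2] := (hF i x_in).1 _ q2.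
  exists (Num.min d1 d2); first by rewrite lt_min d10.
  move=> h; rewrite le_min => /andP[/h1 hh1 /h2 hh2].
  by rewrite big_cons [q in _ <= q * _]splitr mulrDl lerD.
exists (Num.min d d1); first by rewrite lt_min d0.
move=> h; rewrite le_min => /andP[hd hd'].
have hx : `|x + h - x| <= d by rewrite addrC addKr.
have le_k i : nm (T i h) <= 3 * `|h| * k i.
  rewrite (le_trans (nmB _ _))//.
  have := @rd_mvt (F i) (F' i) x d (k i) (x + h) (hF i) hx.
  have [_ ] := hF i x_in; rewrite addrAC subrr add0r nmM nm_real => h1 h2.
  have : `|h| * nm (F' i x) <= `|h| * k i by rewrite ler_wpM2l.
  lra.
have aFh := asum_rd hx.
rewrite -(tsumZ _ asum_rd') -!tsumB//; first last.
- exact: asumZ asum_rd'.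
- by apply: asum_eq (asumD aFh (asumZ (-1) aF)) => i; rewrite mulN1r.
have aT : asum (fun i => T i h).
  by apply: (asum_le (bsumZ _ kK) le_k); rewrite mulr_ge0.
apply: (has_tsum_le (asum_has_tsum aT)) => B uB.
rewrite (bigID (mem A)) /= -!(big_filter B) [e in _ <= e * _]splitr mulrDl lerD//.
  apply: le_trans (hd1 h hd').
  have u' : uniq [seq i <- B | i \in A] by rewrite filter_uniq.
  rewrite [leRHS](perm_big _ (perm_cat_filter u' uA _)); last first.
    by move=> i; rewrite mem_filter => /andP[].
  by rewrite big_cat lerDl sumr_ge0// => i _; exact: nm_ge0.
apply: (@le_trans _ _ (\sum_(i <- [seq i <- B | i \notin A]) 3 * `|h| * k i)).
  by apply: ler_sum => i _; exact: le_k.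
rewrite -mulr_sumr.
have := hA [seq i <- B | i \notin A]; rewrite filter_uniq// => /(_ isT).
set S := \sum_(i <- _) _ => hS.
have {}hS : S <= e / 6 by apply: hS => i; rewrite mem_filter => /andP[].
have : `|h| * S <= `|h| * (e / 6) by rewrite ler_wpM2l.
lra.
Qed.

End Termwise.

End RealDerivative.

(** * The complex exponential *)

Section ComplexExp.
Variable R : realType.
Local Notation C := R[i].
Local Notation Re := (@complex.Re R).
Local Notation Im := (@complex.Im R).
Implicit Types (x y z w t a b : C).

Lemma cexpD x y : cexp (x + y) = cexp x * cexp y.
Proof.
rewrite /cexp cReD cImD expRD cosD sinD; apply/eqP; rewrite eq_complex /=.
by apply/andP; split; apply/eqP; ring.
Qed.

Lemma cexp0 : cexp 0 = 1 :> C.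
Proof. by rewrite /cexp /= expR0 cos0 sin0 mul1r. Qed.

Lemma cexpN x : cexp (- x) = (cexp x)^-1.
Proof.
have h : cexp (- x) * cexp x = 1 by rewrite -cexpD addNr cexp0.
have x0 : cexp x != 0.
  by apply/eqP => e; move: h; rewrite e mulr0 => /eqP; rewrite eq_sym oner_eq0.
by rewrite -[LHS]mulr1 -(mulfV x0) mulrA h mul1r.
Qed.

Lemma cexp_neq0 x : cexp x != 0.
Proof.
apply/eqP => e; have := cexpD x (- x).
by rewrite subrr cexp0 e mul0r => /eqP; rewrite oner_eq0.
Qed.

Lemma cexpMn x n : cexp (n%:R * x) = cexp x ^+ n.
Proof.
elim: n => [|n IH]; first by rewrite mul0r cexp0 expr0.
by rewrite -natr1 mulrDl mul1r cexpD IH exprSr.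
Qed.

Lemma nm_cexp z : nm (cexp z) = expR (Re z).
Proof.
rewrite /cexp nmM nm_real ger0_norm ?expR_ge0// /nm /=.
by rewrite cos2Dsin2 sqrtr1 mulr1.
Qed.

Lemma cexp_real (r : R) : cexp r%:C = (expR r)%:C.
Proof. by rewrite /cexp /= cos0 sin0 mulr1. Qed.

Lemma cexp_pi : cexp (cpi R * 'i%C) = -1.
Proof.
have -> : cpi R * 'i%C = 0 +i* pi by apply/eqP; rewrite eq_complex /= !mul0r !mulr0 mulr1 subr0 addr0 !eqxx.
rewrite /cexp /= expR0 mul1r cospi sinpi; apply/eqP.
by rewrite eq_complex /= oppr0 !eqxx.
Qed.

Lemma cexp_pin (n : int) : cexp (cpi R * 'i%C * n%:~R) = (-1) ^ n.
Proof.
case: n => n; first by rewrite mulrC cexpMn cexp_pi.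
by rewrite NegzE mulrNz mulrN cexpN mulrC cexpMn cexp_pi.
Qed.

Lemma rd_cexp a b (x : R) :
  rd (fun s => cexp (a + s%:C * b)) x (b * cexp (a + x%:C * b)).
Proof.
case: b => p q.
have lin (c : R) : is_derive x 1 (fun s : R => s * c) c.
  have h : is_derive x 1 (fun s : R => c *: s) (c *: (1 : R)) by exact: is_deriveZ.
  move: h; rewrite -[c *: 1]/(c * 1) mulr1.
  by rewrite (_ : (fun s => c *: s) = (fun s => s * c))//; apply/funext => s; rewrite mulrC.
have h1 := rd_is_derive (is_derive1_comp (is_derive_expR _) (lin p)).
have h2 := rd_is_derive (is_derive1_comp (is_derive_cos _) (lin q)).
have h3 := rd_is_derive (is_derive1_comp (is_derive_sin _) (lin q)).
have := rdZ (cexp a) (rdM h1 (rdD h2 (rdZ 'i%C h3))).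
set L := (X in rd _ _ X); have -> : L = (p +i* q) * cexp (a + x%:C * (p +i* q)).
  rewrite /L cexpD mulrCA; congr (_ * _).
  rewrite /cexp /= !mul0r !subr0 !addr0.
  by apply/eqP; rewrite eq_complex; apply/andP; split; apply/eqP => /=; ring.
apply: rd_eq => s; rewrite cexpD; congr (_ * _).
rewrite /cexp /= !mul0r !subr0 !addr0.
by apply/eqP; rewrite eq_complex; apply/andP; split; apply/eqP => /=; ring.
Qed.

End ComplexExp.

(** * Partial derivatives and smoothness on the upper half-plane *)

Section Wirtinger.
Variable R : realType.
Local Notation C := R[i].
Local Notation Re := (@complex.Re R).
Local Notation Im := (@complex.Im R).
Implicit Types (f g : C -> C) (t w : C).

Lemma dpart_rd w f t l : rd (along w f t) 0 l ->
  has_dpart w f t /\ dpart w f t = l.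
Proof.
move=> h; have h1 := rd_Re h; have h2 := rd_Im h.
split; first by split; exact: ex_derive.
by have [_ e1] := h1; have [_ e2] := h2; rewrite /dpart !derive1E e1 e2; case: (l).
Qed.

Lemma has_dpart_rd w f t : has_dpart w f t -> rd (along w f t) 0 (dpart w f t).
Proof.
move=> [h1 h2]; apply: rd_ReIm; rewrite derive1E; exact: DeriveDef.
Qed.

(** Only real differentiability along 1 and [i] is asked, because [G] and the completion are not
    holomorphic; [D] depends on nothing else. *)
Definition has_partials f t a b := rd (along 1 f t) 0 a /\ rd (along 'i%C f t) 0 b.

Definition diff f t := has_partials f t (du f t) (dv f t).

Lemma has_partials_uv f t a b : has_partials f t a b -> du f t = a /\ dv f t = b.
Proof. by move=> [/dpart_rd[_ <-] /dpart_rd[_ <-]]. Qed.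

Lemma has_partials_diff f t a b : has_partials f t a b -> diff f t.
Proof. by move=> h; have [] := has_partials_uv h; rewrite /diff => -> ->. Qed.

Lemma has_partials_D f t a b : has_partials f t a b ->
  D f t = (2 * cpi R * 'i%C)^-1 * (2^-1 * (a - 'i%C * b)).
Proof. by move=> /has_partials_uv[<- <-]. Qed.

Lemma has_partials_cst c t : has_partials (fun=> c) t 0 0.
Proof. by split; exact: rd_cst. Qed.

Lemma dffD f g t a b a' b' : has_partials f t a b -> has_partials g t a' b' ->
  has_partials (fun s => f s + g s) t (a + a') (b + b').
Proof. by move=> [h1 h2] [h3 h4]; split; exact: rdD. Qed.

Lemma dffM f g t a b a' b' : has_partials f t a b -> has_partials g t a' b' ->
  has_partials (fun s => f s * g s) t (a * g t + f t * a') (b * g t + f t * b').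
Proof.
move=> [h1 h2] [h3 h4]; have e w : t + (0 : R)%:C * w = t by rewrite mul0r addr0.
split; first by have := rdM h1 h3; rewrite /along e.
by have := rdM h2 h4; rewrite /along e.
Qed.

Definition eqH f g := forall t, 0 < Im t -> f t = g t.

Lemma along_H t w (s : R) : 0 < Im t -> w = 1 \/ w = 'i%C -> `|s| <= Im t / 2 ->
  Im t / 2 <= Im (t + s%:C * w) /\ Im (t + s%:C * w) <= 3 / 2 * Im t.
Proof.
move=> t0 hw; rewrite ler_norml => /andP[h1 h2]; rewrite cImD cImM /= mul0r addr0.
by case: hw => -> /=; lra.
Qed.

(** A step of length at most [Im t / 2] along 1 or [i] stays in the upper half-plane, so the values
    elsewhere do not affect derivatives. *)
Lemma rd_eqH f g t w l : 0 < Im t -> w = 1 \/ w = 'i%C -> eqH f g ->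
  rd (along w f t) 0 l -> rd (along w g t) 0 l.
Proof.
move=> t0 hw fg; apply: (@rd_near _ _ _ _ _ (Im t / 2)); first by rewrite divr_gt0.
move=> s; rewrite subr0 => /(along_H t0 hw)[h _]; apply: fg.
by rewrite (lt_le_trans _ h)// divr_gt0.
Qed.

Lemma has_partials_eqH f g t a b : 0 < Im t -> eqH f g -> has_partials f t a b -> has_partials g t a b.
Proof.
by move=> t0 fg [h1 h2]; split; [apply: rd_eqH fg h1|apply: rd_eqH fg h2] => //;
  [left|right].
Qed.

Lemma diff_eqH f g t : 0 < Im t -> eqH f g -> diff f t -> diff g t.
Proof. by move=> t0 fg /(has_partials_eqH t0 fg)/has_partials_diff. Qed.

Lemma D_eqH f g : (forall t, 0 < Im t -> diff f t) -> eqH f g -> eqH (D f) (D g).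
Proof.
by move=> df fg t t0; have := has_partials_eqH t0 fg (df t t0) => /has_partials_D ->; rewrite (has_partials_D (df t t0)).
Qed.

Lemma DD f g t : diff f t -> diff g t -> D (fun s => f s + g s) t = D f t + D g t.
Proof. by move=> h h'; rewrite (has_partials_D (dffD h h')) (has_partials_D h) (has_partials_D h'); ring. Qed.

Lemma DM f g t : diff f t -> diff g t ->
  D (fun s => f s * g s) t = D f t * g t + f t * D g t.
Proof. by move=> h h'; rewrite (has_partials_D (dffM h h')) (has_partials_D h) (has_partials_D h'); ring. Qed.

Lemma D_cst c t : D (fun=> c) t = 0.
Proof. by rewrite (has_partials_D (has_partials_cst c t)) mulr0 subrr !mulr0. Qed.

Lemma diff_cst c t : diff (fun=> c) t. Proof. exact: has_partials_diff (has_partials_cst c t). Qed.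

Lemma diffD f g t : diff f t -> diff g t -> diff (fun s => f s + g s) t.
Proof. by move=> h h'; exact: has_partials_diff (dffD h h'). Qed.

Lemma diffM f g t : diff f t -> diff g t -> diff (fun s => f s * g s) t.
Proof. by move=> h h'; exact: has_partials_diff (dffM h h'). Qed.

Lemma diffZ c f t : diff f t -> diff (fun s => c * f s) t.
Proof. exact/diffM/diff_cst. Qed.

Lemma DZ c f t : diff f t -> D (fun s => c * f s) t = c * D f t.
Proof. by move=> h; rewrite (DM (diff_cst c t) h) D_cst mul0r add0r. Qed.

Lemma diff_sum (n : nat) (F : nat -> C -> C) t :
  (forall j, (j < n)%N -> diff (F j) t) -> diff (fun s => \sum_(j < n) F j s) t.
Proof.
elim: n => [|n IH] h.
  by rewrite (_ : (fun s => _) = fun=> 0); [exact: diff_cst|apply/funext => s; rewrite big_ord0].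
rewrite (_ : (fun s => _) = fun s => \sum_(j < n) F j s + F n s).
  by apply: diffD (h _ _) => //; apply: IH => j jn; exact/h/ltnW.
by apply/funext => s; rewrite big_ord_recr.
Qed.

Lemma D_sum (n : nat) (F : nat -> C -> C) t :
  (forall j, (j < n)%N -> diff (F j) t) ->
  D (fun s => \sum_(j < n) F j s) t = \sum_(j < n) D (F j) t.
Proof.
elim: n => [|n IH] h.
  rewrite big_ord0 (_ : (fun s => _) = fun=> 0) ?D_cst//.
  by apply/funext => s; rewrite big_ord0.
rewrite (_ : (fun s => _) = fun s => \sum_(j < n) F j s + F n s).
  have h' j : (j < n)%N -> diff (F j) t by move=> jn; exact/h/ltnW.
  by rewrite DD ?IH ?big_ord_recr//; [exact: diff_sum|exact: h].
by apply/funext => s; rewrite big_ord_recr.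
Qed.

Fixpoint smN (n : nat) f := (forall t, 0 < Im t -> diff f t) /\
  (if n is m.+1 then smN m (du f) /\ smN m (dv f) else True).

Definition smooth f := forall n, smN n f.

Lemma smN_eqH n f g : eqH f g -> smN n f -> smN n g.
Proof.
have key h : (forall t, 0 < Im t -> diff f t) -> eqH f h ->
    eqH (du f) (du h) /\ eqH (dv f) (dv h).
  by move=> df fh; split=> t t0; have [e1 e2] := has_partials_uv (has_partials_eqH t0 fh (df t t0)).
elim: n f g key => [|n IH] f g key fg [df h].
  by split=> // t t0; apply: diff_eqH fg _ => //; exact: df.
split; first by move=> t t0; apply: diff_eqH fg _ => //; exact: df.
have [e1 e2] := key g df fg; case: h => h1 h2.
split; [apply: IH e1 h1|apply: IH e2 h2] => h d1 fh;
  by split=> t t0; have [? ?] := has_partials_uv (has_partials_eqH t0 fh (d1 t t0)).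
Qed.

Lemma smNW n f : smN n.+1 f -> smN n f.
Proof.
elim: n f => [|n IH] f [h [h1 h2]]; first by split.
split; first exact: h.
split; [exact: IH h1|exact: IH h2].
Qed.

Lemma smooth_diff f t : smooth f -> 0 < Im t -> diff f t.
Proof. by move=> /(_ 0%N)[h _]; exact: h. Qed.

Lemma smooth_eqH f g : eqH f g -> smooth f -> smooth g.
Proof. by move=> fg h n; exact: smN_eqH fg (h n). Qed.

Lemma smND n f g : smN n f -> smN n g -> smN n (fun s => f s + g s).
Proof.
elim: n f g => [|n IH] f g hf hg.
  by split=> // t t0; apply: diffD; [exact: hf.1|exact: hg.1].
have [df [h1 h2]] := hf; have [dg [h3 h4]] := hg.
split; first by move=> t t0; apply: diffD; [exact: df|exact: dg].
split.
  apply: smN_eqH (IH _ _ h1 h3) => t t0.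
  by have [] := has_partials_uv (dffD (df t t0) (dg t t0)).
apply: smN_eqH (IH _ _ h2 h4) => t t0.
by have [] := has_partials_uv (dffD (df t t0) (dg t t0)).
Qed.

Lemma smNM n f g : smN n f -> smN n g -> smN n (fun s => f s * g s).
Proof.
elim: n f g => [|n IH] f g hf hg.
  by split=> // t t0; apply: diffM; [exact: hf.1|exact: hg.1].
have [df [h1 h2]] := hf; have [dg [h3 h4]] := hg.
have f' := smNW hf; have g' := smNW hg.
split; first by move=> t t0; apply: diffM; [exact: df|exact: dg].
split.
  apply: smN_eqH (smND (IH _ _ h1 g') (IH _ _ f' h3)) => t t0.
  by have [] := has_partials_uv (dffM (df t t0) (dg t t0)).
apply: smN_eqH (smND (IH _ _ h2 g') (IH _ _ f' h4)) => t t0.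
by have [] := has_partials_uv (dffM (df t t0) (dg t t0)).
Qed.

Lemma smooth_cst c : smooth (fun=> c).
Proof.
move=> n; elim: n c => [|n IH] c; first by split=> // t _; exact: diff_cst.
split; first by move=> t _; exact: diff_cst.
split; apply: (@smN_eqH _ (fun=> 0)) (IH 0) => t _.
  by have [] := has_partials_uv (has_partials_cst c t).
by have [] := has_partials_uv (has_partials_cst c t).
Qed.

Lemma smM f g : smooth f -> smooth g -> smooth (fun s => f s * g s).
Proof. by move=> h h' n; exact: smNM. Qed.

Lemma smD f g : smooth f -> smooth g -> smooth (fun s => f s + g s).
Proof. by move=> h h' n; exact: smND. Qed.

Lemma smZ c f : smooth f -> smooth (fun s => c * f s).
Proof. exact/smM/smooth_cst. Qed.

Lemma smooth_D f : smooth f -> smooth (D f).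
Proof.
move=> h; have h1 : smooth (du f) by move=> n; have [_ []] := h n.+1.
have h2 : smooth (dv f) by move=> n; have [_ []] := h n.+1.
apply: (smooth_eqH _ (smZ (2 * cpi R * 'i%C)^-1 (smZ 2^-1 (smD h1 (smZ (- 'i%C) h2))))).
by move=> t _; rewrite /D /dtau mulNr.
Qed.

Lemma smooth_H_smooth f : smooth_H f -> smooth f.
Proof.
(* The index is shifted by one: the last level of [smN n] already asks for differentiability, that
   of [Cn_H n] only for continuity. *)
move=> h n; move: (h n.+1); elim: n f {h} => [|n IH] f [_ [h h1 h2]].
  by split=> // t t0; have [d1 d2] := h t t0; split; exact: has_dpart_rd.
split; first by move=> t t0; have [d1 d2] := h t t0; split; exact: has_dpart_rd.
by split; [exact: IH h1|exact: IH h2].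
Qed.

End Wirtinger.

(** * Series in nonnegative real powers of [q] *)

Section ExponentialSeries.
Variable R : realType.
Local Notation C := R[i].
Local Notation Re := (@complex.Re R).
Local Notation Im := (@complex.Im R).
Variable I : choiceType.
Implicit Types (a : I -> R) (w : I -> C) (t : C).

(** Absolute convergence of [\sum_i w i q^(a i)] on the whole upper half-plane. The exponents are
    real because theta series bring fractional powers of [q]; the condition survives multiplication
    of the weights by [a i], which is the action of [D]. *)
Definition qsummable a w := (forall i, 0 <= a i) /\
  forall y : R, 0 < y -> asum (fun i => w i * (expR (- y * a i))%:C).

Definition qsum a w t : C := tsum (fun i => w i * ee ((a i)%:C * t)).

Lemma nm_ee (r : R) t : nm (ee (r%:C * t)) = expR (- (2 * pi * Im t) * r).
Proof.
rewrite /ee nm_cexp; congr expR.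
rewrite !(cReM, cImM) Re_natC Im_natC /=; ring.
Qed.

Lemma esokZ a w (c : C) : qsummable a w -> qsummable a (fun i => c * w i).
Proof.
move=> [a0 h]; split=> // y /h/(asumZ c); apply: asum_eq => i; exact: mulrA.
Qed.

Lemma esokM a w : qsummable a w -> qsummable a (fun i => (a i)%:C * w i).
Proof.
move=> [a0 h]; split=> // y y0; have y2 : 0 < y / 2 by rewrite divr_gt0.
apply: asum_nm (asumZ (2 / y)%:C (h _ y2)) _ => i.
rewrite !nmM !nm_real !ger0_norm ?expR_ge0 ?divr_ge0 ?(ltW y0)//.
(* Half of the exponential absorbs the factor [a i], by [z * e^(- z) <= 1]. *)
have -> : - y * a i = - (y / 2) * a i + - (y / 2) * a i by field.
rewrite expRD; set E := expR _.
have E0 : 0 < E by exact: expR_gt0.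
have : a i * E <= 2 / y.
  have := expR_ge1Dx (y / 2 * a i); have : expR (y / 2 * a i) = E^-1.
    by rewrite /E mulNr expRN invrK.
  move=> -> hE; rewrite -ler_pdivlMr// -[_ / E](mulrC E^-1).
  have : y / 2 * a i <= E^-1 by lra.
  rewrite -ler_pdivlMl// => /le_trans; apply; rewrite invf_div.
  by rewrite mulrC.
move=> hE.
have -> : a i * nm (w i) * (E * E) = (a i * E) * (nm (w i) * E) by ring.
by rewrite ler_wpM2r// mulr_ge0 ?nm_ge0// ltW.
Qed.

Lemma qsum_asum a w t : qsummable a w -> 0 < Im t ->
  asum (fun i => w i * ee ((a i)%:C * t)).
Proof.
move=> [a0 h] t0.
have y0 : 0 < 2 * pi * Im t by rewrite !mulr_gt0// pi_gt0.
apply: asum_nm (h _ y0) _ => i; rewrite nmM [leRHS]nmM nm_ee nm_real.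
by rewrite ger0_norm ?expR_ge0.
Qed.

Lemma qsum_rd a w t v : qsummable a w -> 0 < Im t -> v = 1 \/ v = 'i%C ->
  rd (along v (qsum a w) t) 0
     (2 * cpi R * 'i%C * v * qsum a (fun i => (a i)%:C * w i) t).
Proof.
move=> ok t0 hv; have okM := esokM ok; have [a0 _] := ok.
(* On the segment considered the imaginary part is at least [Im t / 2], and [pi * Im t] is [2 * pi]
   times that. *)
have y0 : 0 < pi * Im t by rewrite mulr_gt0// pi_gt0.
have [K hK] := okM.2 _ y0.
have nv : nm v = 1 by case: hv => ->; rewrite ?nm1 ?nm_i.
have npi : nm (2 * cpi R * 'i%C) = 2 * pi.
  by rewrite !nmM nm_i nm_nat nm_real mulr1 ger0_norm// pi_ge0.
have pi0 : 0 <= 2 * pi :> R by rewrite mulr_ge0 ?pi_ge0.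
rewrite /qsum -tsumZ; last exact: qsum_asum.
pose F i (s : R) := w i * ee ((a i)%:C * (t + s%:C * v)).
pose F' i (s : R) := 2 * cpi R * 'i%C * v * ((a i)%:C * w i * ee ((a i)%:C * (t + s%:C * v))).
have -> : (fun i => 2 * cpi R * 'i%C * v * ((a i)%:C * w i * ee ((a i)%:C * t))) =
    (fun i => F' i 0) by apply/funext => i; rewrite /F' mul0r addr0.
have d0 : 0 < Im t / 2 by rewrite divr_gt0.
apply: (rd_tsum (F := F) (F' := F') d0 (bsumZ pi0 hK)) => [i s|].
  rewrite subr0 => has_tsum; have [h1 _] := along_H t0 hv has_tsum; split.
    have := rdZ (w i) (rd_cexp (2 * cpi R * 'i%C * ((a i)%:C * t))
              (2 * cpi R * 'i%C * ((a i)%:C * v)) s).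
    have -> : w i * (2 * cpi R * 'i%C * ((a i)%:C * v) * cexp (2 * cpi R * 'i%C * ((a i)%:C * t) + s%:C * (2 * cpi R * 'i%C * ((a i)%:C * v)))) = F' i s.
      rewrite /F' /ee.
      have -> : 2 * cpi R * 'i%C * ((a i)%:C * t) + s%:C * (2 * cpi R * 'i%C * ((a i)%:C * v)) = 2 * cpi R * 'i%C * ((a i)%:C * (t + s%:C * v)) by ring.
      ring.
    by apply: rd_eq => u; rewrite /F /ee; congr (_ * cexp _); ring.
  rewrite /F' nmM nmM npi nv mulr1 ler_wpM2l//.
  rewrite nmM [leRHS]nmM nm_ee nm_real ler_wpM2l ?nm_ge0//.
  rewrite (ger0_norm (expR_ge0 _)) ler_expR !mulNr lerN2 ler_wpM2r//.
  by have := pi_gt0 R; nra.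
apply: asum_eq (qsum_asum ok t0) => i.
by rewrite /F mul0r addr0.
Qed.

Lemma qsum_has_partials a w t : qsummable a w -> 0 < Im t ->
  has_partials (qsum a w) t (2 * cpi R * 'i%C * qsum a (fun i => (a i)%:C * w i) t)
     (2 * cpi R * 'i%C * 'i%C * qsum a (fun i => (a i)%:C * w i) t).
Proof.
move=> ok t0; split.
  by have := qsum_rd ok t0 (or_introl (erefl 1)); rewrite mulr1.
exact: qsum_rd ok t0 (or_intror (erefl _)).
Qed.

Lemma qsum_smooth a w : qsummable a w -> smooth (qsum a w).
Proof.
move=> + n; elim: n w => [|n IH] w ok.
  by split=> // t t0; exact: has_partials_diff (qsum_has_partials ok t0).
split; first by move=> t t0; exact: has_partials_diff (qsum_has_partials ok t0).
split.
  apply: (@smN_eqH _ _ (fun t => 2 * cpi R * 'i%C * qsum a (fun i => (a i)%:C * w i) t)).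
    by move=> t t0; have [-> _] := has_partials_uv (qsum_has_partials ok t0).
  by apply: smNM (smooth_cst _ _) (IH _ _); exact: esokM.
apply: (@smN_eqH _ _ (fun t => 2 * cpi R * 'i%C * 'i%C * qsum a (fun i => (a i)%:C * w i) t)).
  by move=> t t0; have [_ ->] := has_partials_uv (qsum_has_partials ok t0).
by apply: smNM (smooth_cst _ _) (IH _ _); exact: esokM.
Qed.

Lemma cpi_neq0 : cpi R != 0.
Proof. by rewrite -nm_eq0 nm_real normr_eq0 gt_eqF ?pi_gt0. Qed.

Lemma two_pi_i_neq0 : 2 * cpi R * 'i%C != 0.
Proof.
by rewrite -nm_eq0 !nmM nm_i nm_nat nm_real mulr1 ger0_norm ?pi_ge0// gt_eqF// mulr_gt0// pi_gt0.
Qed.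

Lemma qsum_D a w t : qsummable a w -> 0 < Im t ->
  D (qsum a w) t = qsum a (fun i => (a i)%:C * w i) t.
Proof.
move=> ok t0; rewrite (has_partials_D (qsum_has_partials ok t0)).
set E := qsum _ _ _; have := two_pi_i_neq0; set c := 2 * cpi R * 'i%C => c0.
have -> : c * E - 'i%C * (c * 'i%C * E) = c * E * (1 - 'i%C ^+ 2) by ring.
by rewrite sqr_i; field.
Qed.

Lemma qsum_eq a w w' t : w =1 w' -> qsum a w t = qsum a w' t.
Proof. by move=> /funext ->. Qed.

Lemma esZ a w (c : C) t : qsummable a w -> 0 < Im t ->
  qsum a (fun i => c * w i) t = c * qsum a w t.
Proof.
move=> ok t0; rewrite /qsum -tsumZ; last exact: qsum_asum.
by apply: eq_tsum => i; rewrite mulrA.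
Qed.

(** The exponents grow at least linearly and the weights at most polynomially in the height; half of
    the decay pays for the weights and the other half leaves a geometric series. *)
Lemma qsummable_geom_summable a w (h : I -> nat) (c c' K : R) (j : nat) : geom_summable R h -> 0 < c ->
  (forall i, 0 <= a i) -> (forall i, c * (h i)%:R - c' <= a i) ->
  (forall i, nm (w i) <= K * (h i).+1%:R ^+ j) -> qsummable a w.
Proof.
move=> gh c0 a0 ha hw; split=> // y y0.
have K0 : 0 <= `|K| by [].
pose r := expR (- (y * c / 2)).
have r0 : 0 < r by exact: expR_gt0.
have r1 : r < 1 by rewrite /r -expR0 ltr_expR oppr_lt0 divr_gt0// mulr_gt0.
have rV1 : 1 < r^-1 by rewrite invf_gt1.
have [L L0 hL] := poly_geo j rV1.
have r01 : 0 < r < 1 by rewrite r0.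
apply: (@asum_geom_summable _ _ _ _ (`|K| * L * r^-1 * expR (y * c')) r gh r01) => i.
rewrite nmM nm_real ger0_norm ?expR_ge0//.
have h1 : nm (w i) <= `|K| * (L * r^-1 ^+ (h i).+1).
  apply: (le_trans (hw i)); apply: (@le_trans _ _ (`|K| * (h i).+1%:R ^+ j)).
    by rewrite ler_wpM2r ?exprn_ge0// ler_norm.
  by rewrite ler_wpM2l.
have h2 : expR (- y * a i) <= expR (y * c') * (r ^+ (h i) * r ^+ (h i)).
  have -> : r ^+ h i * r ^+ h i = expR (- (y * c) * (h i)%:R).
    rewrite -expRM_natr -expRD; congr expR; by field.
  rewrite -expRD ler_expR; have := ha i; nra.
apply: (le_trans (ler_pM (nm_ge0 _) (expR_ge0 _) h1 h2)).
rewrite exprS le_eqVlt; apply/orP; left; apply/eqP.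
have e : r^-1 ^+ h i * r ^+ h i = 1 by rewrite -exprMn mulVf ?gt_eqF// expr1n.
transitivity (`|K| * L * r^-1 * expR (y * c') * r ^+ h i * (r^-1 ^+ h i * r ^+ h i)); last by rewrite e mulr1.
ring.
Qed.

End ExponentialSeries.

(** * The ring of formal power series with its derivation *)

Section FormalPowerSeries.
Variable R : realType.
Local Notation C := R[i].

Definition fps : Type := nat -> C.

HB.instance Definition _ := gen_eqMixin fps.
HB.instance Definition _ := gen_choiceMixin fps.

Implicit Types f g h : fps.

Let fadd f g : fps := fun n => f n + g n.
Let fopp f : fps := fun n => - f n.
Let fzero : fps := fun=> 0.

Let faddA : associative fadd.
Proof. by move=> f g h; apply/funext => n; rewrite /fadd addrA. Qed.
Let faddC : commutative fadd.
Proof. by move=> f g; apply/funext => n; rewrite /fadd addrC. Qed.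
Let fadd0 : left_id fzero fadd.
Proof. by move=> f; apply/funext => n; rewrite /fadd add0r. Qed.
Let faddN : left_inverse fzero fopp fadd.
Proof. by move=> f; apply/funext => n; rewrite /fadd addNr. Qed.

HB.instance Definition _ := GRing.isZmodule.Build fps faddA faddC fadd0 faddN.

Definition trunc n f : {poly C} := \poly_(i < n) f i.

Let fmul f g : fps := fun n => \sum_(i < n.+1) f i * g (n - i)%N.
Let fone : fps := fun n => (n == 0%N)%:R.

(** A coefficient of a product sees only truncations, so the ring axioms, and later the Leibniz
    rule, are inherited from polynomials. *)
Let fmul_trunc f g n m : (n < m)%N -> fmul f g n = (trunc m f * trunc m g)`_n.
Proof.
move=> lt_nm; rewrite coefM; apply: eq_bigr => i _; rewrite !coef_poly.
have -> : (i < m)%N by have := ltn_ord i; lia.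
by have -> : (n - i < m)%N by lia.
Qed.

Let fmulA : associative fmul.
Proof.
move=> f g h; apply/funext => n.
have -> : fmul f (fmul g h) n = (trunc n.+1 f * (trunc n.+1 g * trunc n.+1 h))`_n.
  rewrite coefM; apply: eq_bigr => i _; rewrite coef_poly ltn_ord.
  by rewrite -fmul_trunc ?ltnS ?leq_subr.
rewrite mulrA coefM; apply: eq_bigr => i _; rewrite coef_poly ltnS leq_subr.
by rewrite -fmul_trunc.
Qed.
Let fmulC : commutative fmul.
Proof. by move=> f g; apply/funext => n; rewrite !(fmul_trunc _ _ (ltnSn n)) mulrC. Qed.
Let fmul1 : left_id fone fmul.
Proof.
move=> f; apply/funext => n; rewrite /fmul big_ord_recl subn0 mul1r big1 ?addr0// => i _.
by rewrite /fone /= mul0r.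
Qed.
Let fmulDl : left_distributive fmul fadd.
Proof.
move=> f g h; apply/funext => n; rewrite /fmul /fadd -big_split.
by apply: eq_bigr => i _; rewrite mulrDl.
Qed.
Let fone_neq0 : fone != fzero.
Proof. by apply/eqP => /(congr1 (@^~ 0%N)) /eqP; rewrite oner_eq0. Qed.

HB.instance Definition _ :=
  GRing.Zmodule_isComNzRing.Build fps fmulA fmulC fmul1 fmulDl fone_neq0.

Definition fC (c : C) : fps := fun n => if n == 0%N then c else 0.
Definition fX : fps := fun n => (n == 1%N)%:R.
Definition fd f : fps := fun n => n.+1%:R * f n.+1.
(** The exponential series of [b X]. *)
Definition fe (b : C) : fps := fun n => b ^+ n / n`!%:R.

Lemma fpsP f g : (forall n, f n = g n) -> f = g. Proof. exact: funext. Qed.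
Lemma faddE f g n : (f + g) n = f n + g n. Proof. by []. Qed.
Lemma foppE f n : (- f) n = - f n. Proof. by []. Qed.
Lemma foneE n : (1 : fps) n = (n == 0%N)%:R. Proof. by []. Qed.
Lemma fmulE f g n : (f * g) n = \sum_(i < n.+1) f i * g (n - i)%N. Proof. by []. Qed.
Lemma fmul_truncE f g n m : (n < m)%N -> (f * g) n = (trunc m f * trunc m g)`_n.
Proof. exact: fmul_trunc. Qed.
Lemma fsumE (I : Type) (s : seq I) (F : I -> fps) n :
  (\sum_(i <- s) F i) n = \sum_(i <- s) F i n.
Proof. by elim: s => [|i s IH]; rewrite ?big_nil// !big_cons faddE IH. Qed.

Lemma fC1 : fC 1 = 1. Proof. by apply: fpsP => -[]. Qed.
Lemma fC0 : fC 0 = 0. Proof. by apply: fpsP => -[]. Qed.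
Lemma fCD a b : fC (a + b) = fC a + fC b.
Proof. by apply: fpsP => -[|n]; rewrite faddE /fC //= addr0. Qed.
Lemma fCN a : fC (- a) = - fC a.
Proof. by apply: fpsP => -[|n]; rewrite foppE /fC //= oppr0. Qed.
Lemma fCB a b : fC (a - b) = fC a - fC b. Proof. by rewrite fCD fCN. Qed.
Lemma fCmE a f n : (fC a * f) n = a * f n.
Proof.
rewrite fmulE big_ord_recl subn0 big1 ?addr0// => i _.
by rewrite /fC /= mul0r.
Qed.
Lemma fCM a b : fC (a * b) = fC a * fC b.
Proof. by apply: fpsP => -[|n]; rewrite fCmE /fC //= mulr0. Qed.
Lemma fCnat n : fC n%:R = n%:R.
Proof.
elim: n => [|n IH]; first exact: fC0.
by rewrite -natr1 fCD IH fC1 natr1.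
Qed.
Lemma fXmE f n : (fX * f) n = if n is m.+1 then f m else 0.
Proof.
case: n => [|n]; first by rewrite fmulE big_ord1 mul0r.
rewrite fmulE big_ord_recl mul0r add0r big_ord_recl big1 ?addr0.
  by rewrite /= mul1r subn1.
by move=> i _; rewrite /fX /= mul0r.
Qed.
Lemma fXnmE N f n : (fX ^+ N * f) n = if (n < N)%N then 0 else f (n - N)%N.
Proof.
elim: N n => [|N IH] n; first by rewrite expr0 mul1r subn0.
by rewrite exprS -mulrA fXmE; case: n => [//|n]; rewrite IH ltnS subSS.
Qed.

Lemma fdD f g : fd (f + g) = fd f + fd g.
Proof. by apply: fpsP => n; rewrite faddE /fd faddE mulrDr. Qed.
Lemma fdN f : fd (- f) = - fd f.
Proof. by apply: fpsP => n; rewrite foppE /fd foppE mulrN. Qed.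
Lemma fdC a : fd (fC a) = 0.
Proof. by apply: fpsP => n; rewrite /fd /fC /= mulr0. Qed.
Lemma fdX : fd fX = 1.
Proof. by apply: fpsP => -[|n]; rewrite /fd /fX /= ?mulr1// mulr0. Qed.
Lemma fdM f g : fd (f * g) = fd f * g + f * fd g.
Proof.
apply: fpsP => n; rewrite faddE /fd (@fmul_truncE _ _ _ n.+2)//.
rewrite mulr_natl -coef_deriv derivM coefD !coefM; congr (_ + _); apply: eq_bigr => i _.
  rewrite coef_deriv !coef_poly.
  have -> : (i.+1 < n.+2)%N by have := ltn_ord i; lia.
  by have -> : (n - i < n.+2)%N; [lia|rewrite mulr_natl].
rewrite coef_deriv !coef_poly.
have -> : (i < n.+2)%N by have := ltn_ord i; lia.
by have -> : ((n - i).+1 < n.+2)%N; [lia|rewrite mulr_natl].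
Qed.
Lemma fdCm a f : fd (fC a * f) = fC a * fd f.
Proof. by rewrite fdM fdC mul0r add0r. Qed.
Lemma fdXn f n : fd (f ^+ n.+1) = n.+1%:R * f ^+ n * fd f.
Proof.
elim: n => [|n IH]; first by rewrite expr1 expr0 !mul1r.
by rewrite exprS fdM IH exprS -[n.+2%:R]natr1; ring.
Qed.

Lemma fth_E f n : (fX * fd f) n = n%:R * f n.
Proof. by rewrite fXmE; case: n => [|n]; rewrite ?mul0r. Qed.

Lemma fact_neq0 n : n`!%:R != 0 :> C.
Proof. by rewrite pnatr_eq0 -lt0n fact_gt0. Qed.

Lemma fd_fe b : fd (fe b) = fC b * fe b.
Proof.
apply: fpsP => n; rewrite fCmE /fd /fe factS natrM exprS invfM.
have : n.+1%:R != 0 :> C by rewrite pnatr_eq0.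
move: (fact_neq0 n); set c := n`!%:R; set a := n.+1%:R => c0 a0.
have -> : a * (b * b ^+ n * (a^-1 / c)) = a / a * (b * (b ^+ n / c)) by ring.
by rewrite mulfV ?mul1r.
Qed.

Lemma fe0 b : fe b 0%N = 1. Proof. by rewrite /fe expr0 fact0 divr1. Qed.

Lemma fps_mul_eq0 f g : f * g = 0 -> f = 0 \/ g = 0.
Proof.
move=> fg; have [->|f0] := eqVneq f 0; first by left.
have [->|g0] := eqVneq g 0; first by right.
have ex h : h != 0 -> exists n, h n != 0.
  move=> /eqP h0; apply: contrapT => hn; apply: h0; apply: fpsP => n.
  by apply/eqP; apply: contrapT => /negP hnn; apply: hn; exists n.
have nz := ex _ f0; have mz := ex _ g0.
case: (ex_minnP nz) => n fn nmin; case: (ex_minnP mz) => m gm mmin.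
have := congr1 (@^~ (n + m)%N) fg; rewrite fmulE.
have hn : (n < (n + m).+1)%N by rewrite ltnS leq_addr.
rewrite (bigD1 (Ordinal hn)) //= addKn big1 ?addr0.
  by move/eqP; rewrite mulf_eq0 (negPf fn) (negPf gm).
move=> i /eqP ni; have {}ni : (nat_of_ord i != n) by apply/eqP => e; apply: ni; exact: val_inj.
have [lt_in|] := ltnP i n.
  have -> : f i = 0; last by rewrite mul0r.
  by apply/eqP; apply: contraTT lt_in => /nmin; rewrite -leqNgt.
rewrite leq_eqVlt eq_sym (negPf ni) /= => lt_ni.
have -> : g (n + m - i)%N = 0; last by rewrite mulr0.
apply/eqP; apply: contraT => /mmin; rewrite leqNgt => /negP[]; have := ltn_ord i; lia.
Qed.

(** Cancellation stands in for division by series with zero constant term, such as [fe 1 - 1] or the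
    theta series. *)
Lemma fps_mulI f g h : f != 0 -> f * g = f * h -> g = h.
Proof.
move=> f0 e; have /fps_mul_eq0[f0'|/eqP] : f * (g - h) = 0 by rewrite mulrBr e subrr.
  by move: f0; rewrite f0' eqxx.
by rewrite subr_eq0 => /eqP.
Qed.

Lemma fX_neq0 : fX != 0.
Proof. by apply/eqP => /(congr1 (@^~ 1%N)) /eqP; rewrite oner_eq0. Qed.

Lemma fps_expf_neq0 f n : f != 0 -> f ^+ n != 0.
Proof.
move=> f0; elim: n => [|n IH]; first exact: oner_neq0.
by apply/eqP; rewrite exprS => /fps_mul_eq0[/eqP|/eqP]; exact/negP.
Qed.

(** As [p 0 = 0], the equation [X f' = p f] expresses [n f_n] through earlier coefficients.
    Exponentials are identified through this equation. *)
Lemma fth_unique (p f g : fps) : p 0%N = 0 -> fX * fd f = p * f -> fX * fd g = p * g ->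
  f 0%N = g 0%N -> f = g.
Proof.
move=> p0 hf hg e0; apply: fpsP => n.
elim: n {-2}n (leqnn n) => [|m IH] n; first by rewrite leqn0 => /eqP ->.
rewrite leq_eqVlt => /orP[/eqP ->|]; last by rewrite ltnS => /IH.
have m0 : m.+1%:R != 0 :> C by rewrite pnatr_eq0.
apply: (mulfI m0); rewrite -!fth_E hf hg !fmulE; apply: eq_bigr => -[[|i] hi] _ /=.
  by rewrite p0 !mul0r.
by rewrite IH// subSS leq_subr.
Qed.

Lemma fpow_small (p : fps) j n : p 0%N = 0 -> (n < j)%N -> (p ^+ j) n = 0.
Proof.
move=> p0; elim: j n => [//|j IH] n nj; rewrite exprS fmulE big1// => -[[|i] hi] _ /=.
  by rewrite p0 mul0r.
by rewrite IH ?mulr0//; move: hi; lia.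
Qed.

Lemma ps_expE (p : fps) n m : p 0%N = 0 -> (n <= m)%N ->
  ps_exp p n = (\sum_(j < m.+1) fC (j`!%:R)^-1 * p ^+ j) n.
Proof.
move=> p0 nm; rewrite fsumE.
have tr j : (p ^+ j) n = ((trunc n.+1 p) ^+ j)`_n.
  elim: j {-2 4}n (leqnn n) => [|j IH] i ni.
    by rewrite !expr0 coef1 foneE.
  rewrite !exprS coefM fmulE; apply: eq_bigr => a _; rewrite coef_poly.
  have -> : (a < n.+1)%N by rewrite (leq_trans (ltn_ord a)).
  by rewrite IH// (leq_trans (leq_subr _ _)).
rewrite /ps_exp coef_sum.
rewrite (eq_bigr (fun j : 'I_n.+1 => (fC (j`!%:R)^-1 * p ^+ j) n)); last first.
  by move=> j _; rewrite coefZ fCmE tr.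
rewrite -!(big_mkord xpredT (fun j => (fC (j`!%:R)^-1 * p ^+ j) n)).
rewrite [in RHS](@big_cat_nat _ _ _ n.+1)//= [X in _ = _ + X](_ : _ = 0) ?addr0//.
rewrite big_nat big1// => j /andP[nj _].
by rewrite fCmE fpow_small ?mulr0.
Qed.

(** The partial sums [S m] of the exponential satisfy [S(m+1)' = p' S(m)], and since [p 0 = 0] the
    coefficients up to [n] have stabilised at [S n]. *)
Lemma fth_ps_exp (p : fps) : p 0%N = 0 ->
  fX * fd (ps_exp p : fps) = (fX * fd p) * ps_exp p.
Proof.
move=> p0; apply: fpsP => n.
pose S m : fps := \sum_(j < m.+1) fC (j`!%:R)^-1 * p ^+ j.
have dS m : fd (S m.+1) = fd p * S m.
  have term j : fd (fC (j.+1`!%:R)^-1 * p ^+ j.+1) = fd p * (fC (j`!%:R)^-1 * p ^+ j).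
    have e : fC (j.+1`!%:R)^-1 * j.+1%:R = fC (j`!%:R)^-1.
      by rewrite -fCnat -fCM factS natrM invfM mulrAC mulVf ?mul1r// pnatr_eq0.
    by rewrite fdCm fdXn !mulrA e; ring.
  elim: m => [|m IH].
    by rewrite /S !big_ord_recr !big_ord0 /= !add0r fdD expr0 mulr1 fdC add0r term expr0 mulr1.
  by rewrite /S big_ord_recr fdD -/(S m.+1) IH term -mulrDr [in RHS]/S big_ord_recr.
have e i : (i <= n)%N -> ps_exp p i = S n i by move=> iN; exact: ps_expE.
rewrite fth_E (@ps_expE _ _ n.+1)// -/(S n.+1) -fth_E dS mulrA !fmulE.
by apply: eq_bigr => i _; rewrite e// leq_subr.
Qed.

Lemma ps_exp0 (p : fps) : p 0%N = 0 -> ps_exp p 0 = 1.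
Proof.
by move=> p0; rewrite (@ps_expE _ _ 0)// big_ord1 fCmE expr0 fact0 invr1 mul1r.
Qed.

Lemma coef_fmul0 f g : (f * g) 0%N = f 0%N * g 0%N.
Proof. by rewrite fmulE big_ord1 subn0. Qed.

End FormalPowerSeries.

(** * Asymptotic expansions at 0 along sets of real numbers *)

Section Asymptotics.
Variable R : realType.
Local Notation C := R[i].
Implicit Types (S : set R) (f g : R -> C) (s r : fps R) (x : R).

(** A Poincare expansion for [x] in [S] tending to 0, with the point 0 itself excluded. It is
    compatible with the ring operations and, by [asym_uniq], determines the formal series even when
    [S] lies on one side of 0; no radius of convergence has to be found. *)
Definition asym S f s := forall N, exists K d : R, 0 < d /\
  forall x, S x -> x != 0 -> `|x| <= d ->
    nm (f x - \sum_(j < N) s j * x%:C ^+ j) <= K * `|x| ^+ N.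

Lemma asym_sub S S' f s : (forall x, S x -> S' x) -> asym S' f s -> asym S f s.
Proof. by move=> h a N; have [K [d [d0 hd]]] := a N; exists K, d; split => // x /h; exact: hd. Qed.

Lemma asym_eq S f g s d : 0 < d -> (forall x, S x -> x != 0 -> `|x| <= d -> f x = g x) ->
  asym S f s -> asym S g s.
Proof.
move=> d0 fg a N; have [K [d' [d'0 hd]]] := a N; exists K, (Num.min d d').
split; first by rewrite lt_min d0.
by move=> x Sx x0; rewrite le_min => /andP[xd xd']; rewrite -fg// hd.
Qed.

Lemma asym_cofinal S f s : (forall N, exists M K d, [/\ (N <= M)%N, 0 < d &
  forall x, S x -> x != 0 -> `|x| <= d ->
    nm (f x - \sum_(j < M) s j * x%:C ^+ j) <= K * `|x| ^+ M]) -> asym S f s.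
Proof.
move=> h N; have [M [K [d [NM d0 hd]]]] := h N.
exists (`|K| + \sum_(j < M) nm (s j)), (Num.min d 1); split; first by rewrite lt_min d0 ltr01.
move=> x Sx x0; rewrite le_min => /andP[xd x1].
have le1 m : (N <= m)%N -> `|x| ^+ m <= `|x| ^+ N by move=> Nm; exact: ler_wiXn2l.
rewrite -(big_mkord xpredT (fun j => s j * x%:C ^+ j)).
have -> : \sum_(0 <= j < N) s j * x%:C ^+ j = \sum_(0 <= j < M) s j * x%:C ^+ j -
    \sum_(N <= j < M) s j * x%:C ^+ j by rewrite (@big_cat_nat _ _ _ N 0 M)//= addrK.
rewrite opprB addrA addrAC (le_trans (nmD _ _))// mulrDl lerD//.
  rewrite big_mkord (le_trans (hd x Sx x0 xd))//.
  apply: (@le_trans _ _ (`|K| * `|x| ^+ M)); first by rewrite ler_wpM2r ?exprn_ge0// ler_norm.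
  by rewrite ler_wpM2l// le1.
rewrite (le_trans (nm_sum _ _ _))// mulr_suml -(big_mkord xpredT (fun j => nm (s j) * `|x| ^+ N)).
rewrite [leRHS](@big_cat_nat _ _ _ N 0 M)//= ler_wpDl//.
  by rewrite sumr_ge0// => i _; rewrite mulr_ge0 ?nm_ge0 ?exprn_ge0.
rewrite big_nat [leRHS]big_nat ler_sum// => j /andP[Nj _].
by rewrite nmM nmX nm_real ler_wpM2l ?nm_ge0// le1.
Qed.

Lemma asymD S f g s r : asym S f s -> asym S g r ->
  asym S (fun x => f x + g x) (s + r).
Proof.
move=> af ag N; have [K [d [d0 hd]]] := af N; have [K' [d' [d'0 hd']]] := ag N.
exists (K + K'), (Num.min d d'); split; first by rewrite lt_min d0.
move=> x Sx x0; rewrite le_min => /andP[xd xd'].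
have -> : \sum_(j < N) (s + r) j * x%:C ^+ j = \sum_(j < N) s j * x%:C ^+ j +
    \sum_(j < N) r j * x%:C ^+ j.
  by rewrite -big_split; apply: eq_bigr => j _; rewrite faddE mulrDl.
by rewrite opprD addrACA mulrDl (le_trans (nmD _ _))// lerD ?hd ?hd'.
Qed.

Lemma poly_asym (p : {poly C}) N : exists K, forall x, `|x| <= 1 ->
  nm (p.[x%:C] - \sum_(j < N) p`_j * x%:C ^+ j) <= K * `|x| ^+ N.
Proof.
have bdd (q : {poly C}) : exists K, forall x, `|x| <= 1 -> nm q.[x%:C] <= K.
  exists (\sum_(i < size q) nm q`_i) => x x1; rewrite horner_coef.
  rewrite (le_trans (nm_sum _ _ _))// ler_sum// => i _.
  by rewrite nmM nmX nm_real ler_piMr ?nm_ge0// exprn_ile1.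
have [K hK] := bdd (drop_poly N p); exists K => x x1.
rewrite -[p in p.[_]](poly_take_drop N) hornerD hornerM hornerXn horner_poly.
by rewrite addrAC subrr add0r nmM nmX nm_real ler_wpM2r ?exprn_ge0// hK.
Qed.

Lemma asymM S f g s r : asym S f s -> asym S g r ->
  asym S (fun x => f x * g x) (s * r).
Proof.
move=> af ag N; have [K [d [d0 hd]]] := af N; have [K' [d' [d'0 hd']]] := ag N.
pose p := trunc N s; pose q := trunc N r.
have [L hL] := poly_asym (p * q) N.
have [M hM] := poly_asym p 0; have [M' hM'] := poly_asym q 0.
exists (`|K| * (`|K'| + M') + M * `|K'| + L), (Num.min 1 (Num.min d d')).
split; first by rewrite !lt_min ltr01 d0.
move=> x Sx x0; rewrite !le_min => /and3P[x1 xd xd'].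
have E (u : fps R) : \sum_(j < N) u j * x%:C ^+ j = (trunc N u).[x%:C].
  by rewrite horner_poly.
have := hd x Sx x0 xd; have := hd' x Sx x0 xd'; rewrite !E -/p -/q => h2 h1.
have -> : (trunc N (s * r)).[x%:C] = \sum_(j < N) (p * q)`_j * x%:C ^+ j.
  by rewrite horner_poly; apply: eq_bigr => j _; rewrite -fmul_truncE.
have := hM x x1; have := hM' x x1; rewrite !big_ord0 !subr0 !expr0 !mulr1 => hq hp.
have := hL x x1; set T := \sum_(j < N) _; rewrite hornerM => hT.
set P := p.[_] in hp h1 hT *; set Q := q.[_] in hq h2 hT *.
have -> : f x * g x - T = (f x - P) * g x + P * (g x - Q) + (P * Q - T) by ring.
have xN0 : 0 <= `|x| ^+ N by rewrite exprn_ge0.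
have xN1 : `|x| ^+ N <= 1 by rewrite exprn_ile1.
have h1' : nm (f x - P) <= `|K| * `|x| ^+ N by apply: le_trans h1 _; rewrite ler_wpM2r// ler_norm.
have h2' : nm (g x - Q) <= `|K'| * `|x| ^+ N by apply: le_trans h2 _; rewrite ler_wpM2r// ler_norm.
have h3 : nm (g x) <= `|K'| + M'.
  have -> : g x = (g x - Q) + Q by ring.
  rewrite (le_trans (nmD _ _))// lerD// (le_trans h2')// ler_piMr//.
have a1 : nm ((f x - P) * g x) <= `|K| * `|x| ^+ N * (`|K'| + M') by rewrite nmM ler_pM ?nm_ge0.
have a2 : nm (P * (g x - Q)) <= M * (`|K'| * `|x| ^+ N) by rewrite nmM ler_pM ?nm_ge0.
have := nmD ((f x - P) * g x + P * (g x - Q)) (P * Q - T).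
have := nmD ((f x - P) * g x) (P * (g x - Q)).
nra.
Qed.

Lemma asym_cst S c : asym S (fun=> c) (fC c).
Proof.
move=> [|N]; [exists (nm c), 1|exists 0, 1]; split=> // x _ _ _.
  by rewrite big_ord0 subr0 mulr1.
rewrite big_ord_recl /= expr0 mulr1 big1 ?addr0 ?subrr ?nm0 ?mul0r// => i _.
by rewrite /fC /= mul0r.
Qed.

Lemma asymZ S c f s : asym S f s -> asym S (fun x => c * f x) (fC c * s).
Proof. exact/asymM/asym_cst. Qed.

Lemma asymN S f s : asym S f s -> asym S (fun x => - f x) (- s).
Proof.
move=> a N; have [K [d [d0 hd]]] := a N; exists K, d; split=> // x Sx x0 xd.
rewrite (eq_bigr (fun j : 'I_N => - (s j * x%:C ^+ j))); last by move=> j _; rewrite -mulNr.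
by rewrite sumrN -opprD nmN hd.
Qed.

Lemma asymB S f g s r : asym S f s -> asym S g r ->
  asym S (fun x => f x - g x) (s - r).
Proof. by move=> af /asymN; exact: asymD. Qed.

Lemma asym_id S : asym S (fun x => x%:C) (fX R).
Proof.
apply: asym_cofinal => N; exists N.+2, 0, 1; split=> //; first by lia.
move=> x _ _ _.
rewrite 2!big_ord_recl /fX /= mul0r add0r mul1r expr1 big1 ?addr0 ?subrr ?nm0 ?mul0r//.
by move=> i _; rewrite mul0r.
Qed.

Lemma asymX S f s n : asym S f s -> asym S (fun x => f x ^+ n) (s ^+ n).
Proof.
move=> a; elim: n => [|n IH]; first by rewrite expr0 -fC1; exact: asym_cst.
by rewrite exprS; have := asymM a IH; apply: asym_eq ltr01 _ => x _ _ _; rewrite exprS.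
Qed.

Lemma asym_sum S (n : nat) (F : nat -> R -> C) (s : nat -> fps R) :
  (forall j, (j < n)%N -> asym S (F j) (s j)) ->
  asym S (fun x => \sum_(j < n) F j x) (\sum_(j < n) s j).
Proof.
elim: n => [|n IH] h.
  rewrite big_ord0 -fC0; apply: asym_eq ltr01 _ (asym_cst S 0) => x _ _ _.
  by rewrite big_ord0.
rewrite big_ord_recr; have h' : forall j, (j < n)%N -> asym S (F j) (s j).
  by move=> j jn; exact/h/ltnW.
apply: asym_eq ltr01 _ (asymD (IH h') (h n (ltnSn n))) => x _ _ _.
by rewrite big_ord_recr.
Qed.

Lemma asym_opp S f s : asym S f s ->
  asym (fun x => S (- x)) (fun x => f (- x)) (fun n => (-1) ^+ n * s n).
Proof.
move=> a N; have [K [d [d0 hd]]] := a N; exists K, d; split=> // x Sx x0 xd.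
have := hd (- x) Sx; rewrite oppr_eq0 normrN => /(_ x0 xd); apply: le_trans.
rewrite le_eqVlt; apply/orP; left; apply/eqP; congr nm; congr (_ - _).
have -> : (- x)%:C = -1 * x%:C by rewrite rmorphN mulN1r.
by apply: eq_bigr => j _; rewrite exprMn mulrCA mulrA.
Qed.

(** If the earlier coefficients agree, the difference of the two expansions bounds the next
    coefficient by a multiple of [|x|], which is arbitrarily small because 0 is an accumulation
    point of [S]. *)
Lemma asym_uniq S f s r : (forall d, 0 < d -> exists x, [/\ S x, x != 0 & `|x| <= d]) ->
  asym S f s -> asym S f r -> s = r.
Proof.
move=> acc af ag; apply: fpsP => n.
elim: n {-2}n (leqnn n) => [|m IH] n nm.
  move: nm; rewrite leqn0 => /eqP ->.
  have := asymB af ag => /(_ 1%N)[K [d [d0 hd]]].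
  apply: eq_eps => e e0; have K0 : 0 < `|K| + 1 by rewrite ltr_wpDl.
  have [|x [Sx x0]] := acc (Num.min d (e / (`|K| + 1))); first by rewrite lt_min d0 divr_gt0.
  rewrite le_min => /andP[xd xe]; have := hd x Sx x0 xd.
  rewrite big_ord1 subrr sub0r nmN expr0 mulr1 => /le_trans; apply.
  apply: (@le_trans _ _ ((`|K| + 1) * `|x|)).
    by rewrite expr1 ler_wpM2r// (le_trans (ler_norm _))// lerDl.
  by rewrite mulrC -ler_pdivlMr.
move: nm; rewrite leq_eqVlt => /orP[/eqP ->|]; last by rewrite ltnS => /IH.
have := asymB af ag => /(_ m.+2)[K [d [d0 hd]]].
apply: eq_eps => e e0; have K0 : 0 < `|K| + 1 by rewrite ltr_wpDl.
have [|x [Sx x0]] := acc (Num.min d (e / (`|K| + 1))); first by rewrite lt_min d0 divr_gt0.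
rewrite le_min => /andP[xd xe]; have := hd x Sx x0 xd.
rewrite big_ord_recr big1 /=; last by move=> j _; rewrite faddE foppE IH ?subrr ?mul0r// -ltnS.
rewrite subrr sub0r nmN add0r nmM nmX nm_real [_ ^+ m.+2]exprS mulrA.
rewrite ler_pM2r ?exprn_gt0 ?normr_gt0// => /le_trans; apply.
apply: (@le_trans _ _ ((`|K| + 1) * `|x|)).
  by rewrite ler_wpM2r// (le_trans (ler_norm _))// lerDl.
by rewrite mulrC -ler_pdivlMr.
Qed.

Lemma nm_cexp_le (z : C) : nm (cexp z) <= expR (nm z).
Proof. by rewrite nm_cexp ler_expR (le_trans (ler_norm _)) ?nm_Re. Qed.

(** The derivative of a remainder is [b] times the previous remainder; the base [2 * nm b * |x|]
    carries the factor 2 of [rd_mvt]. *)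
Lemma cexp_remainder (b : C) N x :
  nm (cexp (x%:C * b) - \sum_(j < N) fe b j * x%:C ^+ j) <=
  (2 * nm b * `|x|) ^+ N * expR (nm b * `|x|).
Proof.
elim: N x => [|N IH] x.
  by rewrite big_ord0 subr0 expr0 mul1r (le_trans (nm_cexp_le _))// nmM nm_real mulrC.
pose P N (u : R) := \sum_(j < N) fe b j * u%:C ^+ j.
have rdX (j : nat) (u : R) : rd (fun y : R => y%:C ^+ j) u (j%:R * u%:C ^+ j.-1).
  elim: j => [|j IHj]; first by rewrite mul0r; exact: rd_cst.
  have i1 : rd (fun y : R => y%:C) u 1 by exact: (rd_is_derive (is_derive_id u 1)).
  have := rdM i1 IHj; rewrite mul1r => h.
  rewrite (_ : _ * _ = u%:C ^+ j + u%:C * (j%:R * u%:C ^+ j.-1)).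
    by apply: rd_eq h => y; rewrite exprS.
  case: j {IHj h} => [|j] /=; first by rewrite expr0 mul0r mulr0 addr0 mul1r.
  by rewrite -[j.+2%:R]natr1 exprS; ring.
have rdP (u : R) : rd (P N.+1) u (b * P N u).
  have h : forall j, (j < N.+1)%N -> rd (fun y : R => fe b j * y%:C ^+ j) u (fe b j * (j%:R * u%:C ^+ j.-1)).
    by move=> j _; exact/rdZ/rdX.
  have := rd_sum h; congr rd; rewrite big_ord_recl mul0r mulr0 add0r mulr_sumr.
  apply: eq_bigr => j _; rewrite lift0 /= mulrA mulrA; congr (_ * _).
  have := congr1 (@^~ (j : nat)) (fd_fe b); rewrite fCmE => <-.
  by rewrite /fd mulrC.
pose F (u : R) := cexp (0 + u%:C * b) - P N.+1 u.
have F0 : F 0 = 0.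
  rewrite /F mul0r addr0 cexp0 /P big_ord_recl fe0 expr0 mulr1 big1 ?addr0 ?subrr// => j _.
  by rewrite lift0 expr0n mulr0.
have rdF (u : R) : rd F u (b * (cexp (0 + u%:C * b) - P N u)).
  have := rdD (rd_cexp 0 b u) (rdN (rdP u)); congr rd; ring.
pose K := nm b * ((2 * nm b * `|x|) ^+ N * expR (nm b * `|x|)).
have key u : `|u - 0| <= `|x| ->
    rd F u (b * (cexp (0 + u%:C * b) - P N u)) /\ nm (b * (cexp (0 + u%:C * b) - P N u)) <= K.
  rewrite subr0 => has_tsum; split=> //; rewrite nmM /K ler_wpM2l ?nm_ge0// add0r.
  rewrite (le_trans (IH u))// ler_pM ?exprn_ge0 ?mulr_ge0 ?nm_ge0 ?expR_ge0//.
    by rewrite lerXn2r ?nnegrE ?mulr_ge0 ?nm_ge0// ler_wpM2l ?mulr_ge0 ?nm_ge0.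
  by rewrite ler_expR ler_wpM2l ?nm_ge0.
have := rd_mvt key (y := x); rewrite subr0 F0 subr0 => /(_ (lexx _)) h.
have -> : cexp (x%:C * b) - \sum_(j < N.+1) fe b j * x%:C ^+ j = F x by rewrite /F add0r.
rewrite (le_trans h)// exprS /K le_eqVlt; apply/orP; left; apply/eqP; ring.
Qed.

Lemma asym_cexp S (b : C) : asym S (fun x => cexp (x%:C * b)) (fe b).
Proof.
move=> N; exists ((2 * nm b) ^+ N * expR (nm b)), 1; split=> // x _ _ x1.
rewrite (le_trans (cexp_remainder b N x))// exprMn mulrAC ler_wpM2r ?exprn_ge0//.
by rewrite ler_wpM2l ?exprn_ge0 ?mulr_ge0 ?nm_ge0// ler_expR ler_piMr ?nm_ge0.
Qed.

(** The [N]-th power of [z <= e^z] at [z = e y / N]. *)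
Lemma expR_pow_le (N : nat) (y e : R) : 0 <= y -> 0 < e ->
  y ^+ N <= (N%:R / e) ^+ N * expR (e * y).
Proof.
move=> y0 e0; case: N => [|N].
  by rewrite !expr0 mul1r -expR0 ler_expR mulr_ge0// ltW.
have h : y <= N.+1%:R / e * expR (e * y / N.+1%:R).
  have := expR_ge1Dx (e * y / N.+1%:R); set E := expR _ => hE.
  rewrite mulrAC ler_pdivlMr//.
  have : N.+1%:R * (1 + e * y / N.+1%:R) <= N.+1%:R * E by rewrite ler_wpM2l.
  rewrite mulrDr mulr1 [_ * (_ / _)]mulrC divfK ?pnatr_eq0// mulrC.
  by apply: le_trans; rewrite lerDr.
apply: (le_trans (_ : _ <= (N.+1%:R / e * expR (e * y / N.+1%:R)) ^+ N.+1)).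
  by rewrite lerXn2r// nnegrE// mulr_ge0 ?expR_ge0// divr_ge0// ltW.
by rewrite exprMn -expRM_natr divfK ?pnatr_eq0.
Qed.

Section ExpSums.
Variables (I : choiceType) (w b : I -> C) (e : R).
Hypotheses (e0 : 0 < e) (ok : asum (fun i => w i * (expR (e * nm (b i)))%:C)).

(** Of the available exponential [e * |b i|], one half pays for the power [|b i|^N] produced by the
    remainder and the other half for [e^(|b i| |x|)]. *)
Let absorb N x : `|x| <= e / 2 -> forall i,
  nm (w i) * (nm (b i) ^+ N * expR (nm (b i) * `|x|)) <=
  (N%:R / (e / 2)) ^+ N * nm (w i * (expR (e * nm (b i)))%:C).
Proof.
move=> xe i; have e2 : 0 < e / 2 by rewrite divr_gt0.
have -> : nm (w i * (expR (e * nm (b i)))%:C) = nm (w i) * expR (e * nm (b i)).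
  by rewrite nmM nm_real ger0_norm ?expR_ge0.
rewrite [leRHS]mulrCA ler_wpM2l ?nm_ge0//.
apply: (le_trans (ler_pM _ _ (expR_pow_le N (nm_ge0 (b i)) e2) (lexx _))).
- by rewrite exprn_ge0 ?nm_ge0.
- exact: expR_ge0.
rewrite -[leLHS]mulrA ler_wpM2l ?exprn_ge0 ?divr_ge0 ?(ltW e0)// -expRD ler_expR.
have := nm_ge0 (b i); nra.
Qed.

Lemma asum_expsum x : `|x| <= e / 2 -> asum (fun i => w i * cexp (x%:C * b i)).
Proof.
move=> xe; apply: asum_nm ok _ => i; have := absorb 0 xe i.
rewrite !expr0 !mul1r => h; apply: le_trans h; rewrite nmM ler_wpM2l ?nm_ge0//.
by rewrite (le_trans (nm_cexp_le _))// nmM nm_real mulrC.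
Qed.

Lemma asum_expsum_coef n : asum (fun i => w i * fe (b i) n).
Proof.
have e2 : 0 <= e / 2 by rewrite divr_ge0// ltW.
have h0 : `|0 : R| <= e / 2 by rewrite normr0.
have c0 : 0 <= (n%:R / (e / 2)) ^+ n by rewrite exprn_ge0// divr_ge0.
apply: asum_nm (asumZ ((n%:R / (e / 2)) ^+ n)%:C ok) _ => i.
rewrite [leRHS]nmM nm_real (ger0_norm c0).
apply: le_trans (absorb n h0 i); rewrite normr0 mulr0 expR0 mulr1 nmM ler_wpM2l ?nm_ge0//.
rewrite /fe nmM nmX nmV nm_nat ler_piMr ?exprn_ge0 ?nm_ge0// invf_le1 ?ltr0n ?fact_gt0//.
by rewrite ler1n fact_gt0.
Qed.

Lemma asym_expsum S : asym S (fun x => tsum (fun i => w i * cexp (x%:C * b i)))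
  (fun n => tsum (fun i => w i * fe (b i) n)).
Proof.
move=> N; have [K hK] := ok; have e2 : 0 < e / 2 by rewrite divr_gt0.
pose c := 2 ^+ N * (N%:R / (e / 2)) ^+ N.
have c0 : 0 <= c by rewrite mulr_ge0 ?exprn_ge0 ?divr_ge0 ?(ltW e0).
exists (c * K), (e / 2); split=> // x _ _ xe.
have aj j : asum (fun i => x%:C ^+ j * (w i * fe (b i) j)).
  exact/asumZ/asum_expsum_coef.
have -> : \sum_(j < N) tsum (fun i => w i * fe (b i) j) * x%:C ^+ j =
    tsum (fun i => \sum_(j < N) x%:C ^+ j * (w i * fe (b i) j)).
  rewrite (@tsum_sum _ _ N (fun j i => x%:C ^+ j * (w i * fe (b i) j))) => [|j _]; last exact: aj.
  by apply: eq_bigr => j _; rewrite (tsumZ _ (asum_expsum_coef j)) mulrC.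
have aS := @asum_sum _ _ N (fun j i => x%:C ^+ j * (w i * fe (b i) j)) (fun j _ => aj j).
rewrite -(tsumB (asum_expsum xe) aS).
rewrite mulrAC; apply: (tsum_le (bsumZ _ hK)) => [|i].
  by rewrite mulr_ge0 ?exprn_ge0.
have -> : \sum_(j < N) x%:C ^+ j * (w i * fe (b i) j) =
    w i * \sum_(j < N) fe (b i) j * x%:C ^+ j.
  by rewrite mulr_sumr; apply: eq_bigr => j _; ring.
have h1 := ler_wpM2l (nm_ge0 (w i)) (cexp_remainder (b i) N x).
rewrite -nmM mulrBr in h1; apply: (le_trans h1).
have two0 : 0 <= 2 ^+ N :> R by rewrite exprn_ge0.
have := ler_wpM2l two0 (ler_wpM2r (exprn_ge0 N (normr_ge0 x)) (absorb N xe i)).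
have -> : c * `|x| ^+ N * nm (w i * (expR (e * nm (b i)))%:C) =
  2 ^+ N * ((N%:R / (e / 2)) ^+ N * nm (w i * (expR (e * nm (b i)))%:C) * `|x| ^+ N).
  by rewrite /c; ring.
apply: le_trans; rewrite !exprMn le_eqVlt; apply/orP; left; apply/eqP; ring.
Qed.

End ExpSums.

End Asymptotics.

(** * Laurent series with bounded pole order, reduced to power series *)

Section LaurentAlgebra.
Variable R : realType.
Local Notation C := R[i].
Implicit Types (f g s u : fps R) (c : int -> C) (N : nat) (n : int).

Definition supp N c := forall n, n < - N%:Z -> c n = 0.

(* The power series [X ^ N * c] of a Laurent series [c] with a pole of order at
   most [N], and back. *)
Definition ser N c : fps R := fun m => c (m%:Z - N%:Z).
Definition lau N u : int -> C := fun n =>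
  if n + N%:Z is Posz m then u m else 0.

(** The product of the Laurent series [c] by the power series [s]; by [em_suppD] every valid pole
    bound [N] gives the same result. *)
Definition em N s c : int -> C := lau N (s * ser N c).

Lemma lau_supp N u : supp N (lau N u).
Proof. by move=> n nN; rewrite /lau; case E: (n + N%:Z) => [m|//]; lia. Qed.

Lemma serK N c : supp N c -> lau N (ser N c) = c.
Proof.
move=> h; apply/funext => n; rewrite /lau; case E: (n + N%:Z) => [m|m].
  by rewrite /ser -E addrK.
by rewrite h//; lia.
Qed.

Lemma lauK N u : ser N (lau N u) = u.
Proof. by apply: fpsP => m; rewrite /ser /lau subrK. Qed.

Lemma ser_inj N c c' : supp N c -> supp N c' -> ser N c = ser N c' -> c = c'.
Proof. by move=> h h' e; rewrite -(serK h) -(serK h') e. Qed.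

Lemma suppW N M c : (N <= M)%N -> supp N c -> supp M c.
Proof. by move=> NM h n nM; apply: h; lia. Qed.

Lemma serS N c : supp N c -> ser N.+1 c = fX R * ser N c.
Proof.
move=> h; apply: fpsP => -[|m]; rewrite fXmE /ser.
  by rewrite h//; lia.
by congr c; lia.
Qed.

Lemma lauX N u : lau N.+1 (fX R * u) = lau N u.
Proof.
have h1 := lau_supp (N := N.+1) (fX R * u); have h2 := lau_supp (N := N) u.
by apply: (ser_inj h1 (suppW (leqnSn N) h2)); rewrite lauK serS ?lauK.
Qed.

Lemma em_suppW N s c : supp N c -> em N.+1 s c = em N s c.
Proof. by move=> h; rewrite /em serS// mulrCA lauX. Qed.

Lemma em_suppD N M s c : supp N c -> em (N + M) s c = em N s c.
Proof.
move=> h; elim: M => [|M IH]; first by rewrite addn0.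
by rewrite addnS em_suppW//; apply: suppW h; exact: leq_addr.
Qed.

Definition ld c : int -> C := fun n => (n + 1)%:~R * c (n + 1).

Lemma ld_supp N c : supp N c -> supp N.+1 (ld c).
Proof. by move=> h n nN; rewrite /ld h ?mulr0//; lia. Qed.

Lemma ser_ld N c :
  ser N.+1 (ld c) = fX R * fd (ser N c) - fC N%:R * ser N c.
Proof.
apply: fpsP => m; rewrite faddE foppE fth_E fCmE -mulrBl /ser /ld.
have -> : m%:Z - N.+1%:Z + 1 = m%:Z - N%:Z by lia.
by rewrite rmorphB.
Qed.

Definition ls c : int -> C := fun n => c (n - 1).

Lemma ser_ls N c : supp N c -> ser N (ls c) = fX R * ser N c.
Proof.
move=> h; apply: fpsP => -[|m]; rewrite fXmE /ser /ls; first by rewrite h//; lia.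
by congr c; lia.
Qed.

Lemma ls_supp N c : supp N c -> supp N (ls c).
Proof. by move=> h n nN; rewrite /ls h//; lia. Qed.

End LaurentAlgebra.

(** * The heat operators and their conjugation by [exp (l E2 X^2 / 24)] *)

Section HeatOperators.
Variables (R : realType) (l : nat).
Local Notation C := R[i].
Local Notation Im := (@complex.Im R).
Local Notation L := (l%:R : C).
Local Notation E2 := (@eisenstein R 2).
Local Notation E4 := (@eisenstein R 4).
Implicit Types (c f g V : laurent R) (t lam : C) (n : int).

(** The weight is allowed to be complex for the sake of [2^-1], the weight at which the conjugated
    operator is [Delta] with no scalar term. *)
Definition heatC lam c : laurent R := fun n t =>
  Defs.lder (Defs.lder c) n t + 2 * L * D (c n) t
  - L / 6 * E2 t * (Defs.lshift 1 (Defs.lder c) n t + lam * c n t)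
  + L ^+ 2 / 144 * E4 t * Defs.lshift 2 c n t.

Definition ldiff c := forall n t, 0 < Im t -> diff (c n) t.

Definition leqH c f := forall n, eqH (c n) (f n).

Lemma heatC_eqH lam c f : ldiff c -> leqH c f -> leqH (heatC lam c) (heatC lam f).
Proof.
move=> dc cf n t t0; rewrite /heatC /Defs.lder /Defs.lshift !(cf _ t t0).
by rewrite (D_eqH (dc n) (cf n) t0).
Qed.

(* The coefficient functions of [Defs.heat_iter] are controlled only on the upper half-plane, where they
   agree with the differentiable [f r]. *)
Definition heat_chain c (f : nat -> laurent R) := [/\ leqH (f 0%N) c, forall r, ldiff (f r) &
  forall r, leqH (f r.+1) (heatC (2 * r + 1)%:R (f r))].

Lemma heat_chain_iter c (f : nat -> laurent R) r : heat_chain c f -> leqH (heat_iter l r c) (f r).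
Proof.
move=> [h0 hd hS]; suff : ldiff (heat_iter l r c) /\ leqH (heat_iter l r c) (f r) by case.
have tr a b : ldiff a -> leqH a b -> ldiff b.
  by move=> da ab n t t0; exact: diff_eqH (ab n) (da n t t0).
elim: r => [|r [IHd IH]].
  have e : leqH c (f 0%N) by move=> n t t0; rewrite h0.
  by split=> //; apply: tr h0; exact: hd.
have e : leqH (heat_iter l r.+1 c) (f r.+1).
  by move=> n t t0; rewrite hS// -(heatC_eqH _ IHd IH).
split=> //; apply: tr (hd r.+1) _ => n t t0; by rewrite e.
Qed.

Lemma heatC_add lam c f n t : diff (c n) t -> diff (f n) t ->
  heatC lam (fun n s => c n s + f n s) n t = heatC lam c n t + heatC lam f n t.
Proof.
by move=> dc df; rewrite /heatC /Defs.lder /Defs.lshift (DD dc df); ring.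
Qed.

Lemma hitD c (f : nat -> laurent R) c' (f' : nat -> laurent R) : heat_chain c f -> heat_chain c' f' ->
  heat_chain (fun n t => c n t + c' n t) (fun r n t => f r n t + f' r n t).
Proof.
move=> [h0 hd hS] [h0' hd' hS']; split=> [n t t0|r n t t0|r n t t0].
- by rewrite h0// h0'.
- by apply: diffD; [exact: hd|exact: hd'].
- by rewrite heatC_add ?hS ?hS'//; [exact: hd|exact: hd'].
Qed.

Lemma hit0 : heat_chain (fun _ _ => 0) (fun _ _ _ => 0).
Proof.
split=> [n t t0|r n t t0|r n t t0] //; first exact: diff_cst.
by rewrite /heatC /Defs.lder /Defs.lshift D_cst; ring.
Qed.

Lemma hitZ a c (f : nat -> laurent R) : heat_chain c f -> heat_chain (fun n t => a * c n t) (fun r n t => a * f r n t).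
Proof.
move=> [h0 hd hS]; split=> [n t t0|r n t t0|r n t t0].
- by rewrite h0.
- exact/diffZ/hd.
- by rewrite hS// /heatC /Defs.lder /Defs.lshift DZ; [ring|exact: hd].
Qed.

Definition podd c : laurent R := fun n t => if odd `|n| then c n t else 0.

(** Every term of the heat operator changes the degree in [X] by an even number, so the operator
    commutes with taking the odd part. *)
Lemma heat_chain_podd c (f : nat -> laurent R) : heat_chain c f -> heat_chain (podd c) (fun r => podd (f r)).
Proof.
move=> [h0 hd hS]; split=> [n t t0|r n t t0|r n t t0]; rewrite /podd.
- by rewrite h0.
- by case: (odd _); [exact: hd|exact: diff_cst].
- have e2 : odd `|n + 1 + 1| = odd `|n| by lia.
  have e1 : odd `|n - 1 + 1| = odd `|n| by lia.
  have e3 : odd `|n - 2| = odd `|n| by lia.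
  rewrite hS// /heatC /Defs.lder /Defs.lshift e1 e2 e3; case: ifP => _; first by [].
  by rewrite D_cst; ring.
Qed.

Section Conjugation.
Hypotheses (smE2 : smooth E2) (smE4 : smooth E4).
Hypothesis ramanujan : forall t, 0 < Im t -> D E2 t = (E2 t ^+ 2 - E4 t) / 12.

Fixpoint serres (r : nat) (h : C -> C) : C -> C :=
  if r is p.+1 then serre (2^-1 + 2 * p%:R) (serres p h) else h.

Lemma smooth_serre kappa (h : C -> C) : smooth h -> smooth (serre kappa h).
Proof.
move=> sh; apply: smooth_eqH (smD (smooth_D sh) (smZ (- (kappa / 12)) (smM smE2 sh))) => t _.
by rewrite /serre; ring.
Qed.

Lemma smooth_serres r (h : C -> C) : smooth h -> smooth (serres r h).
Proof. by move=> sh; elim: r => //= r; exact: smooth_serre. Qed.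

(** Since the operator of weight 1/2 kills [g], the one of weight [2 r + 1] acts on [h g] through
    [2 l D - (l / 6) (2 r + 1/2) E2] on [h], which is [2 l] times the Serre derivative of weight
    [1/2 + 2 r]. *)
Lemma heat_chain_mul (h : C -> C) g : smooth h -> ldiff g ->
  (forall n t, 0 < Im t -> heatC 2^-1 g n t = 0) ->
  heat_chain (fun n t => h t * g n t)
      (fun r n t => (2 * L) ^+ r * serres r h t * g n t).
Proof.
move=> sh dg hg; split=> [n t t0|r n t t0|r n t t0].
- by rewrite expr0 mul1r.
- apply: diffM (dg n t t0); apply: diffZ; exact/smooth_diff/t0/smooth_serres.
- have ds := smooth_diff (smooth_serres r sh) t0.
  have dgn := dg n t t0; have hgn := hg n t t0.
  apply/eqP; rewrite -subr_eq0; apply/eqP.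
  transitivity (- ((2 * L) ^+ r * serres r h t * heatC 2^-1 g n t)); last first.
    by rewrite hgn mulr0 oppr0.
  rewrite /heatC /Defs.lder /Defs.lshift (DM (diffZ _ ds) dgn) (DZ _ ds).
  rewrite exprS /= /serre natrD natrM.
  set X := (2 * L) ^+ r; set s := serres r h t; set s' := D _ t; set g' := D _ t.
  set a1 := g (n + 1 + 1) t; set a2 := g (n - 1 + 1) t; set a3 := g n t.
  set a4 := g (n - 2) t; set b1 := (n + 1)%:~R; set b2 := (n + 1 + 1)%:~R.
  set b3 := (n - 1 + 1)%:~R; set e2 := E2 t; set e4 := E4 t.
  by field.
Qed.

(** Coefficients of [exp (l E2 X^2 / 24)], which is the Gaussian factor of [Rsharp] after the
    substitution [Z = X / (2 pi i)]. *)
Definition Ecoef (j : nat) (t : C) : C :=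
  if odd j then 0 else (L / 24 * E2 t) ^+ j./2 / (j./2)`!%:R.

Definition Efps t : fps R := fun j => Ecoef j t.

Lemma fd_Efps t : fd (Efps t) = fC (L / 12 * E2 t) * (fX R * Efps t).
Proof.
apply: fpsP => -[|j]; rewrite fCmE fXmE /fd /Efps /Ecoef; first by rewrite !mulr0.
rewrite /= negbK; case: ifP => oj; first by rewrite !mulr0.
rewrite -[in LHS](odd_double_half j) oj add0n.
have : (j./2).*2.+2%:R = 2 * (j./2).+1%:R :> C by rewrite -doubleS -muln2 natrM mulrC.
rewrite /= => ->; rewrite doubleK factS natrM exprS invfM.
have : (j./2).+1%:R != 0 :> C by rewrite pnatr_eq0.
set a := _.+1%:R; set b := _`!%:R => a0.
have -> : 2 * a * (L / 24 * E2 t * (L / 24 * E2 t) ^+ j./2 * (a^-1 / b)) =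
  a / a * (2 * (L / 24 * E2 t * (L / 24 * E2 t) ^+ j./2 / b)) by ring.
by rewrite mulfV// mul1r; field.
Qed.

Lemma smooth_Ecoef j : smooth (Ecoef j).
Proof.
rewrite /Ecoef; case: (odd j); first exact: smooth_cst.
have pw (m : nat) : smooth (fun t => (L / 24 * E2 t) ^+ m).
  elim: m => [|m IH]; first exact: smooth_cst.
  by apply: smooth_eqH (smM (smZ (L / 24) smE2) IH) => t _; rewrite exprS.
by apply: smooth_eqH (smZ ((j./2)`!%:R)^-1 (pw j./2)) => t _; rewrite mulrC.
Qed.

Lemma D_Ecoef j t : 0 < Im t ->
  D (Ecoef j) t = (fC (L / 288 * (E2 t ^+ 2 - E4 t)) * (fX R * (fX R * Efps t))) j.
Proof.
move=> t0; rewrite fCmE fXmE.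
case: j => [|[|j]]; rewrite ?fXmE ?mulr0 /Ecoef /=.
- by rewrite (_ : (fun t => _) = fun=> 1 / 1) ?D_cst//; apply/funext => s; rewrite expr0.
- exact: D_cst.
rewrite negbK /Efps /Ecoef; case: ifP => _; first by rewrite D_cst mulr0.
set m := j./2.
have dE : diff (fun t => L / 24 * E2 t) t by apply/diffZ/smooth_diff.
have dpw i : diff (fun t => (L / 24 * E2 t) ^+ i) t /\
    D (fun t => (L / 24 * E2 t) ^+ i) t =
      i%:R * (L / 24 * E2 t) ^+ i.-1 * (L / 24 * D E2 t).
  elim: i => [|i [d1 IH]].
    by rewrite !mul0r; split; [exact: diff_cst|exact: D_cst].
  have -> : (fun t => (L / 24 * E2 t) ^+ i.+1) =
      (fun t => (L / 24 * E2 t) * (L / 24 * E2 t) ^+ i).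
    by apply/funext => s; rewrite exprS.
  split; first exact: diffM.
  rewrite (DM dE d1) DZ ?IH; last exact: smooth_diff.
  case: i {d1 IH} => [|i] /=; first by rewrite expr0; ring.
  by rewrite -[i.+2%:R]natr1 exprS; ring.
have -> : (fun t => (L / 24 * E2 t) ^+ m.+1 / (m.+1)`!%:R) =
    (fun t => ((m.+1)`!%:R)^-1 * (L / 24 * E2 t) ^+ m.+1).
  by apply/funext => s; rewrite mulrC.
have [d1 e1] := dpw m.+1; rewrite (DZ _ d1) e1 ramanujan// factS natrM invfM /=.
have : m.+1%:R != 0 :> C by rewrite pnatr_eq0.
set a := m.+1%:R; set b := m`!%:R => a0; set P := _ ^+ m; set Q := E2 t ^+ 2 - E4 t.
have -> : a^-1 / b * (a * P * (L / 24 * (Q / 12))) = a / a * (P / b * (L / 24 * (Q / 12))) by ring.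
by rewrite mulfV// mul1r; field.
Qed.

Definition emE N V : laurent R := fun n t => em N (Efps t) (V ^~ t) n.

Definition lsupp N V := forall t, supp N (V ^~ t).

Lemma emE_diff N V : ldiff V -> ldiff (emE N V).
Proof.
move=> dV n t t0; rewrite /emE /em /lau.
case: (n + N%:Z) => m; last exact: diff_cst.
have -> : (fun s => (Efps s * ser N (V ^~ s)) m) =
   (fun s => \sum_(i < m.+1) Ecoef i s * V ((m - i)%N%:Z - N%:Z) s).
  by apply/funext => s; rewrite fmulE.
apply: (@diff_sum _ m.+1 (fun i s => Ecoef i s * V ((m - i)%N%:Z - N%:Z) s)) => i _.
by apply: diffM; [exact/smooth_diff/t0/smooth_Ecoef|exact: dV].
Qed.

Lemma D_emE N V n t : 0 < Im t -> ldiff V ->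
  D (emE N V n) t = lau N (Efps t * ser N (fun m => D (V m) t) +
     fC (L / 288 * (E2 t ^+ 2 - E4 t)) * (fX R * (fX R * Efps t)) * ser N (V ^~ t)) n.
Proof.
move=> t0 dV; rewrite /emE /em /lau.
case: (n + N%:Z) => m; last by rewrite D_cst.
have -> : (fun s => (Efps s * ser N (V ^~ s)) m) =
   (fun s => \sum_(i < m.+1) Ecoef i s * V ((m - i)%N%:Z - N%:Z) s).
  by apply/funext => s; rewrite fmulE.
rewrite (@D_sum _ m.+1 (fun i s => Ecoef i s * V ((m - i)%N%:Z - N%:Z) s)) => [|i _]; last first.
  by apply: diffM; [exact/smooth_diff/t0/smooth_Ecoef|exact: dV].
rewrite faddE 2!fmulE -big_split; apply: eq_bigr => i _.
rewrite DM ?D_Ecoef//; [|exact/smooth_diff/t0/smooth_Ecoef|exact: dV].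
by rewrite addrC.
Qed.

(* Conjugating by [E = exp (l E2 X^2 / 24)] removes the first-order term and, by
   Ramanujan's formula for [D E2], the [E4] term of the heat operators. *)
Lemma heatC_emE N V lam n t : 0 < Im t -> ldiff V -> lsupp N V ->
  heatC lam (emE N V) n t = emE N.+2 (fun n t =>
    Defs.lder (Defs.lder V) n t + 2 * L * D (V n) t
      - L / 6 * (lam - 2^-1) * E2 t * V n t) n t.
Proof.
move=> t0 dV sV; rewrite /heatC (D_emE _ _ t0 dV).
set c := emE N V ^~ t.
have hc : supp N c by exact: lau_supp.
have v := sV t.
pose DV := fun m => D (V m) t.
have sDV : supp N DV.
  move=> m mN; rewrite /DV (_ : V m = fun=> 0) ?D_cst//; apply/funext => s.
  exact: (sV s).
set dc := lau N _.
have sdc : supp N dc by exact: lau_supp.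
pose lhs n := ld (ld c) n + 2 * L * dc n - L / 6 * E2 t * (ls (ld c) n + lam * c n)
  + L ^+ 2 / 144 * E4 t * ls (ls c) n.
pose vv := fun n => ld (ld (V ^~ t)) n + 2 * L * DV n - L / 6 * (lam - 2^-1) * E2 t * V n t.
have -> : Defs.lder (Defs.lder (emE N V)) n t + 2 * L * dc n -
    L / 6 * E2 t * (Defs.lshift 1 (Defs.lder (emE N V)) n t + lam * emE N V n t) +
    L ^+ 2 / 144 * E4 t * Defs.lshift 2 (emE N V) n t = lhs n.
  by rewrite /lhs /ls /c /Defs.lshift -[n - 1 - 1]addrA.
change (lhs n = em N.+2 (Efps t) vv n).
have s1 := ld_supp (ld_supp hc); have s2 := ls_supp (ld_supp hc).
have sW M (d : int -> C) : supp N d -> supp (N + M) d.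
  by apply: suppW; exact: leq_addr.
have sl : supp N.+2 lhs.
  move=> m mN; rewrite /lhs s1// sdc ?hc ?(ls_supp (ls_supp hc)) ?s2//; try lia.
  by ring.
have svv : supp N.+2 vv.
  move=> m mN; rewrite /vv (ld_supp (ld_supp v))// sDV ?v//; try lia.
  by ring.
suff -> : lhs = em N.+2 (Efps t) vv by [].
have sr : supp N.+2 (em N.+2 (Efps t) vv) by exact: lau_supp.
apply: (ser_inj sl sr); rewrite /em lauK.
have u2 (d : int -> C) : supp N d -> ser N.+2 d = fX R * (fX R * ser N d).
  by move=> h; rewrite serS ?serS//; exact: suppW h.
have -> : ser N.+2 vv = ser N.+2 (ld (ld (V ^~ t))) + fC (2 * L) * ser N.+2 DV
    - fC (L / 6 * (lam - 2^-1) * E2 t) * ser N.+2 (V ^~ t).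
  by apply: fpsP => m; rewrite !(faddE, foppE) !fCmE.
have -> : ser N.+2 lhs = ser N.+2 (ld (ld c)) + fC (2 * L) * ser N.+2 dc
    - fC (L / 6 * E2 t) * (ser N.+2 (ls (ld c)) + fC lam * ser N.+2 c)
    + fC (L ^+ 2 / 144 * E4 t) * ser N.+2 (ls (ls c)).
  by apply: fpsP => m; rewrite !(faddE, foppE) !fCmE faddE fCmE.
rewrite [ser N.+2 (ls (ld c))]serS//.
rewrite (ser_ls (ld_supp hc)) (u2 _ sdc) (u2 _ hc) (u2 _ sDV) (u2 _ v) (u2 _ (ls_supp (ls_supp hc))) (ser_ls (ls_supp hc)) (ser_ls hc) !ser_ld.
have -> : ser N c = Efps t * ser N (V ^~ t) by exact: lauK.
rewrite /dc lauK -/DV !(fdD, fdN, fdM, fdC, fdX, fd_Efps).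
(* Power series form a ring only, so all the constants 1/6, 1/12, 1/144 and 1/288 are written as
   integer multiples of one element [q0] with [288 * q0 = 1]. *)
pose q0 : C := 288%:R^-1; have q0E : 288%:R * q0 = 1 by rewrite mulfV ?pnatr_eq0.
have -> : L / 288 * (E2 t ^+ 2 - E4 t) = q0 * (L * (E2 t * E2 t - E4 t)).
  by rewrite /q0; field.
have -> : L / 6 * (lam - 2^-1) * E2 t = 24%:R * (q0 * (L * ((lam + lam - 1) * E2 t))).
  by rewrite /q0; field.
have -> : L ^+ 2 / 144 * E4 t = 2%:R * (q0 * (L * (L * E4 t))) by rewrite /q0; field.
have -> : L / 6 * E2 t = 48%:R * (q0 * (L * E2 t)) by rewrite /q0; field.
have -> : L / 12 * E2 t = 24%:R * (q0 * (L * E2 t)) by rewrite /q0; field.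
have h288 : 288 * fC q0 = 1 :> fps R by rewrite -fCnat -fCM q0E fC1.
move: h288; move: q0 {q0E} (E2 t) (E4 t) L => q0 x y L0 h288.
have e1 : fC (q0 * (L0 * (x * x - y))) = fC q0 * (fC L0 * (fC x * fC x - fC y)).
  by rewrite fCM fCM fCB fCM.
have e2 : fC (24%:R * (q0 * (L0 * ((lam + lam - 1) * x)))) =
    24%:R * (fC q0 * (fC L0 * ((fC lam + fC lam - 1) * fC x))).
  by rewrite fCM fCnat fCM fCM fCM fCB fCD fC1.
have e3 : fC (2%:R * (q0 * (L0 * (L0 * y)))) = 2%:R * (fC q0 * (fC L0 * (fC L0 * fC y))).
  by rewrite fCM fCnat fCM fCM fCM.
have e4 k : fC (k%:R * (q0 * (L0 * x))) = k%:R * (fC q0 * (fC L0 * fC x)).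
  by rewrite fCM fCnat fCM fCM.
have e5 : fC (2 * L0) = 2 * fC L0 by rewrite fCM fCnat.
rewrite e1 e2 e3 !e4 e5 -[N.+1%:R]natr1 fCD fC1; move: h288 {e1 e2 e3 e4 e5}.
set q := fC q0; set a := fC N%:R; set ll := fC L0; set e2 := fC x.
set e4 := fC y; set lm := fC lam; set X := fX R; set e := Efps t.
set w := ser N (V ^~ t); set w' := fd w; set w'' := fd w'; set dw := ser N DV.
move=> h288.
apply/eqP; rewrite -subr_eq0; apply/eqP.
(* With [q] treated as an indeterminate the two sides differ by this multiple of [1 - 288 * q]. *)
transitivity ((1 - 288 * q) * (2 * q * ll ^+ 2 * e2 ^+ 2 * X ^+ 4 * e * w)); first ring.
by rewrite h288 subrr mul0r.
Qed.

End Conjugation.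

End HeatOperators.

(** * Iterated heat operators as polynomials in [Delta] *)

Section HeatIterates.
Variables (R : realType) (l : nat).
Local Notation C := R[i].
Local Notation Im := (@complex.Im R).
Local Notation L := (l%:R : C).
Local Notation E2 := (@eisenstein R 2).
Local Notation E4 := (@eisenstein R 4).
Implicit Types (c V : laurent R) (t lam : C) (n : int) (h g : C -> C).
Hypotheses (l0 : (0 < l)%N) (smE2 : smooth E2) (smE4 : smooth E4).
Hypothesis ramanujan : forall t, 0 < Im t -> D E2 t = (E2 t ^+ 2 - E4 t) / 12.

Lemma L_neq0 : L != 0. Proof. by rewrite pnatr_eq0 -lt0n. Qed.

(* The coefficients of the heat iterates, expanded in powers of
   [Delta = d^2/dX^2 + 2 l D], after conjugation by [exp (l E2 X^2 / 24)]. *)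
Fixpoint heat_coef (r i : nat) : C -> C :=
  if r is p.+1 then fun t =>
    (if i is j.+1 then heat_coef p j t else 0) + 2 * L * D (heat_coef p i) t
      - L / 6 * (2^-1 + 2 * p%:R) * E2 t * heat_coef p i t
  else fun=> (i == 0%N)%:R.

Lemma smooth_heat_coef r i : smooth (heat_coef r i).
Proof.
elim: r i => [|r IH] i /=; first exact: smooth_cst.
have h : smooth (fun t => if i is j.+1 then heat_coef r j t else 0).
  by case: i => [|i]; [exact: smooth_cst|exact: IH].
apply: smooth_eqH (smD (smD h (smZ (2 * L) (smooth_D (IH i))))
  (smZ (- (L / 6 * (2^-1 + 2 * r%:R))) (smM smE2 (IH i)))) => t _.
by rewrite mulNr !mulrA.
Qed.

Lemma heat_coef_gt r i : (r < i)%N -> eqH (heat_coef r i) (fun=> 0).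
Proof.
elim: r i => [|r IH] [|i] //= ri t t0.
rewrite (D_eqH (fun s s0 => smooth_diff (smooth_heat_coef r i.+1) s0) (IH _ (ltnW ri)) t0).
by rewrite D_cst !IH// ?(ltnW ri)// !mulr0 subr0 addr0.
Qed.

Lemma heat_coef_diag r : eqH (heat_coef r r) (fun=> 1).
Proof.
elim: r => [|r IH] //= t t0.
rewrite (D_eqH (fun s s0 => smooth_diff (smooth_heat_coef r r.+1) s0) (heat_coef_gt (ltnSn r)) t0).
by rewrite D_cst IH// heat_coef_gt// !mulr0 subr0 addr0.
Qed.

Section Hop.
Variable V : nat -> laurent R.
Hypothesis dV : forall i, ldiff (V i).
Hypothesis VS : forall i n t, 0 < Im t ->
  Defs.lder (Defs.lder (V i)) n t + 2 * L * D (V i n) t = V i.+1 n t.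

(** By [VS], [V i] is [Delta^i (V 0)]; hence [hop r] is the [r]-th heat iterate with the conjugating
    factor removed. *)
Definition hop r : laurent R := fun n t => \sum_(i < r.+1) heat_coef r i t * V i n t.

Let dterm r n t i : 0 < Im t -> diff (fun t => heat_coef r i t * V i n t) t.
Proof. by move=> t0; apply: diffM; [exact/smooth_diff/t0/smooth_heat_coef|exact: dV]. Qed.

Lemma hop_diff r : ldiff (hop r).
Proof.
move=> n t t0; apply: (@diff_sum _ r.+1 (fun i t => heat_coef r i t * V i n t)) => i _.
exact: dterm.
Qed.

Lemma hopS r n t : 0 < Im t ->
  Defs.lder (Defs.lder (hop r)) n t + 2 * L * D (hop r n) t
    - L / 6 * (2^-1 + 2 * r%:R) * E2 t * hop r n t = hop r.+1 n t.
Proof.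
move=> t0.
rewrite (@D_sum _ r.+1 (fun i t => heat_coef r i t * V i n t)) => [|i _]; last exact: dterm.
have -> : Defs.lder (Defs.lder (hop r)) n t =
    \sum_(i < r.+1) heat_coef r i t * Defs.lder (Defs.lder (V i)) n t.
  by rewrite /Defs.lder /hop !mulr_sumr; apply: eq_bigr => i _; ring.
rewrite /hop !mulr_sumr -big_split -sumrB /=.
rewrite (eq_bigr (fun i : 'I_r.+1 => heat_coef r i t * V i.+1 n t +
   (2 * L * D (heat_coef r i) t - L / 6 * (2^-1 + 2 * r%:R) * E2 t * heat_coef r i t) * V i n t)); last first.
  move=> i _; rewrite -VS// DM; first ring.
    exact/smooth_diff/t0/smooth_heat_coef.
  exact: dV.
rewrite big_split /= (eq_bigr (fun i : 'I_r.+2 => (if (i : nat) is j.+1 then heat_coef r j t else 0) * V i n t +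
   (2 * L * D (heat_coef r i) t - L / 6 * (2^-1 + 2 * r%:R) * E2 t * heat_coef r i t) * V i n t)); last first.
  by move=> i _; rewrite -mulrDl addrA.
rewrite big_split /=; congr (_ + _).
  by rewrite [RHS]big_ord_recl mul0r add0r; apply: eq_bigr => i _.
rewrite [in RHS]big_ord_recr /=.
rewrite (D_eqH (fun s s0 => smooth_diff (smooth_heat_coef r r.+1) s0) (heat_coef_gt (ltnSn r)) t0).
by rewrite D_cst heat_coef_gt// !mulr0 subr0 mul0r addr0.
Qed.

Lemma heat_chain_emE N : (forall i, lsupp (N + i.*2) (V i)) ->
  heat_chain l (emE l N (V 0%N)) (fun r => emE l (N + r.*2) (hop r)).
Proof.
move=> sV; have sh r : lsupp (N + r.*2) (hop r).
  move=> t n nN; rewrite /hop big1// => i _; rewrite (sV i t n) ?mulr0//.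
  have := ltn_ord i; lia.
split=> [n t t0|r|r n t t0].
- rewrite addn0 /emE; congr (em _ _ _ _); apply/funext => m.
  by rewrite /hop big_ord1 /= mul1r.
- exact/emE_diff/hop_diff.
- rewrite heatC_emE//; last exact: hop_diff.
  have -> : (N + r.+1.*2 = (N + r.*2).+2)%N by lia.
  rewrite /emE; congr (em _ _ _ _); apply/funext => m; rewrite -hopS//.
  by congr (_ - _ * _ * _); rewrite natrD natrM; field.
Qed.

End Hop.

(** The heat coefficients do not depend on the series acted upon. A function of [t] alone is a
    series concentrated in degree 0, on which [Delta] is [2 l D] and the heat operators become Serre
    derivatives; this carries the relation between Serre derivatives over to a polynomial in
    [Delta]. *)
Lemma serres_heat_coef r h t : smooth h -> 0 < Im t ->
  (2 * L) ^+ r * serres r h t = \sum_(i < r.+1) heat_coef r i t * ((2 * L) ^+ i * iter i (@D R) h t).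
Proof.
move=> sh; have siter i : smooth (iter i (@D R) h) by elim: i => //= i; exact: smooth_D.
pose V i : laurent R := fun n t => if n == 0 then (2 * L) ^+ i * iter i (@D R) h t else 0.
have dV i : ldiff (V i).
  move=> n s s0; rewrite /V; case: eqP => _; last exact: diff_cst.
  exact/diffZ/smooth_diff.
have VS i n s : 0 < Im s ->
    Defs.lder (Defs.lder (V i)) n s + 2 * L * D (V i n) s = V i.+1 n s.
  move=> s0; rewrite /Defs.lder.
  have -> : (n + 1)%:~R * ((n + 1 + 1)%:~R * V i (n + 1 + 1) s) = 0.
    rewrite /V; case: eqP => e; last by rewrite !mulr0.
    by rewrite e mul0r mulr0.
  rewrite add0r /V; case: eqP => _; last by rewrite D_cst mulr0.
  by rewrite DZ ?exprS ?mulrA//; exact: smooth_diff.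
elim: r t => [|r IH] t t0.
  by rewrite expr0 mul1r big_ord1 /= mul1r expr0 mul1r.
have -> : \sum_(i < r.+2) heat_coef r.+1 i t * ((2 * L) ^+ i * iter i (@D R) h t) = hop V r.+1 0 t by [].
rewrite -(hopS dV VS)//.
have -> : Defs.lder (Defs.lder (hop V r)) 0 t = 0.
  by rewrite /Defs.lder /hop /V big1 ?mulr0// => i _; rewrite mulr0.
have eq : eqH (fun t => (2 * L) ^+ r * serres r h t) (hop V r 0) by move=> s s0; rewrite IH.
have ds s : 0 < Im s -> diff (serres r h) s by apply: smooth_diff; exact: smooth_serres.
rewrite -(D_eqH (fun s s0 => diffZ _ (ds s s0)) eq t0) -eq// DZ; last exact: ds.
by rewrite /= /serre exprS; field.
Qed.

Lemma serre_iterS (kappa : C) m g t : serre_iter kappa m.+1 g t =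
  serre (kappa + 2 * m%:R) (serre_iter kappa m g) t
  - m%:R * (m%:R + kappa - 1) / 144 * E4 t * serre_iter kappa m.-1 g t.
Proof.
case: m => [|m] //=; rewrite !mul0r subr0; congr (serre _ _ _).
by rewrite mulr0 addr0.
Qed.

Lemma smooth_serre_iter (kappa : C) m g : smooth g -> smooth (serre_iter kappa m g).
Proof.
move=> sg; suff : smooth (serre_iter kappa m g) /\ smooth (serre_iter kappa m.+1 g) by case.
elim: m => [|m [IH1 IH2]]; first by split=> //; exact: smooth_serre.
split=> //; apply: smooth_eqH (smD (smooth_serre smE2 (kappa + 2 * m.+1%:R) IH2)
  (smZ (- (m.+1%:R * (m.+1%:R + kappa - 1) / 144)) (smM smE4 IH1))) => t _.
by rewrite serre_iterS mulNr mulrA.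
Qed.

(** The odd series with leading term [g X] killed by the heat operator of weight 1/2. Comparing
    coefficients in that equation produces exactly the recursion of [serre_iter (3 / 2)], its [E4]
    term coming from [l^2 E4 X^2 / 144]. *)
Definition odd_chain g : laurent R := fun n t =>
  if n is Posz m then
    if odd m then (- (2 * L)) ^+ m./2 / m`!%:R * serre_iter (3 / 2) m./2 g t else 0
  else 0.

Lemma odd_chain_diff g : smooth g -> ldiff (odd_chain g).
Proof.
move=> sg [m|m] t t0; rewrite /odd_chain; last exact: diff_cst.
by case: (odd m); [exact/diffZ/smooth_diff/t0/smooth_serre_iter|exact: diff_cst].
Qed.

Lemma heatC_odd_chain g n t : smooth g -> 0 < Im t -> heatC l 2^-1 (odd_chain g) n t = 0.
Proof.
move=> sg t0; rewrite /heatC /Defs.lder /Defs.lshift.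
have zero m : ~~ odd `|m| -> odd_chain g m = fun=> 0.
  by case: m => m //= om; apply/funext => s; rewrite /odd_chain (negPf om).
have neg m : odd_chain g (Negz m) = fun=> 0 by [].
case: (boolP (odd `|n|)) => on; last first.
  rewrite !zero ?D_cst; try lia.
  by ring.
case: n on => [[//|m]|m] on; last first.
  rewrite neg D_cst.
  have -> : Negz m - 1 + 1 = Negz m by lia.
  have -> : Negz m - 2 = Negz m.+2 by lia.
  rewrite !neg; case: m on => [|[//|m]] on; first by ring.
  have -> : Negz m.+2 + 1 + 1 = Negz m by lia.
  by rewrite neg; ring.
have om : ~~ odd m by [].
pose j := m./2; have mE : m = j.*2 by rewrite -[LHS]odd_double_half (negPf om).
have -> : Posz m.+1 - 1 + 1 = Posz m.+1 by lia.
have -> : Posz m.+1 + 1 + 1 = Posz m.+3 by lia.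
have e0 : D (odd_chain g m.+1) t = (- (2 * L)) ^+ j / m.+1`!%:R * D (serre_iter (3 / 2) j g) t.
  have ds := smooth_diff (smooth_serre_iter (3 / 2) j sg) t0.
  by rewrite /odd_chain on (_ : m.+1./2 = j) ?DZ// mE /= uphalf_double.
have e1 : odd_chain g m.+1 t = (- (2 * L)) ^+ j / m.+1`!%:R * serre_iter (3 / 2) j g t.
  by rewrite /odd_chain on mE /= uphalf_double.
have e2 : odd_chain g m.+3 t = (- (2 * L)) ^+ j.+1 / m.+3`!%:R * serre_iter (3 / 2) j.+1 g t.
  have o3 : odd m.+3 by rewrite /= negbK.
  by rewrite /odd_chain o3 (_ : m.+3./2 = j.+1)// mE /= uphalf_double.
(* The factor [m = 2 j] keeps the formula valid at [j = 0], where the shifted coefficient has index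
   -1 and vanishes. *)
have e3 : L ^+ 2 / 144 * E4 t * odd_chain g (Posz m.+1 - 2) t =
    L ^+ 2 / 144 * E4 t * ((- (2 * L)) ^+ j / (- (2 * L)) * (m%:R * m.+1%:R) / m.+1`!%:R * serre_iter (3 / 2) j.-1 g t).
  congr (_ * _); rewrite mE; case: (j) => [|i]; first by rewrite mul0r mulr0 !mul0r.
  have -> : Posz i.+1.*2.+1 - 2 = Posz i.*2.+1 by lia.
  rewrite /odd_chain /= odd_double /= uphalf_double.
  rewrite [in RHS]exprSr mulfK ?oppr_eq0 ?mulf_neq0 ?pnatr_eq0 -?lt0n//.
  congr (_ * _); rewrite -mulrA; congr (_ * _).
  have -> : (i.*2.+3`! = (i.*2.+3 * i.*2.+2) * i.*2.+1`!)%N by rewrite !factS mulnA.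
  rewrite natrM invfM natrM mulrA [X in X * _](_ : _ = 1) ?mul1r//.
  by rewrite [i.*2.+2%:R * _]mulrC mulfV// mulf_neq0 ?pnatr_eq0.
have e4 : (Posz m.+1 + 1)%:~R * ((Posz m.+3)%:~R * odd_chain g m.+3 t) =
    (- (2 * L)) ^+ j.+1 / m.+1`!%:R * serre_iter (3 / 2) j.+1 g t.
  rewrite e2.
  have -> : Posz m.+1 + 1 = Posz m.+2 by lia.
  have -> : (m.+3`! = (m.+2 * m.+3) * m.+1`!)%N by rewrite !factS mulnA (mulnC m.+3).
  rewrite natrM invfM natrM -!pmulrn; set a := m.+2%:R; set b := m.+3%:R.
  have ab : a * b * (a * b)^-1 = 1 by rewrite mulfV// mulf_neq0 ?pnatr_eq0.
  set P := _ ^+ _; set s := serre_iter _ _ _ _; set q := m.+1`!%:R^-1.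
  have -> : a * (b * (P * ((a * b)^-1 * q) * s)) = a * b * (a * b)^-1 * (P * q * s) by ring.
  by rewrite ab mul1r.
rewrite e4 e3 e0 e1 serre_iterS /serre -!pmulrn exprS.
have -> : m%:R = 2 * j%:R :> C by rewrite mE -muln2 natrM mulrC.
have -> : m.+1%:R = 2 * j%:R + 1 :> C by rewrite -natr1 mE -muln2 natrM [2 * _]mulrC.
have := L_neq0; set X := (- _) ^+ j; set f := _`!%:R^-1; set a := D _ t.
set b := serre_iter _ _ _ _; set c := serre_iter _ _ _ _; set e := L => e00.
set x := E2 t; set y := E4 t; set k := j%:R.
by field.
Qed.

Section Qoperator.
Variables (k d : nat) (F : nat -> C -> C).
Hypotheses (lE : l = ell k) (dE : d = k.-1).
Hypothesis F0 : forall t, 0 < Im t -> F 0%N t = 1.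
Let Fr r := F (ell k - 2 * r - 1)%N.

Lemma Qop_heat_chain c f n t : heat_chain l c f -> 0 < Im t ->
  Qop k F c n t = \sum_(r < d.+1) (2 * L) ^+ (d - r) * Fr r t * f r n t.
Proof.
move=> hc t0; rewrite /Qop -dE; apply: eq_bigr => r _.
by rewrite -(heat_chain_iter r hc)// /Fr lE.
Qed.

Lemma Qop_annihilated h (g : laurent R) n t : 0 < Im t ->
  heat_chain l (fun n t => h t * g n t) (fun r n t => (2 * L) ^+ r * serres r h t * g n t) ->
  \sum_(r < d.+1) Fr r t * serres r h t = 0 ->
  Qop k F (fun n t => h t * g n t) n t = 0.
Proof.
move=> t0 hc an; rewrite (Qop_heat_chain _ hc)//.
rewrite (eq_bigr (fun r : 'I_d.+1 => (2 * L) ^+ d * g n t * (Fr r t * serres r h t))).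
  by rewrite -mulr_sumr an mulr0.
move=> r _; have -> : (2 * L) ^+ d = (2 * L) ^+ (d - r) * (2 * L) ^+ r.
  by rewrite -exprD subnK// -ltnS.
by ring.
Qed.

(** The coefficient of [Delta^i] in the conjugate of the operator [Q_l]. *)
Definition Qcoef i t : C := \sum_(r < d.+1) (2 * L) ^+ (d - r) * Fr r t * heat_coef r i t.

Let heat_coef_widen r (G : nat -> C) t : (r < d.+1)%N -> 0 < Im t ->
  \sum_(i < r.+1) heat_coef r i t * G i = \sum_(i < d.+1) heat_coef r i t * G i.
Proof.
move=> rd t0; rewrite -(big_mkord xpredT (fun i => heat_coef r i t * G i)).
rewrite -[RHS](big_mkord xpredT (fun i => heat_coef r i t * G i)).
rewrite [RHS](@big_cat_nat _ _ _ r.+1)//= [X in _ = _ + X](_ : _ = 0) ?addr0//.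
by rewrite big_nat big1// => i /andP[ri _]; rewrite heat_coef_gt ?mul0r.
Qed.

Lemma Qcoef_sum (G : nat -> C) t : 0 < Im t ->
  \sum_(r < d.+1) (2 * L) ^+ (d - r) * Fr r t * \sum_(i < r.+1) heat_coef r i t * G i =
  \sum_(i < d.+1) Qcoef i t * G i.
Proof.
move=> t0.
rewrite (eq_bigr (fun r : 'I_d.+1 => \sum_(i < d.+1) (2 * L) ^+ (d - r) * Fr r t * heat_coef r i t * G i)).
  by rewrite exchange_big; apply: eq_bigr => i _; rewrite /Qcoef mulr_suml.
by move=> r _; rewrite heat_coef_widen// mulr_sumr; apply: eq_bigr => i _; rewrite mulrA.
Qed.

(** The relation between Serre derivatives now says that the polynomial with coefficients [Qcoef],
    evaluated at [2 l D], kills [h]. On a power [q^(y^2 / (2 l))] the operator [2 l D] is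
    multiplication by [y^2]. *)
Lemma Qcoef_annihilated h t : smooth h -> 0 < Im t ->
  \sum_(r < d.+1) Fr r t * serres r h t = 0 ->
  \sum_(i < d.+1) Qcoef i t * ((2 * L) ^+ i * iter i (@D R) h t) = 0.
Proof.
move=> sh t0 an; rewrite -(Qcoef_sum (fun i => (2 * L) ^+ i * iter i (@D R) h t))//.
rewrite (eq_bigr (fun r : 'I_d.+1 => (2 * L) ^+ d * (Fr r t * serres r h t))).
  by rewrite -mulr_sumr an mulr0.
move=> r _; rewrite -serres_heat_coef//; have -> : (2 * L) ^+ d = (2 * L) ^+ (d - r) * (2 * L) ^+ r.
  by rewrite -exprD subnK// -ltnS.
by ring.
Qed.

Lemma Qcoef_lead t : (0 < k)%N -> 0 < Im t -> Qcoef d t = 1.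
Proof.
move=> k0 t0; rewrite /Qcoef big_ord_recr big1 /= ?add0r.
  rewrite subnn expr0 mul1r heat_coef_diag// mulr1 /Fr.
  have e : (ell k - 2 * d - 1 = 0)%N by rewrite dE /ell; lia.
  by rewrite e F0.
by move=> r _; rewrite heat_coef_gt ?mulr0//= -ltnS ltn_ord.
Qed.

Lemma Qop_emE N (V : nat -> laurent R) n t : 0 < Im t ->
  (forall i, ldiff (V i)) ->
  (forall i n t, 0 < Im t ->
    Defs.lder (Defs.lder (V i)) n t + 2 * L * D (V i n) t = V i.+1 n t) ->
  (forall i, lsupp (N + i.*2) (V i)) ->
  Qop k F (emE l N (V 0%N)) n t =
  em (N + d.*2) (Efps l t) (fun n => \sum_(i < d.+1) Qcoef i t * V i n t) n.
Proof.
move=> t0 dV VS sV; rewrite (Qop_heat_chain _ (heat_chain_emE dV VS sV))//.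
have sh r : lsupp (N + r.*2) (hop V r).
  move=> s m nN; rewrite /hop big1// => i _; rewrite (sV i s m) ?mulr0//.
  have := ltn_ord i; lia.
(* Iterates of different pole orders are brought to the common bound [N + d.*2], so that the
   conjugating factor can be taken out of the sum. *)
rewrite (eq_bigr (fun r : 'I_d.+1 => (2 * L) ^+ (d - r) * Fr r t *
    em (N + d.*2) (Efps l t) (hop V r ^~ t) n)); last first.
  move=> r _; rewrite /emE; congr (_ * _).
  have -> : (N + d.*2 = N + r.*2 + (d - r).*2)%N by have := ltn_ord r; lia.
  by rewrite (em_suppD _ _ (sh r t)).
have -> : (fun n => \sum_(i < d.+1) Qcoef i t * V i n t) =
    (fun n => \sum_(r < d.+1) (2 * L) ^+ (d - r) * Fr r t * hop V r n t).
  by apply/funext => m; rewrite -(Qcoef_sum (fun i => V i m t)).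
rewrite /em /lau; case: (n + _) => m; last by rewrite big1// => r _; rewrite mulr0.
rewrite fmulE (eq_bigr (fun r : 'I_d.+1 => \sum_(i < m.+1) (2 * L) ^+ (d - r) * Fr r t * (Efps l t i *
    ser (N + d.*2) (hop V r ^~ t) (m - i)%N))); last by move=> r _; rewrite fmulE mulr_sumr.
rewrite exchange_big; apply: eq_bigr => i _; rewrite /ser mulr_sumr.
by apply: eq_bigr => r _; rewrite mulrCA.
Qed.

End Qoperator.

End HeatIterates.

(** * Bilateral series in [zeta = e^x] and their convolution *)

Section BilateralSeries.
Variable R : realType.
Local Notation C := R[i].
Implicit Types (a b : int -> C) (x : R) (n s : int).

Definition ez x n : C := cexp (x%:C * n%:~R).

Lemma ezD x n s : ez x (n + s) = ez x n * ez x s.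
Proof. by rewrite /ez -cexpD intrD mulrDr. Qed.

Lemma ez0 x : ez x 0 = 1. Proof. by rewrite /ez mulr0 cexp0. Qed.

Lemma nm_ez x n : nm (ez x n) = expR (x * n%:~R).
Proof.
rewrite /ez nm_cexp; congr expR.
by rewrite (_ : n%:~R = (n%:~R : R)%:C) -?rmorphM//= rmorph_int.
Qed.

(** The series [\sum_n a_n zeta^n] at [zeta = e^x] with [x] real, which is enough for expansions at
    0. *)
Definition zeval a x : C := tsum (fun n => a n * ez x n).
Definition zsummable a x := asum (fun n => a n * ez x n).
Definition zconv a b n : C := tsum (fun s => a (n - s) * b s).

Let mix (p : int * int) := (p.1 - p.2, p.2).
Let unmix (p : int * int) := (p.1 + p.2, p.2).
Let mixK : cancel mix unmix. Proof. by case=> n s; rewrite /mix /unmix /= subrK. Qed.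
Let unmixK : cancel unmix mix. Proof. by case=> n s; rewrite /mix /unmix /= addrK. Qed.

Let asum_mix a b x : zsummable a x -> zsummable b x ->
  asum (fun p : int * int => ez x p.1 * (a (p.1 - p.2) * b p.2)).
Proof.
move=> ha hb; apply: asum_eq (asum_bij mixK (asum_prod ha hb)) => -[n s] /=.
by rewrite -[n in RHS](subrK s) [in RHS]ezD addrK; ring.
Qed.

Lemma asum_zconv a b x n : zsummable a x -> zsummable b x -> asum (fun s => a (n - s) * b s).
Proof.
move=> ha hb; have h := asum_fst n (asum_mix ha hb).
apply: asum_eq (asumZ (ez x n)^-1 h) => s /=.
by rewrite mulrA mulVf ?mul1r// cexp_neq0.
Qed.

Lemma zeval_zconv a b x : zsummable a x -> zsummable b x ->
  zsummable (zconv a b) x /\ zeval (zconv a b) x = zeval a x * zeval b x.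
Proof.
move=> ha hb; have h := asum_mix ha hb.
have e n : zconv a b n * ez x n = tsum (fun s => ez x n * (a (n - s) * b s)).
  by rewrite (tsumZ _ (asum_zconv n ha hb)) mulrC.
split; first by apply: asum_eq (asum_pair h) => n /=; rewrite e.
rewrite /zeval -(tsum_prod ha hb) (eq_tsum e) -(tsum_pair h).
rewrite (tsum_bij mixK unmixK (asum_prod ha hb)); apply: eq_tsum => -[n s] /=.
by rewrite -[n in LHS](subrK s) [in LHS]ezD addrK; ring.
Qed.

Definition addz (k n : int) : int := n + k.
Lemma addzK k : cancel (addz k) (addz (- k)). Proof. by move=> n; rewrite /addz addrK. Qed.
Lemma addzNK k : cancel (addz (- k)) (addz k). Proof. by move=> n; rewrite /addz subrK. Qed.

Lemma tsum_shift k (f : int -> C) : asum f -> tsum f = tsum (fun n => f (n + k)).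
Proof. by move=> af; rewrite (tsum_bij (addzK k) (addzNK k) af). Qed.

Lemma asum_shift k (f : int -> C) : asum f -> asum (fun n => f (n + k)).
Proof. by move=> af; exact: (asum_bij (addzK k) af). Qed.

Lemma tsum_oppz (f : int -> C) : asum f -> tsum f = tsum (fun n => f (- n)).
Proof. by move=> af; rewrite (tsum_bij (@opprK int) (@opprK int) af). Qed.

Lemma asum_oppz (f : int -> C) : asum f -> asum (fun n => f (- n)).
Proof. by move=> af; exact: (asum_bij (@opprK int) af). Qed.

Lemma tsum_rev k (f : int -> C) : asum f -> tsum f = tsum (fun n => f (k - n)).
Proof.
move=> af; rewrite (tsum_shift k af) (tsum_oppz (asum_shift k af)).
by apply: eq_tsum => n; rewrite addrC.
Qed.

Lemma asum_rev k (f : int -> C) : asum f -> asum (fun n => f (k - n)).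
Proof.
by move=> /(asum_shift k)/asum_oppz; apply: asum_eq => n; rewrite addrC.
Qed.

Definition entire a := forall x, zsummable a x.

Lemma entire_zconv a b : entire a -> entire b -> entire (zconv a b).
Proof. by move=> ha hb x; have [] := zeval_zconv (ha x) (hb x). Qed.

Lemma nm_intr n : nm (n%:~R : C) = `|n|%N%:R.
Proof.
rewrite (_ : n%:~R = (n%:~R : R)%:C); last by rewrite rmorph_int.
by rewrite nm_real -intr_norm natr_absz.
Qed.

(** One of [e n] and [- e n] equals [|e| |n|], so convergence at the two points [e] and [- e]
    suffices. *)
Lemma entire_exp a e : entire a -> asum (fun n => a n * (expR (e * nm (n%:~R : C)))%:C).
Proof.
move=> ha; have [K hK] := ha e; have [K' hK'] := ha (- e).
exists (K + K') => B uB; apply: le_trans (lerD (hK B uB) (hK' B uB)).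
rewrite -big_split /= ler_sum// => n _; rewrite !(nmM (a n)) -mulrDr ler_wpM2l ?nm_ge0//.
rewrite nm_real ger0_norm ?expR_ge0// nm_intr !nm_ez.
case: n => n /=; first by rewrite -pmulrn lerDl expR_ge0.
by rewrite NegzE mulrNz mulrNN -pmulrn lerDr expR_ge0.
Qed.

Lemma asym_zeval S a : entire a -> asym S (zeval a) (fun j => tsum (fun n => a n * fe n%:~R j)).
Proof. by move=> ha; exact: (asym_expsum (b := fun n : int => n%:~R) ltr01 (entire_exp 1 ha)). Qed.

Lemma asum_moment a j : entire a -> asum (fun n => a n * n%:~R ^+ j).
Proof.
move=> ha; have h := asum_expsum_coef (b := fun n : int => n%:~R) ltr01 (entire_exp 1 ha) j.
apply: asum_eq (asumZ j`!%:R h) => n; rewrite /fe mulrCA; congr (_ * _).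
by rewrite mulrC divfK// fact_neq0.
Qed.

Lemma moment_fe a j : entire a ->
  tsum (fun n => a n * fe n%:~R j) = tsum (fun n => a n * n%:~R ^+ j) / j`!%:R.
Proof.
move=> ha; rewrite mulrC -tsumZ; last exact: asum_moment.
by apply: eq_tsum => n; rewrite /fe; ring.
Qed.

Lemma moment_poly a l (c : C) j : entire a ->
  (forall i, (i < l)%N -> tsum (fun n => a n * n%:~R ^+ i) = 0) -> (j < l)%N ->
  tsum (fun n => a n * (c - n%:~R) ^+ j) = 0 /\ asum (fun n => a n * (c - n%:~R) ^+ j).
Proof.
move=> ha h0 jl.
pose G (i : nat) (n : int) := (-1) ^+ i *+ 'C(j, i) * c ^+ (j - i) * (a n * n%:~R ^+ i).
have e n : a n * (c - n%:~R) ^+ j = \sum_(i < j.+1) G i n.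
  rewrite exprBn mulr_sumr; apply: eq_bigr => i _; rewrite /G !mulrnAl !mulrnAr.
  by congr (_ *+ _); ring.
have aG i : (i < j.+1)%N -> asum (G i) by move=> _; exact/asumZ/asum_moment.
split; last by apply: asum_eq (asum_sum aG) => n; rewrite e.
rewrite (eq_tsum e) (tsum_sum aG) big1// => i _.
rewrite tsumZ; last exact: asum_moment.
by rewrite h0 ?mulr0// (leq_trans (ltn_ord i)).
Qed.

End BilateralSeries.

(** * The theta series, its powers and its logarithmic derivative *)

Section ThetaSequence.
Variables (R : realType) (t : R[i]).
Local Notation C := R[i].
Local Notation Im := (@complex.Im R).
Hypothesis t0 : 0 < Im t.
Implicit Types (x : R) (n s : int).

Definition qpow n : C := ee (n%:~R * t).

Lemma qzD n s : qpow (n + s) = qpow n * qpow s.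
Proof. by rewrite /qpow /ee intrD -cexpD; congr cexp; ring. Qed.

Lemma qz0 : qpow 0 = 1. Proof. by rewrite /qpow /ee mul0r mulr0 cexp0. Qed.

Lemma qpow_neq0 n : qpow n != 0. Proof. exact: cexp_neq0. Qed.

Lemma qzN n : qpow (- n) = (qpow n)^-1.
Proof.
apply: (mulfI (qpow_neq0 n)); rewrite mulfV ?qpow_neq0//.
by rewrite -qzD subrr qz0.
Qed.

Lemma nm_qpow n : nm (qpow n) = expR (- (2 * pi * Im t) * n%:~R).
Proof.
by rewrite /qpow (_ : n%:~R = (n%:~R : R)%:C) ?nm_ee//= rmorph_int.
Qed.

Definition aT n : R := n%:~R * (n%:~R - 1) / 2.

Lemma aT_ge0 n : 0 <= aT n.
Proof.
by rewrite /aT divr_ge0// -[1]/(1%:~R) -intrB -intrM ler0z; clear t0; nia.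
Qed.

(* The coefficients of [\sum_n (-1)^n q^(n(n-1)/2) zeta^n]. *)
Definition theta_coef n : C := (-1) ^ n * ee ((aT n)%:C * t).

Lemma signz_neq0 n : (-1) ^ n != 0 :> C.
Proof. by rewrite expfz_neq0// oppr_eq0 oner_eq0. Qed.

Lemma nm_signz n : nm ((-1) ^ n : C) = 1.
Proof.
case: n => n; rewrite ?NegzE -?exprnN; first exact: nm_sign.
by rewrite -[LHS]mulr1 nmV nm_sign invr1 mulr1.
Qed.

Lemma theta_coef_neq0 n : theta_coef n != 0.
Proof. by rewrite mulf_neq0 ?signz_neq0 ?cexp_neq0. Qed.

Lemma signzS n : (-1) ^ (n + 1) = - (-1) ^ n :> C.
Proof. by rewrite exprzDr ?unitrN1// expr1z mulrN1. Qed.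

Lemma TnS n : qpow n * theta_coef n = - theta_coef (n + 1).
Proof.
rewrite /theta_coef signzS mulNr opprK mulrCA; congr (_ * _).
rewrite /qpow /ee -cexpD; congr cexp; rewrite -mulrDr; congr (_ * _).
rewrite -mulrDl; congr (_ * _).
rewrite (_ : n%:~R = (n%:~R : R)%:C); last by rewrite rmorph_int.
by rewrite -rmorphD /aT; congr (_%:C); rewrite intrD; field.
Qed.

Lemma quad_ge (c b y : R) : 0 < c -> - (b ^+ 2 / (4 * c)) <= c * y ^+ 2 - b * y.
Proof.
move=> c0; have c4 : 0 < 4 * c by rewrite mulr_gt0.
rewrite -subr_ge0 -(pmulr_rge0 _ c4).
have -> : 4 * c * (c * y ^+ 2 - b * y - - (b ^+ 2 / (4 * c))) = (2 * c * y - b) ^+ 2.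
  by field; rewrite gt_eqF.
exact: sqr_ge0.
Qed.

Lemma entire_theta_coef : entire theta_coef.
Proof.
move=> x; set c := pi * Im t; have c0 : 0 < c by rewrite mulr_gt0 ?pi_gt0.
set b := c + `|x| + 1; pose r := expR (-1 : R).
have r01 : 0 < r < 1 by rewrite expR_gt0 -expR0 ltr_expR oppr_lt0 ltr01.
apply: (asum_geom_summable (K := expR (b ^+ 2 / (4 * c))) (@geom_summable_int R) r01) => n.
rewrite (nmM (theta_coef n)) nm_ez [nm (theta_coef n)]nmM nm_signz mul1r nm_ee.
rewrite /r -expRM_natr -!expRD ler_expR.
have := quad_ge b (`|n|%N%:R) c0; set y : R := `|n|%N%:R.
have yn : (n%:~R : R) ^+ 2 = y ^+ 2 by rewrite /y natr_absz intr_norm real_normK// num_real.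
have y1 : `|n%:~R : R| = y by rewrite /y natr_absz intr_norm.
have h1 : x * n%:~R <= `|x| * y by rewrite -y1 -normrM ler_norm.
have h2 : c * n%:~R <= c * y by rewrite ler_pM2l// -y1 ler_norm.
rewrite -/c (_ : - (2 * pi * Im t) * aT n = - (c * n%:~R ^+ 2) + c * n%:~R); last first.
  by rewrite /aT /c; field.
rewrite yn /b; lra.
Qed.

Lemma theta_coef_rev n : theta_coef (1 - n) = - theta_coef n.
Proof.
rewrite /theta_coef (_ : aT (1 - n) = aT n); last by rewrite /aT intrB; field.
rewrite -mulNr; congr (_ * _); rewrite addrC signzS; congr (- _).
by case: n => n; rewrite ?NegzE ?opprK -?exprnN -?exprVn invrN1.
Qed.

(** Theta vanishes at [zeta = 1] because [n -> 1 - n] changes the sign of its coefficients. *)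
Lemma sum_theta_coef : tsum theta_coef = 0.
Proof.
have aT0 : asum theta_coef by apply: asum_eq (entire_theta_coef 0) => n; rewrite /ez mul0r cexp0 mulr1.
have := tsum_rev 1 aT0; rewrite (eq_tsum theta_coef_rev).
rewrite (_ : tsum (fun n => - theta_coef n) = tsum (fun n => -1 * theta_coef n)); last first.
  by apply: eq_tsum => n; rewrite mulN1r.
rewrite (tsumZ _ aT0) mulN1r => /eqP; rewrite -addr_eq0 -mulr2n -mulr_natr mulf_eq0 pnatr_eq0 orbF.
by move/eqP.
Qed.

Fixpoint Tpow (m : nat) : int -> C :=
  if m is p.+1 then zconv theta_coef (Tpow p) else fun n => (n == 0)%:R.

Lemma asum_delta (c : int -> C) : asum (fun n : int => (n == 0)%:R * c n).
Proof.
exists (nm (c 0)) => B uB; rewrite (bigID (pred1 (0 : int))) /= [X in _ + X]big1 ?addr0; last first.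
  by move=> n /negPf ->; rewrite mul0r nm0.
rewrite -big_filter; have : uniq [seq n <- B | n == 0] by rewrite filter_uniq.
have : all (pred1 0) [seq n <- B | n == 0] by rewrite filter_all.
case: [seq n <- B | n == 0] => [|n1 [|n2 s]] /=; first by rewrite big_nil nm_ge0.
  by move=> /andP[/eqP -> _] _; rewrite big_seq1 eqxx mul1r.
by move=> /and3P[/eqP -> /eqP -> _]; rewrite inE eqxx.
Qed.

Lemma tsum_delta (c : int -> C) : tsum (fun n : int => (n == 0)%:R * c n) = c 0.
Proof.
apply: tsum_has_tsum => e e0; exists [:: 0] => B uB sB.
have B0 : (0 : int) \in B by apply: sB; rewrite mem_head.
rewrite (bigD1_seq _ B0 uB) eqxx mul1r /= big1 => [|n /negPf ->]; last exact: mul0r.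
by rewrite addr0 subrr nm0 ltW.
Qed.

Lemma entire_Tpow m : entire (Tpow m).
Proof. by elim: m => [|m IH] /=; [move=> x; exact: asum_delta|exact: entire_zconv entire_theta_coef IH]. Qed.

Lemma zeval_Tpow m x : zeval (Tpow m) x = zeval theta_coef x ^+ m.
Proof.
elim: m => [|m IH] /=; first by rewrite expr0 /zeval tsum_delta ez0.
by have [_ ->] := zeval_zconv (entire_theta_coef x) (entire_Tpow m x); rewrite exprS IH.
Qed.

(** Coefficient form of [theta(q zeta)^m = (-1)^m zeta^(-m) theta(zeta)^m]. *)
Lemma Tpow_shift m n : qpow n * Tpow m n = (-1) ^+ m * Tpow m (n + m%:Z).
Proof.
elim: m n => [|m IH] n /=.
  by rewrite expr0 mul1r addr0; case: eqP => [->|_]; rewrite ?qz0 ?mulr1// mulr0.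
have a0 k := asum_zconv k (entire_theta_coef 0) (entire_Tpow m 0).
rewrite -(tsumZ _ (a0 _)) -(tsumZ _ (a0 _)).
have a1 := asumZ ((-1) ^+ m.+1) (asum_zconv (n + m.+1%:Z) (entire_theta_coef 0) (entire_Tpow m 0)).
rewrite (tsum_shift m%:Z a1); apply: eq_tsum => s.
have -> : n + m.+1%:Z - (s + m%:Z) = (n - s) + 1 by lia.
rewrite -[n in qpow n](subrK s) qzD.
transitivity ((qpow (n - s) * theta_coef (n - s)) * (qpow s * Tpow m s)); first by ring.
by rewrite TnS IH exprS; ring.
Qed.

Definition theta_taylor : fps R := fun j => tsum (fun n => theta_coef n * fe n%:~R j).

Lemma asym_theta_coef S : asym S (zeval theta_coef) theta_taylor. Proof. exact: asym_zeval entire_theta_coef. Qed.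

Lemma fT0 : theta_taylor 0%N = 0.
Proof. by rewrite -[RHS]sum_theta_coef; apply: eq_tsum => n; rewrite fe0 mulr1. Qed.

(** Up to factorials the moments are the Taylor coefficients in [x] of [theta(e^x)^m], which
    vanishes to order [m] at 0. *)
Lemma Tpow_moment m i : (i < m)%N -> tsum (fun n => Tpow m n * n%:~R ^+ i) = 0.
Proof.
move=> im.
have e : (fun j => tsum (fun n => Tpow m n * fe n%:~R j)) = theta_taylor ^+ m :> fps R.
  apply: (@asym_uniq _ setT (zeval (Tpow m))); last 2 first.
  - exact: asym_zeval (entire_Tpow m).
  - by apply: asym_eq ltr01 _ (asymX m (asym_theta_coef setT)) => x _ _ _; rewrite zeval_Tpow.
  by move=> d d0; exists d; rewrite gt_eqF// gtr0_norm.
have := congr1 (@^~ i) e; rewrite (fpow_small fT0 im) (moment_fe _ (entire_Tpow m)).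
by move/eqP; rewrite mulf_eq0 invr_eq0 (negPf (fact_neq0 R i)) orbF => /eqP.
Qed.

(* Testing against [\prod_(1 <= i <= K) (1 - n^2/i^2)], which is 1 at 0, vanishes for
   0 < |n| <= K and is at most [e^(2 |n|)] elsewhere, shows that the moments of [theta_coef]
   are not all zero. *)
Lemma theta_taylor_neq0 : theta_taylor != 0.
Proof.
apply/eqP => T0.
have mom i : tsum (fun n => theta_coef n * n%:~R ^+ i) = 0.
  have := congr1 (@^~ i) T0; rewrite /theta_taylor (moment_fe _ entire_theta_coef) => /eqP.
  by rewrite mulf_eq0 invr_eq0 (negPf (fact_neq0 R i)) orbF => /eqP.
pose Q K (n : int) : R := \prod_(i < K) (1 - n%:~R ^+ 2 / i.+1%:R ^+ 2).
pose p K : {poly C} := \prod_(i < K) (1 - (i.+1%:R ^- 2) *: 'X^2).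
have pE K n : (p K).[n%:~R] = (Q K n)%:C.
  rewrite horner_prod rmorph_prod; apply: eq_bigr => i _.
  rewrite hornerD hornerN hornerZ hornerXn hornerC.
  by rewrite rmorphB rmorph1 rmorphM fmorphV !rmorphXn rmorph_nat rmorph_int mulrC.
have Qsum K : tsum (fun n => theta_coef n * (Q K n)%:C) = 0 /\ asum (fun n => theta_coef n * (Q K n)%:C).
  have aj j : (j < size (p K))%N -> asum (fun n => (p K)`_j * (theta_coef n * n%:~R ^+ j)).
    by move=> _; exact/asumZ/asum_moment/entire_theta_coef.
  have e n : theta_coef n * (Q K n)%:C = \sum_(j < size (p K)) (p K)`_j * (theta_coef n * n%:~R ^+ j).
    rewrite -pE horner_coef mulr_sumr; apply: eq_bigr => i _; ring.
  split; last by apply: asum_eq (asum_sum aj) => n; rewrite e.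
  rewrite (eq_tsum e) (tsum_sum aj) big1// => i _.
  by rewrite (tsumZ _ (asum_moment _ entire_theta_coef)) mom mulr0.
have Q0 K : Q K 0 = 1.
  by rewrite /Q big1// => i _; rewrite expr0n mul0r subr0.
have Qz K n : n != 0 -> (`|n| <= K)%N -> Q K n = 0.
  move=> n0 nK; have n1 : (0 < `|n|)%N by rewrite absz_gt0.
  have h : (`|n|.-1 < K)%N by rewrite prednK.
  rewrite /Q (bigD1 (Ordinal h)) //= prednK//.
  have -> : (n%:~R : R) ^+ 2 = `|n|%N%:R ^+ 2.
    by rewrite natr_absz intr_norm real_normK// num_real.
  by rewrite mulfV ?subrr ?mul0r// expf_neq0// pnatr_eq0 -lt0n.
have Qb K n : (K < `|n|)%N -> `|Q K n| <= expR (2 * `|n|%N%:R).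
  move=> Kn; set y : R := `|n|%N%:R.
  have ny : (n%:~R : R) ^+ 2 = y ^+ 2.
    by rewrite /y natr_absz intr_norm real_normK// num_real.
  (* For [i <= K < y] the factor [1 - y^2 / i^2] is at most [(y / i)^2] in modulus. *)
  have h m : (m <= K)%N -> `|Q m n| <= (y ^+ m / m`!%:R) ^+ 2.
    elim: m => [|m IH] mK; first by rewrite /Q big_ord0 normr1 expr0 fact0 divr1 expr1n.
    rewrite /Q big_ord_recr normrM /=.
    have -> : (y ^+ m.+1 / m.+1`!%:R) ^+ 2 = (y ^+ m / m`!%:R) ^+ 2 * (y / m.+1%:R) ^+ 2.
      by rewrite -exprMn; congr (_ ^+ 2); rewrite factS natrM exprS invfM; ring.
    rewrite ler_pM//; first exact: IH (ltnW mK).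
    have m1 : 1 <= y / m.+1%:R.
      by rewrite ler_pdivlMr// mul1r ler_nat (leq_trans mK)// ltnW.
    rewrite ny -expr_div_n ler_norml; have := sqr_ge0 (y / m.+1%:R).
    have : 1 <= (y / m.+1%:R) ^+ 2 by rewrite exprn_ege1.
    by move: ((y / m.+1%:R) ^+ 2) => z h1 h0; apply/andP; split; lra.
  apply: (le_trans (h K (leqnn K))).
  have -> : expR (2 * y) = expR y ^+ 2 by rewrite -expRM_natr mulrC.
  have y0 : 0 <= y by [].
  rewrite lerXn2r ?nnegrE ?expR_ge0 ?divr_ge0 ?exprn_ge0//.
  case: (K) => [|j]; first by rewrite expr0 fact0 divr1 -expR0 ler_expR.
  by rewrite (le_trans _ (expR_ge1Dxn j y0))// lerDr.
have [K hK] := entire_exp 2 entire_theta_coef.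
have k0 n : 0 <= nm (theta_coef n * (expR (2 * nm (n%:~R : C)))%:C) by exact: nm_ge0.
have half : 0 < 1 / 2 :> R by rewrite divr_gt0.
have [A uA hA] := bsum_tail k0 hK half.
(* Since [|n| <= M] on [A], the test product keeps at most the term [n = 0] of [A]. The rest is a
   tail bounded by 1/2, while [theta_coef 0] has modulus 1. *)
pose M := \max_(n <- A) `|n|%N.
have [s0 aQ] := Qsum M.
have e1 : tsum (fun n => theta_coef n * (Q M n)%:C - (n == 0)%:R * theta_coef n) = - theta_coef 0.
  by rewrite (tsumB aQ (asum_delta theta_coef)) s0 tsum_delta sub0r.
have aD : asum (fun n => theta_coef n * (Q M n)%:C - (n == 0)%:R * theta_coef n).
  apply: asum_eq (asumD aQ (asumZ (-1) (asum_delta theta_coef))) => n.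
  by rewrite mulN1r.
have T01 : nm (- theta_coef 0) = 1.
  by rewrite nmN /theta_coef nmM nm_signz mul1r nm_ee /aT mul0r mul0r mulr0 expR0.
have : nm (- theta_coef 0) <= 1 / 2.
  rewrite -e1; apply: (has_tsum_le (asum_has_tsum aD)) => B uB.
  rewrite (bigID (fun n => (n \in A) || (n == 0))) /= [X in X + _]big1 ?add0r; last first.
    move=> n /orP[nA|/eqP ->]; last by rewrite eqxx mul1r Q0 mulr1 subrr nm0.
    have [->|n0] := eqVneq n 0; first by rewrite mul1r Q0 mulr1 subrr nm0.
    rewrite Qz ?mulr0 ?mul0r ?subr0 ?nm0//.
    exact: (@leq_bigmax_seq _ A xpredT (fun n : int => `|n|%N)).
  rewrite -big_filter.
  set B' := [seq n <- B | _].
  apply: (le_trans _ (hA B' _ _)); rewrite ?filter_uniq//; last first.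
    by move=> n; rewrite mem_filter negb_or => /andP[/andP[]].
  rewrite [leLHS]big_seq [leRHS]big_seq ler_sum// => n; rewrite mem_filter negb_or => /andP[/andP[_ n0] _].
  rewrite (negPf n0) mul0r subr0 !(nmM (theta_coef n)) ler_wpM2l ?nm_ge0// !nm_real (ger0_norm (expR_ge0 _)) nm_intr.
  have [nM|Mn] := leqP `|n|%N M; last exact: Qb.
  by rewrite Qz// normr0 expR_ge0.
rewrite T01; lra.
Qed.

(* The coefficients of the expansion of [zeta d/dzeta log theta] on [|q| < |zeta| < 1]. *)
Definition theta_dlog s : C := if s == 0 then 0 else - (1 - qpow s)^-1.

Lemma qpow_neq1 s : s != 0 -> 1 - qpow s != 0.
Proof.
move=> s0; apply/eqP => /eqP; rewrite subr_eq0 => /eqP e.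
have := congr1 (@nm R) e; rewrite nm1 nm_qpow -{1}expR0 => /expR_inj/esym/eqP.
by rewrite mulf_eq0 oppr_eq0 !mulf_eq0 pnatr_eq0 (gt_eqF (pi_gt0 R)) (gt_eqF t0) intr_eq0 (negPf s0).
Qed.

Lemma phs1 s : theta_dlog s * (1 - qpow s) = (s == 0)%:R - 1.
Proof.
rewrite /theta_dlog; case: eqP => [->|/eqP s0]; first by rewrite mul0r subrr.
by rewrite mulNr mulVf ?qpow_neq1// sub0r.
Qed.

Lemma phsN s : theta_dlog (- s) = (s == 0)%:R - 1 - theta_dlog s.
Proof.
rewrite /theta_dlog oppr_eq0; case: eqP => [_|/eqP s0]; first by rewrite subrr subr0.
have := qpow_neq1 s0; have := qpow_neq0 s; rewrite qzN sub0r => a b; field.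
by rewrite b a /= -opprB oppr_eq0.
Qed.

Definition strip x := - (2 * pi * Im t) < x < 0.

Lemma zsummable_theta_dlog x : strip x -> zsummable theta_dlog x.
Proof.
move=> /andP[x1 x2]; set c := 2 * pi * Im t in x1.
have c0 : 0 < c by rewrite !mulr_gt0 ?pi_gt0.
(* The two ends of the series decay with ratios [e^x] for [n -> +oo] and [e^(- (c + x))] for
   [n -> -oo]. *)
pose r := expR (Num.max x (- (c + x))).
have r01 : 0 < r < 1.
  by rewrite expR_gt0 -expR0 ltr_expR gt_max x2 oppr_lt0 -ltrBlDl sub0r.
have rho1 : 0 < 1 - expR (- c) by rewrite subr_gt0 -expR0 ltr_expR oppr_lt0.
apply: (asum_geom_summable (K := (1 - expR (- c))^-1) (@geom_summable_int R) r01) => n.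
have [->|n0] := eqVneq n 0.
  by rewrite /theta_dlog eqxx mul0r nm0 mulr_ge0 ?invr_ge0 ?(ltW rho1)// exprn_ge0// ltW// expR_gt0.
rewrite /theta_dlog (negPf n0) mulNr nmN nmM nmV nm_ez.
have key m : (0 < m)%N -> 1 - expR (- c) <= nm (1 - qpow m%:Z).
  move=> m0; have h : 1 <= nm (1 - qpow m%:Z) + nm (qpow m%:Z).
    by rewrite -{1}(nm1 R) -{1}(subrK (qpow m%:Z) 1) nmD.
  have : nm (qpow m%:Z) <= expR (- c).
    rewrite nm_qpow -/c ler_expR -pmulrn mulNr lerN2 ler_peMr ?(ltW c0)//.
    by rewrite ler1n.
  lra.
case: n n0 => [m|m] n0.
  have m0 : (0 < m)%N by rewrite lt0n; apply: contra n0 => /eqP ->.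
  rewrite ler_pM ?invr_ge0 ?nm_ge0 ?expR_ge0//.
    by rewrite lef_pV2 ?posrE ?key// (lt_le_trans rho1)// key.
  rewrite -pmulrn expRM_natr /r lerXn2r ?nnegrE ?expR_ge0// ler_expR le_max lexx//.
have e : nm (1 - qpow (Negz m)) = nm (1 - qpow m.+1%:Z) * expR (c * m.+1%:R).
  rewrite NegzE qzN.
  have -> : 1 - (qpow m.+1%:Z)^-1 = - ((1 - qpow m.+1%:Z) / qpow m.+1%:Z).
    by have := qpow_neq0 m.+1; move=> h; field.
  rewrite nmN nmM nmV nm_qpow -/c; congr (_ * _).
  by rewrite -pmulrn mulNr expRN invrK.
rewrite e invfM -mulrA ler_pM ?invr_ge0 ?nm_ge0 ?mulr_ge0 ?invr_ge0 ?expR_ge0//.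
  by rewrite lef_pV2 ?posrE ?key// (lt_le_trans rho1)// key.
rewrite -expRN -expRD NegzE mulrNz -pmulrn /r -expRM_natr ler_expR.
have -> : - (c * m.+1%:R) + x * - m.+1%:R = - (c + x) * m.+1%:R by ring.
by rewrite abszN absz_nat ler_wpM2r// le_max lexx orbT.
Qed.

Lemma strip_ex : strip (- (pi * Im t)).
Proof.
have := pi_gt0 R; have := t0; rewrite /strip => h p.
have : 0 < pi * Im t by rewrite mulr_gt0.
by move=> c0; apply/andP; split; lra.
Qed.

(* The logarithmic derivative of the theta series, as a convolution identity. *)
Lemma zconv_theta_dlog n : zconv theta_coef theta_dlog n = n%:~R * theta_coef n.
Proof.
have hT := entire_theta_coef (- (pi * Im t)); have hp := zsummable_theta_dlog strip_ex.
have aU m := asum_zconv m hT hp; pose u m := zconv theta_coef theta_dlog m.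
have aT1 m : asum (fun s => theta_coef (m - s)).
  apply: (asum_rev m); apply: asum_eq (entire_theta_coef 0) => s.
  by rewrite /ez mul0r cexp0 mulr1.
have sT1 m : tsum (fun s => theta_coef (m - s)) = 0.
  rewrite -tsum_rev ?sum_theta_coef//; apply: asum_eq (entire_theta_coef 0) => s.
  by rewrite /ez mul0r cexp0 mulr1.
have aD m : asum (fun s : int => (s == 0)%:R * theta_coef (m - s)) by exact: asum_delta.
(* From [theta_dlog s * (1 - q^s) = (s == 0) - 1] and the vanishing of theta at 1, [u] satisfies a
   first-order recurrence: [u m / theta_coef m] increases by 1 at each step, so only [u 0 = 0]
   remains to be shown. *)
have step m : u (m + 1) - qpow m * - u m = theta_coef (m + 1).
  have -> : - u m = -1 * u m by rewrite mulN1r.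
  rewrite /u /zconv -(tsumZ _ (aU m)) -(tsumZ _ (asumZ _ (aU m))).
  rewrite -(tsumB (aU _) (asumZ _ (asumZ _ (aU m)))).
  transitivity (tsum (fun s : int => (s == 0)%:R * theta_coef (m + 1 - s) - theta_coef (m + 1 - s))).
    apply: eq_tsum => s;
    have -> : (s == 0)%:R * theta_coef (m + 1 - s) - theta_coef (m + 1 - s) = theta_dlog s * (1 - qpow s) * theta_coef (m + 1 - s).
      by rewrite phs1; ring.
    have -> : qpow m = qpow s * qpow (m - s) by rewrite -qzD addrC subrK.
    have := TnS (m - s); rewrite (_ : m - s + 1 = m + 1 - s); last by lia.
    move=> e; transitivity (theta_coef (m + 1 - s) * theta_dlog s + qpow s * theta_dlog s * (qpow (m - s) * theta_coef (m - s))); first ring.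
    by rewrite e; ring.
  rewrite (tsumB (aD _) (aT1 _)).
  by rewrite (tsum_delta (fun s => theta_coef (m + 1 - s))) sT1 !subr0.
have w m : u (m + 1) / theta_coef (m + 1) = u m / theta_coef m + 1.
  have /eqP := step m; rewrite mulrN opprK; have := TnS m => e.
  have -> : qpow m = - theta_coef (m + 1) / theta_coef m by rewrite -e mulfK ?theta_coef_neq0.
  move/eqP => {}e; have a := theta_coef_neq0 m; have b := theta_coef_neq0 (m + 1).
  have -> : u (m + 1) = theta_coef (m + 1) + theta_coef (m + 1) / theta_coef m * u m by rewrite -{1}e; ring.
  by field; rewrite a b.
(* The reflection [s -> - s] gives a second relation between [u 0] and [u 1]; with the recurrence it
   forces [u 0 = - u 0]. *)
have sym : u 0 = u 1 + 1.
  have -> : u 0 = tsum (fun s : int => theta_coef (1 - s) * theta_dlog s + (theta_coef (1 - s) - (s == 0)%:R * theta_coef (1 - s))).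
    rewrite /u /zconv (tsum_oppz (aU 0)); apply: eq_tsum => s.
    rewrite phsN sub0r opprK !theta_coef_rev; ring.
  have a3 : asum (fun s : int => theta_coef (1 - s) - (s == 0)%:R * theta_coef (1 - s)).
    apply: asum_eq (asumD (aT1 1) (asumZ (-1) (aD 1))) => s.
    by rewrite mulN1r.
  rewrite (tsumD (aU 1) a3) (tsumB (aT1 1) (aD 1)).
  rewrite (tsum_delta (fun s => theta_coef (1 - s))) sT1 sub0r subr0; congr (_ + _).
  by rewrite /theta_coef /aT subrr mulr0 mul0r rmorph0 mul0r /ee mulr0 cexp0 mulr1 expr1z opprK.
have T0 : theta_coef 0 = 1 by rewrite /theta_coef /aT !mul0r /ee mulr0 cexp0 expr0z mulr1.
have T1 : theta_coef 1 = -1 by rewrite -[1 in LHS]add0r -[LHS]opprK -TnS T0 qz0 mulr1.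
have w0 : u 0 = 0.
  have := w 0; rewrite add0r T0 T1 divr1 invrN1 mulrN1 => e.
  have : u 0 + u 0 = 0 by rewrite {2}sym -[u 1]opprK e; ring.
  by move/eqP; rewrite -mulr2n -mulr_natr mulf_eq0 pnatr_eq0 orbF => /eqP.
suff -> : zconv theta_coef theta_dlog n = n%:~R * theta_coef n by [].
apply: (mulIf (_ : (theta_coef n)^-1 != 0)); first by rewrite invr_eq0 theta_coef_neq0.
rewrite mulfK ?theta_coef_neq0// -/(u n).
have pos (m : nat) : u m%:Z / theta_coef m%:Z = m%:R.
  elim: m => [|m IH]; first by rewrite w0 mul0r.
  have -> : (m.+1%:Z = m%:Z + 1) by lia.
  by rewrite w IH natr1.
case: n => m; first exact: pos.
rewrite NegzE mulrNz -pmulrn; elim: m => [|m IH].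
  have := w (-1); rewrite addNr w0 mul0r => /eqP; rewrite eq_sym addr_eq0 => /eqP ->.
  by [].
have := w (- m.+2%:Z); have -> : - m.+2%:Z + 1 = - m.+1%:Z by lia.
by rewrite IH => e; apply: (addIr 1); rewrite -e -[m.+2%:R]natr1; ring.
Qed.

Lemma zeval_dTn x : strip x -> zeval (fun n => n%:~R * theta_coef n) x = zeval theta_coef x * zeval theta_dlog x.
Proof.
move=> sx; have [_ <-] := zeval_zconv (entire_theta_coef x) (zsummable_theta_dlog sx).
by apply: eq_tsum => n; rewrite zconv_theta_dlog.
Qed.

Lemma asym_dTn S : asym S (zeval (fun n => n%:~R * theta_coef n)) (fd theta_taylor).
Proof.
have hd : entire (fun n => n%:~R * theta_coef n).
  move=> x; have hT := entire_exp (`|x| + 1) entire_theta_coef.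
  apply: asum_nm hT _ => n; rewrite (nmM (_ * theta_coef n)) (nmM n%:~R) (nmM (theta_coef n)) nm_real (ger0_norm (expR_ge0 _)) nm_ez.
  rewrite [nm n%:~R * _]mulrC -mulrA ler_wpM2l ?nm_ge0// mulrDl expRD mulrC mul1r.
  rewrite ler_pM ?expR_ge0 ?nm_ge0//.
    rewrite ler_expR nm_intr natr_absz intr_norm -normrM; exact: ler_norm.
  by rewrite (le_trans _ (expR_ge1Dx _))// lerDr.
have -> : fd theta_taylor = (fun j => tsum (fun n => n%:~R * theta_coef n * fe n%:~R j)); last exact: asym_zeval hd.
apply: fpsP => j; rewrite /fd /theta_taylor -tsumZ.
  apply: eq_tsum => n; have := congr1 (@^~ j) (fd_fe (n%:~R : C)).
  by rewrite fCmE /fd => e; rewrite mulrCA e mulrA [_ * theta_coef n]mulrC.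
exact: (asum_expsum_coef (b := fun n : int => n%:~R) ltr01 (entire_exp 1 entire_theta_coef)).
Qed.

End ThetaSequence.

(** * Bernoulli numbers: generating series, Riccati equation and signs *)

Section Bernoulli.
Variable R : realType.
Local Notation C := R[i].
Implicit Types (f g : fps R) (b c : C).

Lemma size_bernoulli_seq n : size (bernoulli_seq n) = n.
Proof. by elim: n => //= n IH; rewrite size_rcons IH. Qed.

Lemma nth_bernoulli_seq n j : (j < n)%N -> (bernoulli_seq n)`_j = bernoulli j.
Proof.
elim: n => //= n IH; rewrite ltnS leq_eqVlt => /orP[/eqP ->//|jn].
by rewrite nth_rcons size_bernoulli_seq jn IH.
Qed.

Lemma bernoulliE n : bernoulli n =
  (n == 0%N)%:R - (n.+1%:R)^-1 * \sum_(j < n) 'C(n.+1, j)%:R * bernoulli j.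
Proof.
rewrite /bernoulli /= nth_rcons size_bernoulli_seq ltnn eqxx; congr (_ - _ * _).
by apply: eq_bigr => j _; rewrite nth_bernoulli_seq.
Qed.

Lemma bernoulli_sum n : \sum_(j < n.+1) 'C(n.+1, j)%:R * bernoulli j = (n == 0%N)%:R.
Proof.
have n0 : n.+1%:R != 0 :> rat by rewrite pnatr_eq0.
rewrite big_ord_recr /= binSn (bernoulliE n) mulrBr mulrA mulfV// mul1r addrC subrK.
by case: n {n0} => [|n]; rewrite ?mul1r ?mulr0.
Qed.

(** The series [X / (e^X - 1)], by [fB_eq]. *)
Definition fB : fps R := fun n => ratr (bernoulli n) / n`!%:R.

Lemma fB_eq : (fe 1 - 1) * fB = fX R.
Proof.
apply: fpsP => n; rewrite mulrC fmulE big_ord_recr /= subnn.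
rewrite faddE foppE fe0 foneE subrr mulr0 addr0.
case: n => [|n]; first by rewrite big_ord0.
transitivity ((n.+1`!%:R)^-1 * ratr (\sum_(j < n.+1) 'C(n.+1, j)%:R * bernoulli j) : C).
  rewrite rmorph_sum mulr_sumr; apply: eq_bigr => j _.
  rewrite faddE foppE foneE subn_eq0 leqNgt (ltn_ord j) subr0 /fe expr1n rmorphM /= ratr_nat /fB.
  have h := bin_fact (ltnW (ltn_ord j)).
  have : ('C(n.+1, j)%:R * (j`!%:R * (n.+1 - j)`!%:R) = n.+1`!%:R :> C) by rewrite -!natrM h.
  have := fact_neq0 R j; have := fact_neq0 R (n.+1 - j); have := fact_neq0 R n.+1.
  move: ('C(n.+1, j)%:R) => x; move: (n.+1`!%:R) (j`!%:R) ((n.+1 - j)`!%:R) => a b c a0 c0 b0 e.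
  rewrite -e in a0 *; move: a0; rewrite mulf_eq0 negb_or => /andP[x0 _].
  by field; rewrite x0 b0 c0.
rewrite bernoulli_sum /fX; case: n => [|n]; last by rewrite rmorph0 mulr0.
have -> : ratr ((0%N == 0%N)%:R : rat) = 1 :> C by rewrite eqxx rmorph1.
by rewrite mulr1 (_ : 1`! = 1%N)// invr1.
Qed.

Definition frefl f : fps R := fun n => (-1) ^+ n * f n.

Lemma freflM f g : frefl (f * g) = frefl f * frefl g.
Proof.
apply: fpsP => n; rewrite /frefl !fmulE mulr_sumr; apply: eq_bigr => i _.
rewrite mulrACA -exprD subnKC//; by rewrite -ltnS.
Qed.

Lemma freflD f g : frefl (f + g) = frefl f + frefl g.
Proof. by apply: fpsP => n; rewrite /frefl !faddE mulrDr. Qed.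

Lemma freflN f : frefl (- f) = - frefl f.
Proof. by apply: fpsP => n; rewrite /frefl !foppE mulrN. Qed.

Lemma frefl1 : frefl 1 = 1.
Proof. by apply: fpsP => -[|n]; rewrite /frefl foneE ?expr0 ?mul1r// mulr0. Qed.

Lemma freflX : frefl (fX R) = - fX R.
Proof.
by apply: fpsP => -[|[|n]]; rewrite /frefl foppE /fX /= ?mulr0 ?oppr0// expr1 mulr1.
Qed.

Lemma frefl_fe b : frefl (fe b) = fe (- b).
Proof. by apply: fpsP => n; rewrite /frefl /fe mulrA -exprNn. Qed.

Lemma feM b c : fe b * fe c = fe (b + c).
Proof.
apply: fpsP => n; rewrite fmulE /fe addrC exprDn mulr_suml; apply: eq_bigr => i _.
rewrite -[_ *+ 'C(n, i)]mulr_natl.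
have iN : (i <= n)%N by rewrite -ltnS.
have : ('C(n, i)%:R * (i`!%:R * (n - i)`!%:R) = n`!%:R :> C) by rewrite -!natrM bin_fact.
have := fact_neq0 R i; have := fact_neq0 R (n - i); have := fact_neq0 R n.
move: ('C(n, i)%:R) => x; move: (n`!%:R) (i`!%:R) ((n - i)`!%:R) => u v w a0 c0 b0 e.
rewrite -e in a0 *; move: a0; rewrite mulf_eq0 negb_or => /andP[x0 _].
by field; rewrite x0 b0 c0.
Qed.

Lemma fe_0 : fe 0 = 1 :> fps R.
Proof. by apply: fpsP => -[|n]; rewrite /fe foneE ?expr0 ?fact0 ?divr1// expr0n mul0r. Qed.

Lemma fe1_neq0 : fe 1 - 1 != 0 :> fps R.
Proof.
apply/eqP => /(congr1 (@^~ 1%N)); rewrite faddE foppE /fe foneE expr1n subr0 divr1.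
by move/eqP; rewrite oner_eq0.
Qed.

Lemma fB_refl : frefl fB = fB + fX R.
Proof.
apply: (fps_mulI fe1_neq0).
have h := congr1 frefl fB_eq; rewrite freflM freflD freflN frefl1 frefl_fe freflX in h.
have e : fe 1 * fe (-1) = 1 :> fps R by rewrite feM subrr fe_0.
rewrite mulrDr fB_eq.
transitivity (- (fe 1 * ((fe (-1) - 1) * frefl fB))).
  transitivity ((fe 1 - fe 1 * fe (-1)) * frefl fB); first by rewrite e.
  by ring.
by rewrite h; ring.
Qed.

(** Adding [X / 2] cancels the only odd term of [X / (e^X - 1)]. *)
Definition fBe : fps R := fB + fC 2^-1 * fX R.

Lemma fBe_refl : frefl fBe = fBe.
Proof.
rewrite /fBe freflD freflM fB_refl freflX.
have -> : frefl (fC 2^-1) = fC (2^-1 : C).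
  by apply: fpsP => -[|n]; rewrite /frefl /fC ?expr0 ?mul1r//= mulr0.
have e : fC 2^-1 + fC 2^-1 = 1 :> fps R by rewrite -fCD -fC1; congr fC; field.
rewrite -[X in fB + X]mul1r -e; ring.
Qed.

Lemma fBe_odd n : odd n -> fBe n = 0.
Proof.
move=> on; have := congr1 (@^~ n) fBe_refl; rewrite /frefl -signr_odd on expr1 mulN1r => /eqP.
by rewrite eq_sym -subr_eq0 opprK -mulr2n -mulr_natr mulf_eq0 pnatr_eq0 orbF => /eqP.
Qed.

Lemma fB0 : fB 0%N = 1. Proof. by rewrite /fB /bernoulli /= big_ord0 mulr0 subr0 rmorph1 fact0 divr1. Qed.

Lemma fBe0 : fBe 0%N = 1.
Proof. by rewrite /fBe faddE fCmE fB0 mulr0 addr0. Qed.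

Lemma fBe_even n : fBe n.+2 = fB n.+2.
Proof. by rewrite /fBe faddE fCmE mulr0 addr0. Qed.

(* The Riccati equation of (x/2) coth (x/2). *)
Lemma fBe_riccati : fX R * fd fBe = fBe - fBe ^+ 2 + fC (4^-1) * fX R ^+ 2.
Proof.
have hB : fX R * fd fB = fB - fX R * fB - fB ^+ 2.
  apply: (fps_mulI fe1_neq0).
  have := congr1 (@fd R) fB_eq; rewrite fdM fdX fdD fdN fd_fe fC1 mul1r.
  rewrite -[1 in X in fe 1 - X]fC1 fdC subr0 => h.
  have -> : (fe 1 - 1) * (fX R * fd fB) = fX R * (fe 1 * fB + (fe 1 - 1) * fd fB) - fX R * (fe 1 * fB) by ring.
  rewrite h -fB_eq; ring.
rewrite /fBe fdD fdM fdC fdX mul0r add0r mulr1 mulrDr hB.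
have e4 : fC 4^-1 = fC 2^-1 * fC 2^-1 :> fps R by rewrite -fCM; congr fC; field.
have e : fC 2^-1 + fC 2^-1 = 1 :> fps R by rewrite -fCD -fC1; congr fC; field.
rewrite e4; move: e; set h := fC 2^-1; set b := fB; set X := fX R => e.
have e2 : h * 2 = 1 by rewrite mulr_natr mulr2n.
apply/eqP; rewrite -subr_eq0; apply/eqP.
transitivity ((h * 2 - 1) * (X * b)); first ring.
by rewrite e2 subrr mul0r.
Qed.

Lemma fBe_rec n : n.+4%:R * fBe n.+3 = - \sum_(i < n.+2) fBe i.+1 * fBe (n.+2 - i)%N.
Proof.
have := congr1 (@^~ n.+3) fBe_riccati.
rewrite fth_E !faddE foppE fCmE expr2 fmulE (_ : (fX R ^+ 2) n.+3 = 0); last first.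
  by rewrite -[_ ^+ 2]mulr1 fXnmE /= subn2.
rewrite mulr0 addr0 big_ord_recl big_ord_recr /= subn0 fBe0 subnn fBe0.
rewrite (_ : bump 0 n.+2 = n.+3)//.
have -> : \sum_(i < n.+2) fBe (bump 0 i) * fBe (n.+3 - bump 0 i)%N =
  \sum_(i < n.+2) fBe i.+1 * fBe (n.+2 - i)%N by apply: eq_bigr => i _; rewrite /bump leq0n add1n subSS.
set S := \sum_(i < _) _; rewrite mul1r mulr1 => e.
by rewrite -[n.+4%:R]natr1 mulrDl e; ring.
Qed.

Lemma fBe2 : fBe 2 = 12^-1.
Proof.
have := congr1 (@^~ 2%N) fBe_riccati.
have -> : (fX R * fd fBe) 2%N = 2%:R * fBe 2 by exact: fth_E.
have h1 : (fBe ^+ 2) 2%N = fBe 2 + fBe 1 * fBe 1 + fBe 2.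
  by rewrite expr2 fmulE !big_ord_recl big_ord0 /= fBe0 mul1r mulr1 addr0 addrA.
have h2 : (fC 4^-1 * fX R ^+ 2) 2%N = 4^-1 :> C.
  by rewrite fCmE -[_ ^+ 2]mulr1 fXnmE /= foneE mulr1.
rewrite faddE faddE foppE h1 h2 (@fBe_odd 1)// mulr0 addr0 => e.
have h : 3 * fBe 2 = 4^-1 by rewrite -[3%:R]/((2 + 1)%:R) natrD mulrDl e; ring.
by apply: (mulfI (_ : 3 != 0 :> C)); rewrite ?pnatr_eq0// h; field.
Qed.

(** In the recurrence [fBe_rec] all products have the same sign by induction, and the one containing
    [fBe 2] is nonzero. The purpose is [bernoulli_neq0]: Eisenstein series are normalised by
    dividing by Bernoulli numbers. *)
Lemma fBe_sign j : 0 < (-1) ^+ j * fBe j.+1.*2.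
Proof.
elim: j {-2}j (leqnn j) => [|m IH] j jm.
  move: jm; rewrite leqn0 => /eqP ->; rewrite expr0 mul1r.
  by rewrite fBe2 invr_gt0.
move: jm; rewrite leq_eqVlt => /orP[/eqP ->|]; last by rewrite ltnS => /IH.
have n4 : 0 < (m.*2.+1).+4%:R :> C by rewrite ltr0n.
rewrite -(pmulr_rgt0 _ n4) mulrCA.
have := fBe_rec m.*2.+1; rewrite -/(m.+2.*2) => ->.
rewrite mulrN -mulNr exprS mulN1r opprK mulr_sumr.
have term (i : 'I_(m.*2.+3)) : 0 <= (-1) ^+ m * (fBe i.+1 * fBe (m.*2.+3 - i)%N).
  have [oi|ei] := boolP (odd i.+1); first by rewrite fBe_odd// mul0r mulr0.
  have := ltn_ord i; case: (nat_of_ord i) ei => [//|a] /= ea al.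
  rewrite negbK in ea.
  have aE : a = a./2.*2 by rewrite -[LHS]odd_double_half (negPf ea).
  rewrite aE; have -> : (m.*2.+3 - a./2.*2.+1 = (m - a./2).+1.*2)%N by move: al; rewrite {1}aE; lia.
  have am : (a./2 <= m)%N by move: al; rewrite {1}aE; lia.
  have -> : (-1) ^+ m = (-1) ^+ a./2 * (-1) ^+ (m - a./2) :> C by rewrite -exprD subnKC.
  rewrite mulrACA.
  by rewrite ltW// mulr_gt0// IH// ?leq_subr// (leq_trans _ am).
have h1 : (1 < m.*2.+3)%N by [].
rewrite (bigD1 (Ordinal h1)) //= ltr_wpDr//; first by apply: sumr_ge0 => i _; exact: term.
have -> : (m.*2.+3 - 1 = m.+1.*2)%N by rewrite subn1.
rewrite mulrCA mulr_gt0//; last exact: IH.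
by have := IH 0%N (leq0n m); rewrite expr0 mul1r.
Qed.

Lemma bernoulli_neq0 j : ratr (bernoulli j.+1.*2) != 0 :> C.
Proof.
have := fBe_sign j; rewrite doubleS fBe_even /fB => h; apply/eqP => e.
by move: h; rewrite e mul0r mulr0 ltxx.
Qed.

Lemma fBe4 : fBe 4 = - 720^-1.
Proof.
have := fBe_rec 1.
have -> : \sum_(i < 3) fBe i.+1 * fBe (3 - i)%N = fBe 1 * fBe 3 + (fBe 2 * fBe 2 + fBe 3 * fBe 1).
  by rewrite !big_ord_recl big_ord0 addr0.
rewrite (@fBe_odd 1)// (@fBe_odd 3)// mulr0 add0r addr0 fBe2 => e.
by apply: (mulfI (_ : 5 != 0 :> C)); rewrite ?pnatr_eq0// e; field.
Qed.

End Bernoulli.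

(** * Eisenstein series as coefficients of the logarithmic derivative of theta, and Ramanujan's
    formula *)

Section EisensteinSeries.
Variable R : realType.
Local Notation C := R[i].
Local Notation Im := (@complex.Im R).
Implicit Types (t z : C) (x : R).

Lemma tsum_fin (I : choiceType) (A : seq I) (f : I -> C) : uniq A ->
  (forall i, i \notin A -> f i = 0) -> asum f /\ tsum f = \sum_(i <- A) f i.
Proof.
move=> uA f0; have key (V : zmodType) (g : I -> V) B : (forall i, i \notin A -> g i = 0) ->
    \sum_(i <- B) g i = \sum_(i <- [seq i <- B | i \in A]) g i.
  move=> g0; rewrite big_filter [LHS](bigID (mem A)) /= [X in _ + X]big1 ?addr0//.
have f0' i : i \notin A -> nm (f i) = 0 by move=> /f0 ->; rewrite nm0.
split.
  exists (\sum_(i <- A) nm (f i)) => B uB; rewrite (key _ _ _ f0').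
  have uF : uniq [seq i <- B | i \in A] by rewrite filter_uniq.
  rewrite [leRHS](perm_big _ (perm_cat_filter uF uA _)) => [|i]; last first.
    by rewrite mem_filter => /andP[].
  by rewrite big_cat lerDl sumr_ge0// => i _; exact: nm_ge0.
apply: tsum_has_tsum => e e0; exists A => B uB sB.
have pB : perm_eq [seq i <- B | i \in A] A.
  apply: uniq_perm; rewrite ?filter_uniq// => i; rewrite mem_filter.
  by case: (boolP (i \in A)) => // /sB ->.
by rewrite (key _ _ _ f0) (perm_big _ pB) subrr nm0 ltW.
Qed.

Lemma tsum_natS (f : nat -> C) : asum (fun n => f n.+1) ->
  asum f /\ tsum f = f 0%N + tsum (fun n => f n.+1).
Proof.
move=> af; pose g n := if n is m.+1 then Some m else None.
pose f1 n := if n is m.+1 then f n else 0.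
have hK : pcancel succn g by [].
have gK i j : g j = Some i -> i.+1 = j by case: j => [//|j] [->].
have f10 j : g j = None -> f1 j = 0 by case: j.
have a1 : asum f1 := asum_inj gK f10 af.
have s1 : tsum f1 = tsum (fun n => f n.+1) := tsum_inj hK gK f10 af.
pose f2 n := if n == 0%N then f 0%N else 0.
have [a2 s2] : asum f2 /\ tsum f2 = f 0%N.
  have [|i|a ->] := @tsum_fin _ [:: 0%N] f2; rewrite ?big_seq1//.
  by rewrite inE /f2 => /negPf ->.
have e n : f2 n + f1 n = f n by case: n => [|n]; rewrite /f1 /f2 /= ?addr0 ?add0r.
split; first exact: asum_eq e (asumD a2 a1).
by rewrite -s1 -s2 -(tsumD a2 a1); apply: eq_tsum => n; rewrite e.
Qed.

Lemma tsum_geo z : nm z < 1 ->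
  asum (fun n => z ^+ n) /\ tsum (fun n => z ^+ n) = (1 - z)^-1.
Proof.
move=> z1; have az : asum (fun n => z ^+ n).
  have [->|z0] := eqVneq z 0.
    have [//|i|a _] := @tsum_fin _ [:: 0%N] (fun n => 0 ^+ n : C).
    - by rewrite inE expr0n => /negPf ->.
    - exact: a.
  have r01 : 0 < nm z < 1 by rewrite nm_gt0 z0.
  by apply: asum_nm (@geom_summable_nat R _ r01) _ => n; rewrite nmX nm_real ler_norm.
split=> //; have aS : asum (fun n => z ^+ n.+1).
  by apply: asum_eq (asumZ z az) => n; rewrite exprS.
have [_] := tsum_natS aS; rewrite expr0.
have -> : tsum (fun n => z ^+ n.+1) = z * tsum (fun n => z ^+ n).
  by rewrite -(tsumZ _ az); apply: eq_tsum => n; rewrite exprS.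
set S := tsum _ => e; have nz : 1 - z != 0.
  by apply/eqP => /eqP; rewrite subr_eq0 => /eqP e1; move: z1; rewrite -e1 nm1 ltxx.
apply: (mulfI nz); rewrite mulfV// mulrBl mul1r {1}e; ring.
Qed.

Lemma sigma_divE j n : sigma_div j n.+1 =
  (\sum_(s <- iota 0 n.+1) if s.+1 %| n.+1 then s.+1 ^ j else 0)%N.
Proof.
rewrite -big_mkcond -big_filter /sigma_div.
rewrite -(big_map succn xpredT (fun d => d ^ j)%N); apply: perm_big.
apply: uniq_perm; rewrite ?divisors_uniq ?map_inj_uniq ?filter_uniq ?iota_uniq//.
  by move=> a b [].
move=> d; rewrite -dvdn_divisors//; apply/idP/mapP => [dn|[s]].
  have d0 : (0 < d)%N := dvdn_gt0 (ltn0Sn n) dn.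
  exists d.-1; last by rewrite prednK.
  by rewrite mem_filter prednK// dn mem_iota /= add0n prednK// dvdn_leq.
by rewrite mem_filter => /andP[h _] ->.
Qed.

Lemma sigma_div_le j n : (sigma_div j n.+1 <= n.+1 ^ j.+1)%N.
Proof.
rewrite sigma_divE expnS; have -> : (n.+1 * n.+1 ^ j)%N = (\sum_(s <- iota 0 n.+1) n.+1 ^ j)%N.
  by rewrite big_const_seq count_predT size_iota iter_addn_0 mulnC.
rewrite big_seq [leqRHS]big_seq leq_sum// => s; rewrite mem_iota /= add0n => sn.
by case: ifP => // _; case: j => [|j]; rewrite ?expn0// leq_exp2r.
Qed.

Lemma qsummable_sigma j : qsummable (fun n : nat => n.+1%:R : R) (fun n => (sigma_div j n.+1)%:R).
Proof.
apply: (qsummable_geom_summable (h := id) (c := 1) (c' := 0) (K := 1) (j := j.+1)) => //.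
- exact: geom_summable_nat.
- by move=> i; rewrite mul1r subr0 ler_nat.
- by move=> i; rewrite mul1r nm_nat -natrX ler_nat sigma_div_le.
Qed.

Lemma eisensteinE w t : 0 < Im t -> eisenstein w t = 1 - 2 * w%:R / ratr (bernoulli w) *
  qsum (fun n : nat => n.+1%:R : R) (fun n => (sigma_div w.-1 n.+1)%:R) t.
Proof.
move=> t0; rewrite /eisenstein /qsum -csum_tsum; last exact: qsum_asum (qsummable_sigma _) t0.
by congr (_ - _ * csum _); apply/funext => n; rewrite rmorph_nat.
Qed.

Lemma eisenstein_smooth w : smooth (@eisenstein R w).
Proof.
apply: smooth_eqH (smD (smooth_cst 1) (smZ (- (2 * w%:R / ratr (bernoulli w)))
  (qsum_smooth (qsummable_sigma w.-1)))) => t t0.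
by rewrite eisensteinE// mulNr.
Qed.

Section Fixed.
Variable t : C.
Hypothesis t0 : 0 < Im t.

Definition lam (s : nat) : C := qpow t s.+1%:Z / (1 - qpow t s.+1%:Z).

Lemma nm_qpow_lt1 (s : nat) : nm (qpow t s.+1%:Z) < 1.
Proof.
rewrite nm_qpow -expR0 ltr_expR mulNr oppr_lt0 -pmulrn mulr_gt0//.
by rewrite !mulr_gt0// pi_gt0.
Qed.

Lemma qzX (s m : nat) : qpow t s%:Z ^+ m = ee ((s * m)%N%:R * t).
Proof.
rewrite /qpow /ee -cexpMn; congr cexp; rewrite natrM -pmulrn; ring.
Qed.

Lemma qsummable_lambert j : qsummable (fun p : nat * nat => (p.1.+1 * p.2.+1)%N%:R : R)
  (fun p => p.1.+1%:R ^+ j).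
Proof.
apply: (qsummable_geom_summable (h := fun p => (p.1 + p.2)%N) (c := 1) (c' := 0) (K := 1) (j := j)) => //.
- exact: geom_summable_pair (@geom_summable_nat R) (@geom_summable_nat R).
- by move=> -[s m] /=; rewrite mul1r subr0 ler_nat; nia.
- move=> -[s m] /=; rewrite mul1r nmX nm_nat lerXn2r ?nnegrE// ler_nat; lia.
Qed.

(** Expanding [q^s / (1 - q^s)] and collecting the pairs [(s, m)] according to [n = s m] turns the
    Lambert series into a divisor sum. *)
Lemma lambert j : asum (fun s : nat => s.+1%:R ^+ j * lam s) /\
  tsum (fun s : nat => s.+1%:R ^+ j * lam s) =
  qsum (fun n : nat => n.+1%:R : R) (fun n => (sigma_div j n.+1)%:R) t.
Proof.
have aP := qsum_asum (qsummable_lambert j) t0.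
have inner (s : nat) : tsum (fun m : nat => s.+1%:R ^+ j * ee ((s.+1 * m.+1)%N%:R%:C * t)) =
    s.+1%:R ^+ j * lam s.
  have [ag sg] := tsum_geo (nm_qpow_lt1 s).
  rewrite /lam mulrA -sg -(tsumZ _ ag); apply: eq_tsum => m.
  by rewrite -mulrA -exprS qzX rmorph_nat.
split; first by apply: asum_eq (asum_pair aP) => s /=; rewrite inner.
transitivity (tsum (fun p : nat * nat => p.1.+1%:R ^+ j * ee ((p.1.+1 * p.2.+1)%N%:R%:C * t))).
  by rewrite (tsum_pair aP); apply: eq_tsum => s; rewrite /= inner.
(* Indices count from 0: the pair [(n, s)] stands for the divisor [s + 1] of [n + 1]. *)
pose F (p : nat * nat) : C := if (p.2.+1 %| p.1.+1)%N then p.2.+1%:R ^+ j * ee (p.1.+1%:R%:C * t) else 0.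
pose h (p : nat * nat) := ((p.1.+1 * p.2.+1).-1, p.1).
pose g (p : nat * nat) := if (p.2.+1 %| p.1.+1)%N then Some (p.2, (p.1.+1 %/ p.2.+1)%N.-1) else None.
have hK : pcancel h g.
  move=> [s m]; have e : ((s.+1 * m.+1).-1.+1 = s.+1 * m.+1)%N by rewrite prednK ?muln_gt0.
  by rewrite /h /g; cbn [fst snd]; rewrite e dvdn_mulr// mulKn.
have gK p1 p2 : g p2 = Some p1 -> h p1 = p2.
  move: p2 => [n s]; rewrite /g; cbn [fst snd]; case: ifP => // dn [<-].
  have e : (s.+1 * (n.+1 %/ s.+1).-1.+1 = n.+1)%N.
    have p : (0 < n.+1 %/ s.+1)%N by rewrite divn_gt0//; exact: dvdn_leq dn.
    by rewrite (prednK p) mulnC (divnK dn).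
  by rewrite /h; cbn [fst snd]; rewrite e.
have F0 p : g p = None -> F p = 0 by rewrite /g /F; case: ifP.
have Fh p : F (h p) = p.1.+1%:R ^+ j * ee ((p.1.+1 * p.2.+1)%N%:R%:C * t).
  case: p => s m; have e : ((s.+1 * m.+1).-1.+1 = s.+1 * m.+1)%N by rewrite prednK ?muln_gt0.
  by rewrite /F /h; cbn [fst snd]; rewrite e dvdn_mulr.
have aF : asum (F \o h) by apply: asum_eq aP => p; rewrite /= Fh.
rewrite -(eq_tsum Fh) -(tsum_inj hK gK F0 aF) (tsum_pair (asum_inj gK F0 aF)).
apply: eq_tsum => n; have [|s|_ ->] := @tsum_fin _ (iota 0 n.+1) (fun s => F (n, s)).
- exact: iota_uniq.
- rewrite mem_iota /= add0n -leqNgt => ns; rewrite /F /=; case: ifP => // /dvdn_leq.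
  by move=> /(_ isT) sn; move: ns; rewrite ltnNge -ltnS sn.
rewrite sigma_divE natr_sum mulr_suml; apply: eq_bigr => s _; rewrite /F /=.
by case: ifP => _; rewrite ?natrX ?mul0r.
Qed.

(** Taylor series of [\sum_(s >= 1) q^s / (1 - q^s) (e^(s x) - e^(- s x))]: up to sign, what remains
    of the logarithmic derivative of theta when [e^x / (e^x - 1)] is split off. *)
Definition fL : fps R := fun j => tsum (fun s => lam s * fe s.+1%:R j) -
  tsum (fun s => lam s * fe (- s.+1%:R) j).

Lemma fL_odd j : fL j.*2.+1 = 2 / j.*2.+1`!%:R *
  qsum (fun n : nat => n.+1%:R : R) (fun n => (sigma_div j.*2.+1 n.+1)%:R) t.
Proof.
have [a <-] := lambert j.*2.+1; have f0 := fact_neq0 R j.*2.+1.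
have e1 s : lam s * fe s.+1%:R j.*2.+1 = (j.*2.+1`!%:R)^-1 * (s.+1%:R ^+ j.*2.+1 * lam s).
  by rewrite /fe; ring.
have e2 s : lam s * fe (- s.+1%:R) j.*2.+1 = - (j.*2.+1`!%:R)^-1 * (s.+1%:R ^+ j.*2.+1 * lam s).
  by rewrite /fe exprNn -signr_odd /= odd_double expr1; ring.
rewrite /fL (eq_tsum e1) (eq_tsum e2) !(tsumZ _ a); ring.
Qed.

Lemma fL_even j : fL j.*2 = 0.
Proof.
rewrite /fL; set a := tsum _; set b := tsum _; have -> : b = a; last exact: subrr.
by apply: eq_tsum => s; rewrite /fe exprNn -signr_odd odd_double expr0 mul1r.
Qed.

Lemma lam_exp b : (forall s, nm (b s) = s.+1%:R) ->
  asum (fun s => lam s * (expR (pi * Im t * nm (b s)))%:C).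
Proof.
move=> hb; set c := pi * Im t; have c0 : 0 < c by rewrite mulr_gt0// pi_gt0.
have r01 : 0 < expR (- c) < 1 by rewrite expR_gt0 -expR0 ltr_expR oppr_lt0.
have rho1 : 0 < 1 - expR (- (c + c)) by rewrite subr_gt0 -expR0 ltr_expR oppr_lt0 addr_gt0.
apply: (asum_geom_summable (K := (1 - expR (- (c + c)))^-1) (@geom_summable_nat R) r01) => s.
rewrite nmM nm_real ger0_norm ?expR_ge0// hb /lam nmM nmV.
have e : nm (qpow t s.+1) = expR (- (c + c) * s.+1%:R).
  by rewrite nm_qpow -pmulrn /c; congr expR; ring.
have h1 : 1 - expR (- (c + c)) <= nm (1 - qpow t s.+1%:Z).
  have : 1 <= nm (1 - qpow t s.+1%:Z) + nm (qpow t s.+1%:Z).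
    by rewrite -{1}(nm1 R) -{1}(subrK (qpow t s.+1%:Z) 1) nmD.
  have : nm (qpow t s.+1%:Z) <= expR (- (c + c)).
    by rewrite e ler_expR mulNr lerN2 ler_peMr ?ler1n// addr_ge0// ltW.
  lra.
rewrite mulrAC mulrC ler_pM ?mulr_ge0 ?invr_ge0 ?nm_ge0 ?expR_ge0//.
  by rewrite lef_pV2 ?posrE// (lt_le_trans rho1).
rewrite e -expRD -expRM_natr ler_expR.
have -> : - (c + c) * s.+1%:R + c * s.+1%:R = - c * s.+1%:R by ring.
by rewrite !mulNr lerN2 ler_wpM2l ?(ltW c0)// ler_nat.
Qed.

(** Only for [x < 0] can [e^x] lie in the annulus where [theta_dlog] converges, so the comparison at
    0 is one-sided. *)
Let neg : set R := fun x => x < 0.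

Lemma neg_acc d : 0 < d -> exists x, [/\ neg x, x != 0 & `|x| <= d].
Proof.
by move=> d0; exists (- d); rewrite /neg oppr_lt0 d0 oppr_eq0 gt_eqF// normrN gtr0_norm.
Qed.

Let Lfun x := tsum (fun s => lam s * cexp (x%:C * s.+1%:R)) -
  tsum (fun s => lam s * cexp (x%:C * - s.+1%:R)).

Let c0 : 0 < pi * Im t. Proof. by rewrite mulr_gt0// pi_gt0. Qed.
Let bp s : nm (s.+1%:R : C) = s.+1%:R. Proof. exact: nm_nat. Qed.
Let bm s : nm (- s.+1%:R : C) = s.+1%:R. Proof. by rewrite nmN nm_nat. Qed.

Lemma asym_Lfun S : asym S Lfun fL.
Proof. exact: asymB (asym_expsum c0 (lam_exp bp) S) (asym_expsum c0 (lam_exp bm) S). Qed.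

Lemma zeval_theta_dlog x : x < 0 -> `|x| <= pi * Im t / 2 ->
  (cexp x%:C - 1) * zeval (theta_dlog t) x = cexp x%:C - (cexp x%:C - 1) * Lfun x.
Proof.
move=> x0 xs.
have sx : strip t x.
  by rewrite /strip x0 andbT; move: xs; rewrite ltr0_norm// => xs; have := c0; lra.
have aph := zsummable_theta_dlog t0 sx.
have z1 : nm (cexp x%:C) < 1 by rewrite nm_cexp /= -expR0 ltr_expR.
have [ag sg] := tsum_geo z1.
have ezn n : ez x n.+1%:Z = cexp x%:C * cexp x%:C ^+ n.
  by rewrite -exprS -cexpMn /ez -pmulrn mulrC.
have phn (s : nat) : theta_dlog t s.+1%:Z = -1 - lam s.
  have h := qpow_neq1 t0 (_ : s.+1%:Z != 0); rewrite /theta_dlog /lam /=.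
  by field; exact: h.
have phm (s : nat) : theta_dlog t (Negz s) = lam s.
  by rewrite NegzE phsN// phn /=; ring.
have a1 := asum_expsum c0 (lam_exp bp) xs; have a2 := asum_expsum c0 (lam_exp bm) xs.
have aS : asum (fun n : nat => theta_dlog t n.+1%:Z * ez x n.+1%:Z) by exact: (asum_comp (h := Posz \o S) (g := fun n => if n is Posz m.+1 then Some m else None)) aph.
have [_ sP] := tsum_natS (f := fun n : nat => theta_dlog t n%:Z * ez x n%:Z) aS.
rewrite /zeval (tsum_int aph) sP {1}/theta_dlog eqxx mul0r add0r.
have -> : tsum (fun n : nat => theta_dlog t n.+1%:Z * ez x n.+1%:Z) =
    - cexp x%:C * (1 - cexp x%:C)^-1 - tsum (fun s => lam s * cexp (x%:C * s.+1%:R)).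
  rewrite -sg -(tsumZ _ ag) -(tsumB (asumZ _ ag) a1); apply: eq_tsum => n.
  have -> : cexp (x%:C * n.+1%:R) = cexp x%:C * cexp x%:C ^+ n by rewrite -exprS -cexpMn mulrC.
  by rewrite phn ezn; ring.
have -> : tsum (fun n : nat => theta_dlog t (Negz n) * ez x (Negz n)) =
    tsum (fun s => lam s * cexp (x%:C * - s.+1%:R)).
  by apply: eq_tsum => s; rewrite phm NegzE /ez mulrNz -pmulrn.
have nz : 1 - cexp x%:C != 0.
  by apply/eqP => /eqP; rewrite subr_eq0 => /eqP e1; move: z1; rewrite -e1 nm1 ltxx.
by rewrite /Lfun; field; exact: nz.
Qed.

Lemma theta_taylor_log_derivative : fX R * fd (theta_taylor t) = theta_taylor t * (fX R + fB R - fX R * fL).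
Proof.
have h : (fe 1 - 1) * fd (theta_taylor t) = theta_taylor t * (fe 1 - (fe 1 - 1) * fL).
  have aE : asym neg (fun x => cexp x%:C) (fe 1).
    by apply: asym_eq ltr01 _ (asym_cexp neg 1) => x _ _ _; rewrite mulr1.
  have aE1 : asym neg (fun x => cexp x%:C - 1) (fe 1 - 1).
    by have := asymB aE (asym_cst neg 1); rewrite fC1.
  apply: (asym_uniq neg_acc (asymM aE1 (asym_dTn t0 neg))).
  have c2 : 0 < pi * Im t / 2 by rewrite divr_gt0.
  apply: asym_eq c2 _ (asymM (asym_theta_coef t0 neg) (asymB aE (asymM aE1 (asym_Lfun neg)))).
  move=> x xn _ xs; have sx : strip t x.
    rewrite /strip; move: xn xs; rewrite /neg => xn; rewrite xn andbT ltr0_norm// => xs.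
    by have := c0; lra.
  by rewrite -(zeval_theta_dlog xn xs) (zeval_dTn t0 sx); ring.
apply: (fps_mulI (fe1_neq0 R)); rewrite mulrCA h -(fB_eq R).
have e : fX R = (fe 1 - 1) * fB R by rewrite fB_eq.
ring.
Qed.

(** Taylor series of [zeta^(-1/2) theta], which is odd in [x]. *)
Definition theta_odd_taylor : fps R := fe (- 2^-1) * theta_taylor t.
(** By [theta_odd_taylor_euler] this is [X d/dX] of the logarithm of [theta_odd_taylor]; by
    [Lam_even] its coefficients are [B_2j E_2j / (2j)!]. *)
Definition Lam : fps R := fBe R - fX R * fL.

Lemma theta_odd_taylor_euler : fX R * fd theta_odd_taylor = Lam * theta_odd_taylor.
Proof.
rewrite /theta_odd_taylor fdM fd_fe mulrDr [X in _ + X]mulrCA theta_taylor_log_derivative /Lam /fBe fCN.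
have e : fC 2^-1 + fC 2^-1 = 1 :> fps R by rewrite -fCD -fC1; congr fC; field.
rewrite -[X in X + fB R - _]mul1r -e; ring.
Qed.

Lemma Lam0 : Lam 0%N = 1.
Proof. by rewrite /Lam faddE foppE fBe0 fXmE subr0. Qed.

Lemma Lam_odd j : Lam j.*2.+1 = 0.
Proof. by rewrite /Lam faddE foppE fXmE fL_even subr0 fBe_odd//= odd_double. Qed.

Lemma Lam_even j : Lam j.+1.*2 = fBe R j.+1.*2 * eisenstein j.+1.*2 t.
Proof.
have b0 := bernoulli_neq0 R j; have f0 := fact_neq0 R j.+1.*2.
rewrite /Lam faddE foppE doubleS fXmE fL_odd eisensteinE// mulrBr mulr1; congr (_ - _).
rewrite fBe_even /fB mulrA /=; congr (_ * _).
rewrite doubleS in b0 f0; move: f0.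
have -> : j.*2.+2`!%:R = j.*2.+2%:R * j.*2.+1`!%:R :> C by rewrite factS natrM.
rewrite mulf_eq0 negb_or => /andP[]; move: (j.*2.+2%:R) (j.*2.+1`!%:R) => a b a1 a2.
by field; rewrite a1 a2 b0.
Qed.

Lemma theta_odd_taylor_neq0 : theta_odd_taylor != 0.
Proof.
apply/eqP => /fps_mul_eq0[/(congr1 (@^~ 0%N))|]; last exact/eqP/theta_taylor_neq0.
by rewrite fe0 => /eqP; rewrite oner_eq0.
Qed.

Lemma fTt0 : theta_odd_taylor 0%N = 0. Proof. by rewrite /theta_odd_taylor coef_fmul0 fT0// mulr0. Qed.

Lemma theta_odd_taylor_coef n : n%:R * theta_odd_taylor n.+1 = \sum_(i < n.+1) Lam i.+1 * theta_odd_taylor (n - i)%N.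
Proof.
have := congr1 (@^~ n.+1) theta_odd_taylor_euler; rewrite fth_E fmulE big_ord_recl Lam0 mul1r subn0.
rewrite -natr1 mulrDl mul1r => e.
by apply: (addIr (theta_odd_taylor n.+1)); rewrite e addrC.
Qed.

(** The recurrence [theta_odd_taylor_coef] would propagate a vanishing first coefficient to all
    others. *)
Lemma fTt1_neq0 : theta_odd_taylor 1 != 0.
Proof.
apply/eqP => h; have /eqP[] := theta_odd_taylor_neq0; apply: fpsP => n.
elim: n {-2}n (leqnn n) => [|m IH] n nm; first by move: nm; rewrite leqn0 => /eqP ->; exact: fTt0.
move: nm; rewrite leq_eqVlt => /orP[/eqP ->|]; last by rewrite ltnS => /IH.
case: m IH => [|m] IH; first exact: h.
apply: (mulfI (_ : m.+1%:R != 0)); first by rewrite pnatr_eq0.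
by rewrite theta_odd_taylor_coef mulr0 big1// => i _; rewrite IH ?mulr0// leq_subr.
Qed.

Lemma fTt3 : theta_odd_taylor 3 = eisenstein 2 t / 24 * theta_odd_taylor 1.
Proof.
have := theta_odd_taylor_coef 2; rewrite 3!big_ord_recl big_ord0 /= (Lam_odd 0) mul0r (Lam_even 0) fBe2 fTt0 mulr0.
rewrite addr0 addr0 add0r /bump /= => e.
by apply: (mulfI (_ : 2 != 0 :> C)); rewrite ?pnatr_eq0// e; field.
Qed.

Lemma fTt5 : theta_odd_taylor 5 = (eisenstein 2 t ^+ 2 / 1152 - eisenstein 4 t / 2880) * theta_odd_taylor 1.
Proof.
have := theta_odd_taylor_coef 4; rewrite !big_ord_recl big_ord0 /= (Lam_odd 0) (Lam_odd 1) (Lam_even 0) (Lam_even 1).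
rewrite fBe2 fBe4 fTt0 mulr0 !mul0r /bump /= fTt3 => e.
by apply: (mulfI (_ : 4 != 0 :> C)); rewrite ?pnatr_eq0// e; field.
Qed.

Let thw j (n : int) : C := (-1) ^ n * fe (n%:~R - 2^-1) j.

Lemma theta_odd_taylor_qsum j : theta_odd_taylor j = qsum (aT R) (thw j) t.
Proof.
have aj i : asum (fun n => theta_coef t n * fe (n%:~R : C) i).
  exact: (asum_expsum_coef (b := fun n : int => n%:~R) ltr01 (entire_exp 1 (entire_theta_coef t0))).
rewrite /theta_odd_taylor fmulE /theta_taylor.
rewrite (eq_bigr (fun i : 'I_j.+1 => tsum (fun n => fe (- 2^-1) i * (theta_coef t n * fe (n%:~R : C) (j - i)%N)))).
  rewrite -(@tsum_sum _ _ j.+1 (fun i n => fe (- 2^-1) i * (theta_coef t n * fe (n%:~R : C) (j - i)%N))).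
    rewrite /qsum; apply: eq_tsum => n; rewrite /thw -addrC -feM mulrAC fmulE mulr_sumr.
    by rewrite /theta_coef; apply: eq_bigr => i _; ring.
  by move=> i _; exact/asumZ/aj.
by move=> i _; rewrite (tsumZ _ (aj _)).
Qed.

End Fixed.

Let thw j (n : int) : C := (-1) ^ n * fe (n%:~R - 2^-1) j.

Lemma qsummable_thw j : qsummable (aT R) (thw j).
Proof.
apply: (qsummable_geom_summable (h := absz) (c := 1) (c' := 2) (K := 1) (j := j)) => //.
- exact: geom_summable_int.
- by move=> n; exact: aT_ge0.
- move=> n; rewrite mul1r /aT; set y : R := `|n|%N%:R.
  have y0 : 0 <= y by [].
  have : (n%:~R : R) = y \/ (n%:~R : R) = - y.
    by case: n @y y0 => n y _; [left|right; rewrite NegzE mulrNz].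
  by case=> ->; have := sqr_ge0 (y - 1); have := sqr_ge0 (y - 2); nra.
- move=> n; rewrite mul1r /thw nmM nm_signz mul1r /fe nmM nmX nmV nm_nat.
  rewrite ler_pdivrMr ?ltr0n ?fact_gt0//; apply: (@le_trans _ _ (`|n|%N.+1%:R ^+ j)).
    have h : nm (n%:~R - 2^-1) <= `|n|%N.+1%:R :> R.
      apply: le_trans (nmB _ _) _; rewrite nm_intr nmV nm_nat -(natr1 `|n|%N) lerD2l.
      by rewrite invf_le1// ler1n.
    by rewrite lerXn2r ?nnegrE ?nm_ge0.
  by rewrite ler_peMr ?exprn_ge0// ler1n fact_gt0.
Qed.

(** The heat equation of theta on Taylor coefficients, from
    [n (n - 1) / 2 = ((n - 1/2)^2 - 1/4) / 2]. *)
Lemma D_theta_odd_taylor j t : 0 < Im t ->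
  D (qsum (aT R) (thw j)) t = 2^-1 * (j.+1%:R * j.+2%:R * qsum (aT R) (thw j.+2) t
     - 4^-1 * qsum (aT R) (thw j) t).
Proof.
move=> t0; rewrite qsum_D//; last exact: qsummable_thw.
rewrite -(esZ _ (qsummable_thw _) t0) -(esZ _ (qsummable_thw _) t0) /qsum.
have ok1 := esokZ (j.+1%:R * j.+2%:R) (qsummable_thw j.+2); have ok2 := esokZ 4^-1 (qsummable_thw j).
rewrite -(tsumB (qsum_asum ok1 t0) (qsum_asum ok2 t0)).
have a3 : asum (fun n => j.+1%:R * j.+2%:R * thw j.+2 n * ee ((aT R n)%:C * t) -
    4^-1 * thw j n * ee ((aT R n)%:C * t)).
  apply: asum_eq (asumD (qsum_asum ok1 t0) (asumZ (-1) (qsum_asum ok2 t0))) => n.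
  by rewrite mulN1r.
rewrite -(tsumZ _ a3); apply: eq_tsum => n.
have -> : (aT R n)%:C = 2^-1 * ((n%:~R - 2^-1) ^+ 2 - 4^-1) :> C.
  have -> : n%:~R = (n%:~R : R)%:C by rewrite rmorph_int.
  have -> : (2^-1 : C) = (2^-1 : R)%:C by rewrite fmorphV rmorph_nat.
  have -> : (4^-1 : C) = (4^-1 : R)%:C by rewrite fmorphV rmorph_nat.
  by rewrite -!(rmorphB, rmorphXn, rmorphM) /aT; congr (_%:C); field.
rewrite /thw; set y := n%:~R - 2^-1.
have e : j.+1%:R * j.+2%:R * fe y j.+2 = y ^+ 2 * fe y j :> C.
  rewrite /fe !factS !natrM; have a := fact_neq0 R j.
  have b : j.+1%:R != 0 :> C by rewrite pnatr_eq0.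
  have c : j.+2%:R != 0 :> C by rewrite pnatr_eq0.
  move: a b c; set A := j`!%:R; set B := j.+1%:R; set D := j.+2%:R => a b c.
  have -> : y ^+ j.+2 = y ^+ 2 * y ^+ j by rewrite -exprD.
  rewrite !invfM; transitivity (B / B * (D / D) * (y ^+ 2 * (y ^+ j / A))); first ring.
  by rewrite !mulfV// !mul1r.
rewrite [_ * ((-1) ^ n * fe y j.+2)]mulrCA e; ring.
Qed.

(** The third Taylor coefficient of theta is [E2 / 24] times the first. Applying [D] to this
    relation, the heat equation replaces the derivatives by the third and fifth coefficients, the
    latter containing [E4], and [D E2] can be read off. *)
Lemma ramanujan t : 0 < Im t ->
  D (@eisenstein R 2) t = (eisenstein 2 t ^+ 2 - eisenstein 4 t) / 12.
Proof.
move=> t0; pose m j := qsum (aT R) (thw j).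
have mE j s : 0 < Im s -> m j s = theta_odd_taylor s j by move=> s0; rewrite theta_odd_taylor_qsum.
have dm j : diff (m j) t by apply: smooth_diff t0; apply: qsum_smooth; exact: qsummable_thw.
have dE := smooth_diff (eisenstein_smooth 2) t0.
have e3 : eqH (m 3) (fun s => 24^-1 * (eisenstein 2 s * m 1 s)).
  by move=> s s0; rewrite !mE// fTt3//; field.
have := D_theta_odd_taylor 3 t0; have D1 := D_theta_odd_taylor 1 t0; rewrite -/(m 1) in D1.
rewrite -/(m 3) (D_eqH (fun s s0 => smooth_diff (qsum_smooth (qsummable_thw 3)) s0) e3 t0).
rewrite (DZ _ (diffM dE (dm 1))) (DM dE (dm 1)) D1 -/(m 3) -/(m 5) !mE// fTt3// fTt5//.
have := fTt1_neq0 t0; set a := theta_odd_taylor t 1; set e2 := eisenstein 2 t; set e4 := eisenstein 4 t.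
set d := D _ t => a0 h; apply: (mulIf a0).
apply: (mulfI (_ : 24^-1 != 0 :> C)); first by rewrite invr_eq0 pnatr_eq0.
transitivity (24^-1 * (d * a + e2 * (2^-1 * (2 * 3 * (e2 / 24 * a) - 4^-1 * a))) -
  24^-1 * (e2 * (2^-1 * (2 * 3 * (e2 / 24 * a) - 4^-1 * a)))); first ring.
by rewrite h; field.
Qed.

End EisensteinSeries.

(** * Expansion at 0 of [e^(b x) / (1 - e^x)] and of its derivatives *)

Section GeometricSums.
Variable R : realType.
Local Notation C := R[i].

(** Division by a function with a simple zero: the expansion of the product is used to one order
    more, since dividing by [g] loses one power of [x]. *)
Lemma asym_div (S : set R) (f g : R -> C) (s r : fps R) : asym S g r -> r 0%N = 0 ->
  r 1%N != 0 -> asym S (fun x => g x * f x) (r * s) -> asym S f s.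
Proof.
move=> ag r0 r1 afg N.
pose u : fps R := \sum_(j < N) fX R ^+ j * fC (s j).
have ap : asym S (fun x => \sum_(j < N) x%:C ^+ j * s j) u.
  by apply: (asym_sum (F := fun j x => x%:C ^+ j * s j) (s := fun j => fX R ^+ j * fC (s j))) =>
    j _; exact: asymM (asymX j (asym_id S)) (asym_cst S _).
have [K [e [e0 hK]]] := asymB afg (asymM ag ap) N.+1.
have [K2 [e2 [e20 hK2]]] := ag 2%N.
have rho0 : 0 < nm (r 1%N) by rewrite lt_neqAle nm_ge0 andbT eq_sym nm_eq0.
set rho := nm (r 1%N) in rho0; have k1 : 0 < `|K2| + 1 by rewrite ltr_wpDl.
exists (2 * K / rho), (Num.min e (Num.min e2 (rho / 2 / (`|K2| + 1)))); split.
  by rewrite !lt_min e0 e20 !divr_gt0.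
move=> x Sx x0; rewrite !le_min => /and3P[xe xe2 xr].
have z n : (n < N.+1)%N -> (r * s - r * u) n = 0.
  move=> nN; rewrite -mulrBr fmulE big1// => i _; case: i => [[|i] /= ip]; first by rewrite r0 mul0r.
  suff -> : (s - u) (n - i.+1)%N = 0 by rewrite mulr0.
  have mN : (n - i.+1 < N)%N by lia.
  rewrite faddE foppE /u fsumE (bigD1 (Ordinal mN))//= fXnmE ltnn subnn big1 ?addr0 ?subrr// => j jm.
  rewrite fXnmE; case: ltnP => // mj; rewrite /fC; case: eqP => // e1.
  case/eqP: jm; apply/val_inj => /=; lia.
have h1 := hK x Sx x0 xe; rewrite [X in _ - X]big1 ?subr0 in h1; last by move=> j _; rewrite z ?mul0r.
have h2 := hK2 x Sx x0 xe2; rewrite !big_ord_recl big_ord0 /= expr0 expr1 r0 mul0r add0r addr0 in h2.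
rewrite -mulrBr nmM in h1.
have x1 : 0 < `|x| by rewrite normr_gt0.
(* [g x] is [r 1 * x] up to [O(x^2)], and the last constraint on [x] makes that error at most half
   of the main term. *)
have h3 : rho / 2 * `|x| <= nm (g x).
  have : nm (r 1%N * x%:C) <= nm (g x) + nm (g x - r 1%N * x%:C).
    by rewrite nmBC -{1}(subrK (g x) (r 1%N * x%:C)) [leRHS]addrC nmD.
  rewrite nmM nm_real -/rho => h4.
  have h5 : K2 * `|x| ^+ 2 <= rho / 2 * `|x|.
    rewrite expr2 mulrA ler_wpM2r ?(ltW x1)//.
    have : `|x| * (`|K2| + 1) <= rho / 2 by rewrite -ler_pdivlMr.
    have := ler_norm K2; have := ltW x1; nra.
  lra.
set q := nm _ in h1 *; rewrite (_ : \sum_(j < N) s j * x%:C ^+ j = \sum_(j < N) x%:C ^+ j * s j); last first.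
  by apply: eq_bigr => j _; rewrite mulrC.
have q0 := nm_ge0 (f x - \sum_(j < N) x%:C ^+ j * s j).
have h4 : rho / 2 * `|x| * nm (f x - \sum_(j < N) x%:C ^+ j * s j) <= K * `|x| ^+ N.+1.
  by apply: le_trans (ler_wpM2r q0 h3) h1.
rewrite -(ler_pM2l (_ : 0 < rho / 2 * `|x|)) ?mulr_gt0// ?invr_gt0//.
by rewrite (le_trans h4)// exprS le_eqVlt; apply/orP; left; apply/eqP; field; rewrite gt_eqF.
Qed.

Lemma pascal_sum (V : comPzRingType) (a : nat -> V) i :
  \sum_(k < i.+2) 'C(i.+1, k)%:R * a k = \sum_(k < i.+1) 'C(i, k)%:R * (a k + a k.+1).
Proof.
rewrite (eq_bigr (fun k : 'I_i.+1 => 'C(i, k)%:R * a k + 'C(i, k)%:R * a k.+1)); last first.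
  by move=> k _; rewrite mulrDr.
rewrite big_split /= big_ord_recl bin0.
rewrite (eq_bigr (fun k : 'I_i.+1 => 'C(i, k.+1)%:R * a k.+1 + 'C(i, k)%:R * a k.+1)); last first.
  by move=> k _; rewrite -mulrDl -natrD.
rewrite big_split /= addrA; congr (_ + _).
have := @big_ord_recl V 0 +%R i.+1 (fun k : 'I_i.+2 => 'C(i, k)%:R * a k).
rewrite /= bin0 => <-; rewrite big_ord_recr /= bin_small// mul0r addr0.
by apply: eq_bigr.
Qed.

Variable b : C.

(* The Laurent expansion of [exp (b x) / (1 - exp x)]. *)
Definition geo_laurent : int -> C := lau 1 (- (fB R * fe b)).

Lemma serD m n (c : int -> C) : supp n c -> ser (m + n) c = fX R ^+ m * ser n c.
Proof.
move=> sc; elim: m => [|m IH]; first by rewrite mul1r.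
by rewrite addSn serS ?IH ?exprS ?mulrA//; apply: suppW sc; rewrite leq_addl.
Qed.

Lemma geo_laurent_supp i : supp i.+1 (iter i (@ld R) geo_laurent).
Proof. by elim: i => [|i IH]; [exact: lau_supp|exact: ld_supp]. Qed.

(** The Leibniz rule applied [i] times to [g = e^x g + e^(b x)], where [g = e^(b x) / (1 - e^x)]. *)
Lemma geo_laurent_rec N i : (i < N)%N -> ser N (iter i (@ld R) geo_laurent) =
  fe 1 * (\sum_(k < i.+1) 'C(i, k)%:R * ser N (iter k (@ld R) geo_laurent)) +
  fC (b ^+ i) * fX R ^+ N * fe b.
Proof.
pose s k := ser N (iter k (@ld R) geo_laurent); rewrite -!/(s _).
have sS k : (k.+1 < N)%N -> fX R * s k.+1 = fX R * fd (s k) - fC N%:R * s k.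
  by move=> kN; rewrite -ser_ld -serS//; apply: suppW kN _; exact: geo_laurent_supp.
elim: i => [|i IH] iN.
  have s0 : s 0%N = fX R ^+ N.-1 * - (fB R * fe b).
    by rewrite /s /= -{1}(prednK iN) -addn1 serD ?lauK//; exact: lau_supp.
  rewrite big_ord_recl big_ord0 bin0 mul1r addr0 -/(s 0%N) expr0 fC1 mul1r s0.
  have -> : fX R ^+ N = fX R ^+ N.-1 * fX R by rewrite -exprSr prednK.
  rewrite -[in X in _ * X * _](fB_eq R); ring.
apply: (fps_mulI (fX_neq0 R)); rewrite sS//.
rewrite [X in _ * fd X - _]IH ?[X in _ - _ * X]IH ?(ltnW iN)//.
rewrite (eq_bigr (fun k : 'I_i.+1 => 'C(i, k)%:R * s k))//.
set M := \sum_(k < i.+1) 'C(i, k)%:R * s k.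
have fM : fX R * fd M - fC N%:R * M = fX R * \sum_(k < i.+1) 'C(i, k)%:R * s k.+1.
  rewrite /M; pose H k := 'C(i, k)%:R * s k.
  have fds n : fd (\sum_(k < n) H k) = \sum_(k < n) fd (H k).
    elim: n => [|n IHn]; last by rewrite !big_ord_recr /= fdD IHn.
    by rewrite !big_ord0 -(fC0 R) fdC fC0.
  rewrite (fds i.+1) !mulr_sumr -sumrB; apply: eq_bigr => k _.
  have kN : (k.+1 < N)%N by apply: leq_ltn_trans iN; exact: ltn_ord.
  rewrite /H -fCnat fdCm mulrCA [X in _ - X]mulrCA -mulrBr -sS//; ring.
rewrite (eq_bigr (fun k : 'I_i.+2 => 'C(i.+1, k)%:R * s k))// pascal_sum.
rewrite (eq_bigr (fun k : 'I_i.+1 => 'C(i, k)%:R * s k + 'C(i, k)%:R * s k.+1)); last first.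
  by move=> k _; rewrite mulrDr.
rewrite big_split /= -/M fdD !fdM fd_fe fC1 mul1r fdC mul0r add0r fd_fe exprSr fCM.
have fXN : fX R * fd (fX R ^+ N) = fC N%:R * fX R ^+ N.
  by rewrite -(prednK (leq_ltn_trans (leq0n _) iN)) fdXn fdX mulr1 exprS -fCnat; ring.
set P := \sum_(k < i.+1) 'C(i, k)%:R * s k.+1 in fM *.
transitivity (fX R * fe 1 * M + fe 1 * (fX R * fd M - fC N%:R * M) +
  fC (b ^+ i) * fe b * (fX R * fd (fX R ^+ N) - fC N%:R * fX R ^+ N) +
  fX R * (fC (b ^+ i) * fC b * fX R ^+ N * fe b)); first by ring.
by rewrite fM fXN subrr mulr0 addr0; ring.
Qed.

(** The [i]-th derivative of the geometric series [\sum_a e^((a + b) x)], convergent for [x < 0]. *)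
Definition geoV i (x : R) : C := tsum (fun a : nat => (a%:R + b) ^+ i * cexp (x%:C * (a%:R + b))).

Lemma asum_geoV i x : x < 0 ->
  asum (fun a : nat => (a%:R + b) ^+ i * cexp (x%:C * (a%:R + b))).
Proof.
move=> x0; have s1 : 1 < expR (- x / 2) by rewrite expR_gt1 divr_gt0// oppr_gt0.
have [K K0 hK] := poly_geo i s1.
have r01 : 0 < expR (x / 2) < 1.
  by rewrite expR_gt0 -expR0 ltr_expR pmulr_llt0// invr_gt0.
apply: (asum_geom_summable (K := (1 + nm b) ^+ i * (K * expR (- x / 2)) * nm (cexp (x%:C * b))) (@geom_summable_nat R) r01).
move=> a; rewrite nmM mulrDr cexpD nmM nmX.
have -> : nm (cexp (x%:C * a%:R)) = expR (x / 2) ^+ a * expR (x / 2) ^+ a.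
  by rewrite mulrC cexpMn nmX cexp_real nm_real ger0_norm ?expR_ge0// -exprMn -expRD -splitr.
have h : nm (a%:R + b) ^+ i <= (1 + nm b) ^+ i * (K * expR (- x / 2) * expR (- x / 2) ^+ a).
  apply: (@le_trans _ _ ((1 + nm b) ^+ i * a.+1%:R ^+ i)).
    rewrite -exprMn lerXn2r ?nnegrE ?nm_ge0 ?mulr_ge0 ?addr_ge0 ?nm_ge0//.
    apply: le_trans (nmD _ _) _; rewrite nm_nat -natr1.
    have := nm_ge0 b; have : 0 <= a%:R :> R by []; nra.
  by rewrite ler_wpM2l ?exprn_ge0 ?addr_ge0 ?nm_ge0// -mulrA -exprS.
have E : expR (- x / 2) ^+ a * expR (x / 2) ^+ a = 1.
  by rewrite -exprMn -expRD mulNr addNr expR0 expr1n.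
set p := expR (x / 2) ^+ a in E *; have p0 : 0 <= p by rewrite exprn_ge0 ?expR_ge0.
have h' := ler_wpM2r (mulr_ge0 (mulr_ge0 p0 p0) (nm_ge0 (cexp (x%:C * b)))) h.
rewrite mulrA in h'; rewrite mulrA; apply: le_trans h' _.
rewrite le_eqVlt; apply/orP; left; apply/eqP.
set Q := nm (cexp _); set B := (1 + nm b) ^+ i; set e := expR (- x / 2) in E *.
by transitivity (B * (K * e) * Q * p * (e ^+ a * p)); [ring|rewrite E mulr1].
Qed.

Lemma geoV_rec i x : x < 0 -> geoV i x =
  cexp x%:C * (\sum_(k < i.+1) 'C(i, k)%:R * geoV k x) + b ^+ i * cexp (x%:C * b).
Proof.
move=> x0; have aV k := asum_geoV k x0.
pose f (a : nat) := (a%:R + b) ^+ i * cexp (x%:C * (a%:R + b)).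
have e (a : nat) : f a.+1 =
    cexp x%:C * \sum_(k < i.+1) 'C(i, k)%:R * ((a%:R + b) ^+ k * cexp (x%:C * (a%:R + b))).
  rewrite /f -natr1 addrAC mulrDr mulr1 cexpD addrC exprDn mulr_sumr mulr_suml.
  by apply: eq_bigr => k _; rewrite expr1n mul1r -mulr_natl; ring.
have aS : asum (fun a => f a.+1).
  apply: asum_eq (fun a => esym (e a)) _; apply: asumZ.
  apply: (@asum_sum _ _ i.+1 (fun k a => 'C(i, k)%:R * ((a%:R + b) ^+ k * cexp (x%:C * (a%:R + b))))).
  by move=> k _; exact/asumZ/aV.
have -> : geoV i x = tsum f by [].
have [_ ->] := tsum_natS aS; rewrite {1}/f add0r [RHS]addrC; congr (_ + _).
rewrite (eq_tsum e) tsumZ; last first.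
  apply: (@asum_sum _ _ i.+1 (fun k a => 'C(i, k)%:R * ((a%:R + b) ^+ k * cexp (x%:C * (a%:R + b))))).
  by move=> k _; exact/asumZ/aV.
congr (_ * _); rewrite (@tsum_sum _ _ _ (fun k a => 'C(i, k)%:R *
  ((a%:R + b) ^+ k * cexp (x%:C * (a%:R + b))))); last by move=> k _; exact/asumZ/aV.
by apply: eq_bigr => k _; rewrite (tsumZ _ (aV k)).
Qed.

(** An asymptotic expansion cannot simply be differentiated. Instead the functions and the formal
    derivatives obey the same recurrence, which gives the [i]-th from the earlier ones after
    division by [1 - e^x]. *)
Lemma asym_geoV N i : (i < N)%N ->
  asym [set x | x < 0] (fun x => x%:C ^+ N * geoV i x) (ser N (iter i (@ld R) geo_laurent)).
Proof.
elim/ltn_ind: i => i IH iN; set S := [set x | x < 0].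
have aE : asym S (fun x => cexp x%:C) (fe 1).
  by apply: asym_eq ltr01 _ (asym_cexp S 1) => x _ _ _; rewrite mulr1.
have aE1 : asym S (fun x => 1 - cexp x%:C) (1 - fe 1).
  by have := asymB (asym_cst S 1) aE; rewrite fC1.
apply: (asym_div aE1); first by rewrite faddE foppE foneE fe0 subrr.
  by rewrite faddE foppE foneE /= sub0r oppr_eq0 /fe expr1 (_ : 1`!%N = 1%N)// divr1 oner_eq0.
have h : (1 - fe 1) * ser N (iter i (@ld R) geo_laurent) =
    fe 1 * (\sum_(k < i) fC 'C(i, k)%:R * ser N (iter k (@ld R) geo_laurent)) +
    fC (b ^+ i) * (fX R ^+ N * fe b).
  rewrite mulrBl mul1r {1}(geo_laurent_rec iN) big_ord_recr /= binn mul1r.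
  rewrite (eq_bigr (fun k : 'I_i => fC 'C(i, k)%:R * ser N (iter k (@ld R) geo_laurent))).
    ring.
  by move=> k _; rewrite fCnat.
rewrite h; have aS : asym S (fun x => \sum_(k < i) 'C(i, k)%:R * (x%:C ^+ N * geoV k x))
    (\sum_(k < i) fC 'C(i, k)%:R * ser N (iter k (@ld R) geo_laurent)).
  apply: (asym_sum (F := fun k x => 'C(i, k)%:R * (x%:C ^+ N * geoV k x))
    (s := fun k => fC 'C(i, k)%:R * ser N (iter k (@ld R) geo_laurent))) => k ki.
  by apply: asymZ; apply: IH => //; exact: ltn_trans ki iN.
have := asymD (asymM aE aS) (asymZ (b ^+ i) (asymM (asymX N (asym_id S)) (asym_cexp S b))).
apply: asym_eq ltr01 _ => x /= x0 _ _.
rewrite mulrBl mul1r {1}(geoV_rec i x0) big_ord_recr /= binn mul1r.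
rewrite (_ : \sum_(k < i) 'C(i, k)%:R * (x%:C ^+ N * geoV k x) =
   x%:C ^+ N * \sum_(k < i) 'C(i, k)%:R * geoV k x); first by ring.
by rewrite mulr_sumr; apply: eq_bigr => k _; ring.
Qed.

End GeometricSums.

(** * Terms of the Appell function and the action of [Delta] on them *)

Section AppellIndex.
Variables (R : realType) (d : nat).
Local Notation C := R[i].
Local Notation Im := (@complex.Im R).
Local Notation l := (d.*2.+1).
Local Notation lr := (l%:R : R).

(* The Appell function is [zeta^(l/2) / (1 - zeta)] plus the sum over this index type of
   [jsg * q^ja * zeta^jb]; [inl] and [inr] collect the terms of its defining series with positive and
   negative index.  The heat operator multiplies the term by [jy ^ 2 = jb ^ 2 + 2 * l * ja]. *)
Definition Jt : choiceType := ((nat * nat) + (nat * nat))%type.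

Definition jb (j : Jt) : R := match j with
  | inl p => p.1%:R + lr / 2 | inr p => - p.1.+1%:R + lr / 2 end.
Definition jm (j : Jt) : R := match j with inl p => p.2.+1%:R | inr p => - p.2.+1%:R end.
Definition jy j := jb j + lr * jm j.
Definition ja j := jm j * jb j + lr * jm j ^+ 2 / 2.
Definition jsg (j : Jt) : C := match j with inl p => (-1) ^+ p.2.+1 | inr p => (-1) ^+ p.2 end.
Definition jh (j : Jt) : nat := match j with inl p => (p.1 + p.2)%N | inr p => (p.1 + p.2)%N end.

Lemma lr_ge1 : 1 <= lr. Proof. by rewrite ler1n. Qed.

Lemma jy_sqr j : jy j ^+ 2 = jb j ^+ 2 + 2 * lr * ja j.
Proof. by rewrite /jy /ja; field. Qed.

Lemma ja_ge j : (jh j)%:R <= ja j.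
Proof.
have := lr_ge1; rewrite /ja; case: j => -[a N] /=; rewrite natrD -?(natr1 a) -?(natr1 N);
have : 0 <= a%:R :> R by []; have : 0 <= N%:R :> R by [];
by set x := a%:R; set y := N%:R; set z := lr; nra.
Qed.

Lemma ja_ge0 j : 0 <= ja j. Proof. exact: le_trans (ler0n _ _) (ja_ge j). Qed.

Lemma geom_summable_jh : geom_summable R jh.
Proof.
move=> r r01; have h := geom_summable_pair (@geom_summable_nat R) (@geom_summable_nat R).
by have := geom_summable_sumt h h r01; apply: asum_eq; case.
Qed.

Lemma jb_le j : `|jb j| <= 3 * lr * (jh j).+1%:R.
Proof.
have := lr_ge1; rewrite /jy; case: j => -[a N] /=;
rewrite -?(natr1 (a + N)) natrD -?(natr1 a) -?(natr1 N);
have : 0 <= a%:R :> R by []; have : 0 <= N%:R :> R by [];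
by set x := a%:R; set y := N%:R; set z := lr => *; rewrite ler_norml; apply/andP; split; nra.
Qed.

Lemma jy_le j : `|jy j| <= 3 * lr * (jh j).+1%:R.
Proof.
have := lr_ge1; rewrite /jy; case: j => -[a N] /=;
rewrite -?(natr1 (a + N)) natrD -?(natr1 a) -?(natr1 N);
have : 0 <= a%:R :> R by []; have : 0 <= N%:R :> R by [];
by set x := a%:R; set y := N%:R; set z := lr => *; rewrite ler_norml; apply/andP; split; nra.
Qed.

Lemma nm_jsg j : nm (jsg j) = 1.
Proof. by case: j => -[a N]; rewrite /jsg nmX nmN nm1 expr1n. Qed.

Lemma qsummable_jt i m : qsummable ja (fun j => jsg j * (jy j)%:C ^+ i * (jb j)%:C ^+ m).
Proof.
apply: (qsummable_geom_summable (h := jh) (c := 1) (c' := 0) (K := (3 * lr) ^+ (i + m)) (j := (i + m)%N)) => //.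
- exact: geom_summable_jh.
- exact: ja_ge0.
- by move=> j; rewrite mul1r subr0 ja_ge.
move=> j; rewrite !nmM nm_jsg mul1r !nmX !nm_real -exprMn exprD.
by rewrite ler_pM ?exprn_ge0// lerXn2r ?nnegrE ?jb_le ?jy_le// !mulr_ge0.
Qed.

Definition jw i m (j : Jt) : C := jsg j * (jy j)%:C ^+ i * fe (jb j)%:C m.

Lemma qsummable_jw i m : qsummable ja (jw i m).
Proof.
have [h1 h2] := esokZ (m`!%:R)^-1 (qsummable_jt i m); split=> // y y0.
by apply: asum_eq (h2 y y0) => j; rewrite /jw /fe; congr (_ * _); ring.
Qed.

(** The image of the Appell function under [Delta^i]: on the polar part [Delta] is the second
    derivative, and each remaining term is multiplied by [jy ^ 2]. *)
Definition appell_iter i : laurent R := fun n t =>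
  iter i.*2 (@ld R) (geo_laurent (l%:R / 2)) n + (if n is Posz m then qsum ja (jw i.*2 m) t else 0).

Lemma appell_iter_has_partials i n t : 0 < Im t -> diff (appell_iter i n) t.
Proof.
move=> t0; apply: diffD; first exact: diff_cst.
by case: n => m; [exact: has_partials_diff (qsum_has_partials (qsummable_jw _ _) t0)|exact: diff_cst].
Qed.

Lemma appell_iter_supp i : lsupp i.*2.+1 (appell_iter i).
Proof.
move=> t n ni; rewrite /appell_iter (@geo_laurent_supp R (l%:R / 2) i.*2 n ni) add0r.
by case: n ni => // m; lia.
Qed.

Lemma appell_iter_heat i n t : 0 < Im t ->
  Defs.lder (Defs.lder (appell_iter i)) n t + 2 * l%:R * D (appell_iter i n) t = appell_iter i.+1 n t.
Proof.
move=> t0; have dK : diff (fun=> iter i.*2 (@ld R) (geo_laurent (l%:R / 2)) n) t := diff_cst _ t.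
rewrite /Defs.lder /appell_iter.
have -> : iter i.+1.*2 (@ld R) (geo_laurent (l%:R / 2)) n = (n + 1)%:~R * ((n + 1 + 1)%:~R *
   iter i.*2 (@ld R) (geo_laurent (l%:R / 2)) (n + 1 + 1)) by rewrite doubleS.
have e2 : D (fun s => iter i.*2 (@ld R) (geo_laurent (l%:R / 2)) n +
      (if n is Posz m then qsum ja (jw i.*2 m) s else 0)) t =
    (if n is Posz m then qsum ja (fun j => (ja j)%:C * jw i.*2 m j) t else 0).
  rewrite DD//; last by case: n {dK} => m; [exact: has_partials_diff (qsum_has_partials (qsummable_jw _ _) t0)|exact: diff_cst].
  rewrite D_cst add0r; case: n {dK} => m; last by rewrite D_cst.
  by rewrite qsum_D//; exact: qsummable_jw.
rewrite e2 !mulrDr -addrA; congr (_ + _).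
case: n {dK e2} => m; last first.
  rewrite mulr0 addr0; case: m => [|[|m]]; rewrite ?mul0r ?mulr0//.
have -> : (m%:Z + 1 + 1 = m.+2%:Z)%R by lia.
have -> : (m%:Z + 1)%:~R = m.+1%:R :> C by rewrite -[m%:Z + 1]/((m + 1)%N%:Z) addn1 -pmulrn.
rewrite -pmulrn.
have ok1 := esokZ (m.+1%:R * m.+2%:R) (qsummable_jw i.*2 m.+2).
have ok2 := esokZ (2 * l%:R) (esokM (qsummable_jw i.*2 m)).
have -> : m.+1%:R * (m.+2%:R * qsum ja (jw i.*2 m.+2) t) =
   qsum ja (fun j => m.+1%:R * m.+2%:R * jw i.*2 m.+2 j) t.
  by rewrite (esZ _ (qsummable_jw _ _) t0) mulrA.
rewrite -(esZ _ (esokM (qsummable_jw _ _)) t0) /qsum -(tsumD (qsum_asum ok1 t0) (qsum_asum ok2 t0)).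
apply: eq_tsum => j; rewrite -mulrDl; congr (_ * _).
rewrite /jw doubleS -(addn2 i.*2) exprD -(rmorphXn _ 2 (jy j)) jy_sqr.
have -> : fe (jb j)%:C m.+2 = (jb j)%:C ^+ 2 * fe (jb j)%:C m / (m.+1%:R * m.+2%:R).
  have f1 : m.+1%:R != 0 :> C by rewrite pnatr_eq0.
  have f2 : m.+2%:R != 0 :> C by rewrite pnatr_eq0.
  have f3 := fact_neq0 R m.
  rewrite /fe !factS !natrM !exprS; field.
  by rewrite nat1r -(natrD _ 2) add2n f1 f2 f3.
have f1 : m.+1%:R != 0 :> C by rewrite pnatr_eq0.
have f2 : m.+2%:R != 0 :> C by rewrite pnatr_eq0.
have hX : (jb j ^+ 2 + 2 * l%:R * ja j)%:C = (jb j)%:C ^+ 2 + 2 * l%:R * (ja j)%:C.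
  by rewrite expr2 rmorphD !rmorphM !rmorph_nat -expr2.
rewrite [X in _ = _ * (_ * X) * _]hX; field.
by rewrite nat1r -(natrD _ 2) add2n f1 f2.
Qed.

End AppellIndex.

(** * Unary theta series, and the image [B] of the Appell function at fixed [t] *)

Section ThetaCosets.
Variables (R : realType) (d : nat).
Local Notation C := R[i].
Local Notation Im := (@complex.Im R).
Local Notation l := (d.*2.+1).
Local Notation lr := (l%:R : R).

Definition vy (s N : int) : R := s%:~R + lr / 2 + lr * N%:~R.
Definition vta (s N : int) : R := vy s N ^+ 2 / (2 * lr).
Definition vtw i (s N : int) : C := (-1) ^ N * (vy s N)%:C ^+ i.
(** The alternating theta series of the coset [s + l/2 + l Z] with exponent [y^2 / (2 l)]. Up to
    sign it depends only on the class of [s] modulo [l] and modulo [s -> - s]; the cases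
    [s = 1, ..., d] are the entries of [Hvec] up to a constant. *)
Definition coset_theta (s : int) : C -> C := qsum (vta s) (vtw 0 s).

Lemma vta_ge0 s N : 0 <= vta s N.
Proof. by rewrite divr_ge0 ?sqr_ge0// mulr_ge0. Qed.

Lemma qsummable_coset_theta i s : qsummable (vta s) (vtw i s).
Proof.
have l1 := @lr_ge1 R d.
set c := `|s%:~R + lr / 2|; have c0 : 0 <= c := normr_ge0 _.
apply: (qsummable_geom_summable (h := absz) (c := 1) (c' := c + lr / 2) (K := (c + lr) ^+ i) (j := i)) => //.
- exact: geom_summable_int.
- exact: vta_ge0.
- move=> N; rewrite mul1r; have e : `|N|%N%:R = `|N%:~R| :> R by rewrite natr_absz intr_norm.
  have h1 : lr * `|N%:~R| <= `|vy s N| + c.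
    have -> : lr * `|N%:~R : R| = `|vy s N - (s%:~R + lr / 2)|.
      by rewrite /vy addrAC subrr add0r normrM ger0_norm.
    exact: ler_normB.
  have h2 : `|vy s N| <= vta s N + lr / 2.
    have l0 : 0 < 2 * lr by rewrite mulr_gt0.
    rewrite -(ler_pM2l l0) mulrDr /vta [2 * lr * (_ / _)]mulrC divfK ?gt_eqF//.
    rewrite -(real_normK (num_real (vy s N))); have := sqr_ge0 (`|vy s N| - lr); nra.
  have : `|N%:~R : R| <= lr * `|N%:~R| by rewrite ler_peMl.
  rewrite e; lra.
move=> N; rewrite /vtw nmM nm_signz mul1r nmX nm_real -exprMn lerXn2r ?nnegrE ?mulr_ge0 ?addr_ge0//.
have e : `|N|%N%:R = `|N%:~R| :> R by rewrite natr_absz intr_norm.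
have : `|vy s N| <= c + lr * `|N%:~R|.
  by apply: le_trans (ler_normD _ _) _; rewrite lerD2l normrM ger0_norm.
rewrite -(natr1 `|N|%N) e; have : 0 <= `|N%:~R : R| by []; nra.
Qed.

Lemma coset_theta_smooth s : smooth (coset_theta s). Proof. exact: qsum_smooth (qsummable_coset_theta 0 s). Qed.

Lemma coset_theta_iterD i s t : 0 < Im t ->
  (2 * l%:R) ^+ i * iter i (@D R) (coset_theta s) t = qsum (vta s) (vtw i.*2 s) t.
Proof.
have smi k : smooth (iter k (@D R) (coset_theta s)) by elim: k => [|k IH]; [exact: coset_theta_smooth|exact: smooth_D].
elim: i t => [|i IH] t t0; first by rewrite mul1r.
rewrite exprS -mulrA iterS -(DZ ((2 * l%:R) ^+ i) (smooth_diff (smi i) t0)).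
rewrite (D_eqH (g := qsum (vta s) (vtw i.*2 s)) _ _ t0) => [|u u0|u u0]; first last.
- exact: IH.
- exact: diffZ (smooth_diff (smi i) u0).
rewrite (qsum_D (qsummable_coset_theta _ _) t0) -(esZ _ (esokM (qsummable_coset_theta _ _)) t0); apply: qsum_eq => N.
have l0 : (l%:R : C) != 0 by rewrite pnatr_eq0.
have e : (vta s N)%:C = (vy s N)%:C ^+ 2 / (2 * l%:R).
  by rewrite /vta fmorph_div (rmorphXn _ 2) rmorphM !rmorph_nat.
by rewrite e /vtw doubleS -(addn2 i.*2) exprD; field.
Qed.

Section Fixed.
Variables (t : C) (pc : nat -> C).
Hypotheses (t0 : 0 < Im t) (pcd : pc d = 1).
Hypothesis ann : forall s, \sum_(i < d.+1) pc i * qsum (vta s) (vtw i.*2 s) t = 0.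

Let P (y : C) : C := \sum_(i < d.+1) pc i * y ^+ i.*2.
Let b : C := l%:R / 2.

Let wP (s N : int) : C := (-1) ^ N * P (vy s N)%:C * ee ((vta s N)%:C * t).

Let wPE s N : wP s N = \sum_(i < d.+1) pc i * (vtw i.*2 s N * ee ((vta s N)%:C * t)).
Proof.
rewrite /wP /P mulr_sumr mulr_suml; apply: eq_bigr => i _; rewrite /vtw; ring.
Qed.

Let asum_wP s : asum (wP s).
Proof.
apply: asum_eq (fun N => esym (wPE s N)) _.
apply: (@asum_sum _ _ d.+1 (fun i N => pc i * (vtw i.*2 s N * ee ((vta s N)%:C * t)))).
by move=> i _; apply: asumZ; exact: qsum_asum (qsummable_coset_theta _ _) t0.
Qed.

Let tsum_wP s : tsum (wP s) = 0.
Proof.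
rewrite (eq_tsum (wPE s)).
rewrite (@tsum_sum _ _ d.+1 (fun i N => pc i * (vtw i.*2 s N * ee ((vta s N)%:C * t)))); last first.
  by move=> i _; apply: asumZ; exact: qsum_asum (qsummable_coset_theta _ _) t0.
rewrite -[RHS](ann s); apply: eq_bigr => i _; rewrite tsumZ//; exact: qsum_asum (qsummable_coset_theta _ _) t0.
Qed.

Let bs s : C := tsum (fun N : nat => wP s N).
Let e0 s : C := ee ((vta s 0)%:C * t).
Let e0_neq0 s : e0 s != 0. Proof. exact: cexp_neq0. Qed.

(** The coefficient of [zeta^s] in [zeta^(- l / 2) B], as a half-range sum over the coset of [s].
    For negative [s] the Appell expansion runs over negative [N]; the annihilation [ann] converts
    that half into this one, so a single formula holds for all [s]. *)
Definition beta s : C := bs s / e0 s.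

Let wP_shift s N : wP (s + l%:Z) N = - wP s (N + 1).
Proof.
have e : vy (s + l%:Z) N = vy s (N + 1).
  by rewrite /vy intrD [(N + 1)%:~R]intrD -pmulrn; ring.
by rewrite /wP /vta e signzS !mulNr opprK.
Qed.

Let e0_shift s : e0 (s + l%:Z) = e0 s * qpow t (s + l%:Z).
Proof.
rewrite /e0 /qpow /ee -cexpD; congr cexp.
have -> : (vta (s + l%:Z) 0)%:C = (vta s 0)%:C + (s + l%:Z)%:~R :> C.
  rewrite -(rmorph_int (real_complex R)) -rmorphD; congr (_%:C).
  rewrite /vta /vy !intrD -!pmulrn /=; have : lr != 0 by rewrite pnatr_eq0.
  by set x := lr => x0; field.
ring.
Qed.

Let bs_rec s : bs s = wP s 0 - bs (s + l%:Z).
Proof.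
have aS : asum (fun n : nat => wP s n.+1%:Z).
  exact: (asum_comp (h := Posz \o S) (g := fun n => if n is Posz m.+1 then Some m else None)) (asum_wP s).
have [_ h] := tsum_natS (f := fun n : nat => wP s n%:Z) aS; rewrite {1}/bs h; congr (_ + _).
rewrite -mulN1r -(tsumZ _ (asum_Posz (asum_wP _))); apply: eq_tsum => n.
by rewrite wP_shift mulN1r opprK; congr wP; lia.
Qed.

Let wP0 s : wP s 0 = P (s%:~R + b) * e0 s.
Proof.
rewrite /wP expr0z mul1r; congr (P _ * _).
by rewrite /vy mulr0 addr0 rmorphD rmorph_int fmorph_div !rmorph_nat.
Qed.

(** Shifting [s] by [l] shifts [N] by 1, so the two half-range sums differ by the term [N = 0]. This
    is the functional equation of [B] under [zeta -> q zeta], read on coefficients. *)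
Lemma beta_rec s : qpow t (s + l%:Z) * beta (s + l%:Z) + beta s = P (s%:~R + b).
Proof.
rewrite /beta (bs_rec s) wP0 e0_shift.
by have h1 := e0_neq0 s; have h2 := qpow_neq0 t (s + l%:Z); field; rewrite h1 h2.
Qed.

Let bs_neg s : tsum (fun N : nat => wP s (Negz N)) = - bs s.
Proof. by have := tsum_wP s; rewrite (tsum_int (asum_wP s)) addrC => /eqP; rewrite addr_eq0 => /eqP. Qed.

Let wJ i (j : Jt) : C := jsg R j * (jy R d j)%:C ^+ i * ee ((ja R d j)%:C * t).
Let JP (j : Jt) : C := \sum_(i < d.+1) pc i * wJ i.*2 j.

Let JPE j : JP j = jsg R j * P (jy R d j)%:C * ee ((ja R d j)%:C * t).
Proof. by rewrite /JP /P mulr_sumr mulr_suml; apply: eq_bigr => i _; rewrite /wJ; ring. Qed.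

Let vta_jy (j : Jt) s N : vy s N = jy R d j -> vy s 0 = jb R d j ->
  ee ((vta s N)%:C * t) / e0 s = ee ((ja R d j)%:C * t).
Proof.
move=> h1 h2; rewrite /e0 /ee -cexpN -cexpD; congr cexp.
have -> : (vta s N)%:C = (vta s 0)%:C + (ja R d j)%:C.
  rewrite -rmorphD; congr (_%:C); rewrite /vta h1 h2 jy_sqr.
  have l0 : lr != 0 by rewrite pnatr_eq0.
  by set x := lr in l0 *; field.
ring.
Qed.

Lemma beta_pos (a : nat) : beta a = P (a%:R + b) + tsum (fun N => JP (inl (a, N))).
Proof.
have aS : asum (fun n : nat => wP a n.+1%:Z).
  exact: (asum_comp (h := Posz \o S) (g := fun n => if n is Posz m.+1 then Some m else None)) (asum_wP a).
have [_ h] := tsum_natS (f := fun n : nat => wP a n%:Z) aS.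
rewrite /beta /bs h wP0 mulrDl mulfK// -pmulrn; congr (_ + _).
rewrite mulrC -(tsumZ _ aS); apply: eq_tsum => N; rewrite JPE.
rewrite -(@vta_jy (inl (a, N)) a N.+1); first last.
- by rewrite /vy mulr0 addr0.
- by rewrite /vy /jy /=.
by rewrite /wP /vy /jy /= -exprnP -!pmulrn; ring.
Qed.

Lemma beta_neg (a : nat) : beta (Negz a) = tsum (fun N => JP (inr (a, N))).
Proof.
have aS := asum_Negz (asum_wP (Negz a)).
rewrite /beta -[bs _]opprK -bs_neg -mulN1r mulrAC -(tsumZ _ aS); apply: eq_tsum => N; rewrite JPE.
have h1 : vy (Negz a) (Negz N) = jy R d (inr (a, N)).
  by rewrite /vy /jy /= !NegzE !mulrNz -!pmulrn.
rewrite -(@vta_jy (inr (a, N)) (Negz a) (Negz N)) //; last first.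
  by rewrite /vy mulr0 addr0 NegzE mulrNz -pmulrn.
have -> : jsg R (inr (a, N)) = - (-1) ^ (Negz N).
  by rewrite /jsg NegzE -exprnN -exprVn invrN1 exprS mulN1r opprK.
by rewrite /wP h1; ring.
Qed.

Let c1 : 0 < pi * Im t. Proof. by rewrite mulr_gt0 ?pi_gt0. Qed.
Let l3 : 0 < 3 * lr. Proof. by rewrite mulr_gt0. Qed.
Let e1 : R := pi * Im t / (3 * lr).
Let e10 : 0 < e1. Proof. by rewrite divr_gt0. Qed.

Let asum_wJ i : asum (fun j => wJ i j * (expR (e1 * nm (jb R d j)%:C))%:C).
Proof.
have [_ ok] := @qsummable_jw R d i 0; have h := ok _ c1.
apply: asum_nm (asumZ (expR (pi * Im t))%:C h) _ => j.
rewrite /wJ /jw fe0 mulr1 [leLHS]nmM (nmM _ (ee _)) (nmM _ (_ * _)) [X in _ <= _ * X]nmM.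
rewrite !nm_real !(ger0_norm (expR_ge0 _)) nm_ee [leRHS]mulrCA -mulrA ler_wpM2l ?nm_ge0//.
rewrite -!expRD ler_expR; have := jb_le R d j; have := ja_ge R d j; rewrite -(natr1 (jh j)) => ja1 jb1.
have : e1 * `|jb R d j| <= pi * Im t * ((jh j)%:R + 1).
  have e3 : e1 * (3 * lr) = pi * Im t by rewrite /e1 divfK// gt_eqF.
  by rewrite -e3 -[leRHS]mulrA ler_wpM2l// ltW.
have := c1; nra.
Qed.

Definition JI i (x : R) : C := tsum (fun j => wJ i j * cexp (x%:C * (jb R d j)%:C)).

Let asum_JI i x : `|x| <= e1 / 2 -> asum (fun j => wJ i j * cexp (x%:C * (jb R d j)%:C)).
Proof. by move=> xe; exact: (asum_expsum (b := fun j => (jb R d j)%:C) e10 (asum_wJ i) xe). Qed.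

Lemma asum_JI_ex i : exists2 e, 0 < e & forall x, `|x| <= e ->
  asum (fun j => wJ i j * cexp (x%:C * (jb R d j)%:C)).
Proof. by exists (e1 / 2); [rewrite divr_gt0|move=> x; exact: asum_JI]. Qed.

Lemma asym_JI S i : asym S (JI i) (fun n => qsum (ja R d) (jw R d i n) t).
Proof.
have h := asym_expsum (b := fun j => (jb R d j)%:C) e10 (asum_wJ i) S.
have -> : (fun n => qsum (ja R d) (jw R d i n) t) =
    (fun n => tsum (fun j => wJ i j * fe (jb R d j)%:C n)); last exact: h.
by apply: funext => n; apply: eq_tsum => j; rewrite /jw /wJ; ring.
Qed.

Definition Bfun x : C := \sum_(i < d.+1) pc i * (geoV b i.*2 x + JI i.*2 x).

(** The terms are collected by powers of [zeta]; the polar part contributes a geometric series,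
    which requires [x < 0]. *)
Lemma Bfun_beta x : x < 0 -> `|x| <= e1 / 2 ->
  zsummable beta x /\ cexp (x%:C * b) * zeval beta x = Bfun x.
Proof.
move=> x0 xe; have z0 : cexp (x%:C * b) != 0 := cexp_neq0 _.
pose gV i (a : nat) := (a%:R + b) ^+ i * cexp (x%:C * (a%:R + b)).
have agV i : asum (gV i) := asum_geoV b i x0.
have aJi i : asum (fun j => wJ i j * cexp (x%:C * (jb R d j)%:C)) := asum_JI i xe.
pose G a := \sum_(i < d.+1) pc i * gV i.*2 a.
have aG : asum G by apply: (@asum_sum _ _ d.+1 (fun i a => pc i * gV i.*2 a)) => i _; exact/asumZ.
pose JX j := JP j * cexp (x%:C * (jb R d j)%:C).
have JXE j : JX j = \sum_(i < d.+1) pc i * (wJ i.*2 j * cexp (x%:C * (jb R d j)%:C)).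
  by rewrite /JX /JP mulr_suml; apply: eq_bigr => i _; rewrite mulrA.
have aJX : asum JX.
  apply: asum_eq (fun j => esym (JXE j)) _.
  apply: (@asum_sum _ _ d.+1 (fun i j => pc i * (wJ i.*2 j * cexp (x%:C * (jb R d j)%:C)))).
  by move=> i _; exact/asumZ/aJi.
have sJX : tsum JX = \sum_(i < d.+1) pc i * JI i.*2 x.
  rewrite (eq_tsum JXE).
  rewrite (@tsum_sum _ _ d.+1 (fun i j => pc i * (wJ i.*2 j * cexp (x%:C * (jb R d j)%:C)))); last first.
    by move=> i _; exact/asumZ/aJi.
  by apply: eq_bigr => i _; rewrite (tsumZ _ (aJi _)).
have sG : tsum G = \sum_(i < d.+1) pc i * geoV b i.*2 x.
  rewrite (@tsum_sum _ _ d.+1 (fun i a => pc i * gV i.*2 a)); last by move=> i _; exact/asumZ.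
  by apply: eq_bigr => i _; rewrite (tsumZ _ (agV _)).
have aL : asum (fun p : nat * nat => JX (inl p)).
  exact: (asum_comp (h := inl) (g := fun j => if j is inl p then Some p else None)) aJX.
have aR : asum (fun p : nat * nat => JX (inr p)).
  exact: (asum_comp (h := inr) (g := fun j => if j is inr p then Some p else None)) aJX.
have eP (a : nat) : cexp (x%:C * b) * (beta a * ez x a) = G a + tsum (fun N => JX (inl (a, N))).
  have ec : cexp (x%:C * b) * ez x a = cexp (x%:C * (a%:R + b)).
    by rewrite /ez -cexpD -pmulrn; congr cexp; ring.
  rewrite beta_pos mulrCA ec mulrDl; congr (_ + _).
    by rewrite /G /P mulr_suml; apply: eq_bigr => i _; rewrite /gV mulrA.
  have eb N : (jb R d (inl (a, N)))%:C = a%:R + b.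
    by rewrite /= rmorphD fmorph_div !rmorph_nat.
  have aJ : asum (fun N => JP (inl (a, N))).
    apply: asum_eq (asumZ (cexp (x%:C * (a%:R + b)))^-1 (asum_fst a aL)) => N.
    by rewrite /JX eb mulrCA mulVf ?mulr1// cexp_neq0.
  by rewrite mulrC -(tsumZ _ aJ); apply: eq_tsum => N; rewrite /JX eb mulrC.
have eN (a : nat) : cexp (x%:C * b) * (beta (Negz a) * ez x (Negz a)) = tsum (fun N => JX (inr (a, N))).
  pose z := - a.+1%:R + b.
  have ec : cexp (x%:C * b) * ez x (Negz a) = cexp (x%:C * z).
    by rewrite /ez -cexpD NegzE mulrNz -pmulrn; congr cexp; rewrite /z; ring.
  rewrite beta_neg mulrCA ec.
  have eb N : (jb R d (inr (a, N)))%:C = z.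
    by rewrite /= rmorphD rmorphN fmorph_div !rmorph_nat.
  have aJ : asum (fun N => JP (inr (a, N))).
    apply: asum_eq (asumZ (cexp (x%:C * z))^-1 (asum_fst a aR)) => N.
    by rewrite /JX eb mulrCA mulVf ?mulr1// cexp_neq0.
  by rewrite mulrC -(tsumZ _ aJ); apply: eq_tsum => N; rewrite /JX eb mulrC.
have aP : asum (fun a : nat => cexp (x%:C * b) * (beta a * ez x a)).
  by apply: asum_eq (fun a => esym (eP a)) _; exact: asumD aG (asum_pair aL).
have aN : asum (fun a : nat => cexp (x%:C * b) * (beta (Negz a) * ez x (Negz a))).
  by apply: asum_eq (fun a => esym (eN a)) _; exact: asum_pair aR.
have ab : asum (fun n : int => cexp (x%:C * b) * (beta n * ez x n)) by exact: asum_int.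
have ab' : zsummable beta x.
  by apply: asum_eq (asumZ (cexp (x%:C * b))^-1 ab) => n; rewrite mulrA mulVf// mul1r.
split=> //; rewrite /zeval -(tsumZ _ ab') (tsum_int ab) (eq_tsum eP) (eq_tsum eN).
rewrite (tsumD aG (asum_pair aL)) -(tsum_pair aL) -(tsum_pair aR) -addrA -(tsum_sumt aL aR) sJX sG.
by rewrite /Bfun -big_split; apply: eq_bigr => i _; rewrite mulrDr.
Qed.

Let x1 : R := - Num.min (e1 / 2) (pi * Im t).
Let x1P : [/\ x1 < 0, `|x1| <= e1 / 2 & zsummable beta x1].
Proof.
have h0 : 0 < Num.min (e1 / 2) (pi * Im t) by rewrite lt_min c1 divr_gt0.
have h1 : x1 < 0 by rewrite oppr_lt0.
have h2 : `|x1| <= e1 / 2 by rewrite normrN gtr0_norm// ge_min lexx.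
by split=> //; have [] := Bfun_beta h1 h2.
Qed.

(* The functional equations of [theta^l] and [beta] give [(q^n - 1) h_n = 0] for the coefficients [h] of
   their product. *)
Lemma zconv_beta n : n != 0 -> zconv (Tpow t l) beta n = 0.
Proof.
move=> n0; have [_ _ ab] := x1P; have hT := entire_Tpow t0 l.
have a1 m := asum_zconv m (hT x1) ab.
(* [P] has degree [2 d < l], so it is orthogonal to the coefficients of [theta^l] by
   [Tpow_moment]. *)
have Pj : asum (fun s => Tpow t l (n - s) * P (s%:~R + b)) /\
    tsum (fun s => Tpow t l (n - s) * P (s%:~R + b)) = 0.
  pose Gi i s := Tpow t l s * (n%:~R + b - s%:~R) ^+ i.
  have g i : (i < l)%N -> tsum (Gi i) = 0 /\ asum (Gi i).
    by move=> il; apply: moment_poly il => //; exact: Tpow_moment.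
  have g' i : (i < d.+1)%N -> (i.*2 < l)%N by rewrite ltnS -leq_double.
  have nonhol_fun i : (i < d.+1)%N -> asum (fun s => pc i * Gi i.*2 (n - s)) /\
      tsum (fun s => pc i * Gi i.*2 (n - s)) = 0.
    move=> id; have [z a] := g _ (g' _ id); split; first exact/asumZ/asum_rev.
    by rewrite (tsumZ _ (asum_rev n a)) -(tsum_rev n a) z mulr0.
  have e s : Tpow t l (n - s) * P (s%:~R + b) = \sum_(i < d.+1) pc i * Gi i.*2 (n - s).
    rewrite /P mulr_sumr; apply: eq_bigr => i _; rewrite /Gi intrB mulrCA; congr (_ * (_ * _ ^+ _)).
    ring.
  have h : forall i, (i < d.+1)%N -> asum (fun s => pc i * Gi i.*2 (n - s)) by move=> i /nonhol_fun[].
  split; first by apply: asum_eq (fun s => esym (e s)) _; exact: (asum_sum h).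
  by rewrite (eq_tsum e) (tsum_sum h) big1// => i _; have [_ ->] := nonhol_fun _ (ltn_ord i).
(* After a shift of the summation index by [l], the functional equations of the two factors are used
   together; the sign [(-1)^l = -1] cancels that of [beta_rec]. *)
have key : qpow t n * zconv (Tpow t l) beta n = zconv (Tpow t l) beta n.
  rewrite /zconv -(tsumZ _ (a1 n)).
  have a2 : asum (fun s => qpow t n * (Tpow t l (n - s) * beta s)) := asumZ _ (a1 n).
  rewrite (tsum_shift l%:Z a2).
  have e s : qpow t n * (Tpow t l (n - (s + l%:Z)) * beta (s + l%:Z)) =
      Tpow t l (n - s) * beta s - Tpow t l (n - s) * P (s%:~R + b).
    have q1 : qpow t n = qpow t (n - (s + l%:Z)) * qpow t (s + l%:Z) by rewrite -qzD subrK.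
    rewrite q1 mulrACA (Tpow_shift t0).
    have <- : _ = P (s%:~R + b) := beta_rec s.
    have -> : n - (s + l%:Z) + l%:Z = n - s by lia.
    by rewrite -signr_odd /= odd_double expr1; ring.
  by rewrite (eq_tsum e) (tsumB (a1 n) Pj.1) Pj.2 subr0.
have := qpow_neq1 t0 n0; move/eqP: key; rewrite -subr_eq0 -{2}[zconv _ _ _]mul1r -mulrBl mulf_eq0.
by case/orP => /eqP // h; rewrite -opprB h oppr0 eqxx.
Qed.

Lemma zeval_beta x : x < 0 -> `|x| <= e1 / 2 ->
  zeval (theta_coef t) x ^+ l * Bfun x = zconv (Tpow t l) beta 0 * cexp (x%:C * b).
Proof.
move=> x0 xe; have [ab <-] := Bfun_beta x0 xe.
have [_ h] := zeval_zconv (entire_Tpow t0 l x) ab.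
rewrite mulrCA -(zeval_Tpow t0) -h mulrC; congr (_ * _).
rewrite /zeval (eq_tsum (g := fun n : int => (n == 0)%:R * (zconv (Tpow t l) beta n * ez x n))).
  by rewrite tsum_delta ez0 mulr1.
by move=> n; case: eqP => [_|/eqP n0]; rewrite ?mul1r// zconv_beta ?mul0r.
Qed.

Definition Bhat : fps R := ser l (fun n => \sum_(i < d.+1) pc i * appell_iter d i n t).

Lemma BhatE : Bhat = \sum_(i < d.+1) fC (pc i) * (ser l (iter i.*2 (@ld R) (geo_laurent b)) +
  fX R ^+ l * (fun n => qsum (ja R d) (jw R d i.*2 n) t)).
Proof.
apply: fpsP => n; rewrite fsumE; apply: eq_bigr => i _.
rewrite fCmE faddE fXnmE /appell_iter /ser; congr (_ * (_ + _)).
case: ltnP => nl; first by have -> : n%:Z - l%:Z = Negz (l - n).-1 by lia.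
by rewrite subzn.
Qed.

Lemma theta_taylor_Bhat : theta_taylor t ^+ l * Bhat = fC (zconv (Tpow t l) beta 0) * (fX R ^+ l * fe b).
Proof.
have acc (e : R) : 0 < e -> exists x, [/\ [set x | x < 0] x, x != 0 & `|x| <= e].
  by move=> e0'; exists (- e); rewrite /= oppr_lt0 e0' normrN gtr0_norm// oppr_eq0 gt_eqF.
apply: (asym_uniq acc); last first.
  exact: asymZ (asymM (asymX l (asym_id _)) (asym_cexp _ b)).
have aB : asym [set x | x < 0] (fun x => \sum_(i < d.+1) pc i * (x%:C ^+ l * geoV b i.*2 x + x%:C ^+ l * JI i.*2 x)) Bhat.
  rewrite BhatE.
  apply: (asym_sum (F := fun i x => pc i * (x%:C ^+ l * geoV b i.*2 x + x%:C ^+ l * JI i.*2 x))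
    (s := fun i => fC (pc i) * (ser l (iter i.*2 (@ld R) (geo_laurent b)) +
     fX R ^+ l * (fun n => qsum (ja R d) (jw R d i.*2 n) t)))) => i id.
  apply: asymZ; apply: asymD; first by apply: asym_geoV; rewrite ltnS leq_double.
  exact: asymM (asymX l (asym_id _)) (asym_JI _ _).
apply: asym_eq (divr_gt0 e10 (ltr0n _ 2)) _ (asymM (asymX l (asym_theta_coef t0 _)) aB) => x /= x0 _ xe.
rewrite mulrCA -(zeval_beta x0 xe) /Bfun mulrCA; congr (_ * _); rewrite mulr_sumr.
by apply: eq_bigr => i _; ring.
Qed.

(** Logarithmic differentiation of [theta_taylor_Bhat]: the unknown constant drops out and the
    exponential [e^(b X)] turns [theta_taylor] into [theta_odd_taylor]. *)
Lemma Bhat_ode : fX R * fd Bhat = - (fC l%:R * (Lam t - 1)) * Bhat.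
Proof.
have fTl0 := fps_expf_neq0 l (theta_taylor_neq0 t0); apply: (fps_mulI fTl0).
have := congr1 (fun f => fX R * fd f) theta_taylor_Bhat.
rewrite fdM fdCm fdM fd_fe !fdXn fdX mulr1 => h.
have h1 := theta_taylor_log_derivative t0; have h2 := theta_taylor_Bhat.
have e2 : fC b = fC l%:R * fC 2^-1 by rewrite -fCM.
transitivity (fX R * (d.*2.+1%:R * theta_taylor t ^+ d.*2 * fd (theta_taylor t) * Bhat + theta_taylor t ^+ l * fd Bhat) -
   d.*2.+1%:R * theta_taylor t ^+ d.*2 * (fX R * fd (theta_taylor t)) * Bhat); first by ring.
rewrite h h1 /Lam /fBe e2 fCnat.
transitivity ((l%:R + l%:R * fC 2^-1 * fX R) * (fC (zconv (Tpow t l) beta 0) * (fX R ^+ l * fe b)) -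
   l%:R * (fX R + fB R - fX R * fL t) * (theta_taylor t ^+ l * Bhat)); first by rewrite !exprS; ring.
rewrite -h2.
have e3 : fC 2^-1 + fC 2^-1 = 1 :> fps R by rewrite -fCD -fC1; congr fC; field.
have e4 : fX R = (fC 2^-1 + fC 2^-1) * fX R by rewrite e3 mul1r.
rewrite [X in X + fB R]e4; ring.
Qed.

Lemma geo_laurent_pole i : iter i (@ld R) (geo_laurent b) (- i.+1%:Z) = - (-1) ^+ i * i`!%:R.
Proof.
elim: i => [|i IH].
  by rewrite /geo_laurent /lau /= foppE coef_fmul0 fB0 fe0 fact0 expr0 !mulr1.
rewrite -[iter i.+1 _ _ _]/((- i.+2%:Z + 1)%:~R * iter i (@ld R) (geo_laurent b) (- i.+2%:Z + 1)).
rewrite (_ : - i.+2%:Z + 1 = - i.+1%:Z); last by lia.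
rewrite IH factS natrM exprS mulrNz -pmulrn; ring.
Qed.

(** Only [Delta^d] reaches the pole order [l], and [pc d = 1]; the factorial comes from
    differentiating [- 1 / X] an even number [2 d] of times. *)
Lemma Bhat0 : Bhat 0%N = - (l.-1)`!%:R.
Proof.
rewrite /Bhat /ser sub0r big_ord_recr /= big1 => [|i _]; last first.
  rewrite (@appell_iter_supp R d i t) ?mulr0//; have := ltn_ord i; lia.
by rewrite add0r pcd mul1r /appell_iter geo_laurent_pole -signr_odd odd_double expr0 addr0 mulN1r.
Qed.

(** Both sides solve the same equation [X f' = p f] with the same constant term. The factor [Efps]
    contributes [l E2 X^2 / 12], which cancels the [E2] term of [Lam]: this is why the source begins
    with [E4]. *)
Lemma E_Bhat : - (Efps l t * Bhat) = fC (l.-1)`!%:R * (fun n => Ssrc l n t).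
Proof.
pose p : fps R := src_exponent l t.
have p0 : p 0%N = 0 by rewrite /p /src_exponent.
have z : (fX R * fd p) 0%N = 0 by rewrite fXmE.
apply: (fth_unique z).
- rewrite fdN fdM fd_Efps mulrN mulrDr [fX R * (Efps l t * fd Bhat)]mulrCA Bhat_ode.
  have -> : fX R * fd p = fC (l%:R / 12 * eisenstein 2 t) * fX R ^+ 2 - fC l%:R * (Lam t - 1).
    apply: fpsP => n; rewrite fth_E faddE foppE [(fC l%:R * _) n]fCmE faddE foppE foneE.
    rewrite [fC _ * _]mulrC fXnmE /p /src_exponent.
    case: n => [|[|[|n]]]; rewrite ?Lam0 ?(@Lam_odd R t 0)//=.
    - ring.
    - by rewrite !subr0 !mulr0 subr0.
    - have := @Lam_even R t t0 0; rewrite /= => ->; by rewrite (fBe2 R) /fC /=; field.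
    have -> : fC (l%:R / 12 * eisenstein 2 t) (n.+3 - 2)%N = 0 by [].
    rewrite subr0 sub0r; case: (boolP (odd n)) => o /=.
      have e : n.+3 = (n.+1./2).+1.*2.
        by rewrite -[LHS]odd_double_half /= o add0n doubleS.
      have -> : (3 < n.+3)%N by case: n o {e}.
      rewrite e (@Lam_even R t t0) -e fBe_even /fB.
      have f0 := fact_neq0 R n.+3; have n0 : (n.+3%:R : C) != 0 by rewrite pnatr_eq0.
      field.
      by rewrite f0 -(natrD _ 3) n0.
    have e : n.+3 = (n.+1./2).+1.*2.+1 by rewrite -[LHS]odd_double_half /= (negPf o).
    by rewrite mulr0 e (@Lam_odd R t) mulr0 oppr0.
  ring.
- pose s : fps R := fun n => Ssrc l n t; rewrite -/s.
  have h : fX R * fd s = (fX R * fd p) * s := fth_ps_exp p0.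
  by rewrite fdCm [LHS]mulrCA h; ring.
rewrite foppE coef_fmul0 Bhat0 fCmE /Ssrc (ps_exp0 p0) /Efps /Ecoef /= expr0 fact0 divr1.
by rewrite mul1r opprK mulr1.
Qed.

End Fixed.

End ThetaCosets.

(** * Expansion of the Appell function at [Z = x / (2 pi i)] *)

Section AppellExpansion.
Variables (R : realType) (d : nat) (t : R[i]).
Local Notation C := R[i].
Local Notation Im := (@complex.Im R).
Local Notation l := (d.*2.+1).
Local Notation lr := (l%:R : R).
Hypothesis t0 : 0 < Im t.

Let b : C := l%:R / 2.
Let JX (x : R) (j : Jt) : C :=
  jsg R j * (jy R d j)%:C ^+ 0 * ee ((ja R d j)%:C * t) * cexp (x%:C * (jb R d j)%:C).

Let term (x : R) (n : int) : C := (-1) ^ n * ee (l%:R * n%:~R * (n%:~R + 1) / 2 * t) *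
  ee (n%:~R * 0) / (1 - cexp x%:C * ee (n%:~R * t)).

Let termP x N : nm (cexp x%:C * qpow t N.+1%:Z) < 1 ->
  cexp (x%:C * b) * term x N.+1%:Z = tsum (fun a => JX x (inl (a, N))).
Proof.
move=> z1; have [ag sg] := tsum_geo z1; rewrite /term mulr0 {2}/ee mulr0 cexp0 mulr1 -[ee (_%:~R * t)]/(qpow t _).
rewrite -sg mulrA -(tsumZ _ ag); apply: eq_tsum => a; rewrite /JX.
have -> : cexp (x%:C * (jb R d (inl (a, N)))%:C) = cexp (x%:C * b) * cexp x%:C ^+ a.
  rewrite -cexpMn -cexpD; congr cexp; rewrite /= rmorphD fmorph_div !rmorph_nat /b; ring.
have -> : ee ((ja R d (inl (a, N)))%:C * t) =
    ee (l%:R * N.+1%:Z%:~R * (N.+1%:Z%:~R + 1) / 2 * t) * qpow t N.+1%:Z ^+ a.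
  rewrite /qpow /ee -cexpMn -cexpD; congr cexp.
  have -> : (ja R d (inl (a, N)))%:C =
      l%:R * N.+1%:R * (N.+1%:R + 1) / 2 + a%:R * N.+1%:R :> C.
    rewrite /ja /jm /jb expr2 !(rmorphD, rmorphM, fmorphV, rmorph_nat).
    by set u : C := l%:R; set v : C := N.+1%:R; field.
  by rewrite -!pmulrn; ring.
by rewrite /jsg /= expr0 exprMn -exprnP; ring.
Qed.

Let termN x N : nm (cexp (- x)%:C * qpow t N.+1%:Z) < 1 ->
  cexp (x%:C * b) * term x (Negz N) = tsum (fun a => JX x (inr (a, N))).
Proof.
move=> z1; have [ag sg] := tsum_geo z1; rewrite /term mulr0 {2}/ee mulr0 cexp0 mulr1.
set w := cexp (- x)%:C * qpow t N.+1%:Z in z1 ag sg.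
have w1 : 1 - w != 0.
  by apply/eqP => /eqP; rewrite subr_eq0 => /eqP e1; move: z1; rewrite -e1 nm1 ltxx.
have w0 : w != 0 by apply: mulf_neq0; [exact: cexp_neq0|exact: qpow_neq0].
have ew : cexp x%:C * ee ((Negz N)%:~R * t) = w^-1.
  have ex : cexp (- x)%:C = (cexp x%:C)^-1 by rewrite -cexpN (rmorphN (real_complex R)).
  by rewrite /w NegzE -[ee _]/(qpow t (- N.+1%:Z)) qzN (invfM (cexp _)) ex invrK.
(* For negative index the expansion is in the inverse [w] of [zeta q^n]; the extra factor [- w]
   accounts for the exponents [a.+1] and for the sign in the [inr] case of [jsg]. *)
rewrite ew; have -> : (1 - w^-1)^-1 = - w * (1 - w)^-1.
  have -> : 1 - w^-1 = - (1 - w) / w by field.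
  by rewrite invfM invrK invrN !mulNr mulrC.
rewrite -sg [X in _ * X]mulrA [LHS]mulrA -(tsumZ _ ag); apply: eq_tsum => a; rewrite /JX.
have -> : cexp (x%:C * (jb R d (inr (a, N)))%:C) = cexp (x%:C * b) * cexp (- x)%:C ^+ a.+1.
  rewrite -cexpMn -cexpD; congr cexp; rewrite /= rmorphD !rmorphN fmorph_div !rmorph_nat /b; ring.
have -> : ee ((ja R d (inr (a, N)))%:C * t) =
    ee (l%:R * (Negz N)%:~R * ((Negz N)%:~R + 1) / 2 * t) * qpow t N.+1%:Z ^+ a.+1.
  rewrite /qpow /ee -cexpMn -cexpD; congr cexp.
  have -> : (ja R d (inr (a, N)))%:C =
      l%:R * (- N.+1%:R) * (- N.+1%:R + 1) / 2 + a.+1%:R * N.+1%:R :> C.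
    rewrite /ja /jm /jb expr2 !(rmorphD, rmorphM, rmorphN, fmorphV, rmorph_nat).
    by set u : C := l%:R; set v : C := N.+1%:R; set y : C := a.+1%:R; field.
  by rewrite NegzE mulrNz -!pmulrn; ring.
have -> : (-1) ^ (Negz N) = - jsg R (inr (a, N)).
  by rewrite /jsg NegzE -exprnN -exprVn invrN1 exprS mulN1r.
by rewrite /= expr0 /w !exprS !exprMn; ring.
Qed.

(** For small [x] each term of index [n <> 0] is a geometric series in [zeta q^n] or in its inverse;
    the term [n = 0] is the polar part. *)
Lemma appell_J : exists2 e, 0 < e & forall x, x != 0 -> `|x| <= e ->
  appell l (x%:C / (2 * cpi R * 'i%C)) 0 t =
  cexp (x%:C * b) / (1 - cexp x%:C) + JI d t 0 x.
Proof.
have [e e0 he] := asum_JI_ex d t0 0; have p0 : 0 < pi * Im t by rewrite mulr_gt0 ?pi_gt0.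
exists (Num.min e (pi * Im t)); first by rewrite lt_min e0.
move=> x x0; rewrite le_min => /andP[xe xp]; have aJ := he x xe.
have small y N : `|y| <= pi * Im t -> nm (cexp y%:C * qpow t N.+1%:Z) < 1.
  move=> yp; rewrite nmM nm_cexp /= nm_qpow -expRD -[X in _ < X]expR0 ltr_expR.
  have -> : (N.+1%:Z)%:~R = N%:R + 1 :> R by rewrite -pmulrn natr1.
  have := ler_norm y; have : 0 <= N%:R :> R by []; nra.
have aL : asum (fun p : nat * nat => JX x (inl (p.2, p.1))).
  apply: (asum_comp (h := fun p : nat * nat => inl (p.2, p.1) : Jt)
    (g := fun j => if j is inl p then Some (p.2, p.1) else None) _ aJ); by case.
have aR : asum (fun p : nat * nat => JX x (inr (p.2, p.1))).
  apply: (asum_comp (h := fun p : nat * nat => inr (p.2, p.1) : Jt)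
    (g := fun j => if j is inr p then Some (p.2, p.1) else None) _ aJ); by case.
have z0 : cexp (x%:C * b) != 0 := cexp_neq0 _.
have eP N : cexp (x%:C * b) * term x N.+1%:Z = tsum (fun a => JX x (inl (a, N))) by exact/termP/small.
have eN N : cexp (x%:C * b) * term x (Negz N) = tsum (fun a => JX x (inr (a, N))).
  by apply/termN/small; rewrite normrN.
have aP : asum (fun N : nat => cexp (x%:C * b) * term x N.+1%:Z).
  by apply: asum_eq (fun N => esym (eP N)) _; exact: asum_pair aL.
have aN : asum (fun N : nat => cexp (x%:C * b) * term x (Negz N)).
  by apply: asum_eq (fun N => esym (eN N)) _; exact: asum_pair aR.
have [a1 s1] := tsum_natS (f := fun n : nat => cexp (x%:C * b) * term x n) aP.
have aT : asum (fun n => cexp (x%:C * b) * term x n) by exact: asum_int.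
have aT' : asum (term x).
  by apply: asum_eq (asumZ (cexp (x%:C * b))^-1 aT) => n; rewrite mulrA mulVf// mul1r.
have ex : 2 * cpi R * 'i%C * (x%:C / (2 * cpi R * 'i%C)) = x%:C.
  by rewrite mulrC divfK// two_pi_i_neq0.
have -> : appell l (x%:C / (2 * cpi R * 'i%C)) 0 t = cexp (x%:C * b) * tsum (term x).
  rewrite /appell; congr (_ * _).
    by congr cexp; rewrite -[in RHS]ex /b; set y := x%:C / _; field.
  have -> : ee (x%:C / (2 * cpi R * 'i%C)) = cexp x%:C by rewrite /ee ex.
  exact: zsum_tsum aT'.
rewrite -(tsumZ _ aT') (tsum_int aT) s1 (eq_tsum eP) (eq_tsum eN) -addrA; congr (_ + _).
  by rewrite /term mulr0z !mul0r !mulr0 !mul0r /ee !mulr0 cexp0 !mulr1 expr0z mul1r.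
have sw (c : nat * nat -> Jt) : asum (fun p => JX x (c p)) ->
    asum (fun p : nat * nat => JX x (c (p.2, p.1))) ->
    tsum (fun N => tsum (fun a => JX x (c (a, N)))) = tsum (fun p => JX x (c p)).
  move=> h1 h2; rewrite -(tsum_pair h2).
  by rewrite (tsum_bij (h := fun p : nat * nat => (p.2, p.1)) (g := fun p => (p.2, p.1)) _ _ h1)//; case.
have aL' : asum (fun p : nat * nat => JX x (inl p)).
  exact: (asum_comp (h := inl) (g := fun j => if j is inl p then Some p else None)) aJ.
have aR' : asum (fun p : nat * nat => JX x (inr p)).
  exact: (asum_comp (h := inr) (g := fun j => if j is inr p then Some p else None)) aJ.
by rewrite (sw inl)// (sw inr)// -(tsum_sumt aL' aR').
Qed.

Lemma asym_appell : asym setT (fun x => x%:C * appell l (x%:C / (2 * cpi R * 'i%C)) 0 t)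
  (ser 1 (fun n => appell_iter d 0 n t)).
Proof.
have [e e0 he] := appell_J; apply: (asym_eq e0 (f := fun x => x%:C * (cexp (x%:C * b) / (1 - cexp x%:C)) +
    x%:C * JI d t 0 x)).
  by move=> x _ x0 xe; rewrite he// mulrDr.
have -> : ser 1 (fun n => appell_iter d 0 n t) = - (fB R * fe b) +
    fX R * (fun n => qsum (ja R d) (jw R d 0 n) t).
  rewrite -[X in X + _](lauK 1); apply: fpsP => n; rewrite faddE fXmE /ser /appell_iter /=; congr (_ + _).
  by case: n => [|n] //; rewrite subzn// subn1.
apply: asymD; last exact: asymM (asym_id _) (asym_JI d t0 _ _).
have aE1 : asym (setT : set R) (fun x => 1 - cexp x%:C) (1 - fe 1).
  have := asymB (asym_cst (setT : set R) 1) (asym_cexp setT 1); rewrite fC1.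
  by apply: asym_eq ltr01 _ => x _ _ _; rewrite mulr1.
apply: (asym_div aE1); first by rewrite faddE foppE foneE fe0 subrr.
  by rewrite faddE foppE foneE /= sub0r oppr_eq0 /fe expr1 (_ : 1`!%N = 1%N)// divr1 oner_eq0.
have -> : (1 - fe 1) * - (fB R * fe b) = fX R * fe b by rewrite -(fB_eq R); ring.
apply: asym_eq ltr01 _ (asymM (asym_id setT) (asym_cexp setT b)) => x _ x0 _.
have z : 1 - cexp x%:C != 0.
  rewrite cexp_real -(rmorph1 (real_complex R)) -rmorphB fmorph_eq0 subr_eq0 eq_sym.
  by rewrite -expR0 (inj_eq (@expR_inj R)).
by field.
Qed.

End AppellExpansion.

(** * The error function on the real line and its Gaussian tail *)

Section ErrorFunction.
Variable R : realType.
Local Notation C := R[i].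
Local Notation Re := (@complex.Re R).
Local Notation Im := (@complex.Im R).
Local Notation mu := (@lebesgue_measure R).
Implicit Types (a b c s w x y : R).

Lemma is_derive_continuous (f : R -> R) (x l : R) : is_derive x 1 f l -> {for x, continuous f}.
Proof. by move=> h; apply/differentiable_continuous/derivable1_diffP; exact: ex_derive. Qed.

Lemma is_derive_integral (F f : R -> R) (a b : R) : a < b ->
  (forall x, is_derive x 1 F (f x)) -> continuous f ->
  \int[mu]_(x in `[a, b]) f x = F b - F a.
Proof.
move=> ab dF cf; rewrite /Rintegral.
rewrite (@continuous_FTC2 _ f F)//.
- exact: continuous_subspaceT.
- have cF x := is_derive_continuous (dF x).
  split=> [x _||]; [exact: (@ex_derive _ _ _ _ _ _ _ (dF x))|apply: cvg_at_right_filter; exact: cF|apply: cvg_at_left_filter; exact: cF].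
- by move=> x _; rewrite derive1E; exact: derive_val.
Qed.

Lemma is_derive_ndecr (f df : R -> R) (a b : R) : a <= b ->
  (forall x, is_derive x 1 f (df x)) -> (forall x, a <= x <= b -> 0 <= df x) -> f a <= f b.
Proof.
move=> ab hd d0; have cf : {within `[a, b], continuous f}.
  by apply: continuous_subspaceT => x; exact: is_derive_continuous (hd x).
have [c] := MVT_segment ab (fun x _ => hd x) cf; rewrite in_itv /= => cab e.
 rewrite -subr_ge0 e mulr_ge0 ?subr_ge0//; exact: d0.
Qed.

Definition gauss_primitive (x : R) : R := \int[mu]_(s in `]-oo, x]) gauss_fun s.
Local Notation G := gauss_primitive.

Lemma gauss_primitive_derive x : is_derive x 1 G (gauss_fun x).
Proof.
have [||||h1 h2] := @continuous_FTC1 R gauss_fun -oo%O x (x + 1).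
- by rewrite ltrDl.
- by apply: (@integrableS _ _ _ mu setT) => //; exact: integrableT_gauss.
- by rewrite ltNyr.
- exact: continuous_gauss_fun.
have h3 : 'D_1 G x = gauss_fun x by rewrite -derive1E; exact: h2.
exact: DeriveDef h1 h3.
Qed.

(** The integral [2 \int_0^w e^(- pi s^2) ds], rescaled to the primitive of [e^(- s^2)]. *)
Definition Er (w : R) : R := 2 / Num.sqrt pi * (G (Num.sqrt pi * w) - G 0).

Let sp : 0 < Num.sqrt (pi : R). Proof. by rewrite sqrtr_gt0 pi_gt0. Qed.

Lemma gauss_scale w : gauss_fun (Num.sqrt pi * w) = expR (- pi * w ^+ 2).
Proof. by rewrite /gauss_fun exprMn sqr_sqrtr ?pi_ge0// mulNr. Qed.

Lemma G_scale_derive c x : is_derive x 1 (fun s => G (c * s)) (c * gauss_fun (c * x)).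
Proof.
have h : is_derive x 1 (fun s : R => c * s) c.
  by apply: is_derive_eq; rewrite scaler1.
by rewrite mulrC; exact: (is_derive1_comp (gauss_primitive_derive (c * x)) h).
Qed.

Lemma Er_derive w : is_derive w 1 Er (2 * expR (- pi * w ^+ 2)).
Proof.
have h := G_scale_derive (Num.sqrt pi) w.
apply: is_derive_eq.
rewrite -gauss_scale subr0.
by rewrite -[_ *: _]/(_ * _) mulrA divfK// gt_eqF.
Qed.

Lemma Er0 : Er 0 = 0. Proof. by rewrite /Er mulr0 subrr mulr0. Qed.

Lemma Efun_Er (w : R) : Efun w%:C = (Er w)%:C.
Proof.
pose c := Num.sqrt (pi : R); have sp0 : c != 0 by rewrite gt_eqF.
pose f (s : R) : R := w * expR (- pi * (w * s) ^+ 2).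
have ef (s : R) : w%:C * cexp (- cpi R * (w%:C * s%:C) ^+ 2) = (f s)%:C.
  by rewrite /f /cpi -rmorphM -(rmorphXn _ 2) -rmorphN -rmorphM cexp_real -rmorphM.
rewrite /Efun /cint01.
rewrite (_ : (fun s : R => Re (w%:C * cexp (- cpi R * (w%:C * s%:C) ^+ 2))) = f); last first.
  by apply: funext => s; rewrite ef.
rewrite (_ : (fun s : R => Im (w%:C * cexp (- cpi R * (w%:C * s%:C) ^+ 2))) = cst 0); last first.
  by apply: funext => s; rewrite ef.
rewrite Rintegral_cst ?mul0r//=.
pose F (s : R) := c^-1 * G (c * w * s).
have dF s : is_derive s 1 F (f s).
  have h := G_scale_derive (c * w) s.
  apply: is_derive_eq.
  rewrite -[c * w * s]mulrA gauss_scale -[_ *: _]/(_ * _) -(mulrA c w).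
  by rewrite (mulKf sp0).
rewrite (is_derive_integral ltr01 dF); last first.
  move=> s; apply: (@is_derive_continuous f s (w * (expR (- pi * (w * s) ^+ 2) * (- pi * (w * w * s *+ 2))))).
  rewrite /f; apply: is_derive_eq; rewrite -![_ *: _]/(_ * _) /=; ring.
rewrite /F mulr1 mulr0 /Er -/c -mulrBr; apply/eqP; rewrite eq_complex /=.
by apply/andP; split; apply/eqP; [field|ring].
Qed.

Lemma Er_ge0 w : 0 <= w -> 0 <= Er w.
Proof.
by move=> w0; rewrite -Er0; apply: (is_derive_ndecr w0 Er_derive) => x _; rewrite mulr_ge0 ?expR_ge0.
Qed.

Lemma Er_ndecr a b : a <= b -> Er a <= Er b.
Proof. by move=> ab; apply: (is_derive_ndecr ab Er_derive) => x _; rewrite mulr_ge0 ?expR_ge0. Qed.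

(** Gauss's integral enters through its square, [pi / 4]; as [Er] is nonnegative for [w >= 0], the
    square carries enough information. *)
Lemma Er_sqr_lim (e : R) : 0 < e -> exists M, forall w, M < w -> `|Er w ^+ 2 - 1| < e.
Proof.
move=> e0; have p0 := pi_gt0 R; have p4 : 0 < 4 / pi :> R by rewrite divr_gt0.
have /cvgrPdist_lt/(_ (e / (4 / pi)) (divr_gt0 e0 p4)) [M [_ hM]] :=
  @gauss_integral_proof.cvg_integral0_gauss_sqr R.
exists (Num.max 0 (M / Num.sqrt pi)) => w; rewrite gt_max => /andP[w0 wM].
have sw : 0 < Num.sqrt pi * w by rewrite mulr_gt0.
have wM' : M < Num.sqrt pi * w by rewrite mulrC -ltr_pdivrMr.
have := hM _ wM'; rewrite /= /gauss_integral_proof.integral0_gauss.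
rewrite (is_derive_integral sw gauss_primitive_derive continuous_gauss_fun) => h.
have -> : Er w ^+ 2 - 1 = - (4 / pi * (pi / 4 - (G (Num.sqrt pi * w) - G 0) ^+ 2)).
  rewrite /Er exprMn expr_div_n sqr_sqrtr ?pi_ge0//.
  have pn : pi != 0 :> R by rewrite gt_eqF.
  by move: (pi : R) pn => p pn; field.
by rewrite normrN normrM gtr0_norm// mulrC -ltr_pdivlMr.
Qed.

Lemma Er_le1 w : Er w <= 1.
Proof.
rewrite leNgt; apply/negP => h.
have h2 : 0 < Er w ^+ 2 - 1 by rewrite subr_gt0 exprn_egt1 ?gt_eqF//; lra.
have [M hM] := Er_sqr_lim h2; pose y := Num.max w (M + 1).
have wy : Er w <= Er y by apply: Er_ndecr; rewrite le_max lexx.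
have := hM y; rewrite lt_max ltrDl ltr01 orbT => /(_ isT).
rewrite ltr_norml => /andP[_]; nra.
Qed.

(** The function [Er x + e^(- pi x^2) / pi] decreases for [x >= 1]. Were it below 1 at [w], [Er]
    would stay bounded away from 1 beyond [w]. *)
Lemma Er_tail w : 1 <= w -> 1 - Er w <= expR (- pi * w ^+ 2).
Proof.
move=> w1; have p0 := pi_gt0 R; have p1 : 1 <= pi :> R by have := pi_ge2 R; lra.
pose phi x := Er x + pi^-1 * expR (- pi * x ^+ 2).
have dphi x : is_derive x 1 (fun x => - phi x) (2 * (x - 1) * expR (- pi * x ^+ 2)).
  have h := Er_derive x; rewrite /phi; apply: is_derive_eq.
  rewrite -![_ *: _]/(_ * _) /=; have pn : pi != 0 :> R by rewrite gt_eqF.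
  by move: (pi : R) pn => p pn; field.
have dec y : w <= y -> Er y <= phi w.
  move=> wy; apply: (@le_trans _ _ (phi y)); first by rewrite lerDl mulr_ge0 ?expR_ge0 ?invr_ge0 ?ltW.
  rewrite -lerN2; apply: (is_derive_ndecr wy dphi) => x /andP[wx _].
  by rewrite mulr_ge0 ?expR_ge0// mulr_ge0// subr_ge0 (le_trans w1).
have h : 1 <= phi w.
  rewrite leNgt; apply/negP => h1.
  have w0 : 0 <= w by rewrite (le_trans _ w1).
  have ph0 : 0 <= phi w := le_trans (Er_ge0 w0) (dec w (lexx w)).
  have q : 0 < 1 - phi w ^+ 2 by nra.
  have [M hM] := Er_sqr_lim q.
  have := hM (Num.max w (M + 1)); rewrite lt_max ltrDl ltr01 orbT.
  have wy : w <= Num.max w (M + 1) by rewrite le_max lexx.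
  have e0 := Er_ge0 (le_trans w0 wy); have e1 := dec _ wy.
  by move=> /(_ isT); rewrite ltr_norml => /andP[]; nra.
rewrite lerBlDl (le_trans h)// lerD2l ler_piMl ?expR_ge0// invf_le1//.
Qed.

Lemma ErN w : Er (- w) = - Er w.
Proof.
have h x : is_derive x 1 (fun s => Er s + Er (- s)) 0.
  have h1 := Er_derive x; have h2 := Er_derive (- x).
  have h3 : is_derive x 1 (fun s => Er (- s)) (2 * expR (- pi * (- x) ^+ 2) * -1).
    by apply: (is_derive1_comp (f := Er) (g := -%R)).
  by apply: is_derive_eq; rewrite sqrrN; ring.
have := is_derive_0_is_cst w 0 h; rewrite /= oppr0 Er0 addr0 => /eqP.
by rewrite addrC addr_eq0 => /eqP.
Qed.

Lemma Er_bound : exists2 K : R, 0 < K &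
  forall w, `|Num.sg w - Er w| <= K * expR (- pi * w ^+ 2).
Proof.
(* On [0 < w < 1] the factor [e^pi] makes the bound at least 1, and [1 - Er w <= 1] suffices
   there. *)
have p0 := pi_gt0 R; exists (expR pi); first exact: expR_gt0.
have pos w : 0 < w -> `|1 - Er w| <= expR pi * expR (- pi * w ^+ 2).
  move=> w0; rewrite ger0_norm ?subr_ge0 ?Er_le1//.
  have [w1|w1] := leP 1 w.
    by rewrite (le_trans (Er_tail w1))// ler_peMl ?expR_ge0// -expR0 ler_expR ltW.
  have := Er_ge0 (ltW w0) => e0; apply: (@le_trans _ _ 1); first lra.
  rewrite -expRD -expR0 ler_expR; have : w ^+ 2 <= 1 by nra.
  nra.
move=> w; case: (ltgtP w 0) => w0.
- by rewrite ltr0_sg// -sqrrN -[w in Er w]opprK ErN -normrN opprB opprK addrC pos// oppr_gt0.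
- by rewrite gtr0_sg// pos.
by rewrite w0 sgr0 Er0 subrr normr0 mulr_ge0 ?expR_ge0.
Qed.

End ErrorFunction.

(** * A single term of the completion: Taylor coefficients in [x], uniform bounds and heat
    equation *)

Section CompletionTerm.
Variables (R : realType) (l : nat).
Hypothesis l0 : (0 < l)%N.
Local Notation L := (l%:R : R).
Implicit Types (s M v x y d K : R).

Definition rr v : R := Num.sqrt (2 * L * v).

(* Up to the phase [cexp (- pi * i * l * M ^ 2 * conj tau)], the terms of the nonholomorphic part. *)
Definition ff s M v x : R :=
  (s - Er ((M - x / (4 * pi * v)) * rr v)) * expR (2 * pi * L * v * M ^+ 2 - L * M * x).

(** The Gaussian produced by differentiating the error function in [ff], so that
    [ff' = - L M ff + HH]. *)
Definition HH v x : R := rr v / (2 * pi * v) * expR (- (L / (8 * pi * v)) * x ^+ 2).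

(** Taylor coefficients of [HH], from [HH' = - (L / (4 pi v)) x HH]. *)
Fixpoint hj (j : nat) v : R := match j with
  | 0%N => rr v / (2 * pi * v) | 1%N => 0
  | p.+2 => - (L / (4 * pi * v)) / p.+2%:R * hj p v end.

(** Taylor coefficients in [x] of [ff]. Defining them by the recursion of [ff' = - L M ff + HH]
    keeps their dependence on [M] and [v] explicit. *)
Fixpoint cj (j : nat) s M v : R :=
  if j is p.+1 then (- (L * M) * cj p s M v + hj p v) / p.+1%:R else ff s M v 0.

Let Lp : 0 < L. Proof. by rewrite ltr0n. Qed.
Let p0 : 0 < (pi : R). Proof. exact: pi_gt0. Qed.

Lemma rr_gt0 v : 0 < v -> 0 < rr v.
Proof. by move=> v0; rewrite sqrtr_gt0 !mulr_gt0. Qed.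

Lemma rr_sqr v : 0 < v -> rr v ^+ 2 = 2 * L * v.
Proof. by move=> v0; rewrite sqr_sqrtr// !mulr_ge0// ltW. Qed.

(* The exponentials of the derivative of the error function and of [ff] combine into a Gaussian in [x]
   that does not depend on [M]. *)
Lemma gauss_square M v x : 0 < v ->
  - pi * ((M - x / (4 * pi * v)) * rr v) ^+ 2 + (2 * pi * L * v * M ^+ 2 - L * M * x) =
  - (L / (8 * pi * v)) * x ^+ 2.
Proof.
move=> v0; rewrite exprMn rr_sqr//; have pn : (pi : R) != 0 by rewrite gt_eqF.
have vn : v != 0 by rewrite gt_eqF.
move: (pi : R) pn (L) => p pn y; field.
by rewrite vn pn.
Qed.

Lemma ff_dx s M v x : 0 < v -> is_derive x 1 (ff s M v) (- (L * M) * ff s M v x + HH v x).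
Proof.
move=> v0.
have dA : is_derive x 1 (fun y => (M - y / (4 * pi * v)) * rr v) (- (rr v / (4 * pi * v))).
  by apply: is_derive_eq; rewrite -![_ *: _]/(_ * _) /=; ring.
have dEr := is_derive1_comp (f := @Er R) (g := fun y => (M - y / (4 * pi * v)) * rr v) (Er_derive _) dA.
have dE : is_derive x 1 (fun y => expR (2 * pi * L * v * M ^+ 2 - L * M * y))
   (expR (2 * pi * L * v * M ^+ 2 - L * M * x) * (- (L * M))).
  by apply: is_derive_eq; rewrite -![_ *: _]/(_ * _) /=; ring.
rewrite /ff /HH -(gauss_square M x v0) (expRD (- pi * _)).
set A := expR (- pi * _); set B := expR (_ - L * M * x) in dE *.
set W := (M - x / (4 * pi * v)) * rr v in A dEr *.
apply: (is_derive_eq (is_deriveM (is_deriveB (is_derive_cst s x 1) dEr) dE)).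
rewrite -![_ *: _]/(_ * _) /=; have pn : (pi : R) != 0 by rewrite gt_eqF.
have vn : v != 0 by rewrite gt_eqF.
rewrite -[(cst s - (@Er R \o _)) x]/(s - Er W) -/A -/B.
move: A {dEr} B {dE} (Er W) (rr v) => A B E r.
move: (pi : R) pn (L) => p pn y; field.
by rewrite vn pn.
Qed.

Lemma HH_dx v x : 0 < v -> is_derive x 1 (HH v) (- (L / (4 * pi * v)) * (x * HH v x)).
Proof.
move=> v0; rewrite /HH; have pn : (pi : R) != 0 by rewrite gt_eqF.
have vn : v != 0 by rewrite gt_eqF.
apply: is_derive_eq; rewrite -![_ *: _]/(_ * _) /=.
move: (expR _) (rr v) => A r.
move: (pi : R) pn (L) => p pn y; field.
by rewrite vn pn.
Qed.

Lemma is_derive_pow n x : is_derive x 1 (fun y : R => y ^+ n) (n%:R * x ^+ n.-1).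
Proof.
elim: n => [|n IH]; first by rewrite mul0r; exact: is_derive_cst.
rewrite (_ : (fun y : R => y ^+ n.+1) = (fun y : R => y * y ^+ n)); last first.
  by apply: funext => y; rewrite exprS.
apply: (is_derive_eq (is_deriveM (is_derive_id x (1 : R)) IH)).
rewrite -![_ *: _]/(_ * _) mulr1 -natr1 mulrDl mul1r; congr (_ + _).
by case: n {IH} => [|n]; rewrite ?mul0r ?mulr0// mulrCA -exprS.
Qed.

Lemma is_derive_poly_sum (c : nat -> R) N x :
  is_derive x 1 (fun y => \sum_(j < N) c j * y ^+ j) (\sum_(j < N) c j * (j%:R * x ^+ j.-1)).
Proof.
elim: N => [|N IH].
  rewrite big_ord0 (_ : (fun y : R => _) = cst 0); first exact: is_derive_cst.
  by apply: funext => y; rewrite big_ord0.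
rewrite big_ord_recr /= (_ : (fun y : R => _) = (fun y => \sum_(j < N) c j * y ^+ j + c N * y ^+ N)).
  apply: is_deriveD; case: N {IH} => [|N].
    rewrite mul0r mulr0 (_ : (fun y => _) = cst (c 0%N)); first exact: is_derive_cst.
    by apply: funext => y; rewrite expr0 mulr1.
  exact: (is_deriveZ (c N.+1) (is_derive_pow N.+1 x)).
by apply: funext => y; rewrite big_ord_recr.
Qed.

Lemma remainder_step (f f' : R -> R) (c : nat -> R) N d K : 0 <= K ->
  (forall x, `|x| <= d -> is_derive x 1 f (f' x)) -> f 0 = c 0%N ->
  (forall x, `|x| <= d -> `|f' x - \sum_(j < N) j.+1%:R * c j.+1 * x ^+ j| <= K * `|x| ^+ N) ->
  forall x, `|x| <= d -> `|f x - \sum_(j < N.+1) c j * x ^+ j| <= K * `|x| ^+ N.+1.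
Proof.
move=> K0 df f0 hf x xd.
pose g y := f y - \sum_(j < N.+1) c j * y ^+ j.
have dg y : `|y - 0| <= `|x| -> is_derive y 1 g (f' y - \sum_(j < N) j.+1%:R * c j.+1 * y ^+ j) /\
    `|f' y - \sum_(j < N) j.+1%:R * c j.+1 * y ^+ j| <= K * `|x| ^+ N.
  rewrite subr0 => yx; have yd := le_trans yx xd; split; last first.
    by rewrite (le_trans (hf y yd))// ler_wpM2l// lerXn2r ?nnegrE.
  have h1 := df y yd; have h2 := is_derive_poly_sum c N.+1 y.
  rewrite /g; apply: is_derive_eq; congr (_ - _).
  rewrite big_ord_recl mul0r mulr0 add0r; apply: eq_bigr => j _.
  by rewrite /= mulrA; congr (_ * _); rewrite mulrC.
have := real_mvt dg (_ : `|x - 0| <= `|x|); rewrite !subr0 lexx => /(_ isT).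
rewrite {2}/g big_ord_recl expr0 mulr1 f0 big1 ?addr0 => [|j _]; last by rewrite exprS mul0r mulr0.
by rewrite subrr subr0 -mulrA -exprSr.
Qed.

Lemma HH_rem v N : 0 < v -> exists2 K, 0 <= K & forall x, `|x| <= 1 ->
  `|HH v x - \sum_(j < N) hj j v * x ^+ j| <= K * `|x| ^+ N.
Proof.
move=> v0; set a := L / (4 * pi * v); have a0 : 0 <= a by rewrite divr_ge0// ltW// !mulr_gt0.
have h00 : 0 <= hj 0 v by rewrite divr_ge0 ?ltW// ?rr_gt0// !mulr_gt0.
have HH0 : HH v 0 = hj 0 v by rewrite /HH expr0n /= mulr0 expR0 mulr1.
have base x : `|HH v x| <= hj 0 v.
  rewrite /HH normrM (ger0_norm h00) (ger0_norm (expR_ge0 _)) ler_piMr// -expR0 ler_expR mulNr oppr_le0 mulr_ge0 ?sqr_ge0//.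
  by rewrite divr_ge0// ltW// !mulr_gt0.
have hjS p : p.+2%:R * hj p.+2 v = - a * hj p v.
  have n2 : p.+2%:R != 0 :> R by rewrite pnatr_eq0.
  by rewrite [hj p.+2 v]/= -/a; move: (hj p v) (a) (p.+2%:R) n2 => h b c c0; field.
suff h n : (exists2 K, 0 <= K & forall x, `|x| <= 1 ->
      `|HH v x - \sum_(j < n) hj j v * x ^+ j| <= K * `|x| ^+ n) /\
    (exists2 K, 0 <= K & forall x, `|x| <= 1 ->
      `|HH v x - \sum_(j < n.+1) hj j v * x ^+ j| <= K * `|x| ^+ n.+1) by have [] := h N.
elim: n => [|n [[K K0 hK] h2]]; last split=> //.
  split; first by exists (hj 0 v) => // x _; rewrite big_ord0 subr0 expr0 mulr1.
  exists (a * hj 0 v); first exact: mulr_ge0.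
  apply: (@remainder_step (HH v) (fun x => - a * (x * HH v x)) (fun j => hj j v) 0 1) => //.
  - exact: mulr_ge0.
  - by move=> x _; exact: HH_dx.
  move=> x x1; rewrite big_ord0 subr0 expr0 mulr1 normrM normrN (ger0_norm a0) ler_wpM2l//.
  by rewrite normrM (le_trans _ (base x))// ler_piMl.
exists (a * K); first exact: mulr_ge0.
apply: (@remainder_step (HH v) (fun x => - a * (x * HH v x)) (fun j => hj j v) n.+1 1) => //.
- exact: mulr_ge0.
- by move=> x _; exact: HH_dx.
move=> x x1; rewrite big_ord_recl [hj 1 v]/= mulr0 mul0r add0r.
rewrite (_ : _ - _ = - a * (x * (HH v x - \sum_(j < n) hj j v * x ^+ j))).
  rewrite normrM normrN (ger0_norm a0) -mulrA ler_wpM2l// normrM exprS mulrCA ler_wpM2l//.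
  exact: hK.
rewrite mulrBr mulrBr; congr (_ - _); rewrite !mulr_sumr; apply: eq_bigr => j _.
by rewrite lift0 hjS exprS; ring.
Qed.

Lemma ff_rem v d K0 N : 0 < v -> d <= 1 -> exists2 K, 0 <= K & forall s M,
  (forall x, `|x| <= d -> `|ff s M v x| <= K0) -> forall x, `|x| <= d ->
  `|ff s M v x - \sum_(j < N) cj j s M v * x ^+ j| <= K * (1 + `|M|) ^+ N * `|x| ^+ N.
Proof.
move=> v0 d1; elim: N => [|N [K Kp IH]].
  exists `|K0| => // s M h x xd; rewrite big_ord0 subr0 !expr0 !mulr1 (le_trans (h x xd))//.
  exact: ler_norm.
have [K' K'p hK'] := HH_rem N v0; exists (L * K + K'); first by rewrite addr_ge0// mulr_ge0// ltW.
move=> s M h x xd; have m1 : 1 <= 1 + `|M| by rewrite lerDl.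
have mN : 1 <= (1 + `|M|) ^+ N by rewrite exprn_ege1.
have KK : 0 <= (L * K + K') * (1 + `|M|) ^+ N.+1.
  apply: mulr_ge0; last by rewrite exprn_ge0// (le_trans ler01).
  by rewrite addr_ge0// mulr_ge0// ltW.
apply: (remainder_step KK (fun y (_ : `|y| <= d) => ff_dx s M y v0) (c := fun j => cj j s M v) erefl _ xd).
move=> y yd; have y1 : `|y| <= 1 := le_trans yd d1.
rewrite (_ : _ - _ = - (L * M) * (ff s M v y - \sum_(j < N) cj j s M v * y ^+ j) +
   (HH v y - \sum_(j < N) hj j v * y ^+ j)); last first.
  rewrite !mulrBr addrACA -opprD; congr (_ - _); rewrite mulr_sumr -big_split; apply: eq_bigr => j _.
  have n1 : j.+1%:R != 0 :> R by rewrite pnatr_eq0.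
  change (j.+1%:R * cj j.+1 s M v * y ^+ j = - (L * M) * (cj j s M v * y ^+ j) + hj j v * y ^+ j).
  rewrite [cj j.+1 _ _ _]/=.
  by move: (cj j s M v) (hj j v) (j.+1%:R) n1 => a b c c0; field.
apply: le_trans (ler_normD _ _) _; rewrite normrM normrN normrM (gtr0_norm Lp).
have h1 := IH s M h y yd; have h2 := hK' y y1; have e0 : 0 <= `|y| ^+ N by rewrite exprn_ge0.
apply: (@le_trans _ _ (L * `|M| * (K * (1 + `|M|) ^+ N * `|y| ^+ N) + K' * `|y| ^+ N)).
  by rewrite lerD// ler_wpM2l// mulr_ge0// ltW.
rewrite [leLHS](_ : _ = (L * `|M| * K * (1 + `|M|) ^+ N + K') * `|y| ^+ N); last by ring.
rewrite ler_wpM2r// exprS mulrDl lerD//.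
  rewrite !mulrA ler_wpM2r ?exprn_ge0 ?addr_ge0// [leRHS]mulrC mulrA.
  have : 0 <= L * K by rewrite mulr_ge0// ltW.
  have := normr_ge0 M; nra.
by rewrite ler_peMr// mulr_ege1.
Qed.

Lemma rr_dv v : 0 < v -> is_derive v 1 rr (L / rr v).
Proof.
move=> v0; have h : 0 < 2 * L * v by rewrite !mulr_gt0.
have d1 : is_derive v 1 (fun y => 2 * L * y) (2 * L).
  by apply: is_derive_eq; rewrite -[_ *: _]/(_ * _) mulr1.
apply: (is_derive_eq (is_derive1_comp (f := @Num.sqrt R) (g := fun y => 2 * L * y) (is_derive1_sqrt h) d1)).
have r0 : rr v != 0 by rewrite gt_eqF// rr_gt0.
rewrite -/(rr v); move: (rr v) r0 (L) => r r0 y; field.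
by rewrite ?r0.
Qed.

Lemma hj_dv j v : 0 < v -> is_derive v 1 (hj j) (- (j.+1%:R / (2 * v)) * hj j v).
Proof.
move=> v0; have pn : (pi : R) != 0 by rewrite gt_eqF.
have vn : v != 0 by rewrite gt_eqF.
have dV : is_derive v 1 (fun y : R => y^-1) (- v ^- 2).
  apply: (is_derive_eq (@is_deriveV _ (@id R) v 1 1 vn (is_derive_id v 1))).
  by rewrite -[_ *: _]/(_ * _) mulr1.
suff h : is_derive v 1 (hj j) (- (j.+1%:R / (2 * v)) * hj j v) /\
   is_derive v 1 (hj j.+1) (- (j.+2%:R / (2 * v)) * hj j.+1 v) by case: h.
elim: j => [|j [h1 h2]]; split=> //.
- have dr := rr_dv v0; rewrite (_ : hj 0 = fun y => (2 * pi)^-1 * (rr y * y^-1)); last first.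
    by apply: funext => y /=; rewrite (invfM _ y); ring.
  apply: is_derive_eq; rewrite -![_ *: _]/(_ * _) /=.
  have r0 : rr v != 0 by rewrite gt_eqF// rr_gt0.
  have e : L = rr v ^+ 2 / (2 * v) by rewrite rr_sqr//; field.
  rewrite {1}e; move: (rr v) r0 {dr} => r r0; move: (pi : R) pn => p pn; field.
  by rewrite ?vn ?r0 ?pn.
- by rewrite (_ : hj 1 = cst 0)// mulr0; exact: is_derive_cst.
rewrite (_ : hj j.+2 = fun y => - (L / (4 * pi)) / j.+2%:R * (y^-1 * hj j y)); last first.
  by apply: funext => y /=; rewrite (invfM _ y); ring.
apply: is_derive_eq; rewrite -![_ *: _]/(_ * _) /=.
have n1 : j.+2%:R != 0 :> R by rewrite pnatr_eq0.
have e3 : j.+3%:R = j.+1%:R + 2 :> R by rewrite -natrD addn2.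
rewrite e3; move: (hj j v) (j.+1%:R) (j.+2%:R) n1 (pi : R) pn (L) => a b c n1 p pn y.
field.
by rewrite ?vn ?n1 ?pn.
Qed.

(** The heat equation [d/dv ff = (2 pi / L) d^2/dx^2 ff] on Taylor coefficients, proved along their
    recursion so that no derivatives in [x] and [v] have to be exchanged. *)
Lemma cj_dv j s M v : 0 < v ->
  is_derive v 1 (cj j s M) (2 * pi / L * (j.+1%:R * j.+2%:R) * cj j.+2 s M v).
Proof.
move=> v0; have pn : (pi : R) != 0 by rewrite gt_eqF.
have vn : v != 0 by rewrite gt_eqF.
have Ln : L != 0 by rewrite gt_eqF.
elim: j => [|j IH].
  have dr := rr_dv v0; have r0 : rr v != 0 by rewrite gt_eqF// rr_gt0.
  have dA : is_derive v 1 (fun y => M * rr y) (M * (L / rr v)) by apply: is_derive_eq.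
  have dEr := is_derive1_comp (f := @Er R) (g := fun y => M * rr y) (Er_derive _) dA.
  have dE : is_derive v 1 (fun y => expR (2 * pi * L * y * M ^+ 2))
      (expR (2 * pi * L * v * M ^+ 2) * (2 * pi * L * M ^+ 2)).
    by apply: is_derive_eq; rewrite -![_ *: _]/(_ * _) /=; ring.
  have e0 y : ff s M y 0 = (s - Er (M * rr y)) * expR (2 * pi * L * y * M ^+ 2).
    by rewrite /ff mul0r !mulr0 !subr0.
  rewrite (_ : cj 0 s M = fun y => (s - Er (M * rr y)) * expR (2 * pi * L * y * M ^+ 2)); last first.
    by apply: funext => y; rewrite /= e0.
  apply: (is_derive_eq (is_deriveM (is_deriveB (is_derive_cst s v 1) dEr) dE)).
  rewrite -![_ *: _]/(_ * _) /= e0.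
  have g : expR (- pi * (M * rr v) ^+ 2) * expR (2 * pi * L * v * M ^+ 2) = 1.
    by rewrite -expRD exprMn rr_sqr// -[RHS]expR0; congr expR; ring.
  rewrite -[(cst s - (@Er R \o _)) v]/(s - Er (M * rr v)).
  set A := expR (- pi * _) in g *; set B := expR (2 * _ * _ * _ * _) in g *.
  rewrite [B * (0 - _)](_ : _ = - (A * B) * (2 * (M * (L / rr v)))); last by ring.
  rewrite g; have e : v = rr v ^+ 2 / (2 * L) by rewrite rr_sqr//; field.
  rewrite [X in rr v / (2 * pi * X)]e; move: (rr v) r0 (Er _) B {dr dA dEr g dE e0} A => r r0 E B A.
  rewrite divr1.
  move: (pi : R) pn (L) Ln {e} => p pn y yn; field.
  by rewrite ?r0 ?yn ?pn.
have h := hj_dv j v0; rewrite (_ : cj j.+1 s M = fun y =>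
  j.+1%:R^-1 * (- (L * M) * cj j s M y + hj j y)); last by apply: funext => y; rewrite /= mulrC.
apply: is_derive_eq; rewrite -![_ *: _]/(_ * _).
have e3 : j.+3%:R * cj j.+3 s M v = - (L * M) * cj j.+2 s M v - (L / (4 * pi * v)) / j.+2%:R * hj j v.
  rewrite [cj j.+3 _ _ _]/= mulrC divfK ?pnatr_eq0//; congr (_ + _); by rewrite !mulNr.
rewrite (_ : _ * cj j.+3 s M v = 2 * pi / L * j.+2%:R * (j.+3%:R * cj j.+3 s M v)); last by ring.
have n1 : j.+1%:R != 0 :> R by rewrite pnatr_eq0.
have n2 : j.+2%:R != 0 :> R by rewrite pnatr_eq0.
rewrite e3; move: (cj j.+2 s M v) (hj j v) (j.+1%:R) n1 (j.+2%:R) n2 => c h1 a a0 b b0.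
move: (pi : R) pn (L) Ln => p pn y yn; field.
by rewrite ?a0 ?b0 ?yn ?pn ?vn.
Qed.

Lemma hj_bound j v0 : 0 < v0 -> exists2 K, 0 <= K & forall v, v0 / 2 <= v -> v <= 2 * v0 -> `|hj j v| <= K.
Proof.
move=> v00.
suff h : (exists2 K, 0 <= K & forall v, v0 / 2 <= v -> v <= 2 * v0 -> `|hj j v| <= K) /\
  (exists2 K, 0 <= K & forall v, v0 / 2 <= v -> v <= 2 * v0 -> `|hj j.+1 v| <= K) by case: h.
have vp v : v0 / 2 <= v -> 0 < v by move=> h; apply: lt_le_trans h; rewrite divr_gt0.
have iv v : v0 / 2 <= v -> v^-1 <= 2 / v0.
  by move=> h; rewrite -[leRHS]invrK invfM invrK mulrC lef_pV2 ?posrE ?vp// divr_gt0.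
elim: j => [|j [[K K0 hK] h2]]; split=> //.
- exists (rr (2 * v0) / (2 * pi) * (2 / v0)); first by rewrite !mulr_ge0 ?invr_ge0 ?sqrtr_ge0 ?mulr_ge0 ?ltW.
  move=> v v1 v2; have vv := vp v v1.
  rewrite /= ger0_norm; last by rewrite divr_ge0 ?sqrtr_ge0// ltW// !mulr_gt0.
  rewrite (invfM _ v) mulrA ler_pM ?iv ?invr_ge0 ?(ltW vv)//.
    by rewrite mulr_ge0 ?sqrtr_ge0// invr_ge0 mulr_ge0 ?ltW.
  rewrite ler_wpM2r ?invr_ge0 ?mulr_ge0 ?(ltW p0)// ler_sqrt ?mulr_ge0 ?(ltW v00)//.
  by rewrite ler_wpM2l// mulr_ge0.
- by exists 0 => // v _ _; rewrite normr0.
exists (L / (4 * pi) * (2 / v0) * K).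
  by rewrite !mulr_ge0 ?invr_ge0 ?mulr_ge0 ?(ltW p0) ?(ltW v00).
move=> v v1 v2; have vv := vp v v1; rewrite [hj j.+2 v]/= normrM ler_pM ?hK//.
rewrite normrM normrN normfV (ger0_norm (ler0n _ _)) ger0_norm; last first.
  by rewrite divr_ge0// ltW// !mulr_gt0.
rewrite ler_pdivrMr ?ltr0n//; apply: (@le_trans _ _ (L / (4 * pi) * (2 / v0))).
  by rewrite (invfM _ v) mulrA ler_wpM2l ?iv// divr_ge0// mulr_ge0// ltW.
rewrite ler_peMr ?ler1n//.
by rewrite !mulr_ge0 ?invr_ge0 ?mulr_ge0 ?(ltW p0) ?(ltW v00).
Qed.

Lemma cj_bound j v0 K0 : 0 < v0 -> exists2 K, 0 <= K & forall s M v, v0 / 2 <= v -> v <= 2 * v0 ->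
  `|ff s M v 0| <= K0 -> `|cj j s M v| <= K * (1 + `|M|) ^+ j.
Proof.
move=> v00; elim: j => [|j [K Kp hK]].
  by exists `|K0| => // s M v _ _ h; rewrite expr0 mulr1 (le_trans h)// ler_norm.
have [K' K'p hK'] := hj_bound j v00; exists (L * K + K'); first by rewrite addr_ge0// mulr_ge0// ltW.
move=> s M v v1 v2 h; rewrite /= normrM normfV (ger0_norm (ler0n _ _)) ler_pdivrMr ?ltr0n//.
have m1 : 1 <= 1 + `|M| by rewrite lerDl.
have mN : 1 <= (1 + `|M|) ^+ j by rewrite exprn_ege1.
apply: (@le_trans _ _ ((L * K + K') * (1 + `|M|) ^+ j.+1)); last first.
  by rewrite ler_peMr ?ler1n// mulr_ge0 ?exprn_ge0 ?addr_ge0 ?mulr_ge0// ltW.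
apply: le_trans (ler_normD _ _) _; rewrite normrM normrN normrM (gtr0_norm Lp) mulrDl lerD//.
  have h1 := hK s M v v1 v2 h; apply: le_trans (ler_wpM2l (_ : 0 <= L * `|M|) h1) _.
    by rewrite mulr_ge0// ltW.
  rewrite exprS [leRHS]mulrA mulrA ler_wpM2r ?(le_trans ler01)//.
  have : 0 <= L * K by rewrite mulr_ge0// ltW.
  have := normr_ge0 M; nra.
apply: le_trans (hK' v v1 v2) _; rewrite ler_peMr// exprS mulr_ege1//.
Qed.

(* The two signs may differ only for [|M| <= 1], where a crude bound suffices. *)
Lemma ff_bound v0 : 0 < v0 -> exists2 K, 0 <= K & forall s M v x, v0 / 2 <= v -> v <= 2 * v0 ->
  `|x| <= pi * v0 -> `|s| <= 1 -> (1 < `|M| -> s = Num.sg M) -> `|ff s M v x| <= K.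
Proof.
move=> v00; have [K Kp hK] := Er_bound R.
exists (K + 2 * expR (pi * (9 * L * v0))); first by rewrite addr_ge0 ?(ltW Kp)// mulr_ge0 ?expR_ge0.
move=> s M v x v1 v2 xv s1 sM; have vv : 0 < v by apply: lt_le_trans v1; rewrite divr_gt0.
(* The range of [x] is chosen so that [M] is shifted by at most 1/2, which cannot change its sign
   when [|M| > 1]. *)
set y := M - x / (4 * pi * v); have xq : `|x / (4 * pi * v)| <= 1 / 2.
  have q0 : 0 <= 4 * pi * v by rewrite !mulr_ge0 ?(ltW p0) ?(ltW vv).
  rewrite normrM normfV (ger0_norm q0).
  rewrite ler_pdivrMr ?mulr_gt0//; have := p0; nra.
set E := expR (2 * pi * L * v * M ^+ 2 - L * M * x).
have g : expR (- pi * (y * rr v) ^+ 2) * E <= 1.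
  rewrite -expRD gauss_square// -[leRHS]expR0 ler_expR mulNr oppr_le0 mulr_ge0 ?sqr_ge0//.
  by rewrite divr_ge0// ltW// !mulr_gt0.
rewrite /ff -/y -/E normrM (ger0_norm (expR_ge0 _)).
have [M1|M1] := leP `|M| 1; last first.
  have e : s = Num.sg (y * rr v).
    rewrite (sM M1) sgrM (gtr0_sg (rr_gt0 vv)) mulr1.
    have hx := xq; rewrite ler_norml in hx; case/andP: hx => hx1 hx2.
    have [M0|M0] := ltP M 0.
      by rewrite !ltr0_sg// /y; rewrite ltr0_norm// in M1; lra.
    by rewrite ger0_norm// in M1; rewrite !gtr0_sg// /y; lra.
  rewrite e; apply: le_trans (ler_wpM2r (expR_ge0 _) (hK (y * rr v))) _.
  rewrite -(mulrA K) -/E (le_trans (ler_wpM2l (ltW Kp) g))// mulr1 lerDl mulr_ge0 ?expR_ge0//.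
have y2 : `|y| <= 3 / 2 by apply: le_trans (ler_normB _ _) _; lra.
have Er1 (w : R) : `|Er w| <= 1.
  rewrite ler_norml Er_le1 andbT -[w]opprK ErN lerN2; exact: Er_le1.
apply: (@le_trans _ _ (2 * E)).
  rewrite ler_wpM2r ?expR_ge0//; apply: le_trans (ler_normB _ _) _; have := Er1 (y * rr v); lra.
(* [9 * L * v0] bounds [(y * rr v)^2], since [|y| <= 3 / 2] and [rr v ^+ 2 <= 4 * L * v0]. *)
have E1 : E <= expR (pi * (9 * L * v0)).
  rewrite ler_expR; have := gauss_square M x vv; rewrite -/y => gs.
  have : 0 <= (L / (8 * pi * v)) * x ^+ 2.
    by rewrite mulr_ge0 ?sqr_ge0// divr_ge0// ltW// !mulr_gt0.
  have h3 : pi * (y * rr v) ^+ 2 <= pi * (9 * L * v0).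
    rewrite ler_pM2l// exprMn rr_sqr//.
    have h4 : y ^+ 2 <= 9 / 4 by rewrite -(real_normK (num_real y)); have := normr_ge0 y; nra.
    have h5 : 2 * L * v <= 4 * L * v0 by have := Lp; nra.
    have : 0 <= 2 * L * v by rewrite !mulr_ge0 ?ltW.
    have := sqr_ge0 y; nra.
  rewrite mulNr in gs; lra.
rewrite (le_trans (ler_wpM2l _ E1))// lerDr ltW//.
Qed.

End CompletionTerm.

(** * The nonholomorphic series: convergence, expansion and heat equation *)

Section CompletionSum.
Variables (R : realType) (l nu : nat).
Hypotheses (l0 : (0 < l)%N) (nul : (nu < l)%N).
Local Notation C := R[i].
Local Notation Im := (@complex.Im R).
Local Notation L := (l%:R : R).
Implicit Types (t w : C) (m : int) (s x : R).

Definition Mm m : R := m%:~R + 2^-1 - nu%:R / L.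
Definition sgm m : R := Num.sg (m%:~R + 2^-1).
(** The antiholomorphic phase split off from the [m]-th term. Its modulus is the Gaussian
    [e^(- pi L v M^2)], which gives convergence although the factors [ff] are merely bounded. *)
Definition ph t m : C := (-1) ^ m * cexp (- cpi R * 'i%C * l%:R * (Mm m)%:C ^+ 2 * conjc t).
Definition nonhol_coef j t : C := tsum (fun m => ph t m * (cj l j (sgm m) (Mm m) (Im t))%:C).
Definition nonhol_fun t x : C := tsum (fun m => ph t m * (ff l (sgm m) (Mm m) (Im t) x)%:C).

Let Lp : 0 < L. Proof. by rewrite ltr0n. Qed.
Let p0 : 0 < (pi : R). Proof. exact: pi_gt0. Qed.

Let nuL : 0 <= nu%:R / L < 1.
Proof. by rewrite divr_ge0//= ltr_pdivrMr// mul1r ltr_nat. Qed.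

Lemma sgm_Mm m : 1 < `|Mm m| -> sgm m = Num.sg (Mm m).
Proof.
have /andP[h1 h2] := nuL; rewrite /sgm /Mm; set y := nu%:R / L in h1 h2 *.
have [M0|M0] := ltP (m%:~R + 2^-1 - y) 0; rewrite ?(ltr0_norm M0) ?(ger0_norm M0) => M1.
  by rewrite !ltr0_sg//; lra.
by rewrite !gtr0_sg//; lra.
Qed.

Lemma sgm_le1 m : `|sgm m| <= 1.
Proof. by rewrite /sgm normr_sg; case: (_ != 0). Qed.

Let X m : C := - cpi R * 'i%C * l%:R * (Mm m)%:C ^+ 2.

Let XE m : X m = (- pi * L * Mm m ^+ 2)%:C * 'i%C.
Proof. by rewrite /X expr2 [in RHS]expr2 !rmorphM rmorphN rmorph_nat /cpi; ring. Qed.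

Let conj_i : conjc 'i%C = - 'i%C :> C.
Proof. by apply/eqP; rewrite eq_complex /= oppr0 !eqxx. Qed.

Let nm_conj w : w = 1 \/ w = 'i%C -> nm (conjc w) = 1.
Proof. by case=> ->; rewrite ?conj_i ?nmN ?nm_i// conjc1 nm1. Qed.

Let Xb m : nm (X m) <= pi * L * (1 + `|Mm m|) ^+ 2.
Proof.
rewrite XE nmM nm_i mulr1 nm_real normrM mulNr normrN (gtr0_norm (mulr_gt0 p0 Lp)) normrX.
by rewrite ler_wpM2l ?mulr_ge0 ?(ltW p0)// lerXn2r ?nnegrE ?addr_ge0// lerDr.
Qed.

Lemma nm_ph t m : nm (ph t m) = expR (- (pi * L * Im t) * Mm m ^+ 2).
Proof.
rewrite /ph nmM nm_signz mul1r nm_cexp -/(X m); congr expR.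
rewrite XE -mulrA.
case: t => a b /=; ring.
Qed.

Lemma gauss_bsum p y : 0 < y ->
  exists K, bsum (fun m => (1 + `|Mm m|) ^+ p * expR (- y * Mm m ^+ 2)) K.
Proof.
move=> y0; have ok : qsummable (fun m => Mm m ^+ 2) (fun m => ((1 + `|Mm m|) ^+ p)%:C).
  have /andP[h1 h2] := nuL.
  have e m : `|m|%N%:R = `|m%:~R| :> R by rewrite natr_absz intr_norm.
  apply: (qsummable_geom_summable (h := absz) (c := 1) (c' := 2) (K := 2 ^+ p) (j := p)) => //.
  - exact: geom_summable_int.
  - by move=> m; exact: sqr_ge0.
  - move=> m; rewrite mul1r e; have : `|m%:~R : R| <= `|Mm m| + 1.
      have -> : m%:~R = Mm m + (nu%:R / L - 2^-1) by rewrite /Mm; ring.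
      apply: le_trans (ler_normD _ _) _; rewrite lerD2l ler_norml; apply/andP; split; lra.
    rewrite -(real_normK (num_real (Mm m))); have := sqr_ge0 (`|Mm m| - 1); nra.
  move=> m; rewrite nm_real ger0_norm ?exprn_ge0 ?addr_ge0// -exprMn lerXn2r ?nnegrE ?addr_ge0//.
  have : `|Mm m| <= `|m%:~R| + 1.
    by rewrite /Mm -addrA; apply: le_trans (ler_normD _ _) _; rewrite lerD2l ler_norml; apply/andP; split; lra.
  rewrite -(natr1 `|m|%N) e; have := normr_ge0 (m%:~R : R); lra.
have [_ /(_ y y0) [K hK]] := ok; exists K => B uB; apply: le_trans (hK B uB).
by apply: ler_sum => m _; apply: le_trans (ler_norm _) _; rewrite -rmorphM nm_real.
Qed.

Section At.
Variable t : C.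
Hypothesis t0 : 0 < Im t.
Local Notation v0 := (Im t).

Let v1 : v0 / 2 <= v0. Proof. by have := t0; lra. Qed.
Let v2 : v0 <= 2 * v0. Proof. by have := t0; lra. Qed.
Let c0 : 0 < pi * L * v0. Proof. by rewrite !mulr_gt0. Qed.

Let cj_unif j : exists2 K, 0 <= K & forall m v, v0 / 2 <= v -> v <= 2 * v0 ->
  `|cj l j (sgm m) (Mm m) v| <= K * (1 + `|Mm m|) ^+ j.
Proof.
have [K0 K0p hK0] := ff_bound l0 t0; have [K Kp hK] := cj_bound l0 j K0 t0.
exists K => // m v h1 h2; apply: hK => //; apply: hK0 => //.
- by rewrite normr0 mulr_ge0// ltW.
- exact: sgm_le1.
- exact: sgm_Mm.
Qed.

Lemma asum_nonhol_coef j : asum (fun m => ph t m * (cj l j (sgm m) (Mm m) v0)%:C).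
Proof.
have [K Kp hK] := cj_unif j; have [K' hK'] := gauss_bsum j c0.
apply: (asum_le (bsumZ Kp hK')) => m; rewrite nmM nm_ph nm_real [leRHS]mulrA mulrC.
by rewrite ler_wpM2r ?expR_ge0// hK.
Qed.

Lemma asum_nonhol_fun x : `|x| <= pi * v0 ->
  asum (fun m => ph t m * (ff l (sgm m) (Mm m) v0 x)%:C).
Proof.
have [K0 K0p hK0] := ff_bound l0 t0; have [K' hK'] := gauss_bsum 0 c0.
move=> xd; apply: (asum_le (bsumZ K0p hK')) => m; rewrite expr0 mul1r nmM nm_ph nm_real mulrC.
rewrite ler_wpM2r ?expR_ge0// hK0//; [exact: sgm_le1|exact: sgm_Mm].
Qed.

Lemma asym_nonhol_fun : asym setT (nonhol_fun t) (fun j => nonhol_coef j t).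
Proof.
move=> N; have [K0 K0p hK0] := ff_bound l0 t0.
pose d := Num.min 1 (pi * v0); have d1 : d <= 1 by rewrite ge_min lexx.
have dp : 0 < d by rewrite lt_min ltr01 mulr_gt0.
have e0 : 0 < pi * v0 by rewrite mulr_gt0.
have [K Kp hK] := ff_rem l0 K0 N t0 d1; have [K' hK'] := gauss_bsum N c0.
exists (K * K'), (Num.min d (pi * v0)); split; first by rewrite lt_min dp.
move=> x _ _; rewrite le_min => /andP[xd xe].
have aj j : asum (fun m => x%:C ^+ j * (ph t m * (cj l j (sgm m) (Mm m) v0)%:C)) := asumZ _ (asum_nonhol_coef j).
have -> : \sum_(j < N) nonhol_coef j t * x%:C ^+ j =
    tsum (fun m => \sum_(j < N) x%:C ^+ j * (ph t m * (cj l j (sgm m) (Mm m) v0)%:C)).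
  rewrite (@tsum_sum _ _ N (fun j m => x%:C ^+ j * (ph t m * (cj l j (sgm m) (Mm m) v0)%:C))); last first.
    by move=> j _; exact: aj.
  by apply: eq_bigr => j _; rewrite (tsumZ _ (asum_nonhol_coef j)) mulrC.
have as' : asum (fun m => \sum_(j < N) x%:C ^+ j * (ph t m * (cj l j (sgm m) (Mm m) v0)%:C)).
  apply: (@asum_sum _ _ N (fun j m => x%:C ^+ j * (ph t m * (cj l j (sgm m) (Mm m) v0)%:C))).
  by move=> j _; exact: aj.
rewrite /nonhol_fun -(tsumB (asum_nonhol_fun xe) as') mulrAC.
have xN : 0 <= K * `|x| ^+ N by rewrite mulr_ge0// exprn_ge0.
apply: (tsum_le (bsumZ xN hK')) => m.
have -> : ph t m * (ff l (sgm m) (Mm m) v0 x)%:C -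
    \sum_(j < N) x%:C ^+ j * (ph t m * (cj l j (sgm m) (Mm m) v0)%:C) =
    ph t m * (ff l (sgm m) (Mm m) v0 x - \sum_(j < N) cj l j (sgm m) (Mm m) v0 * x ^+ j)%:C.
  rewrite rmorphB mulrBr; congr (_ - _); rewrite rmorph_sum mulr_sumr; apply: eq_bigr => j _.
  by rewrite rmorphM rmorphXn; ring.
rewrite nmM nm_ph nm_real mulrC [leRHS]mulrA ler_wpM2r ?expR_ge0// [leRHS]mulrAC.
apply: hK => // y yd; apply: hK0 => //; [|exact: sgm_le1|exact: sgm_Mm].
by rewrite (le_trans yd)// ge_min lexx orbT.
Qed.

Let cd j m v : R := 2 * pi / L * (j.+1%:R * j.+2%:R) * cj l j.+2 (sgm m) (Mm m) v.

Let nonhol_coef_rd j w : w = 1 \/ w = 'i%C -> rd (along w (nonhol_coef j) t) 0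
  (tsum (fun m => X m * conjc w * (ph t m * (cj l j (sgm m) (Mm m) v0)%:C) +
    ph t m * (Im w * cd j m v0)%:C)).
Proof.
move=> hw.
have cw (s : R) : conjc (t + s%:C * w) = conjc t + s%:C * conjc w.
  by case: hw => ->; case: t => a b; apply/eqP; rewrite eq_complex /=; apply/andP; split; apply/eqP; ring.
have iw (s : R) : Im (t + s%:C * w) = v0 + s * Im w.
  by case: hw => ->; case: t => a b /=; ring.
have w1 := nm_conj hw.
have iw1 : `|Im w| <= 1 by case: hw => -> /=; rewrite ?normr0 ?normr1.
have [K Kp hK] := cj_unif j; have [K2 K2p hK2] := cj_unif j.+2.
(* Near [t] the height is at least [v0 / 2], so the Gaussian at that height dominates; the
   derivative costs two more powers of [1 + |M|], hence [j.+2]. *)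
pose y := pi * L * (v0 / 2); have y0 : 0 < y by rewrite !mulr_gt0// invr_gt0.
have [B hB] := gauss_bsum j.+2 y0.
pose F m s := ph (t + s%:C * w) m * (cj l j (sgm m) (Mm m) (Im (t + s%:C * w)))%:C.
pose F' m s := X m * conjc w * F m s +
   ph (t + s%:C * w) m * (Im w * cd j m (Im (t + s%:C * w)))%:C.
pose P := 2 * pi / L * (j.+1%:R * j.+2%:R) : R.
have P0 : 0 <= P by rewrite !mulr_ge0 ?invr_ge0// ltW.
have KK : 0 <= pi * L * K + P * K2 by apply: addr_ge0; apply: mulr_ge0 => //; rewrite mulr_ge0// ltW.
have key m s : `|s - 0| <= v0 / 2 -> rd (F m) s (F' m s) /\
    nm (F' m s) <= (pi * L * K + P * K2) * ((1 + `|Mm m|) ^+ j.+2 * expR (- y * Mm m ^+ 2)).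
  rewrite subr0 => sv; have [vs1 vs2] := along_H t0 hw sv.
  have vs : 0 < Im (t + s%:C * w) by apply: lt_le_trans vs1; rewrite divr_gt0.
  split.
    have r1 : rd (fun s : R => ph (t + s%:C * w) m) s (X m * conjc w * ph (t + s%:C * w) m).
      have h := rd_cexp (X m * conjc t) (X m * conjc w) s.
      have h' := rdZ ((-1) ^ m) h.
      have -> : X m * conjc w * ph (t + s%:C * w) m =
          (-1) ^ m * (X m * conjc w * cexp (X m * conjc t + s%:C * (X m * conjc w))).
        by rewrite /ph cw -/(X m) mulrCA; congr (_ * (_ * cexp _)); ring.
      by apply: rd_eq h' => z; rewrite /ph cw -/(X m); congr (_ * cexp _); ring.
    have r2 : rd (fun s : R => (cj l j (sgm m) (Mm m) (Im (t + s%:C * w)))%:C) s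
        (Im w * cd j m (Im (t + s%:C * w)))%:C.
      apply: rd_is_derive.
      have dA : is_derive s 1 (fun z : R => v0 + z * Im w) (Im w).
        by apply: is_derive_eq; rewrite -![_ *: _]/(_ * _) /=; ring.
      have vs' := vs; rewrite iw in vs'.
      have h := is_derive1_comp (f := cj l j (sgm m) (Mm m)) (g := fun z : R => v0 + z * Im w)
        (cj_dv l0 j (sgm m) (Mm m) vs') dA.
      rewrite iw mulrC (_ : (fun s0 : R => _) = (cj l j (sgm m) (Mm m) \o (fun z : R => v0 + z * Im w))) //.
      by apply: funext => z; rewrite iw.
    have := rdM r1 r2; rewrite /F' /F => h.
    by rewrite mulrA.
  have h1 := hK m _ vs1 (le_trans vs2 _); have h2 := hK2 m _ vs1 (le_trans vs2 _).
  have v32 : 3 / 2 * v0 <= 2 * v0 by have := t0; lra.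
  move: {h1 h2} (h1 v32) (h2 v32) => h1 h2.
  have M1 : 1 <= 1 + `|Mm m| by rewrite lerDl.
  set A := 1 + `|Mm m| in M1 h1 h2 *; have A0 : 0 <= A := le_trans ler01 M1.
  have phb : nm (ph (t + s%:C * w) m) <= expR (- y * Mm m ^+ 2).
    rewrite nm_ph ler_expR ler_wpM2r ?sqr_ge0// lerN2 /y ler_wpM2l//.
    by rewrite mulr_ge0// ltW.
  have Xb' : nm (X m) <= pi * L * A ^+ 2 := Xb m.
  apply: le_trans (nmD _ _) _; rewrite (nmM (X m * _)) (nmM (X m)) w1 mulr1 (nmM (ph _ _)) nm_real.
  rewrite [nm (F m s)]nmM nm_real mulrDl lerD//.
    have -> : pi * L * K * (A ^+ j.+2 * expR (- y * Mm m ^+ 2)) =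
       (pi * L * A ^+ 2) * (expR (- y * Mm m ^+ 2) * (K * A ^+ j)).
      by rewrite -addn2 exprD; ring.
    by rewrite ler_pM ?nm_ge0 ?mulr_ge0 ?nm_ge0// ler_pM ?nm_ge0.
  have -> : P * K2 * (A ^+ j.+2 * expR (- y * Mm m ^+ 2)) =
     expR (- y * Mm m ^+ 2) * (1 * (P * (K2 * A ^+ j.+2))) by ring.
  rewrite ler_pM ?nm_ge0// normrM ler_pM// /cd normrM (ger0_norm P0) ler_wpM2l//.
have aF : asum (fun m => F m 0).
  by apply: asum_eq (asum_nonhol_coef j) => m; rewrite /F mul0r addr0.
have h := @rd_tsum R _ F F' 0 (v0 / 2) _ _ (divr_gt0 t0 (ltr0n _ 2)) (bsumZ KK hB) key aF.
have e0 : t + (0 : R)%:C * w = t by rewrite mul0r addr0.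
rewrite (_ : tsum _ = tsum (fun m => F' m 0)); first exact: h.
by apply: eq_tsum => m; rewrite /F' /F e0.
Qed.

Let asum_X j w : w = 1 \/ w = 'i%C -> asum (fun m => X m * conjc w * (ph t m * (cj l j (sgm m) (Mm m) v0)%:C)).
Proof.
move=> hw; have [K Kp hK] := cj_unif j; have [K' hK'] := gauss_bsum j.+2 c0.
have KK : 0 <= pi * L * K by rewrite !mulr_ge0// ltW.
have w1 := nm_conj hw.
apply: (asum_le (bsumZ KK hK')) => m.
rewrite (nmM (X m * _)) (nmM (X m)) w1 mulr1 (nmM (ph _ _)) nm_ph nm_real.
have -> : pi * L * K * ((1 + `|Mm m|) ^+ j.+2 * expR (- (pi * L * v0) * Mm m ^+ 2)) =
    (pi * L * (1 + `|Mm m|) ^+ 2) * (expR (- (pi * L * v0) * Mm m ^+ 2) * (K * (1 + `|Mm m|) ^+ j)).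
  by rewrite -addn2 exprD; ring.
by rewrite ler_pM ?nm_ge0 ?mulr_ge0 ?expR_ge0// ler_wpM2l ?expR_ge0 ?hK.
Qed.

Lemma nonhol_coef_diff j : diff (nonhol_coef j) t.
Proof.
apply: (has_partials_diff (a := tsum _) (b := tsum _)); split; [exact: nonhol_coef_rd (or_introl erefl)|exact: nonhol_coef_rd (or_intror erefl)].
Qed.

Lemma nonhol_coef_heat j : j.+1%:R * j.+2%:R * nonhol_coef j.+2 t + 2 * l%:R * D (nonhol_coef j) t = 0.
Proof.
have h1 := nonhol_coef_rd j (or_introl erefl); have h2 := nonhol_coef_rd j (or_intror erefl).
rewrite (has_partials_D (conj h1 h2)).
pose a m := X m * (ph t m * (cj l j (sgm m) (Mm m) v0)%:C).
pose b m := ph t m * (cd j m v0)%:C.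
have aa : asum a.
  by apply: asum_eq (asum_X j (or_introl erefl)) => m; rewrite conjc1 mulr1.
have eb m : b m = (2 * pi / L * (j.+1%:R * j.+2%:R))%:C * (ph t m * (cj l j.+2 (sgm m) (Mm m) v0)%:C).
  by rewrite /b /cd rmorphM; ring.
have ab : asum b by apply: asum_eq (fun m => esym (eb m)) _; exact/asumZ/asum_nonhol_coef.
have -> : tsum (fun m => X m * conjc 1 * (ph t m * (cj l j (sgm m) (Mm m) v0)%:C) +
    ph t m * (Im 1 * cd j m v0)%:C) = tsum a.
  by apply: eq_tsum => m; rewrite conjc1 mulr1 /= mul0r mulr0 addr0.
have -> : tsum (fun m => X m * conjc 'i%C * (ph t m * (cj l j (sgm m) (Mm m) v0)%:C) +
    ph t m * (Im 'i%C * cd j m v0)%:C) = - 'i%C * tsum a + tsum b.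
  rewrite -(tsumZ _ aa) -(tsumD (asumZ _ aa) ab); apply: eq_tsum => m.
  by rewrite conj_i /a /b /= mul1r; ring.
have -> : tsum b = (2 * pi / L * (j.+1%:R * j.+2%:R))%:C * nonhol_coef j.+2 t.
  by rewrite (eq_tsum eb) (tsumZ _ (asum_nonhol_coef _)).
have Ln : (l%:R : C) != 0 by rewrite pnatr_eq0 -lt0n.
have ii : 'i%C * 'i%C = -1 :> C by rewrite -expr2 sqr_i.
have i0 : 'i%C != 0 :> C by apply/eqP => e; move: ii; rewrite e mul0r => /eqP; rewrite eq_sym oppr_eq0 oner_eq0.
have pn := cpi_neq0 R.
have -> : (2 * pi / L * (j.+1%:R * j.+2%:R))%:C = 2 * cpi R / l%:R * (j.+1%:R * j.+2%:R) :> C.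
  by rewrite !rmorphM fmorphV !rmorph_nat.
set A := tsum a; set g := nonhol_coef j.+2 t; set q := _ * j.+2%:R.
have -> : A - 'i%C * (- 'i%C * A + 2 * cpi R / l%:R * q * g) =
    (1 + 'i%C * 'i%C) * A - 'i%C * (2 * cpi R / l%:R * q * g) by ring.
rewrite ii subrr mul0r add0r.
move: (cpi R) pn ('i%C : C) i0 (l%:R : C) Ln => p pn i in0 y yn; field.
by rewrite ?yn ?pn ?in0.
Qed.

End At.

End CompletionSum.

(** * Decomposition of [Asharp] into the Appell function and theta series times nonholomorphic
    series *)

Section AsharpSplit.
Variables (R : realType) (d : nat).
Local Notation C := R[i].
Local Notation Im := (@complex.Im R).
Local Notation l := (d.*2.+1).
Local Notation L := (l%:R : R).

Lemma signzM_odd (m : int) (k : nat) : (-1) ^ (k%:Z * (2 * m + 1)) = (-1) ^+ k :> C.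
Proof.
have y0 : (-1) ^ k%:Z != 0 :> C by rewrite -exprnP signr_eq0.
rewrite -exprz_exp expfzDr// -exprz_exp -(exprnP ((-1) ^ k%:Z) 2) -(exprnP _ k).
by rewrite sqrr_sign exp1rz mul1r expr1z.
Qed.

Lemma cexp_half (m : int) (k : nat) : cexp (2 * cpi R * 'i%C * half_int R m * k%:R) = (-1) ^+ k.
Proof.
rewrite -(signzM_odd m) -cexp_pin; congr cexp.
by rewrite /half_int !intrM !intrD !intrM -!pmulrn; field.
Qed.

(** Completing the square in the exponent. The half-integral index turns the shift by [2^-1] into
    the factor [(-1)^m i], and the shift by [k] into [(-1)^k]. *)
Lemma thetaJ_coset_theta (nu k : nat) t : 0 < Im t ->
  thetaJ (nu%:R * t + k%:R) (l%:R * t) =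
  (-1) ^+ k * 'i%C * ee (- (nu%:R ^+ 2 / (2 * l%:R)) * t) * coset_theta d nu t.
Proof.
move=> t0; have l0 : (l%:R : C) != 0 by rewrite pnatr_eq0.
have av : asum (fun N => (-1) ^+ k * 'i%C * ee (- (nu%:R ^+ 2 / (2 * l%:R)) * t) *
    (vtw R d 0 nu N * ee ((vta R d nu N)%:C * t))) := asumZ _ (qsum_asum (qsummable_coset_theta R d 0 nu) t0).
rewrite /coset_theta /qsum -(tsumZ _ (qsum_asum (qsummable_coset_theta R d 0 nu) t0)).
have e (m : int) : cexp (cpi R * 'i%C * half_int R m ^+ 2 * (l%:R * t) +
    2 * cpi R * 'i%C * half_int R m * (nu%:R * t + k%:R + 2^-1)) =
    (-1) ^+ k * 'i%C * ee (- (nu%:R ^+ 2 / (2 * l%:R)) * t) *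
    (vtw R d 0 nu m * ee ((vta R d nu m)%:C * t)).
  have zeval : (vta R d nu m)%:C = (nu%:R + l%:R * half_int R m) ^+ 2 / (2 * l%:R).
    rewrite /vta fmorph_div (rmorphXn _ 2) rmorphM !rmorph_nat; congr (_ ^+ _ / _).
    have -> : half_int R m = (m%:~R + 2^-1)%:C by rewrite /half_int rmorphD rmorph_int fmorphV rmorph_nat.
    rewrite (_ : vy R d nu m = nu%:R + L * (m%:~R + 2^-1)); last by rewrite /vy -pmulrn; ring.
    by rewrite rmorphD rmorphM !rmorph_nat.
  have ei : cexp (cpi R * 'i%C * half_int R m) = (-1) ^ m * 'i%C.
    rewrite /half_int mulrDr cexpD cexp_pin; congr (_ * _).
    have -> : cpi R * 'i%C * 2^-1 = (0 : R) +i* (pi / 2).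
      by rewrite /cpi -(rmorph_nat (real_complex R)) -fmorphV; apply/eqP; rewrite eq_complex /=; apply/andP; split; apply/eqP; ring.
    by rewrite /cexp /= expR0 cos_pihalf sin_pihalf mul1r.
  rewrite -(cexp_half m k) zeval /vtw expr0 mulr1.
  transitivity (cexp (2 * cpi R * 'i%C * half_int R m * k%:R) * cexp (cpi R * 'i%C * half_int R m) *
    (ee (- (nu%:R ^+ 2 / (2 * l%:R)) * t) * ee ((nu%:R + l%:R * half_int R m) ^+ 2 / (2 * l%:R) * t))).
    rewrite /ee -!cexpD; congr cexp; move: (half_int R m) (l%:R : C) l0 => h y yn; field.
    by rewrite ?yn.
  by rewrite ei; ring.
rewrite /thetaJ zsum_tsum; first exact: eq_tsum.
by apply: asum_eq av => m; rewrite e.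
Qed.

(** Completing the square again, now with [conjc t]. Apart from [i], the prefactor is inverse to
    that of [thetaJ_coset_theta] times [ee (nu * Z)], so all phases cancel in [Asharp]. *)
Lemma Ssharp_nonhol_fun (nu k : nat) t (x : R) (Z := x%:C / (2 * cpi R * 'i%C)) : 0 < Im t ->
  (nu < l)%N -> `|x| <= pi * Im t ->
  Ssharp (l%:R * Z - nu%:R * t - k%:R) (l%:R * 0 - nu%:R * conjc t - k%:R) (l%:R * t) =
  (-1) ^+ k * ee (nu%:R ^+ 2 / (2 * l%:R) * t) * ee (- (nu%:R * Z)) * nonhol_fun l nu t x.
Proof.
move=> t0 nul xt; have l0 : (l%:R : C) != 0 by rewrite pnatr_eq0.
have pin := two_pi_i_neq0 R; have pn := cpi_neq0 R.
have ii : 'i%C * 'i%C = -1 :> C by rewrite -expr2 sqr_i.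
have i0 : 'i%C != 0 :> C.
  by apply/eqP => e; move: ii; rewrite e mul0r => /eqP; rewrite eq_sym oppr_eq0 oner_eq0.
have vn : (Im t)%:C != 0 :> C by rewrite (fmorph_eq0 (real_complex R)) gt_eqF.
have ag := asum_nonhol_fun (ltn0Sn d.*2) nul t0 xt.
set A := (-1) ^+ k * _ * _.
have ct : conjc t = t - 2 * 'i%C * (Im t)%:C.
  by case: t {t0 xt vn ag A} => a b; apply/eqP; rewrite eq_complex /=; apply/andP; split; apply/eqP; ring.
have eI : (Im (l%:R * t)) = L * Im t.
  rewrite -(rmorph_nat (real_complex R) l); case: t {t0 xt vn ag A ct} => a b /=; ring.
have eM m : (Mm R l nu m)%:C = half_int R m - nu%:R / l%:R.
  by rewrite /Mm rmorphB rmorphD rmorph_int fmorphV fmorph_div !rmorph_nat.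
have xE : x%:C = 2 * cpi R * 'i%C * Z by rewrite mulrC divfK.
have e (m : int) : ((Num.sg (m%:~R + 2^-1 : R))%:C
   - Efun ((half_int R m + (l%:R * Z - nu%:R * t - k%:R - (l%:R * 0 - nu%:R * conjc t - k%:R)) /
             (2 * 'i%C * (Im (l%:R * t))%:C)) * (Num.sqrt (2 * Im (l%:R * t)))%:C))
  * (-1) ^ m
  * cexp (- cpi R * 'i%C * (l%:R * t) * half_int R m ^+ 2 -
          2 * cpi R * 'i%C * half_int R m * (l%:R * Z - nu%:R * t - k%:R)) =
  A * (ph l nu t m * (ff l (sgm R m) (Mm R l nu m) (Im t) x)%:C).
  rewrite eI; have -> : 2 * (L * Im t) = 2 * L * Im t by rewrite mulrA.
  have -> : half_int R m + (l%:R * Z - nu%:R * t - k%:R - (l%:R * 0 - nu%:R * conjc t - k%:R)) /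
             (2 * 'i%C * (L * Im t)%:C) = (Mm R l nu m - x / (4 * pi * Im t))%:C.
    have eq4 : (x / (4 * pi * Im t))%:C = x%:C / (4 * cpi R * (Im t)%:C) :> C.
      by rewrite fmorph_div !rmorphM rmorph_nat.
    have iv : 'i%C^-1 = - 'i%C :> C by apply: (mulfI i0); rewrite mulfV// mulrN ii opprK.
    have eB : (Mm R l nu m - x / (4 * pi * Im t))%:C = (Mm R l nu m)%:C - (x / (4 * pi * Im t))%:C.
      exact: rmorphB.
    have eL : (L * Im t)%:C = l%:R * (Im t)%:C by rewrite rmorphM rmorph_nat.
    rewrite eB eM eq4 eL ct /Z !invfM iv.
    transitivity (half_int R m + ((('i%C * 'i%C) * x%:C / (2 * cpi R) / (2 * (Im t)%:C)) +
      nu%:R / l%:R * ('i%C * 'i%C))).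
      move: (half_int R m) (Im t)%:C vn (cpi R) pn (l%:R : C) l0 => h v vn p pn y yn; field.
      by rewrite ?yn ?pn ?vn.
    rewrite ii; move: (half_int R m) (Im t)%:C vn (cpi R) pn (l%:R : C) l0 => h v vn p pn y yn; field.
    by rewrite ?yn ?pn ?vn.
  pose r : R := sgm R m - Er ((Mm R l nu m - x / (4 * pi * Im t)) * rr l (Im t)).
  have eF : (ff l (sgm R m) (Mm R l nu m) (Im t) x)%:C =
      r%:C * cexp (2 * pi * L * Im t * Mm R l nu m ^+ 2 - L * Mm R l nu m * x)%:C.
    by rewrite cexp_real -rmorphM.
  have eS : (Num.sg (m%:~R + 2^-1 : R))%:C -
      (Er ((Mm R l nu m - x / (4 * pi * Im t)) * Num.sqrt (2 * L * Im t)))%:C = r%:C :> C.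
    by rewrite -rmorphB.
  rewrite -rmorphM Efun_Er eS eF /A -(cexp_half m k) /ph.
  transitivity (r%:C * (-1) ^ m * (cexp (2 * cpi R * 'i%C * half_int R m * k%:R) *
     ee (nu%:R ^+ 2 / (2 * l%:R) * t) * ee (- (nu%:R * Z)) *
     cexp (- cpi R * 'i%C * l%:R * (Mm R l nu m)%:C ^+ 2 * conjc t) *
     cexp (2 * pi * L * Im t * Mm R l nu m ^+ 2 - L * Mm R l nu m * x)%:C)); last by ring.
  congr (_ * _); rewrite /ee -!cexpD; congr cexp.
  have -> : (2 * pi * L * Im t * Mm R l nu m ^+ 2 - L * Mm R l nu m * x)%:C =
     2 * cpi R * l%:R * (Im t)%:C * (Mm R l nu m)%:C ^+ 2 - l%:R * (Mm R l nu m)%:C * x%:C.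
    by rewrite expr2 rmorphB !rmorphM !rmorph_nat -expr2.
  rewrite eM ct xE.
  set h := half_int R m; set M := h - _; set v := (Im t)%:C; set p := cpi R.
  have -> : - p * 'i%C * l%:R * M ^+ 2 * (t - 2 * 'i%C * v) =
    - p * 'i%C * l%:R * M ^+ 2 * t + 2 * p * l%:R * v * M ^+ 2 * ('i%C * 'i%C) by ring.
  rewrite ii /M; move: (l%:R : C) l0 => y yn; field.
  by rewrite ?yn.
rewrite /Ssharp zsum_tsum.
  by rewrite (eq_tsum e) (tsumZ _ ag).
by apply: asum_eq (asumZ A ag) => m; rewrite e.
Qed.

Lemma Asharp_nonhol_fun (k : nat) t (x : R) (Z := x%:C / (2 * cpi R * 'i%C)) : 0 < Im t ->
  ell k = l -> `|x| <= pi * Im t ->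
  Asharp k Z 0 t = appell l Z 0 t - 2^-1 * \sum_(nu < l) coset_theta d nu t * nonhol_fun l nu t x.
Proof.
move=> t0 lE xt; rewrite /Asharp lE; congr (_ + _); rewrite -mulNr.
have ii : 'i%C * 'i%C = -1 :> C by rewrite -expr2 sqr_i.
transitivity (2^-1 * ('i%C * \sum_(nu < l) 'i%C * (coset_theta d nu t * nonhol_fun l nu t x))); last first.
  by rewrite -mulr_sumr (mulrA 'i%C 'i%C) ii; ring.
rewrite [RHS]mulrA [2^-1 * _]mulrC !mulr_sumr; apply: eq_bigr => nu _.
rewrite (thetaJ_coset_theta _ _ t0) (Ssharp_nonhol_fun _ t0 (ltn_ord nu) xt).
have z1 : ee (nu%:R * Z) * ee (- (nu%:R * Z)) = 1.
  by rewrite /ee -cexpD -mulrDr subrr mulr0 cexp0.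
have z2 : ee (- (nu%:R ^+ 2 / (2 * l%:R)) * t) * ee (nu%:R ^+ 2 / (2 * l%:R) * t) = 1 :> C.
  by rewrite /ee -cexpD mulNr mulrN addNr cexp0.
have z3 : (-1) ^+ k * (-1) ^+ k = 1 :> C by rewrite -expr2 sqrr_sign.
set a := ee _ in z1; set a' := ee _ in z1; set c := ee _ in z2; set c' := ee _ in z2.
rewrite -/a -/a' -/c -/c'.
transitivity ('i%C / 2 * ('i%C * (coset_theta d nu t * nonhol_fun l nu t x)) * (a * a') * (c * c') * ((-1) ^+ k * (-1) ^+ k)).
  by ring.
by rewrite z1 z2 z3; ring.
Qed.

End AsharpSplit.

(** * Convergence and non-vanishing of the eta product *)

Section EtaProduct.
Variables (R : realType) (t : R[i]).
Local Notation C := R[i].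
Local Notation Im := (@complex.Im R).
Hypothesis t0 : 0 < Im t.

Let q (m : nat) : C := ee (m%:R * t).
Let r : R := expR (- (2 * pi * Im t)).
Let P (N : nat) : C := \prod_(1 <= m < N.+1) (1 - q m).

Let r01 : 0 < r < 1.
Proof. by rewrite expR_gt0 -expR0 ltr_expR oppr_lt0 !mulr_gt0 ?pi_gt0. Qed.

Let nm_q m : nm (q m) = r ^+ m.
Proof. by rewrite /q -(rmorph_nat (real_complex R)) nm_ee /r -expRM_natr. Qed.

Let PS N : P N.+1 = P N * (1 - q N.+1).
Proof. by rewrite /P big_nat_recr. Qed.

Let geo_le M N : \sum_(M <= m < N) r ^+ m <= r ^+ M / (1 - r).
Proof.
have /andP[r0 r1] := r01; have d : 0 < 1 - r by rewrite subr_gt0.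
have [NM|MN] := leqP N M.
  by rewrite big_geq// divr_ge0 ?(ltW d)// exprn_ge0// ltW.
have h n : (\sum_(M <= m < M + n) r ^+ m) * (1 - r) = r ^+ M - r ^+ (M + n).
  elim: n => [|n IH]; first by rewrite addn0 big_geq// mul0r subrr.
  rewrite addnS big_nat_recr ?leq_addr//= mulrDl IH !exprS; ring.
by rewrite ler_pdivlMr// -(subnKC (ltnW MN)) h lerBlDr lerDl exprn_ge0// ltW.
Qed.

Let P_bound : exists2 B, 0 <= B & forall N, nm (P N) <= B.
Proof.
have /andP[r0 r1] := r01; exists (expR (r ^+ 1 / (1 - r))); first exact: expR_ge0.
move=> N; apply: (@le_trans _ _ (expR (\sum_(1 <= m < N.+1) r ^+ m))); last by rewrite ler_expR geo_le.
elim: N => [|N IH]; first by rewrite /P !big_geq// nm1 expR0.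
rewrite PS big_nat_recr//= expRD nmM ler_pM ?nm_ge0//.
apply: le_trans (nmB _ _) _; rewrite nm1 nm_q; exact: expR_ge1Dx.
Qed.

(** The partial products are bounded, so their increments are dominated by a geometric series. *)
Let P_lim : exists p, (fun N => P N : C^o) @ \oo --> (p : C^o).
Proof.
have [B B0 hB] := P_bound; have aS : asum (fun n => - (P n * q n.+1)).
  apply: (asum_geom_summable (K := B * r) (@geom_summable_nat R) r01) => n.
  by rewrite nmN nmM nm_q exprS -[leRHS]mulrA ler_wpM2r// mulr_ge0 ?exprn_ge0// expR_ge0.
have h := has_tsum_series (asum_has_tsum aS); exists (1 + tsum (fun n => - (P n * q n.+1))).
have e N : P N = 1 + \sum_(0 <= n < N) - (P n * q n.+1).
  elim: N => [|N IH]; first by rewrite /P !big_geq// addr0.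
  by rewrite PS big_nat_recr//= addrA -IH; ring.
apply/cvgCP => x x0; have /cvgCP/(_ x x0)[N hN] := h; exists N => n Nn.
by rewrite e opprD addrACA subrr add0r; exact: hN.
Qed.

(** The factors beyond a suitable index [M] multiply to at least [1 - \sum_(m > M) r^m >= 1/2] in
    modulus, which keeps the limit away from 0. *)
Lemma eta_neq0 : eta t != 0.
Proof.
have /andP[r0 r1] := r01; have d : 0 < 1 - r by rewrite subr_gt0.
rewrite /eta mulf_neq0 ?cexp_neq0//; have [p hp] := P_lim; rewrite (clim_eq hp).
have [M hM] : exists M, r ^+ M.+1 / (1 - r) <= 1 / 2.
  have ri : 1 < r^-1 by rewrite invf_gt1.
  have [K K0 hK] := poly_geo 1 ri.
  have [M hM] : exists M : nat, 2 * K / (1 - r) <= M%:R.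
    exists (Num.bound (2 * K / (1 - r))); apply: ltW; apply: archi_boundP.
    by rewrite divr_ge0 ?mulr_ge0 ?ltW.
  exists M; have := hK M.+1; rewrite expr1 => h.
  have rM : 0 < r ^+ M.+1 by rewrite exprn_gt0.
  have h1 : M.+1%:R * r ^+ M.+1 <= K.
    by have := ler_wpM2r (ltW rM) h; rewrite -mulrA exprVn mulVf ?mulr1// gt_eqF.
  rewrite ler_pdivrMr//; rewrite ler_pdivrMr// in hM.
  have h2 : M%:R * r ^+ M.+1 <= K.
    by apply: le_trans h1; rewrite ler_wpM2r ?(ltW rM)// ler_nat.
  have := ler_wpM2r (ltW rM) hM; nra.
have nz N : P N != 0.
  elim: N => [|N IH]; first by rewrite /P big_geq// oner_eq0.
  rewrite PS mulf_neq0// subr_eq0; apply/eqP => e.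
  have := congr1 (@nm R) e; rewrite nm1 nm_q => /esym e1.
  have : r ^+ N.+1 < 1 by rewrite exprn_ilt1 ?(ltW r0).
  by rewrite e1 ltxx.
have low N : nm (P M) * (1 - \sum_(M.+1 <= m < (M + N).+1) r ^+ m) <= nm (P (M + N)).
  elim: N => [|N IH]; first by rewrite addn0 big_geq// subr0 mulr1.
  have s0 : 0 <= \sum_(M.+1 <= m < (M + N).+1) r ^+ m by apply: sumr_ge0 => m _; rewrite exprn_ge0// ltW.
  rewrite addnS PS nmM big_nat_recr/= ?ltnS ?leq_addr//.
  have h1 : 1 - r ^+ (M + N).+1 <= nm (1 - q (M + N).+1).
    by rewrite -nm_q lerBlDr -{1}(nm1 R) -{1}(subrK (q (M + N).+1) 1) nmD.
  have r2 : 0 <= r ^+ (M + N).+1 by rewrite exprn_ge0// ltW.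
  have r3 : r ^+ (M + N).+1 <= 1 by rewrite exprn_ile1// ltW.
  apply: (@le_trans _ _ (nm (P (M + N)) * (1 - r ^+ (M + N).+1))); last by rewrite ler_wpM2l ?nm_ge0.
  apply: le_trans (ler_wpM2r (_ : 0 <= 1 - r ^+ (M + N).+1) IH); last by rewrite subr_ge0.
  rewrite -mulrA ler_wpM2l ?nm_ge0//; nra.
have low2 N : (M <= N)%N -> nm (P M) / 2 <= nm (P N).
  move=> MN; rewrite -(subnKC MN); apply: le_trans (low _); rewrite ler_wpM2l ?nm_ge0//.
  have := le_trans (geo_le M.+1 (M + (N - M)).+1) hM; lra.
have M0 : 0 < nm (P M) by rewrite nm_gt0.
apply/eqP => p0; move: hp; rewrite p0 => /cvgCP/(_ _ (divr_gt0 M0 (ltr0n _ 4)))[N hN].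
have := hN (maxn M N) (leq_maxr _ _); rewrite subr0 => h.
have := low2 _ (leq_maxl M N); lra.
Qed.

End EtaProduct.

(** * Asymptotic expansion of a convergent odd power series *)

Section PowerSeries.
Variable R : realType.
Local Notation C := R[i].

(** Convergence at the single point [e] bounds the coefficients as in Abel's lemma; for
    [|x| <= e / 2] the tail is then geometric with ratio at most 1/2. *)
Lemma asym_odd_series (c : nat -> C) (f : R -> C) (e : R) : 0 < e ->
  (forall x, x != 0 -> `|x| <= e ->
    (fun N => \sum_(0 <= n < N) c n * x%:C ^+ (2 * n + 1) : C^o) @ \oo --> (f x : C^o)) ->
  asym setT f (fun j => if odd j then c j./2 else 0).
Proof.
move=> e0 hf; have e00 : e != 0 by rewrite gt_eqF.
have [B B0 hB] : exists2 B, 0 <= B & forall n, nm (c n) * e ^+ (2 * n + 1) <= B.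
  have ee : `|e| <= e by rewrite ger0_norm// ltW.
  have /cvgCP/(_ 1 ltr01)[N hN] := hf e e00 ee.
  have tl n : (N <= n)%N -> nm (c n) * e ^+ (2 * n + 1) <= 2.
    move=> Nn; have := hN n Nn; have := hN n.+1 (leqW Nn); rewrite big_nat_recr//=.
    set S := \sum_(0 <= i < n) _ => h1 h2.
    have -> : nm (c n) * e ^+ (2 * n + 1) = nm (c n * e%:C ^+ (2 * n + 1)).
      by rewrite nmM nmX nm_real gtr0_norm.
    have -> : c n * e%:C ^+ (2 * n + 1) = (S + c n * e%:C ^+ (2 * n + 1) - f e) - (S - f e) by ring.
    apply: le_trans (nmB _ _) _; lra.
  exists (2 + \sum_(n < N) nm (c n) * e ^+ (2 * n + 1)).
    by rewrite addr_ge0// sumr_ge0// => n _; rewrite mulr_ge0 ?nm_ge0 ?exprn_ge0 ?ltW.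
  move=> n; have s0 : 0 <= \sum_(n < N) nm (c n) * e ^+ (2 * n + 1).
    by rewrite sumr_ge0// => i _; rewrite mulr_ge0 ?nm_ge0 ?exprn_ge0 ?ltW.
  have [Nn|nN] := leqP N n; first by have := tl n Nn; lra.
  rewrite (bigD1 (Ordinal nN))//=; set s := \sum_(i < N | _) _.
  have : 0 <= s by rewrite sumr_ge0// => i _; rewrite mulr_ge0 ?nm_ge0 ?exprn_ge0 ?ltW.
  lra.
apply: asym_cofinal => N; exists N.*2, (B * 2 / e ^+ N.*2), (e / 2); split.
- by rewrite -addnn leq_addr.
- by rewrite divr_gt0.
move=> x _ x0 xe; have xe' : `|x| <= e by rewrite (le_trans xe)// ler_pdivrMr// ler_peMr ?ltW// ltr1n.
have -> : \sum_(j < N.*2) (if odd j then c j./2 else 0) * x%:C ^+ j =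
    \sum_(0 <= n < N) c n * x%:C ^+ (2 * n + 1).
  elim: N => [|N IH]; first by rewrite big_ord0 big_geq.
  rewrite doubleS !big_ord_recr /= IH big_nat_recr//= odd_double mul0r addr0 uphalf_double.
  by rewrite mul2n addn1.
pose y := `|x| / e; have y0 : 0 <= y by rewrite divr_ge0// ltW.
have y2 : y <= 1 / 2 by rewrite ler_pdivrMr// mulrC mulrA mulr1.
have tb n : nm (c n * x%:C ^+ (2 * n + 1)) <= B * y ^+ (2 * n + 1).
  rewrite nmM nmX nm_real /y expr_div_n mulrCA [leLHS]mulrC ler_wpM2l ?exprn_ge0//.
  by rewrite ler_pdivlMr ?exprn_gt0.
have part N' : (N <= N')%N -> nm (\sum_(N <= n < N') c n * x%:C ^+ (2 * n + 1)) <=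
    B * (y ^+ N.*2 * 2) - B * y ^+ N'.*2 * 2.
  move=> NN'; rewrite -(subnKC NN'); elim: (N' - N)%N => [|n IH].
    by rewrite addn0 big_geq// nm0; lra.
  rewrite addnS big_nat_recr ?leq_addr//=; apply: le_trans (nmD _ _) _.
  apply: le_trans (lerD IH (tb _)) _; rewrite doubleS mul2n addn1 !exprS.
  have : 0 <= y ^+ (N + n).*2 by rewrite exprn_ge0.
  set z := y ^+ (N + n).*2 => z0; have := mulr_ge0 B0 z0; set w := B * z => w0.
  have -> : B * (y * z) = y * w by rewrite /w; ring.
  have -> : B * (y * (y * z)) = y * (y * w) by rewrite /w; ring.
  have h1 : y * w <= w / 2 by rewrite mulrC ler_wpM2l// -[_^-1]mul1r.
  have y1 : y <= 1 by rewrite (le_trans y2)// mul1r invf_le1// ler1n.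
  have h2 : y * (y * w) <= y * w by rewrite ler_piMl// mulr_ge0.
  lra.
have yN : B * 2 / e ^+ N.*2 * `|x| ^+ N.*2 = B * (y ^+ N.*2 * 2).
  by rewrite /y expr_div_n; ring.
rewrite yN; apply: le_eps => a a0; have /cvgCP/(_ a a0)[N1 hN1] := hf x x0 xe'.
pose N' := maxn N N1; have h1 := hN1 N' (leq_maxr _ _).
have h2 := part N' (leq_maxl _ _).
have h3 : 0 <= B * y ^+ N'.*2 * 2 by rewrite !mulr_ge0 ?exprn_ge0.
rewrite (big_cat_nat (n := N)) ?leq_maxl//= in h1.
set S := \sum_(0 <= n < N) _ in h1 *; set T := \sum_(N <= n < N') _ in h1 h2.
have -> : f x - S = T - (S + T - f x) by ring.
apply: le_trans (nmB _ _) _; lra.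
Qed.

End PowerSeries.

(** * Symmetries of the unary theta series and their annihilation by the forms [F] *)

Section ThetaRelations.
Variables (R : realType) (d : nat).
Local Notation C := R[i].
Local Notation Im := (@complex.Im R).
Local Notation l := (d.*2.+1).
Implicit Types (t : C) (s : int).

Let vtE s t N : 0 < Im t -> vtw R d 0 s N = (-1) ^ N.
Proof. by move=> _; rewrite /vtw expr0 mulr1. Qed.

Lemma coset_theta_shift s t : 0 < Im t -> coset_theta d (s + l%:Z) t = - coset_theta d s t.
Proof.
move=> t0; have a1 := qsum_asum (qsummable_coset_theta R d 0 s) t0; have a2 := qsum_asum (qsummable_coset_theta R d 0 (s + l%:Z)) t0.
rewrite /coset_theta /qsum (tsum_shift 1 a1) -[RHS]mulN1r -(tsumZ _ (asum_shift 1 a1)).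
apply: eq_tsum => N; have e : vta R d (s + l%:Z) N = vta R d s (N + 1).
  by rewrite /vta /vy !intrD -pmulrn; congr (_ ^+ 2 / _); ring.
by rewrite !(vtE _ _ t0) signzS e; ring.
Qed.

Lemma coset_theta_opp s t : 0 < Im t -> coset_theta d (- s) t = - coset_theta d s t.
Proof.
move=> t0; have a1 := qsum_asum (qsummable_coset_theta R d 0 s) t0.
rewrite /coset_theta /qsum (tsum_rev (-1) a1) -[RHS]mulN1r -(tsumZ _ (asum_rev (-1) a1)).
apply: eq_tsum => N; have zeval : vta R d (- s) N = vta R d s (-1 - N).
  rewrite /vta /vy -[in LHS]sqrrN intrB mulrNz; congr (_ ^+ 2 / _).
  by field.
rewrite !(vtE _ _ t0) zeval.
have -> : (-1) ^ (-1 - N) = - (-1) ^ N :> C.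
  have := signzS R (-1 - N); have -> : -1 - N + 1 = - N by lia.
  move=> e; rewrite -[LHS]opprK -e; congr (- _).
  by case: N {e zeval} => n; rewrite ?NegzE ?opprK -?exprnN -?exprVn ?invrN1.
by ring.
Qed.

Section Annihilation.
Variables (k : nat) (F : nat -> C -> C).
Hypotheses (hk : (0 < k)%N) (lE : l = ell k) (dE : d = k.-1).
Hypothesis hF : annihilating_forms k F.
Let Fr r := F (ell k - 2 * r - 1)%N.

Definition cH : C := (Num.sqrt (l%:R / 2))%:C.

Lemma cH_neq0 : cH != 0.
Proof. by rewrite (fmorph_eq0 (real_complex R)) gt_eqF// sqrtr_gt0 divr_gt0. Qed.

Lemma Hvec_coset_theta (j : 'I_(k.-1)) t : 0 < Im t -> Hvec k t j 0 = cH * coset_theta d j.+1%:Z t.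
Proof.
move=> t0; have e0 := eta_neq0 t0; rewrite /Hvec /Fvec /Theta !mxE /Theta_coord -lE.
have h := thetaJ_coset_theta d j.+1 0 t0; rewrite addr0 expr0 mul1r in h; rewrite h.
have z : ee (j.+1%:R ^+ 2 / (2 * l%:R) * t) * ee (- (j.+1%:R ^+ 2 / (2 * l%:R)) * t) = 1 :> C.
  by rewrite /ee -cexpD mulNr mulrN subrr cexp0.
have ii : 'i%C * 'i%C = -1 :> C by rewrite -expr2 sqr_i.
rewrite /cH; set q := (Num.sqrt _)%:C; set a := ee _ in z *; set b := ee _ in z *.
transitivity (- ('i%C * 'i%C) * (a * b) * (eta t / eta t) * (q * coset_theta d j.+1%:Z t)); first by ring.
by rewrite ii z divff// opprK !mul1r.
Qed.

Lemma Hiter_serres r (j : 'I_(k.-1)) t : Hiter k r t j 0 = serres r (fun t => Hvec k t j 0) t.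
Proof.
elim: r t => [//|r IH] t; rewrite /= /vop mxE; congr (serre _ _ t).
by apply: funext => u; exact: IH.
Qed.

Lemma serres_eqH r (h g : C -> C) : smooth h -> eqH h g -> eqH (serres r h) (serres r g).
Proof.
move=> smh hg; elim: r => [//|r IH] t t0 /=; rewrite /serre IH//; congr (_ - _).
by apply: (D_eqH _ IH t0) => u u0; apply: smooth_diff u0; exact: (smooth_serres (@eisenstein_smooth R 2)).
Qed.

Lemma serresZ r (c : C) (h : C -> C) : smooth h ->
  eqH (serres r (fun t => c * h t)) (fun t => c * serres r h t).
Proof.
move=> smh; elim: r => [//|r IH] t t0 /=.
have sr := smooth_serres (@eisenstein_smooth R 2) r smh; rewrite /serre IH//.
rewrite (D_eqH (g := fun t => c * serres r h t) _ IH t0); last first.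
  by move=> u u0; apply: smooth_diff u0; apply: (smooth_serres (@eisenstein_smooth R 2)); exact: smZ.
by rewrite DZ; [ring|exact: smooth_diff].
Qed.

Let Ann (h : C -> C) := forall t, 0 < Im t -> \sum_(r < d.+1) Fr r t * serres r h t = 0.

Let AnnZ c h g : smooth h -> eqH (fun t => c * h t) g -> Ann h -> Ann g.
Proof.
move=> smh hg ah t t0; have := congr1 ( *%R c) (ah t t0); rewrite mulr0 mulr_sumr => e.
apply: etrans e; apply: eq_bigr => r _.
by rewrite -(serres_eqH r (smZ c smh) hg t0) (serresZ r c smh t0) mulrCA.
Qed.

(** The defining relation of the forms covers [1 <= s <= d]. The symmetries [s -> s + l] and
    [s -> - s], which change the series by a sign, reach all other nonzero classes modulo [l], and
    the class 0 gives the zero function. *)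
Lemma coset_theta_annihilated s t : 0 < Im t -> \sum_(r < d.+1) Fr r t * serres r (coset_theta d s) t = 0.
Proof.
have AnnN s1 s2 : (forall t, 0 < Im t -> coset_theta d s2 t = - coset_theta d s1 t) -> Ann (coset_theta d s1) -> Ann (coset_theta d s2).
  by move=> h; apply: (AnnZ (c := -1)); [exact: coset_theta_smooth|move=> u u0; rewrite mulN1r h].
have A1 (j : nat) : (0 < j <= d)%N -> Ann (coset_theta d j).
  case: j => // j jd; have jk : (j < k.-1)%N by rewrite -dE.
  have smj : smooth (fun t => Hvec k t (Ordinal jk) 0).
    apply: (@smooth_eqH _ (fun u => cH * coset_theta d j.+1 u)); last exact: (smZ cH (@coset_theta_smooth R d j.+1)).
    by move=> u u0; rewrite (Hvec_coset_theta (Ordinal jk) u0).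
  apply: (AnnZ (c := cH^-1) smj).
    by move=> u u0; rewrite (Hvec_coset_theta (Ordinal jk) u0) mulKf// cH_neq0.
  move=> u u0; case: hF => _ _ /(_ u u0) /(congr1 (fun M : 'cV_(k.-1) => M (Ordinal jk) 0)).
  rewrite summxE [in X in _ = X -> _]mxE dE => h; rewrite -[RHS]h; apply: eq_bigr => r _.
  by rewrite mxE Hiter_serres.
have A0 : Ann (coset_theta d 0).
  have v0 u : 0 < Im u -> coset_theta d 0 u = 0.
    move=> u0; have := coset_theta_opp 0 u0; rewrite oppr0 => /eqP; rewrite -addr_eq0 -mulr2n -mulr_natr.
    by rewrite mulf_eq0 pnatr_eq0 orbF => /eqP.
  have sm0 := @coset_theta_smooth R d 0; move=> u u0; rewrite big1// => r _.
  have e : eqH (fun u : C => 0 * coset_theta d 0 u) (coset_theta d 0) by move=> w w0; rewrite mul0r v0.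
  by rewrite -(serres_eqH r (smZ 0 sm0) e u0) (serresZ r 0 sm0 u0) mul0r mulr0.
have A2 (j : nat) : (j < l)%N -> Ann (coset_theta d j).
  move=> jl; have [->|j0] := posnP j; first exact: A0.
  have [jd|dj] := leqP j d; first by apply: A1; rewrite j0.
  apply: (@AnnN (- (l - j)%N%:Z)).
    move=> u u0; have -> : j%:Z = - (l - j)%N%:Z + l%:Z by lia.
    by rewrite coset_theta_shift.
  apply: (@AnnN (l - j)%N%:Z); last by apply: A1; lia.
  by move=> u u0; rewrite coset_theta_opp.
have A3 (j : nat) (n : nat) : (j < l)%N -> Ann (coset_theta d (j%:Z + (n * l)%N%:Z)).
  move=> jl; elim: n => [|n IH]; first by rewrite mul0n addr0; exact: A2.
  apply: (AnnN (j%:Z + (n * l)%N%:Z) _ _ IH) => u u0.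
  have -> : (j%:Z + (n.+1 * l)%N%:Z = (j%:Z + (n * l)%N%:Z) + l%:Z) by rewrite mulSn PoszD addrCA addrC.
  exact: coset_theta_shift.
have A4 (n : nat) : Ann (coset_theta d n).
  have := A3 (n %% l)%N (n %/ l)%N; rewrite ltn_mod => /(_ isT); congr Ann; congr coset_theta.
  by rewrite -PoszD addnC -divn_eq.
case: s => n; first exact: A4.
by apply: (AnnN n.+1%:Z); [move=> u u0; rewrite NegzE coset_theta_opp|exact: A4].
Qed.

End Annihilation.

End ThetaRelations.

(** * The Taylor coefficients of the completed rank function in the variable [X] *)

Section TaylorCoefficients.
Variables (R : realType) (d k : nat) (t : R[i]).
Local Notation C := R[i].
Local Notation Im := (@complex.Im R).
Local Notation l := (d.*2.+1).
Hypotheses (t0 : 0 < Im t) (lE : ell k = l).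

Lemma asym_sqr (f : R -> C) (s : fps R) : asym setT f s ->
  asym setT (fun x => f (x ^+ 2)) (fun n => if odd n then 0 else s n./2).
Proof.
move=> af; apply: asym_cofinal => N; have [K [e [e0 hK]]] := af N.
exists N.*2, K, (Num.min 1 e); split; first by rewrite -addnn leq_addr.
  by rewrite lt_min ltr01.
move=> x _ x0; rewrite le_min => /andP[x1 xe].
have h := hK (x ^+ 2) I; rewrite expf_neq0// normrX in h.
have -> : \sum_(j < N.*2) (if odd j then 0 else s j./2) * x%:C ^+ j =
   \sum_(j < N) s j * (x ^+ 2)%:C ^+ j.
  elim: N {hK h} => [|N IH]; first by rewrite !big_ord0.
  rewrite doubleS !big_ord_recr /= IH odd_double mul0r addr0 half_double.
  by rewrite (rmorphXn (real_complex R) 2) -exprM mul2n.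
rewrite -mul2n exprM; apply: h => //; apply: le_trans xe; rewrite expr2 ler_piMl//.
Qed.

(** The expansion of [x * Asharp] at [Z = x / (2 pi i)]; the factor [x] clears the simple pole. *)
Definition sA : fps R := ser 1 (fun n => appell_iter d 0 n t) -
  fC 2^-1 * (fX R * \sum_(nu < l) fC (coset_theta d nu t) * (fun j => nonhol_coef l nu j t)).

Let Zx (x : R) : C := x%:C / (2 * cpi R * 'i%C).

Lemma asym_Asharp : asym setT (fun x => x%:C * Asharp k (Zx x) 0 t) sA.
Proof.
have p0 : 0 < pi * Im t by rewrite mulr_gt0 ?pi_gt0.
have aG : asym setT (fun x => \sum_(nu < l) coset_theta d nu t * nonhol_fun l nu t x)
    (\sum_(nu < l) fC (coset_theta d nu t) * (fun j => nonhol_coef l nu j t)).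
  apply: (asym_sum (F := fun nu x => coset_theta d nu t * nonhol_fun l nu t x)
    (s := fun nu => fC (coset_theta d nu t) * (fun j => nonhol_coef l nu j t))) => nu nul.
  by apply: asymZ; exact: asym_nonhol_fun.
apply: asym_eq p0 _ (asymB (asym_appell d t0) (asymZ 2^-1 (asymM (asym_id _) aG))) => x _ _ xp.
by rewrite (Asharp_nonhol_fun t0 lE xp); ring.
Qed.

Let ex (x : R) : C := cexp (- ((ell k)%:R * cpi R ^+ 2 / 6) * eisenstein 2 t * Zx x ^+ 2).

Lemma asym_ex : asym setT ex (Efps l t).
Proof.
have h := asym_sqr (asym_cexp setT (l%:R / 24 * eisenstein 2 t)).
have -> : Efps l t = (fun n => if odd n then 0 else fe (l%:R / 24 * eisenstein 2 t) n./2) by [].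
apply: asym_eq ltr01 _ h => x _ _ _; rewrite /ex lE; congr cexp.
have ii : 'i%C ^+ 2 = -1 :> C by rewrite sqr_i.
have pn := cpi_neq0 R.
have eX : (x ^+ 2)%:C = x%:C ^+ 2 :> C by exact: (rmorphXn (real_complex R)).
rewrite eX /Zx expr_div_n exprMn ii.
move: (cpi R) pn (x%:C) (eisenstein 2 t) (l%:R : C) => p pn y E2 L.
rewrite mulrN1 invrN exprMn; field.
by rewrite ?pn.
Qed.

Variable r : nat -> C -> C.
Hypothesis hr : rank_taylor k r.

Let sR : fps R := Efps l t * sA.
Let cr n : C := r n t / (2 * cpi R * 'i%C) ^+ (2 * n + 1).
Let fr : fps R := fun j => if odd j then cr j./2 else 0.
Let ff (x : R) : C := 2^-1 * (Rsharp k (Zx x) 0 t - Rsharp k (- Zx x) 0 t)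
         - (2 * cpi R * 'i%C * eta t)^-1 * (Zx x)^-1.

Let asym_fr : asym setT ff fr.
Proof.
have [e e0 he] := hr t0; have p2 : 0 < 2 * pi :> R by rewrite mulr_gt0 ?pi_gt0.
have nz : nm (2 * cpi R * 'i%C) = 2 * pi.
  by rewrite nmM nm_i mulr1 nmM nm_nat nm_real gtr0_norm// pi_gt0.
have h0 : 0 < e / 2 * (2 * pi) by rewrite mulr_gt0// divr_gt0.
apply: (asym_odd_series h0) => x x0 xe.
have nZ : nm (Zx x) = `|x| / (2 * pi) by rewrite /Zx nmM nmV nz nm_real.
have := he (Zx x); rewrite !normE nZ !ltcR => h.
have h1 : 0 < `|x| / (2 * pi) by rewrite divr_gt0// normr_gt0.
have h2 : `|x| / (2 * pi) < e.
  by rewrite ltr_pdivrMr//; apply: le_lt_trans xe _; rewrite ltr_pM2r// gtr_pMr// invf_lt1// ltr1n.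
have := h h1 h2; rewrite /series.
have -> : (fun N => \sum_(0 <= n < N) cr n * x%:C ^+ (2 * n + 1) : C^o) =
   (fun N => \sum_(0 <= n < N) r n t * Zx x ^+ (2 * n + 1) : C^o).
  apply: funext => N; apply: eq_bigr => n _; rewrite /cr /Zx expr_div_n; ring.
exact.
Qed.

(** The defining equation of the coefficients multiplied by [X]: the odd part of [Rsharp] becomes
    the even part of [sR] divided by [- eta], and the polar term becomes a constant. *)
Let xff : fX R * fr = - fC (2^-1 / eta t) * (sR + frefl sR) - fC (eta t)^-1.
Proof.
have acc (e : R) : 0 < e -> exists x, [/\ (setT : set R) x, x != 0 & `|x| <= e].
  by move=> e0; exists e; split=> //; rewrite ?gt_eqF// ger0_norm// ltW.
apply: (asym_uniq acc (asymM (asym_id setT) asym_fr)).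
have a1 := asymM asym_ex asym_Asharp.
have a2 := asym_opp a1.
have a3 := asymB (asymZ (- (2^-1 / eta t)) (asymD a1 (asym_sub (S' := fun x => setT (- x)) (fun x _ => I) a2))) (asym_cst setT (eta t)^-1).
rewrite fCN in a3; apply: asym_eq ltr01 _ a3 => x _ x0 _.
have e0 := eta_neq0 t0; have pin := two_pi_i_neq0 R.
have xn : x%:C != 0 :> C by rewrite (fmorph_eq0 (real_complex R)).
have ZN : Zx (- x) = - Zx x by rewrite /Zx rmorphN mulNr.
have exN : ex (- x) = ex x by rewrite /ex ZN sqrrN.
have xN : (- x)%:C = - x%:C :> C by exact: rmorphN.
have Zi : (Zx x)^-1 = 2 * cpi R * 'i%C / x%:C by rewrite /Zx invfM invrK mulrC.
rewrite /ff /Rsharp Zi sqrrN -/(ex x) exN ZN xN.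
move: (2 * cpi R * 'i%C) pin => q q0; move: (Asharp k (Zx x) 0 t) (Asharp k (- Zx x) 0 t) => A1 A2.
move: (ex x) (eta t) e0 (x%:C) xn => E y y0 z z0; field.
by rewrite ?y0 ?q0 ?z0.
Qed.

Let sR_even m : (fX R * fr) m.*2 = - (eta t)^-1 * sR m.*2 - (m == 0%N)%:R * (eta t)^-1.
Proof.
rewrite xff faddE foppE -fCN fCmE faddE /frefl -signr_odd odd_double expr0 mul1r /fC double_eq0.
by case: eqP => _ /=; rewrite ?mul0r ?mul1r; field; exact: eta_neq0.
Qed.

(** [X fr] has no constant term, so the pole prescribed in [rank_taylor] must be cancelled by that
    of [sR]. *)
Lemma taylor0 : sR 0%N = -1.
Proof.
have := sR_even 0; rewrite double0 fXmE eqxx mul1r => /esym/eqP.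
have e0 := eta_neq0 t0; rewrite mulNr -opprD oppr_eq0 -[X in _ + X]mulr1 -mulrDr mulf_eq0 invr_eq0 (negPf e0) /=.
by rewrite addr_eq0 => /eqP.
Qed.

Lemma taylorS i : eta t / (2 * cpi R * 'i%C) ^+ (2 * i + 1) * r i t = - sR i.+1.*2.
Proof.
have e0 := eta_neq0 t0; have := sR_even i.+1; rewrite mul0r subr0 doubleS fXmE /fr /= odd_double /= uphalf_double /cr => h.
rewrite mulrAC -mulrA h; by rewrite mulrA mulrN mulfV// mulN1r.
Qed.

End TaylorCoefficients.

(** * Linearity of the operator [Q_l] *)

Section QValues.
Variables (R : realType) (k d l : nat) (F : nat -> R[i] -> R[i]).
Local Notation C := R[i].
Local Notation Im := (@complex.Im R).
Implicit Types (c q : laurent R) (t : C) (n : int).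
Hypotheses (lE : l = ell k) (dE : d = k.-1).

(** The heat chain records that all iterates have differentiable coefficients; only on such series
    is [Qop] additive, because [D] is. *)
Definition Qval c q := (exists f, heat_chain l c f) /\
  forall n t, 0 < Im t -> Qop k F c n t = q n t.

Lemma QvalD c q c' q' : Qval c q -> Qval c' q' ->
  Qval (fun n t => c n t + c' n t) (fun n t => q n t + q' n t).
Proof.
move=> [[f hf] cq] [[f' hf'] cq']; have h := hitD hf hf'.
split=> [|n t t0]; first by eexists; exact: h.
rewrite -cq// -cq'// (Qop_heat_chain F lE dE n h t0) (Qop_heat_chain F lE dE n hf t0) (Qop_heat_chain F lE dE n hf' t0).
by rewrite -big_split; apply: eq_bigr => r _; rewrite mulrDr.
Qed.

Lemma QvalZ a c q : Qval c q -> Qval (fun n t => a * c n t) (fun n t => a * q n t).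
Proof.
move=> [[f hf] cq]; have h := hitZ a hf; split=> [|n t t0]; first by eexists; exact: h.
rewrite -cq// (Qop_heat_chain F lE dE n h t0) (Qop_heat_chain F lE dE n hf t0) mulr_sumr.
by apply: eq_bigr => r _; rewrite mulrCA.
Qed.

Lemma Qval_podd c q : Qval c q -> Qval (podd c) (podd q).
Proof.
move=> [[f hf] cq]; have h := heat_chain_podd hf; split=> [|n t t0]; first by eexists; exact: h.
rewrite (Qop_heat_chain F lE dE n h t0) /podd; case: (odd _).
  by rewrite -cq// (Qop_heat_chain F lE dE n hf t0).
by rewrite big1// => r _; rewrite mulr0.
Qed.

Lemma Qval_eqH c q c' q' : leqH c c' -> leqH q q' -> Qval c q -> Qval c' q'.
Proof.
move=> cc' qq' [[f hf] cq]; have h : heat_chain l c' f.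
  by case: hf => h0 h1 h2; split=> // n t t0; rewrite h0// cc'.
split=> [|n t t0]; first by eexists; exact: h.
by rewrite -qq'// -cq// (Qop_heat_chain F lE dE n h t0) (Qop_heat_chain F lE dE n hf t0).
Qed.

Lemma Qval_sum N (c : nat -> laurent R) : (forall j, (j < N)%N -> Qval (c j) (fun _ _ => 0)) ->
  Qval (fun n t => \sum_(j < N) c j n t) (fun _ _ => 0).
Proof.
elim: N => [|N IH] h.
  apply: (Qval_eqH (c := fun _ _ => 0) (q := fun _ _ => 0)) => //.
    by move=> n t t0; rewrite big_ord0.
  have h0 := hit0 R l; split=> [|n t t0]; first by eexists; exact: h0.
  by rewrite (Qop_heat_chain F lE dE n h0 t0) big1// => r _; rewrite mulr0.
have h1 := IH (fun j jN => h j (ltnW jN)).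
apply: Qval_eqH (QvalD h1 (h N (ltnSn N))) => n t t0; first by rewrite big_ord_recr.
by rewrite addr0.
Qed.

End QValues.

(** In [n f_n = \sum_j j p_j f_(n - j)] with [n] odd, either [j] or [n - j] is odd. *)
Lemma ps_exp_odd (R : realType) (p : fps R) n : p 0%N = 0 -> (forall j, odd j -> p j = 0) ->
  odd n -> ps_exp p n = 0.
Proof.
move=> p0 po; elim/ltn_ind: n => n IH on; have n0 : n%:R != 0 :> R[i] by rewrite pnatr_eq0; case: n on {IH}.
apply: (mulfI n0); rewrite mulr0 -(fth_E (ps_exp p : fps R)) (fth_ps_exp p0) fmulE big1// => j _.
rewrite fth_E; have [oj|ej] := boolP (odd j); first by rewrite po// mulr0 mul0r.
have [->|j0] := posnP j; first by rewrite !mul0r.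
rewrite IH ?mulr0//; first by rewrite ltn_subrL j0; case: n on {IH n0 j ej j0}.
by rewrite oddB -1?ltnS// on (negPf ej).
Qed.

(** * Assembly of the three contributions *)

Section MainIdentity.
Variables (R : realType) (k : nat) (F : nat -> R[i] -> R[i]).
Local Notation C := R[i].
Local Notation Im := (@complex.Im R).
Local Notation d := (k.-1).
Local Notation l := (d.*2.+1).
Implicit Types (t : C) (n : int).
Hypotheses (hk : (0 < k)%N) (hF : annihilating_forms k F).

Let lE : l = ell k. Proof. by rewrite /ell; lia. Qed.
Let F0 t : 0 < Im t -> F 0%N t = 1. Proof. by case: hF => _ h _; exact: h. Qed.
Let smE2 := @eisenstein_smooth R 2.
Let smE4 := @eisenstein_smooth R 4.
Let ram := @ramanujan R.

Definition glau nu : laurent R := fun n t => if n is Posz m then nonhol_coef l nu m t else 0.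

Lemma glau_diff nu : (nu < l)%N -> ldiff (glau nu).
Proof. by move=> nul [] m t t0; [exact: nonhol_coef_diff|exact: diff_cst]. Qed.

Lemma glau_supp nu : lsupp 0 (glau nu).
Proof. by move=> t [] m //; rewrite oppr0 ltrNn. Qed.

Lemma heatC_glau nu n t : (nu < l)%N -> 0 < Im t -> heatC l 2^-1 (emE l 0 (glau nu)) n t = 0.
Proof.
move=> nul t0; rewrite (heatC_emE l smE2 ram)//; [|exact: glau_diff|exact: glau_supp].
rewrite /emE; set V := (V in em _ _ V).
have -> : V = fun=> 0.
  apply/funext => -[m|m]; rewrite /V.
    rewrite /Defs.lder; have -> : m%:Z + 1 = m.+1%:Z by lia.
    have -> : m.+1%:Z + 1 = m.+2%:Z by lia.
    rewrite -[RHS](nonhol_coef_heat (ltn0Sn d.*2) nul t0 m) -!pmulrn.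
    change (glau nu m) with (@nonhol_coef R l nu m); change (glau nu m.+2) with (@nonhol_coef R l nu m.+2).
    move: (D _ t) (nonhol_coef l nu m.+2 t) (nonhol_coef l nu m t) (eisenstein 2 t) => *; ring.
  change (glau nu (Negz m)) with (fun _ : C => 0 : C); rewrite D_cst /Defs.lder.
  rewrite !mulr0 subr0 addr0; case: m => [|[|m]]; first by rewrite !mul0r.
    by rewrite mul0r mulr0.
  have -> : Negz m.+2 + 1 + 1 = Negz m by lia.
  by rewrite /= !mulr0.
rewrite /em /lau; case: (n + _) => m //; rewrite fmulE big1// => i _.
by rewrite /ser mulr0.
Qed.

Let ann s t : 0 < Im t -> \sum_(r < d.+1) F (ell k - 2 * r - 1)%N t * serres r (coset_theta d s) t = 0.
Proof. exact: coset_theta_annihilated hk lE erefl hF s t. Qed.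

(** Because [g] is killed in weight 1/2, the heat iterates act on the theta factor only, by Serre
    derivatives, and the relation defining the forms [F] applies. *)
Lemma Qval_coset_theta s (g : laurent R) : ldiff g ->
  (forall n t, 0 < Im t -> heatC l 2^-1 g n t = 0) ->
  Qval k l F (podd (fun n t => coset_theta d s t * g n t)) (fun _ _ => 0).
Proof.
move=> dg hg; apply: (@Qval_eqH _ _ _ _ _ lE erefl _ (podd (fun _ _ => 0))) => [n t t0 //|n t t0|].
  by rewrite /podd; case: ifP.
have h := heat_chain_mul smE2 (@coset_theta_smooth R d s) dg hg.
apply: (Qval_podd lE erefl); split=> [|n t t0]; first by eexists; exact: h.
exact: (Qop_annihilated lE erefl n t0 h (ann s t0)).
Qed.

(** At each fixed [t] the numbers [Qcoef] serve as the [pc] of the coset analysis: monic because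
    [F 0 = 1], and annihilating every coset theta series. *)
Lemma Qval_appell : Qval k l F (emE l 1 (appell_iter d 0))
  (fun n t => - (l.-1)`!%:R * Defs.lshift (- l%:Z) (of_powerseries (Ssrc l)) n t).
Proof.
have l0 : (0 < l)%N by [].
have h := heat_chain_emE l0 smE2 ram (V := appell_iter d) (fun i => @appell_iter_has_partials R d i) (@appell_iter_heat R d) (N := 1)
  (fun i t => @appell_iter_supp R d i t).
split=> [|n t t0]; first by eexists; exact: h.
rewrite (@Qop_emE R l l0 smE2 ram k d F lE erefl 1 (appell_iter d) n t t0)//; last first.
- by move=> i; exact: appell_iter_supp.
- exact: appell_iter_heat.
- by move=> i m s; exact: appell_iter_has_partials.
pose pc i := Qcoef l k d F i t.
have pcd : pc d = 1 by exact: (Qcoef_lead l0 smE2 lE erefl F0 hk t0).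
have an s : \sum_(i < d.+1) pc i * qsum (vta R d s) (vtw R d i.*2 s) t = 0.
  rewrite -[RHS](Qcoef_annihilated l smE2 (@coset_theta_smooth R d s) t0 (ann s t0)).
  by apply: eq_bigr => i _; rewrite coset_theta_iterD.
have := E_Bhat t0 pcd an; rewrite /Bhat => e.
rewrite /em /lau /Defs.lshift opprK; case: (n + _) => m; last by rewrite mulr0.
have := congr1 (fun s : fps R => s m) e; rewrite foppE fCmE /= => e1.
by rewrite mulNr -e1 opprK.
Qed.

Variables (r : nat -> C -> C) (G : C -> 'cV[C]_d).
Hypotheses (hr : rank_taylor k r) (smG : forall j, smooth_H (fun t => G t j 0)).

(** The coordinates of [G] are extended by 0 to all natural indices, the form of index used by
    [Qval_sum]. *)
Definition Gcoord (j : nat) : C -> C := if insub j is Some o then fun t => G t o 0 else fun=> 0.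

Lemma Gcoord_smooth j : smooth (Gcoord j).
Proof. by rewrite /Gcoord; case: (insub j) => [u|]; [exact: smooth_H_smooth (smG u)|exact: smooth_cst]. Qed.

Lemma GcoordE (o : 'I_d) : Gcoord o = fun t => G t o 0.
Proof. by rewrite /Gcoord valK. Qed.

(** The weight -1 is the sign in [Rsharp], and with the [- 1/2] of the completion it gives [2^-1].
    In the last weight, [cH] is the constant of [Hvec] and [2 pi i] is what survives of
    [(2 pi i)^(2n+1)]. *)
Let Cparts : laurent R := fun n t => -1 * podd (emE l 1 (appell_iter d 0)) n t +
  (2^-1 * \sum_(nu < l) podd (fun n t => coset_theta d nu t * emE l 0 (glau nu) n t) n t +
   (- (2 * cpi R * 'i%C)^-1 * cH R d) *
     \sum_(j < d) podd (fun n t => coset_theta d j.+1 t * odd_chain l (Gcoord j) n t) n t).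

Lemma scalar_correction i t : 0 < Im t -> a_coef r G i t =
  - (Efps l t * sA d t) i.+1.*2 - (2 * cpi R * 'i%C)^-1 * cH R d *
    \sum_(j < d) coset_theta d j.+1 t * ((- (2 * l%:R)) ^+ i / (i.*2.+1)`!%:R * serre_iter (3 / 2) i (Gcoord j) t).
Proof.
move=> t0; rewrite /a_coef mulrBr (taylorS t0 (esym lE) hr i); congr (_ - _).
rewrite mxE !mulr_sumr; apply: eq_bigr => j _.
rewrite [(Fvec k t)^T 0 j]mxE [vop _ _ _ _ _]mxE GcoordE -lE.
have e0 := eta_neq0 t0; have pn := cpi_neq0 R; have pin := two_pi_i_neq0 R.
have hF' : Fvec k t j 0 = cH R d * coset_theta d j.+1 t / eta t.
  by rewrite -(Hvec_coset_theta lE j t0) [Hvec k t j 0]mxE mulrC mulKf.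
rewrite hF' mul2n addn1.
(* [8 l pi^2 = (- 2 l) (2 pi i)^2]: the even powers of [2 pi i] cancel and the coefficients of
   [odd_chain] appear. *)
have -> : (8 * l%:R * cpi R ^+ 2) ^+ i = (- (2 * l%:R)) ^+ i * (2 * cpi R * 'i%C) ^+ i.*2.
  rewrite -(mul2n i) exprM -exprMn; congr (_ ^+ i); have ii : 'i%C ^+ 2 = -1 :> C by rewrite sqr_i.
  by rewrite !exprMn ii; ring.
rewrite exprS; have qn := expf_neq0 i.*2 pin; have fn := fact_neq0 R i.*2.+1.
move: (serre_iter _ _ _ _) ((2 * cpi R * 'i%C) ^+ _) qn ((- (2 * _)) ^+ i) ((_)`!%:R) fn => s q qn u f fn.
move: (2 * cpi R * 'i%C) pin (cH R d) (coset_theta d _ _) (eta t) e0 => p p0 c v y y0; field.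
by rewrite y0 qn p0 fn.
Qed.

Lemma Cseries_parts : leqH Cparts (Cseries r G).
Proof.
have ser0 t nu : ser 0 (glau nu ^~ t) = (fun j => nonhol_coef l nu j t) :> fps R.
  by apply: fpsP => j; rewrite /ser subr0.
have EsA t m : (Efps l t * sA d t) m.+1 = (Efps l t * ser 1 (appell_iter d 0 ^~ t)) m.+1 -
    2^-1 * \sum_(nu < l) coset_theta d nu t * (Efps l t * ser 0 (glau nu ^~ t)) m.
  have -> : Efps l t * sA d t = Efps l t * ser 1 (appell_iter d 0 ^~ t) - fC 2^-1 *
      (fX R * \sum_(nu < l) fC (coset_theta d nu t) * (Efps l t * ser 0 (glau nu ^~ t))).
    rewrite /sA mulrBr; congr (_ - _); rewrite mulrCA [Efps l t * (fX R * _)]mulrCA mulr_sumr.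
    by congr (_ * (_ * _)); apply: eq_bigr => nu _; rewrite ser0 mulrCA.
  rewrite faddE foppE fCmE fXmE fsumE; congr (_ - _ * _).
  by apply: eq_bigr => nu _; rewrite fCmE.
move=> [m|m] t t0; rewrite /Cparts /Cseries /podd /=.
  case: ifP => om; last by rewrite !big1// !mulr0 !addr0.
  rewrite (scalar_correction m./2 t0).
  have em1 : m.+1 = (m./2).+1.*2 by rewrite -[in LHS](odd_double_half m) om.
  rewrite -em1 EsA /emE /em /lau addr0 -PoszD addn1.
  have -> : (m./2).*2.+1 = m by rewrite -[RHS]odd_double_half om.
  rewrite mulN1r opprB -mulNr; ring.
(* [Negz 0] is the exponent -1, where [taylor0] gives the coefficient 1. *)
have [->|m0] := eqVneq m 0%N.
  have := taylor0 t0 (esym lE) hr.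
  rewrite /sA mulrBr faddE foppE mulrCA fCmE mulrCA fXmE mulr0 subr0 => h.
  rewrite !big1; first last.
  - by move=> nu _; rewrite /emE /em /lau mulr0.
  - by move=> nu _; rewrite /odd_chain mulr0.
  have -> : emE l 1 (appell_iter d 0) (Negz 0) t = -1 by exact: h.
  by rewrite !mulr0 !addr0 mulN1r opprK.
rewrite !big1; first last.
- by move=> nu _; rewrite /emE /em /lau; case: ifP; rewrite ?mulr0.
- by move=> nu _; rewrite /odd_chain; case: ifP; rewrite ?mulr0.
rewrite /emE /em /lau; have -> : Negz m + 1 = Negz m.-1 by lia.
by rewrite if_same !mulr0 !addr0.
Qed.

Lemma Qop_Cseries n t : 0 < Im t -> Qop k F (Cseries r G) n t = rhs_series (ell k) n t.
Proof.
move=> t0; suff h : Qval k l F (Cseries r G) (rhs_series (ell k)) by case: h => _; exact.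
have h1 := QvalZ lE erefl (-1) (Qval_podd lE erefl Qval_appell).
have h2 : Qval k l F (fun n t => \sum_(nu < l) podd (fun n t => coset_theta d nu t * emE l 0 (glau nu) n t) n t)
    (fun _ _ => 0).
  apply: (Qval_sum lE erefl (c := fun nu => podd (fun n t => coset_theta d nu t * emE l 0 (glau nu) n t))) => nu nul.
  apply: Qval_coset_theta; first by exact: (emE_diff _ smE2 0 (glau_diff nul)).
  by move=> m s s0; exact: heatC_glau.
have h3 : Qval k l F (fun n t => \sum_(j < d) podd (fun n t => coset_theta d j.+1 t * odd_chain l (Gcoord j) n t) n t)
    (fun _ _ => 0).
  apply: (Qval_sum lE erefl (c := fun j => podd (fun n t => coset_theta d j.+1 t * odd_chain l (Gcoord j) n t))) => j jd.
  apply: Qval_coset_theta; first by exact: (odd_chain_diff _ smE2 smE4 (Gcoord_smooth j)).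
  by move=> m s s0; exact: (heatC_odd_chain (ltn0Sn _) smE2 smE4 m (Gcoord_smooth j) s0).
have h := QvalD lE erefl h1 (QvalD lE erefl (QvalZ lE erefl 2^-1 h2)
  (QvalZ lE erefl (- (2 * cpi R * 'i%C)^-1 * cH R d) h3)).
apply: (Qval_eqH lE erefl Cseries_parts _ h) => m s s0.
rewrite !mulr0 !addr0 mulN1r /podd /rhs_series -lE; case: ifP => om; first by rewrite mulNr opprK.
(* For even [n] the index [n + l] is odd, and the source has only even powers; so the right-hand
   side equals its own odd part. *)
rewrite oppr0 /Defs.lshift opprK; case E: (m + l%:Z) => [j|j]; last by rewrite mulr0.
have oj : odd j by lia.
rewrite /of_powerseries /Ssrc ps_exp_odd ?mulr0//.
by move=> i oi; rewrite /src_exponent oi.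
Qed.

End MainIdentity.

Theorem theorem5p10 (R : realType) (k : nat) (hk : (2 <= k)%N)
    (sigma : mp R -> 'M[R[i]]_(k.-1)) (hsigma : is_sigma sigma)
    (r : nat -> R[i] -> R[i]) (hr : rank_taylor k r)
    (F : nat -> R[i] -> R[i]) (hF : annihilating_forms k F)
    (G : R[i] -> 'cV[R[i]]_(k.-1))
    (hG : harmonic_plus 3 (contragredient sigma) G)
    (hxi : forall t : R[i], 0 < complex.Im t -> vop (xi 3) G t = - Theta k t) :
  forall t : R[i], 0 < complex.Im t -> forall n : int,
    Qop k F (Cseries r G) n t = rhs_series (ell k) n t.
Proof.
case: hG => smG _ _ _ _ t t0 n.
exact: (Qop_Cseries (ltnW hk) hF hr smG n t0).
Qed.
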